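(* Let $d\ge1$ and $k\in\mathbb{Z}$, let $\chi$ be a multiplicative character on the residue classes of $\mathbb{Z}[i]$ modulo $4d$, and put $\psi(z)=\chi(z)(z/|z|)^k$. Define for $n\ge1$ $$\lambda(n)=\sum_{\substack{z\in\mathbb{Z}[i],\ z\bar z=n\\ z \text{ primary}}}\psi(z)[z].$$ Then for every integer $c\ge1$ and every $x\ge 2$, $$\sum_{n\le x}\Lambda(n)\lambda(cn)\ll c\, f\, x^{76/77},\qquad f=d(|k|+1),$$ where the implied constant is absolute.
   Context: A Gaussian integer $z=r+is$ is called primary if $z\equiv 1 \pmod{2(1+i)}$, i.e. $r$ is odd and $s\equiv r-1\pmod 4$. For $z=r+is\equiv 1\pmod 2$ (i.e. $r$ odd, $s$ even) the Jacobi–Kubota symbol is $[z]=i^{(r-1)/2}\big(\frac{s}{|r|}\big)$, where $\big(\frac{s}{|r|}\big)$ is the Jacobi symbol. A character $\chi$ modulo $4d$ on $\mathbb{Z}[i]$ is a homomorphism $(\mathbb{Z}[i]/4d\mathbb{Z}[i])^*\to\mathbb{C}^*$, extended by $0$ to $z$ not coprime to $4d$. $\Lambda$ is the von Mangoldt function. *)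

(* Defs.v *)
From HB Require Import structures.
From mathcomp Require Import all_boot all_order all_algebra.
From mathcomp Require Import boolp classical_sets functions cardinality fsbigop.
From mathcomp Require Import reals exp.
From mathcomp Require Import complex.

Set Implicit Arguments.
Unset Strict Implicit.
Unset Printing Implicit Defensive.

Import Order.TTheory GRing.Theory Num.Theory.
Local Open Scope classical_set_scope.
Local Open Scope ring_scope.

(* Z[i], as the complex numbers over int.  The library makes [complex F] a
   ring only when F is a field, so the ring structure is built here from the
   library's complex multiplication [mulc]. *)
Definition gint := complex int.

HB.instance Definition _ := GRing.Zmodule.copy gint (complex int).

Lemma gint_mul1 : left_id (Complex 1 0 : gint) (@ComplexField.mulc int).
Proof. by move=> [a b] /=; rewrite !mul1r !mul0r subr0 addr0. Qed.

Lemma gint_mulDl : left_distributive (@ComplexField.mulc int) (@GRing.add gint).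
Proof.
move=> [a b] [c d] [e f] /=; rewrite !mulrDl opprD.
by rewrite addrACA (addrACA (a * f)).
Qed.

Lemma gint_one_neq0 : (Complex 1 0 : gint) != 0.
Proof. by rewrite eq_complex. Qed.

HB.instance Definition _ := GRing.Zmodule_isComNzRing.Build gint
  (@ComplexField.mulcA int) (@ComplexField.mulcC int)
  gint_mul1 gint_mulDl gint_one_neq0.

Definition gi : gint := Complex 0 1.

Definition gconj (z : gint) : gint := conjc z.

Definition gcong (m z w : gint) : Prop := exists q : gint, z - w = q * m.

(* z represents a unit of Z[i]/mZ[i], i.e. z is coprime to m. *)
Definition gunit_mod (m z : gint) : Prop := exists w : gint, gcong m (z * w) 1.

Definition primary (z : gint) : Prop := gcong (2%:R * (1 + gi)) z 1.

(* The group homomorphisms (Z[i]/mZ[i])^* -> C^*, inflated to Z[i] and extended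
   by 0 outside the classes coprime to m. *)
Record mult_char (R : realType) (m : gint) (chi : gint -> R[i]) : Prop :=
  MultChar {
    mult_char_cong : forall z w, gcong m z w -> chi z = chi w;
    mult_char_neq0 : forall z, gunit_mod m z -> chi z != 0;
    mult_charM : forall z w, gunit_mod m z -> gunit_mod m w ->
      chi (z * w) = chi z * chi w;
    mult_char_eq0 : forall z, ~ gunit_mod m z -> chi z = 0
  }.

Definition legendre (a : int) (p : nat) : int :=
  if (p %| a)%Z then 0
  else if [exists b : 'I_p, ((b : nat)%:Z ^+ 2 == a %[mod p])%Z] then 1
  else -1.

(* Only meaningful for odd n. *)
Definition jacobi (a : int) (n : nat) : int :=
  \prod_(p <- primes n) legendre a p ^+ logn p n.

(* [z] = i^((r-1)/2) (s/|r|) for z = r + is with r odd; the integer division is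
   then exact, and the exponent may be negative. *)
Definition jacobi_kubota (R : realType) (z : gint) : R[i] :=
  (Complex 0 1 : R[i]) ^ ((complex.Re z - 1) %/ 2)%Z *
  (jacobi (complex.Im z) `|complex.Re z|%N)%:~R.

Definition gintC (R : realType) (z : gint) : R[i] :=
  Complex (complex.Re z)%:~R (complex.Im z)%:~R.

Definition psi (R : realType) (chi : gint -> R[i]) (k : int)
    (z : gint) : R[i] :=
  chi z * (gintC R z / `|gintC R z|) ^ k.

(* The index set is finite for every n (finite_gnorm below), so this is the
   ordinary finite sum. *)
Definition lambda (R : realType) (chi : gint -> R[i]) (k : int)
    (n : nat) : R[i] :=
  \sum_(z \in [set z : gint | z * gconj z = n%:R /\ primary z])
     psi chi k z * jacobi_kubota R z.

(* primes n is the singleton [:: p] exactly when n = p ^ e with p prime and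
   e >= 1. *)
Definition von_mangoldt (R : realType) (n : nat) : R :=
  if primes n is [:: p] then ln p%:R else 0.

Lemma gint_natr (n : nat) : n%:R = Complex n%:Z 0 :> gint.
Proof.
elim: n => [//|n IHn]; rewrite -addn1 natrD IHn PoszD.
by rewrite [LHS]/GRing.add /= addr0.
Qed.

Lemma finite_gnorm (n : nat) : finite_set [set z : gint | z * gconj z = n%:R].
Proof.
pose g (t : 'I_n.+1 * 'I_n.+1 * (bool * bool)) : gint :=
  Complex ((-1) ^+ t.2.1 * (t.1.1 : nat)%:Z) ((-1) ^+ t.2.2 * (t.1.2 : nat)%:Z).
apply: (@sub_finite_set _ _ (range g)); last exact: finite_image.
move=> [a b] /=; rewrite gint_natr /gconj /= => -[] ab _.
have {}ab : (`|a| ^ 2 + `|b| ^ 2 = n)%N.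
  apply/eqP; rewrite -eqz_nat PoszD !expnS !expn0 !muln1 !PoszM !abszE -!expr2.
  by rewrite !real_normK ?num_real // -ab mulrN opprK !expr2.
have le_sq m : (m <= m ^ 2)%N by case: m => // m; rewrite leq_pmulr.
have lea : (`|a| < n.+1)%N.
  by rewrite ltnS -ab (leq_trans (le_sq _)) ?leq_addr.
have leb : (`|b| < n.+1)%N.
  by rewrite ltnS -ab (leq_trans (le_sq _)) ?leq_addl.
exists (Ordinal lea, Ordinal leb, (a < 0, b < 0)) => //.
by rewrite /g /= -!intEsign.
Qed.

(* Main.v *)
(** Write N for the norm.  The symbol [y] vanishes unless the real and imaginary
    parts of y are coprime, and for such primary y the divisors a of N y are the
    norms of exactly one primary divisor w of y each.  Hence a convolution of
    arithmetic functions at N y unfolds into a sum over factorizations y = w t;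
    the sum to be bounded becomes the sum of Lambda(N t) psi(z0 t) [z0 t] over
    primary z0 of norm c and primary t with N t <= x, and Vaughan's identity
    applies with n = N t and cut-offs about x^(4/70).

    Quadratic reciprocity gives [w z] = +-[w] [z] J(re (w z), N w), where the sign
    depends only on the signs of a few real and imaginary parts.

    Sums of type I: for fixed r = re y the sum over im y is an incomplete sum of
    Jacobi symbols modulo |r|, bounded through the correlations of the symbol;
    partial summation removes (y/|y|)^k and the weights.

    Sums of type II: localize w to small cells so that the sharp cut-off and the
    sign no longer depend on w, apply Hoelder's inequality with exponent 2, 8 or
    16 according to the size of N w, and use the orthogonality of the symbols
    J(re (w z), N w) for distinct squarefree N w.  This saves x^(1/70) up to
    divisor functions, and 1/70 > 1/77. *)
Require Import Defs.
From mathcomp Require Import all_boot all_order all_algebra all_solvable all_field.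
From mathcomp Require Import boolp classical_sets fsbigop.
From mathcomp Require Import reals exp sequences complex.
From mathcomp Require Import ring lra zify.

Set Implicit Arguments.
Unset Strict Implicit.
Unset Printing Implicit Defensive.

Import Order.TTheory GRing.Theory Num.Theory.
Local Open Scope ring_scope.

(** * Legendre symbols *)

Lemma sum_residues (V : zmodType) (G : int -> V) (n : nat) (a b : int) :
  (0 < n)%N -> coprimez a n -> (forall x, G (x + n%:Z) = G x) ->
  \sum_(i < n) G (b + a * i%:Z) = \sum_(i < n) G i%:Z.
Proof.
move=> n_gt0 co_an perG.
have n_neq0 : n%:Z != 0 by rewrite -lt0n in n_gt0 *; lia.
have perN k x : G (x + k%:Z * n%:Z) = G x.
  elim: k x => [|k IH] x; first by rewrite mul0r addr0.
  by rewrite -addn1 PoszD mulrDl mul1r addrA perG IH.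
have perZ k x : G (x + k * n%:Z) = G x.
  case: k => k; first exact: perN.
  by rewrite -(perN k.+1 (x + _)) NegzE mulNr addrNK.
have Gmod x : G (x %% n%:Z)%Z = G x by rewrite -[LHS](perZ (x %/ n)%Z) addrC -divz_eq.
have lt_mod x : (`|(x %% n%:Z)%Z| < n)%N.
  by have := modz_ge0 x n_neq0; have := ltz_pmod x (_ : 0 < n%:Z); lia.
pose h (i : 'I_n) := Ordinal (lt_mod (b + a * i%:Z)).
have inj_h : injective h.
  move=> i j /(congr1 val) /= eq_ij; apply: val_inj => /=.
  have {eq_ij} : (b + a * i%:Z = b + a * j%:Z %[mod n%:Z])%Z.
    by have := modz_ge0 (b + a * i%:Z) n_neq0; have := modz_ge0 (b + a * j%:Z) n_neq0; lia.
  move/eqP; rewrite eqz_mod_dvd opprD addrACA subrr add0r -mulrBr.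
  rewrite Gauss_dvdzr; last by rewrite coprimez_sym.
  rewrite -eqz_mod_dvd => /eqP; rewrite !modz_small; first by case.
    by have := ltn_ord j; lia.
  by have := ltn_ord i; lia.
rewrite [RHS](reindex_inj inj_h); apply: eq_bigr => i _ /=.
by rewrite gez0_abs ?modz_ge0 // Gmod.
Qed.

Lemma legendre_cases (a : int) (p : nat) :
  [\/ legendre a p = 0, legendre a p = 1 | legendre a p = -1].
Proof.
by rewrite /legendre; case: ifP => _; [constructor 1 | case: ifP => _; [constructor 2 | constructor 3]].
Qed.

Lemma legendre_abs_le1 (a : int) (p : nat) : `|legendre a p| <= 1.
Proof. by case: (legendre_cases a p) => ->. Qed.

Lemma legendre_mod (a b : int) (p : nat) : (a = b %[mod p])%Z -> legendre a p = legendre b p.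
Proof.
move=> eq_ab; rewrite /legendre; congr (if _ then _ else _).
  by apply/dvdz_mod0P/dvdz_mod0P; rewrite eq_ab.
by congr (if _ then _ else _); apply: eq_existsb => i; rewrite eq_ab.
Qed.

Lemma legendre_eq0 (a : int) (p : nat) : (legendre a p == 0) = (p %| a)%Z.
Proof. by rewrite /legendre; case: ifP => //; case: ifP. Qed.

Lemma odd_prime_dvd_small (p : nat) (x : int) :
  prime p -> odd p -> `|x| <= 2 -> (p %| x)%Z -> x = 0.
Proof.
move=> pr_p odd_p x2 /dvdzP[k xE].
have := prime_gt1 pr_p; have : p <> 2%N by move=> p2; rewrite p2 in odd_p.
move=> p2 p1; have p3 : (3 <= p)%N by lia.
by case: (eqVneq k 0) => [k0|k0]; [rewrite xE k0 mul0r | nia].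
Qed.

Lemma legendre_euler (a : int) (p : nat) : prime p -> odd p ->
  (p %| legendre a p - a ^+ p.-1./2)%Z.
Proof.
move=> pr_p odd_p; have pch := pchar_Fp pr_p.
have p1 := prime_gt1 pr_p.
have p3 : (3 <= p)%N by case: p pr_p odd_p {pch} p1 => [|[|[|]]].
have half : (p.-1 = p.-1./2 * 2)%N by move: odd_p p1; lia.
have half_gt0 : (0 < p.-1./2)%N by lia.
rewrite (dvdz_pcharf pch) rmorphB /= rmorphXn /= subr_eq0 /legendre.
have Fermat (y : 'F_p) : y != 0 -> y ^+ p.-1 = 1.
  move=> y0; apply: (mulfI y0); rewrite -exprS prednK ?mulr1; last by lia.
  by rewrite -[X in _ ^+ X](card_Fp pr_p) expf_card.
rewrite (dvdz_pcharf pch); case: (boolP (a%:~R == 0 :> 'F_p)) => [/eqP ->|a0].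
  by rewrite expr0n /= gtn_eqF.
case: ifP => [/existsP[b /eqP]|nsq].
  move/eqP; rewrite eqz_mod_dvd (dvdz_pcharf pch) rmorphB rmorphXn /= subr_eq0.
  move=> /eqP ab; rewrite -ab -exprM mulnC -half Fermat //.
  by apply: contraNneq a0 => b0; rewrite -ab b0 expr0n.
have /hasP[g _ prim_g] : has p.-1.-primitive_root (enum (predC1 (0 : 'F_p))).
  apply: has_prim_root; first by lia.
  - apply/allP => y; rewrite mem_enum !inE => y0.
    by rewrite unity_rootE Fermat.
  - exact: enum_uniq.
  - by rewrite -cardE cardC1 card_Fp.
have [i ai] := prim_rootP prim_g (Fermat _ a0).
have [odd_i|even_i] := boolP (odd i); last first.
  suff: false by []; rewrite -nsq; apply/existsP.
  have lt_b : (((g ^+ i./2 : 'F_p) : nat) < p)%N by rewrite -[X in (_ < X)%N](Fp_cast pr_p) ltn_ord.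
  exists (Ordinal lt_b) => /=; rewrite eqz_mod_dvd (dvdz_pcharf pch) rmorphB rmorphXn /=.
  have -> : ((g ^+ i./2 : 'F_p) : nat)%:~R = g ^+ i./2 :> 'F_p.
    by rewrite -[RHS]natr_Zp.
  by rewrite ai -exprM muln2 -[X in _ - _ ^+ X]odd_double_half (negPf even_i) add0n subrr.
have gh : g ^+ p.-1./2 = -1.
  have : (g ^+ p.-1./2) ^+ 2 == 1 by rewrite -exprM -half (prim_expr_order prim_g).
  rewrite sqrf_eq1 => /orP[|/eqP//]; rewrite -(prim_order_dvd prim_g) => /dvdn_leq.
  by move/(_ half_gt0); lia.
rewrite ai -exprM mulnC exprM gh -signr_odd odd_i expr1.
by rewrite rmorphN rmorph1.
Qed.

Lemma legendreM (a b : int) (p : nat) : prime p -> odd p ->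
  legendre (a * b) p = legendre a p * legendre b p.
Proof.
move=> pr_p odd_p; apply/eqP; rewrite -subr_eq0; apply/eqP.
apply: (odd_prime_dvd_small pr_p odd_p).
  by case: (legendre_cases (a * b) p) => ->; case: (legendre_cases a p) => ->;
    case: (legendre_cases b p) => ->.
have -> : legendre (a * b) p - legendre a p * legendre b p =
   (legendre (a * b) p - (a * b) ^+ p.-1./2) - (legendre a p - a ^+ p.-1./2) * legendre b p
   - a ^+ p.-1./2 * (legendre b p - b ^+ p.-1./2) by rewrite exprMn; ring.
apply: rpredB; last by apply: dvdz_mull; apply: legendre_euler.
by apply: rpredB; [|apply: dvdz_mulr]; apply: legendre_euler.
Qed.

Lemma legendre1 (p : nat) : prime p -> odd p -> legendre 1 p = 1.
Proof.
move=> pr_p odd_p; have p1 := prime_gt1 pr_p; rewrite /legendre.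
rewrite dvdz1 /=; case: eqP => [|_]; first by lia.
case: ifP => // /existsP[]; exists (Ordinal p1); by rewrite /= expr1n.
Qed.

Lemma legendre_sqr (a : int) (p : nat) : prime p -> odd p -> ~~ (p %| a)%Z ->
  legendre a p * legendre a p = 1.
Proof.
by move=> pr_p odd_p; rewrite -legendre_eq0; case: (legendre_cases a p) => ->.
Qed.

Lemma legendreD (p : nat) (x : int) : legendre (x + p%:Z) p = legendre x p.
Proof. by apply: legendre_mod; rewrite modzDr. Qed.

Lemma nonresidue_exists (p : nat) : prime p -> odd p -> exists a, legendre a p = -1.
Proof.
move=> pr_p odd_p; apply: contrapT => noN.
have p3 : (3 <= p)%N by case: p pr_p odd_p {noN} => [|[|[|]]].
have all1 (a : int) : ~~ (p %| a)%Z -> legendre a p = 1.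
  rewrite -legendre_eq0; case: (legendre_cases a p) => [->|//|h] //.
  by case: noN; exists a.
have pch := pchar_Fp pr_p.
have a_neq0 (k : nat) : (0 < k < p)%N -> ~~ (p %| k%:Z)%Z.
  by move=> /andP[k0 kp]; rewrite dvdzE /= gtnNdvd.
pose q : {poly 'F_p} := 'X^(p.-1./2) - 1.
have size_q : size q = (p.-1./2).+1.
  by rewrite size_XnsubC //; move: odd_p p3; lia.
suff roots : all (root q) (enum (predC1 (0 : 'F_p))).
  have q0 : q != 0 by rewrite -size_poly_eq0 size_q.
  have := max_poly_roots q0 roots (enum_uniq _).
  by rewrite -cardE cardC1 card_Fp // size_q; move: odd_p p3; lia.
apply/allP => y; rewrite mem_enum !inE => y0; rewrite rootE !hornerE subr_eq0.
have := legendre_euler (y : nat)%:Z pr_p odd_p.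
rewrite (dvdz_pcharf pch) rmorphB rmorphXn /= subr_eq0.
have -> : (y : nat)%:~R = y :> 'F_p by rewrite -[RHS]natr_Zp.
move=> /eqP <-; rewrite all1 ?rmorph1 //.
apply: a_neq0; rewrite lt0n; apply/andP; split.
  by apply: contraNneq y0 => y0; apply/eqP/val_inj.
by rewrite -[X in (_ < X)%N](Fp_cast pr_p) ltn_ord.
Qed.

Lemma sum_legendre (p : nat) : prime p -> odd p -> \sum_(i < p) legendre i%:Z p = 0.
Proof.
move=> pr_p odd_p; have [a la] := nonresidue_exists pr_p odd_p.
have co_a : coprimez a p.
  rewrite coprimez_sym /coprimez /= ; apply/eqP.
  have : coprime p `|a| by rewrite prime_coprime // -[(p %| _)%N]/(p %| a)%Z -legendre_eq0 la.
  by rewrite /coprime /gcdz /= => /eqP ->.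
have := sum_residues 0 (prime_gt0 pr_p) co_a (legendreD p).
under eq_bigr do rewrite add0r legendreM // la mulN1r.
rewrite sumrN; move: (\sum_(i < p) _) => S; lia.
Qed.

Lemma legendreX (a : int) (p n : nat) : prime p -> odd p ->
  legendre (a ^+ n) p = legendre a p ^+ n.
Proof.
move=> pr_p odd_p; elim: n => [|n IH]; first by rewrite !expr0 legendre1.
by rewrite !exprS legendreM // IH.
Qed.

Lemma legendreN1 (p : nat) : prime p -> odd p -> legendre (-1) p = (-1) ^+ p.-1./2.
Proof.
move=> pr_p odd_p; apply/eqP; rewrite -subr_eq0; apply/eqP.
apply: (odd_prime_dvd_small pr_p odd_p); last exact: legendre_euler.
by case: (legendre_cases (-1) p) => ->; rewrite -signr_odd; case: (odd _).
Qed.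

Section GaussSum.
Variables (F : fieldType) (p q : nat) (zeta : F).
Hypotheses (pr_p : prime p) (odd_p : odd p) (prim_zeta : p.-primitive_root zeta).

Let p_gt0 := prime_gt0 pr_p.
Let p_neq0 : p%:Z != 0.
Proof. by move: p_gt0; lia. Qed.
Definition addchar (x : int) : F := zeta ^+ `|(x %% p)%Z|.

Lemma addcharD x y : addchar (x + y) = addchar x * addchar y.
Proof.
rewrite /addchar -exprD; apply/eqP; rewrite (eq_prim_root_expr prim_zeta).
rewrite -eqz_nat -!modz_nat PoszD !gez0_abs ?modz_ge0 //.
by rewrite modz_mod modzDm.
Qed.

Lemma addchar_periodic x : addchar (x + p%:Z) = addchar x.
Proof. by rewrite /addchar modzDr. Qed.

Lemma sum_addchar (c : int) :
  \sum_(a < p) addchar (a%:Z * c) = if (p %| c)%Z then p%:R else 0.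
Proof.
case: ifPn => [/dvdzP[k ->]|ndiv].
  under eq_bigr do rewrite /addchar mulrA modzMl expr0.
  by rewrite big_const_ord iter_addr_0.
have co_c : coprimez c p.
  rewrite coprimez_sym /coprimez /gcdz eqz_nat -[_ == _]/(coprime p `|c|).
  by rewrite prime_coprime.
have := sum_residues 0 p_gt0 co_c addchar_periodic.
have -> : \sum_(i < p) addchar (0 + c * i%:Z) = \sum_(a < p) addchar (a%:Z * c).
  by apply: eq_bigr => i _; rewrite add0r mulrC.
move=> ->.
have := sum_residues 1 p_gt0 (coprime1n p : coprimez 1 p) addchar_periodic.
under eq_bigr do rewrite mul1r addcharD.
rewrite -mulr_sumr => /eqP.
rewrite -subr_eq0 -[X in _ - X]mul1r -mulrBl mulf_eq0 subr_eq0 => /orP[|/eqP//].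
rewrite /addchar modz_small; last by have := prime_gt1 pr_p; lia.
rewrite -(prim_order_dvd prim_zeta) dvdn1 => /eqP p1.
by move: pr_p; rewrite p1.
Qed.

Definition gauss_sum : F := \sum_(a < p) (legendre a%:Z p)%:~R * addchar a%:Z.

Lemma gauss_sum_twist (c : int) : ~~ (p %| c)%Z ->
  \sum_(a < p) (legendre a%:Z p)%:~R * addchar (a%:Z * c) = (legendre c p)%:~R * gauss_sum.
Proof.
move=> ndiv; have co_c : coprimez c p.
  rewrite coprimez_sym /coprimez /gcdz eqz_nat -[_ == _]/(coprime p `|c|).
  by rewrite prime_coprime.
pose G (x : int) : F := (legendre x p)%:~R * addchar x.
have perG x : G (x + p%:Z) = G x by rewrite /G legendreD addchar_periodic.
rewrite /gauss_sum -(sum_residues 0 p_gt0 co_c perG) mulr_sumr.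
apply: eq_bigr => a _; rewrite /G add0r legendreM // rmorphM /= !mulrA.
rewrite -rmorphM /= legendre_sqr // mul1r; congr (_ * addchar _).
by rewrite mulrC.
Qed.

Lemma gauss_sum_sqr : gauss_sum ^+ 2 = (legendre (-1) p * p%:Z)%:~R.
Proof.
rewrite expr2 {1}/gauss_sum mulr_suml.
have step (a : 'I_p) : (legendre a%:Z p)%:~R * addchar a%:Z * gauss_sum =
    \sum_(b < p) (legendre b%:Z p)%:~R * (if (p %| a%:Z)%Z then 0 else addchar (a%:Z * (1 + b%:Z))).
  have [a0|a0] := boolP (p %| a%:Z)%Z.
    have -> : legendre a p = 0 by apply/eqP; rewrite legendre_eq0.
    by rewrite !mul0r big1 // => b _; rewrite mulr0.
  rewrite mulrAC -(gauss_sum_twist a0) mulr_suml; apply: eq_bigr => b _.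
  rewrite -mulrA -addcharD; congr (_ * addchar _); ring.
rewrite (eq_bigr _ (fun a _ => step a)) exchange_big /=.
have inner (b : 'I_p) : \sum_(a < p) (legendre b%:Z p)%:~R *
   (if (p %| a%:Z)%Z then 0 else addchar (a%:Z * (1 + b%:Z))) =
   (legendre b%:Z p)%:~R * ((if (p %| (1 + b%:Z))%Z then p%:R else 0) - 1).
  rewrite -mulr_sumr -(sum_addchar (1 + b%:Z)); congr (_ * _).
  rewrite (bigD1 (Ordinal p_gt0)) //= dvdz0 add0r.
  rewrite [in RHS](bigD1 (Ordinal p_gt0)) //= mul0r /addchar mod0z expr0 addrAC subrr add0r.
  apply: eq_bigr => a a0; rewrite dvdzE /= gtnNdvd //.
  by rewrite lt0n; apply: contraNneq a0 => a0; apply/eqP/val_inj.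
rewrite (eq_bigr _ (fun b _ => inner b)).
under eq_bigr do rewrite mulrBr mulr1.
rewrite sumrB -(rmorph_sum (intmul 1)) /= sum_legendre // subr0.
have lt_p : (p.-1 < p)%N by rewrite prednK.
have dvd1 (b : 'I_p) : (p %| 1 + b%:Z)%Z = (b == Ordinal lt_p).
  rewrite -[RHS](inj_eq val_inj) /= dvdzE.
  have -> : absz (1 + b%:Z) = b.+1 by lia.
  apply/idP/eqP => [/dvdn_leq|->]; last by rewrite prednK.
  by move=> /(_ isT); have := ltn_ord b; lia.
rewrite (bigD1 (Ordinal lt_p)) // dvd1 eqxx big1 ?addr0; last first.
  by move=> b nb; rewrite dvd1 (negPf nb) mulr0.
have -> : legendre (Ordinal lt_p : nat)%:Z p = legendre (-1) p; last first.
  by rewrite rmorphM /= addr0.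
apply: legendre_mod; rewrite -[RHS]modzDr /=; congr (_ %% _)%Z.
by move: p_gt0; clear; lia.
Qed.

Lemma gauss_sum_frobenius : prime q -> odd q -> q \in [pchar F] -> ~~ (p %| q)%N ->
  gauss_sum ^+ q = (legendre q%:Z p)%:~R * gauss_sum.
Proof.
move=> pr_q odd_q chq npq; rewrite -(pFrobenius_autE chq) rmorph_sum /=.
rewrite -gauss_sum_twist; last by rewrite dvdzE.
apply: eq_bigr => a _; rewrite rmorphM /= rmorph_int; congr (_ * _).
rewrite pFrobenius_autE mulrC.
elim: (q) => [|n IH]; first by rewrite mul0r expr0 /addchar mod0z expr0.
by rewrite exprS IH -addcharD; congr addchar; lia.
Qed.
End GaussSum.

Lemma prim_root_in_char (p q : nat) : prime q -> coprime p q -> (1 < p)%N ->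
  exists F : finFieldType, q \in [pchar F] /\ exists z : F, p.-primitive_root z.
Proof.
move=> pr_q co_pq p1.
have tot0 : (0 < totient p)%N by rewrite totient_gt0; lia.
have [F chq cardF] := pPrimePowerField pr_q tot0.
exists F; split=> //.
have dvd_p : (p %| #|F|.-1)%N.
  rewrite cardF -subn1 -eqn_mod_dvd; last by rewrite expn_gt0 prime_gt0.
  by rewrite eq_sym Euler_exp_totient // coprime_sym.
have F1 := finNzRing_gt1 F.
have /hasP[g _ prim_g] : has (#|F|.-1).-primitive_root (enum (predC1 (0 : F))).
  apply: has_prim_root; first by rewrite -subn1 subn_gt0.
  - apply/allP => y; rewrite mem_enum !inE => y0; rewrite unity_rootE.
    apply/eqP; apply: (mulfI y0); rewrite -exprS prednK ?mulr1 ?expf_card //.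
    exact: ltnW.
  - exact: enum_uniq.
  - by rewrite -cardE cardC1.
by eexists; exact: (dvdn_prim_root prim_g dvd_p).
Qed.

Lemma sign_eq_in_char (F : fieldType) (q : nat) (a b : int) : prime q -> odd q -> q \in [pchar F] ->
  `|a| <= 1 -> `|b| <= 1 -> a%:~R = b%:~R :> F -> a = b.
Proof.
move=> pr_q odd_q chq a1 b1 /eqP; rewrite -subr_eq0 -rmorphB /= -(dvdz_pcharf chq) => dv.
have := odd_prime_dvd_small pr_q odd_q _ dv; lia.
Qed.

Lemma legendre_eulerF (F : fieldType) (a : int) (q : nat) : prime q -> odd q -> q \in [pchar F] ->
  (legendre a q)%:~R = a%:~R ^+ q.-1./2 :> F.
Proof.
move=> pr_q odd_q chq; have := legendre_euler a pr_q odd_q.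
by rewrite (dvdz_pcharf chq) rmorphB rmorphXn /= subr_eq0 => /eqP.
Qed.

Lemma legendre_reciprocity (p q : nat) : prime p -> prime q -> odd p -> odd q ->
  legendre p q = legendre q p * (-1) ^+ (p.-1./2 * q.-1./2).
Proof.
move=> pr_p pr_q odd_p odd_q; case: (eqVneq p q) => [<-|neq].
  by have /eqP -> : legendre p p == 0; rewrite ?mul0r // legendre_eq0.
have npq : ~~ (p %| q)%N by rewrite dvdn_prime2.
have nqp : ~~ (q %| p)%N by rewrite dvdn_prime2 // eq_sym.
have co_pq : coprime p q by rewrite prime_coprime.
have [F [chq [z prim_z]]] := prim_root_in_char pr_q co_pq (prime_gt1 pr_p).
have Gq := gauss_sum_frobenius pr_p odd_p prim_z pr_q odd_q chq npq.
have G2 := gauss_sum_sqr pr_p odd_p prim_z.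
set G := gauss_sum p z in Gq G2.
have G0 : G != 0.
  rewrite -sqrf_eq0 G2 -(dvdz_pcharf chq) dvdzE abszM Euclid_dvdM // negb_or nqp andbT.
  have := legendreN1 pr_p odd_p; rewrite -signr_odd => ->.
  by case: (odd _) => //; rewrite /= dvdn1; apply: contraTneq pr_q => ->.
have half : q = (q.-1./2).*2.+1 by move: odd_q (prime_gt0 pr_q); lia.
move: Gq; rewrite {1}half exprS mulrC => /(mulIf G0).
rewrite -mul2n exprM G2 -legendre_eulerF // => /(sign_eq_in_char pr_q odd_q chq).
move=> /(_ (legendre_abs_le1 _ _) (legendre_abs_le1 _ _)) <-.
rewrite legendreM // legendreN1 // legendreX // legendreN1 // -exprM mulnC mulrAC.
by rewrite -exprD addnn -signr_odd odd_double mul1r.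
Qed.

Lemma legendre2 (p : nat) : prime p -> odd p ->
  legendre 2 p = if (p %% 8 == 1)%N || (p %% 8 == 7)%N then 1 else -1.
Proof.
move=> pr_p odd_p; have co8 : coprime 8 p by rewrite (@coprime_pexpl 3 2) // coprime2n.
have [F [chp [z prim_z]]] := prim_root_in_char pr_p co8 isT.
have z8 := prim_expr_order prim_z.
have z0 : z != 0 by apply: contra_eq_neq z8 => ->; rewrite expr0n /= eq_sym oner_neq0.
have z4 : z ^+ 4 = -1.
  have : (z ^+ 4) ^+ 2 == 1 by rewrite -exprM z8.
  by rewrite sqrf_eq1 => /orP[|/eqP//]; rewrite -(prim_order_dvd prim_z).
pose y := z + z ^+ 7.
have y2 : y ^+ 2 = 2%:~R.
  have -> : y ^+ 2 = z ^+ 2 * (1 + z ^+ 4 * z ^+ 8) + 2 * z ^+ 8 by rewrite /y; ring.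
  by rewrite z4 z8 mulr1 subrr mulr0 add0r mulr1.
have y0 : y != 0.
  rewrite -sqrf_eq0 y2 -(dvdz_pcharf chp) dvdzE /=.
  by apply: contraTN odd_p => /(fun h => dvdn_leq (isT : 0 < 2)%N h); move: (prime_gt1 pr_p); lia.
have yp : y ^+ p = z ^+ p + z ^+ (7 * p) by rewrite -(pFrobenius_autE chp) rmorphD /= !pFrobenius_autE exprM.
have half : p = (p.-1./2).*2.+1 by move: odd_p (prime_gt0 pr_p); lia.
have yp2 : y ^+ p = (legendre 2 p)%:~R * y.
  by rewrite [X in _ ^+ X]half exprS -mul2n exprM y2 -legendre_eulerF // mulrC.
have modE k : z ^+ k = z ^+ (k %% 8) by rewrite [in LHS](divn_eq k 8) exprD mulnC exprM z8 expr1n mul1r.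
have p8 : (p %% 8 = 1 \/ p %% 8 = 3 \/ p %% 8 = 5 \/ p %% 8 = 7)%N by move: odd_p; lia.
have key e : `|e| <= 1 -> z ^+ p + z ^+ (7 * p) = e%:~R * y -> legendre 2 p = e.
  move=> e1 eE; apply: (sign_eq_in_char pr_p odd_p chp) => //; first exact: legendre_abs_le1.
  by apply: (mulIf y0); rewrite -yp2 yp.
have m7 : (7 * p %% 8 = 7 * (p %% 8) %% 8)%N by rewrite modnMmr.
apply: key; first by case: ifP.
rewrite (modE p) (modE (7 * p)%N) m7 /y.
have z5 : z ^+ 5 = - z by rewrite exprS z4 mulrN1.
have z7 : z ^+ 7 = - z ^+ 3 by rewrite (exprD _ 4 3) z4 mulN1r.
by case: p8 => [->|[->|[->|->]]] /=; rewrite ?z5 ?z7 ?rmorphN ?rmorph1 /=; ring.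
Qed.

(** * Jacobi symbols *)

Lemma jacobi1 (a : int) : jacobi a 1 = 1.
Proof. by rewrite /jacobi big_nil. Qed.

Lemma jacobi_widen (a : int) (n N : nat) : (0 < n)%N -> (n < N)%N ->
  jacobi a n = \prod_(p <- iota 0 N | prime p) legendre a p ^+ logn p n.
Proof.
move=> n0 nN; rewrite /jacobi [RHS](bigID (mem (primes n))) /= [X in _ * X]big1 ?mulr1; last first.
  move=> p /andP[pr_p]; rewrite mem_primes pr_p n0 /= => ndv.
  by rewrite lognE pr_p n0 (negPf ndv) expr0.
rewrite -[RHS]big_filter; apply: perm_big; apply: uniq_perm.
- exact: primes_uniq.
- by rewrite filter_uniq ?iota_uniq.
move=> p; rewrite mem_filter mem_iota add0n /= mem_primes.
case: (prime p) => //=; rewrite n0 /=; case dv: (p %| n)%N => //=.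
by rewrite (leq_ltn_trans (dvdn_leq n0 dv)).
Qed.

Lemma jacobi_muln (a : int) (m n : nat) : (0 < m)%N -> (0 < n)%N ->
  jacobi a (m * n) = jacobi a m * jacobi a n.
Proof.
move=> m0 n0; have mn0 : (0 < m * n)%N by rewrite muln_gt0 m0.
pose N := (m * n).+1.
rewrite !(@jacobi_widen a _ N) //.
- rewrite -big_split /=; apply: eq_bigr => p pr_p.
  by rewrite lognM // exprD.
- by rewrite ltnS leq_pmull.
- by rewrite ltnS leq_pmulr.
Qed.

Lemma jacobi_prime (a : int) (p : nat) : prime p -> jacobi a p = legendre a p.
Proof.
by move=> pr_p; rewrite /jacobi primes_prime // big_seq1 logn_prime // eqxx expr1.
Qed.

Lemma jacobi_mod (a b : int) (n : nat) : (a = b %[mod n])%Z -> jacobi a n = jacobi b n.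
Proof.
move=> eq_ab; apply: eq_big_seq => p; rewrite mem_primes => /and3P[_ _ dv].
congr (_ ^+ _); apply: legendre_mod; apply/eqP; rewrite eqz_mod_dvd.
by apply: (@dvdz_trans n%:Z); [rewrite dvdzE | rewrite -eqz_mod_dvd eq_ab].
Qed.

Lemma jacobi_congr (a b : int) (n : nat) : (n %| a - b)%Z -> jacobi a n = jacobi b n.
Proof. by rewrite -eqz_mod_dvd => /eqP; apply: jacobi_mod. Qed.

Lemma odd_primes (n p : nat) : odd n -> p \in primes n -> prime p /\ odd p.
Proof.
move=> odd_n; rewrite mem_primes => /and3P[pr_p _ dv]; split=> //.
exact: dvdn_odd dv odd_n.
Qed.

Lemma jacobiM (a b : int) (n : nat) : odd n -> jacobi (a * b) n = jacobi a n * jacobi b n.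
Proof.
move=> odd_n; rewrite /jacobi -big_split; apply: eq_big_seq => p /(odd_primes odd_n)[pr_p odd_p].
by rewrite legendreM // exprMn.
Qed.

Lemma jacobi_1 (n : nat) : odd n -> jacobi 1 n = 1.
Proof.
move=> odd_n; rewrite /jacobi big1_seq // => p /= /(odd_primes odd_n)[pr_p odd_p].
by rewrite legendre1 // expr1n.
Qed.

Lemma jacobi_cases (a : int) (n : nat) :
  [\/ jacobi a n = 0, jacobi a n = 1 | jacobi a n = -1].
Proof.
rewrite /jacobi; elim: (primes n) => [|p s IH]; first by rewrite big_nil; constructor 2.
rewrite big_cons; set J := \prod_(j <- s) _ in IH *.
elim: (logn p n) => [|k IHk]; first by rewrite expr0 mul1r.
rewrite exprS -mulrA; move: (_ ^+ k * J) IHk => x IHk.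
case: (legendre_cases a p) => ->.
- by constructor 1; rewrite mul0r.
- by rewrite mul1r; exact: IHk.
- by rewrite mulN1r; case: IHk => ->; rewrite ?oppr0 ?opprK; [constructor 1|constructor 3|constructor 2].
Qed.

Lemma jacobi_abs_le1 (a : int) (n : nat) : `|jacobi a n| <= 1.
Proof. by case: (jacobi_cases a n) => ->. Qed.

Lemma jacobi_neq0 (a : int) (n : nat) : (0 < n)%N -> (jacobi a n != 0) = coprimez a n.
Proof.
move=> n0; rewrite /jacobi prodf_seq_neq0 coprimez_sym.
rewrite /coprimez /gcdz eqz_nat -[_ == 1%N]/(coprime n `|a|).
apply/allP/idP => [h|co p pn]; last first.
  apply: expf_neq0; rewrite legendre_eq0.
  move: pn; rewrite mem_primes => /and3P[pr_p _ dv].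
  apply/negP => dva; have := prime_gt1 pr_p.
  have : (p %| gcdn n `|a|)%N by rewrite dvdn_gcd dv.
  by move: co; rewrite /coprime => /eqP ->; rewrite dvdn1 => /eqP ->.
rewrite /coprime; apply: contraT => g1.
have g0 : (0 < gcdn n `|a|)%N by rewrite gcdn_gt0 n0.
have pr_p : prime (pdiv (gcdn n `|a|)) by apply: pdiv_prime; lia.
have := pdiv_dvd (gcdn n `|a|); rewrite dvdn_gcd => /andP[dvn dva].
have pin : pdiv (gcdn n `|a|) \in primes n by rewrite mem_primes pr_p n0.
have := h _ pin; rewrite /= => /negP[].
rewrite expf_eq0 legendre_eq0 dvdzE /= dva andbT.
by move: pin; rewrite -logn_gt0.
Qed.

Lemma odd_nat_ind (P : nat -> Prop) :
  P 1%N -> (forall p, prime p -> odd p -> P p) ->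
  (forall m n, odd m -> odd n -> P m -> P n -> P (m * n)%N) -> forall n, odd n -> P n.
Proof.
move=> P1 Pp PM n; elim/ltn_ind: n => n IH odd_n.
case: (eqVneq n 1%N) => [->//|n1].
have n0 : (0 < n)%N by case: n odd_n {IH n1}.
have pr_p : prime (pdiv n) by apply: pdiv_prime; lia.
have nE := divnK (pdiv_dvd n); rewrite -nE.
have : odd (n %/ pdiv n * pdiv n) by rewrite nE.
rewrite oddM => /andP[odd_m odd_p]; apply: PM => //; last exact: Pp.
apply: IH => //; rewrite -[X in (_ < X)%N]nE ltn_Pmulr ?prime_gt1 //.
by case: (n %/ pdiv n)%N odd_m.
Qed.

Definition odd_sign (m n : nat) : int := (-1) ^+ (m.-1./2 * n.-1./2).

Lemma odd_signC m n : odd_sign m n = odd_sign n m.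
Proof. by rewrite /odd_sign mulnC. Qed.

Lemma odd_signM m m' n : odd m -> odd m' -> odd_sign (m * m') n = odd_sign m n * odd_sign m' n.
Proof.
have half k : odd k -> exists a, k = a.*2.+1 by move=> ok; exists k./2; lia.
case/half => a -> /half[b ->]; rewrite /odd_sign -exprD -mulnDl -signr_odd -[RHS]signr_odd !oddM.
have -> : ((a.*2.+1 * b.*2.+1).-1 = (a * b.*2.+1 + b).*2)%N by lia.
by rewrite doubleK /= !doubleK !oddD oddM /= odd_double /= andbT.
Qed.

Lemma odd_sign1 n : odd_sign 1 n = 1.
Proof. by rewrite /odd_sign mul0n. Qed.

Lemma jacobi_reciprocity_nat (m n : nat) : odd m -> odd n ->
  jacobi m%:Z n = jacobi n%:Z m * odd_sign m n.
Proof.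
have pos k : odd k -> (0 < k)%N by case: k.
move=> om on; elim/odd_nat_ind: n / on => [|q pr_q oq|n n' on on' IH IH'].
- by rewrite jacobi1 odd_signC odd_sign1 mulr1 jacobi_1.
- elim/odd_nat_ind: m / om => [|p pr_p op|m m' om om' IH IH'].
  + by rewrite jacobi1 odd_sign1 mulr1 jacobi_1.
  + by rewrite !jacobi_prime // legendre_reciprocity.
  + rewrite PoszM jacobiM // IH IH' jacobi_muln ?pos // odd_signM //; ring.
- rewrite jacobi_muln ?pos // PoszM jacobiM // IH IH'.
  by rewrite [odd_sign m (_ * _)]odd_signC odd_signM // !(odd_signC _ m); ring.
Qed.

Lemma jacobiN1 (n : nat) : odd n -> jacobi (-1) n = (-1) ^+ n.-1./2.
Proof.
have pos k : odd k -> (0 < k)%N by case: k.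
elim/odd_nat_ind => [|q pr_q oq|m m' om om' IH IH'].
- by rewrite jacobi1.
- by rewrite jacobi_prime // legendreN1.
- rewrite jacobi_muln ?pos // IH IH'.
  by have := odd_signM 3 om om'; rewrite /odd_sign /= !muln1.
Qed.

Lemma jacobi2 (n : nat) : odd n ->
  jacobi 2 n = if (n %% 8 == 1)%N || (n %% 8 == 7)%N then 1 else -1.
Proof.
have pos k : odd k -> (0 < k)%N by case: k.
elim/odd_nat_ind => [|q pr_q oq|m m' om om' IH IH'].
- by rewrite jacobi1.
- by rewrite jacobi_prime // legendre2.
- rewrite jacobi_muln ?pos // IH IH' -modnMm.
  have : (m %% 8 = 1 \/ m %% 8 = 3 \/ m %% 8 = 5 \/ m %% 8 = 7)%N by move: om; lia.
  have : (m' %% 8 = 1 \/ m' %% 8 = 3 \/ m' %% 8 = 5 \/ m' %% 8 = 7)%N by move: om'; lia.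
  by move=> [->|[->|[->|->]]] [->|[->|[->|->]]].
Qed.

Definition hilbert_inf (m n : int) : int := (-1) ^+ ((m < 0) && (n < 0)).
Definition hilbert_two (m n : int) : int := (-1) ^+ ((m %% 4 == 3)%Z && (n %% 4 == 3)%Z).

Lemma jacobi_abs (m : int) (n : nat) : odd n ->
  jacobi m n = jacobi `|m|%N n * (-1) ^+ ((m < 0) && (n %% 4 == 3)%N).
Proof.
move=> on; case: (ltrP m 0) => m0; last by rewrite gez0_abs // expr0 mulr1.
have -> : m = (-1) * (absz m)%:Z by lia.
rewrite [LHS]jacobiM // mulrC; congr (_ * _); first by congr (jacobi _ n); lia.
rewrite jacobiN1 // -signr_odd; congr (_ ^+ nat_of_bool _); lia.
Qed.

Lemma jacobi_reciprocity (m n : int) : odd `|m| -> odd `|n| ->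
  jacobi m `|n| = jacobi n `|m| * (hilbert_inf m n * hilbert_two m n).
Proof.
move=> om on; rewrite jacobi_abs // [in RHS]jacobi_abs // jacobi_reciprocity_nat //.
rewrite /odd_sign /hilbert_inf /hilbert_two -!mulrA; congr (_ * _).
rewrite -[_ ^+ (_ * _)]signr_odd -!signr_addb; congr (_ ^+ nat_of_bool _).
rewrite oddM; case: m om => m om; case: n on => n on /=; lia.
Qed.

Lemma jacobi_denominator_odd (s x y : int) : odd `|s| -> odd `|x| -> odd `|y| ->
  (s %| x - y)%Z -> (4 %| x - y)%Z ->
  jacobi s `|x| = jacobi s `|y| * (-1) ^+ ((s < 0) && ((x < 0) != (y < 0))).
Proof.
move=> os ox oy sxy xy4; rewrite (jacobi_reciprocity os ox) (jacobi_reciprocity os oy).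
have -> : jacobi x `|s| = jacobi y `|s| by apply: jacobi_congr; rewrite dvdzE.
rewrite -!mulrA; congr (_ * _); rewrite /hilbert_inf /hilbert_two -!signr_addb.
congr (_ ^+ nat_of_bool _).
have -> : (x %% 4 = y %% 4)%Z by apply/eqP; rewrite eqz_mod_dvd.
by move: (s < 0) (x < 0) (y < 0) (s %% 4 == 3)%Z (y %% 4 == 3)%Z => [] [] [] [] [].
Qed.

Lemma jacobi2_int (x : int) : odd `|x| ->
  jacobi 2 `|x| = (-1) ^+ ((x %% 8 == 3)%Z || (x %% 8 == 5)%Z).
Proof.
move=> ox; rewrite jacobi2 //.
have -> : ((x %% 8 == 3)%Z || (x %% 8 == 5)%Z) = ~~ ((`|x| %% 8 == 1)%N || (`|x| %% 8 == 7)%N).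
  by move: ox; case: x => x /=; lia.
by case: (_ || _).
Qed.

Lemma jacobi_denominator (k : nat) (s x y : int) : odd `|s| -> odd `|x| -> odd `|y| ->
  (s %| x - y)%Z -> (4 %| x - y)%Z ->
  jacobi (2 ^+ k * s) `|x| = jacobi (2 ^+ k * s) `|y| *
   (-1) ^+ ((s < 0) && ((x < 0) != (y < 0))) * (-1) ^+ (odd k && ~~ (8 %| x - y)%Z).
Proof.
move=> os ox oy sxy xy4; elim: k => [|k IH].
  by rewrite expr0 mul1r /= mulr1; apply: jacobi_denominator_odd.
rewrite exprS -!mulrA !(jacobiM 2) // IH.
have -> : jacobi 2 `|x| = jacobi 2 `|y| * (-1) ^+ (~~ (8 %| x - y)%Z).
  rewrite !jacobi2_int // -signr_addb; congr (_ ^+ nat_of_bool _).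
  by move: ox oy xy4; clear; lia.
have -> : (-1) ^+ (odd k.+1 && ~~ (8 %| x - y)%Z) =
   (-1) ^+ (~~ (8 %| x - y)%Z) * (-1) ^+ (odd k && ~~ (8 %| x - y)%Z) :> int.
  by rewrite -signr_addb /=; case: (odd k); case: (8 %| _)%Z.
ring.
Qed.

Definition mult_sign (u r s a : int) : bool :=
  if u < 0 then (if s < 0 then r < 0 else ~~ (a < 0))
  else (if s < 0 then (a < 0) (+) (r < 0) else false).

Lemma jacobi_coprime_sqr (a : int) (n : nat) : (0 < n)%N -> coprimez a n ->
  jacobi a n * jacobi a n = 1.
Proof. by move=> n0; rewrite -jacobi_neq0 //; case: (jacobi_cases a n) => ->. Qed.

Lemma sign_sqr (b : bool) : (-1) ^+ b * (-1) ^+ b = 1 :> int.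
Proof. by case: b. Qed.

Lemma jacobi_Re_norm (u v : int) : odd `|u| -> ~~ odd `|v| -> coprimez u v ->
  jacobi u `|u ^+ 2 + v ^+ 2| = 1.
Proof.
move=> ou ev co; have q0 : 0 <= u ^+ 2 + v ^+ 2 by rewrite addr_ge0 ?sqr_ge0.
have oq : odd `|u ^+ 2 + v ^+ 2|.
  have [x ux] : exists x, u = x * 2 + 1 by exists (u %/ 2)%Z; move: ou; clear; lia.
  have [y vy] : exists y, v = y * 2 by exists (v %/ 2)%Z; move: ev; clear; lia.
  have -> : u ^+ 2 + v ^+ 2 = (2 * x ^+ 2 + 2 * x + 2 * y ^+ 2) * 2 + 1 by rewrite ux vy; ring.
  move: (_ + 2 * y ^+ 2); clear; lia.
rewrite jacobi_reciprocity //.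
have -> : hilbert_two u (u ^+ 2 + v ^+ 2) = 1.
  have [x ux] : exists x, u = x * 2 + 1 by exists (u %/ 2)%Z; move: ou; clear; lia.
  have [y vy] : exists y, v = y * 2 by exists (v %/ 2)%Z; move: ev; clear; lia.
  have : u ^+ 2 + v ^+ 2 = (x ^+ 2 + x + y ^+ 2) * 4 + 1 by rewrite ux vy; ring.
  rewrite /hilbert_two => ->; rewrite modzMDl andbF; by [].
have -> : hilbert_inf u (u ^+ 2 + v ^+ 2) = 1 by rewrite /hilbert_inf [_ + _ < 0]ltNge q0 andbF.
rewrite !mulr1 -(jacobi_coprime_sqr (_ : 0 < `|u|)%N (_ : coprimez v `|u|)); last 2 first.
- by case: (absz u) ou.
- by rewrite coprimez_sym /coprimez /gcdz absz_nat.
rewrite -jacobiM //; apply: jacobi_congr.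
by rewrite -expr2 addrK dvdzE abszX /= expnS dvdn_mulr.
Qed.

(* With [g = gcd(u, s)], [u = g u1], [s = g s1] and [a = g a1] one has
   [u1 b - v a1 = q s1]; this gives [J(b, a1)] in terms of symbols which
   reciprocity evaluates. *)
Lemma jacobi_product (u v r s : int) :
  let a := u * r - v * s in let b := u * s + v * r in let q := u ^+ 2 + v ^+ 2 in
  odd `|u| -> ~~ odd `|v| -> odd `|r| -> ~~ odd `|s| -> s != 0 ->
  coprimez u v -> coprimez r s ->
  jacobi b `|a| = jacobi v `|u| * jacobi s `|r| * jacobi a `|q| *
    (-1) ^+ (mult_sign u r s a) *
    ((-1) ^+ ((u %% 4 == 3)%Z && (r %% 4 == 3)%Z) * (-1) ^+ ~~ (8 %| v * s)%Z).
Proof.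
move=> a b q ou ev or es s0 co_uv co_rs.
pose g := gcdn `|u| `|s|.
have [u1 uE] : exists u1, u = g%:Z * u1.
  by exists (u %/ g)%Z; rewrite mulrC divzK // dvdzE dvdn_gcdl.
have [s1 sE] : exists s1, s = g%:Z * s1.
  by exists (s %/ g)%Z; rewrite mulrC divzK // dvdzE dvdn_gcdr.
have g0 : (0 < g)%N by rewrite gcdn_gt0 orbC; case: (absz s) (absz_eq0 s) s0 => // <-.
have gZ : g%:Z != 0 by move: g0; clear; lia.
have og : odd g by apply: dvdn_odd (dvdn_gcdl _ _) ou.
have ou1 : odd `|u1| by move: ou; rewrite uE abszM oddM => /andP[].
have es1 : ~~ odd `|s1| by move: es; rewrite sE abszM oddM /= og.
have s10 : s1 != 0 by apply: contraNneq s0 => s10; rewrite sE s10 mulr0.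
have co_us1 : coprimez u1 s1.
  have uN : (`|u| = g * `|u1|)%N by rewrite [in LHS]uE abszM.
  have sN : (`|s| = g * `|s1|)%N by rewrite [in LHS]sE abszM.
  have : (g * gcdn `|u1| `|s1| = g * 1)%N by rewrite muln1 muln_gcdr -uN -sN.
  by move/eqP; rewrite eqn_pmul2l // /coprimez /gcdz eqz_nat.
pose a1 := u1 * r - v * s1.
have aE : a = g%:Z * a1 by rewrite /a /a1 uE sE; ring.
have key : u1 * b - v * a1 = q * s1 by rewrite /b /a1 /q uE sE; ring.
have odd_mulz (x y : int) : odd `|x * y| = odd `|x| && odd `|y| by rewrite abszM oddM.
have oa1 : odd `|a1|.
  have : odd `|u1 * r| by rewrite odd_mulz ou1.
  have : ~~ odd `|v * s1| by rewrite odd_mulz negb_and ev.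
  by rewrite /a1; clear; lia.
have pos n : odd n -> (0 < n)%N by case: n.
have co_ua : coprimez u1 a1.
  have -> : a1 = r * u1 + - (v * s1) by rewrite /a1; ring.
  rewrite /coprimez gcdzMDl -/(coprimez u1 _) coprimezN coprimezMr co_us1 andbT.
  by move: co_uv; rewrite uE coprimezMl => /andP[].
have co_vu1 : coprimez v u1 by move: co_uv; rewrite uE coprimezMl coprimez_sym => /andP[_]; rewrite coprimez_sym.
have co_vg : coprimez v g by move: co_uv; rewrite uE coprimezMl coprimez_sym => /andP[].
have oq : odd `|q|.
  by rewrite /q; have := odd_mulz u u; have := odd_mulz v v; rewrite !expr2; move: ou ev; clear; lia.
have q0 : 0 <= q by rewrite addr_ge0 ?sqr_ge0.
have q4 : (q %% 4 = 1)%Z.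
  have [x ux] : exists x, u = x * 2 + 1 by exists (u %/ 2)%Z; move: ou; clear; lia.
  have [y vy] : exists y, v = y * 2 by exists (v %/ 2)%Z; move: ev; clear; lia.
  have -> : q = (x ^+ 2 + x + y ^+ 2) * 4 + 1 by rewrite /q ux vy; ring.
  by rewrite modzMDl.
have Jb : jacobi b `|a| = jacobi b g * jacobi b `|a1|.
  by rewrite aE abszM jacobi_muln ?pos.
have Jbg : jacobi b g = jacobi v g * jacobi r g.
  rewrite -jacobiM //; apply: jacobi_congr.
  have -> : b - v * r = g%:Z * (u1 * s) by rewrite /b uE; ring.
  exact: dvdz_mulr.
have E1 : jacobi b `|a1| = jacobi u1 `|a1| * (jacobi q `|a1| * jacobi s1 `|a1|).
  have sq := jacobi_coprime_sqr (pos _ oa1) (co_ua : coprimez u1 `|a1|).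
  rewrite -[LHS]mul1r -sq -mulrA; congr (_ * _); rewrite -!jacobiM //.
  apply: jacobi_congr; have -> : u1 * b - q * s1 = v * a1 by rewrite -key; ring.
  by apply: dvdz_mull; rewrite dvdzE.
have E2 : jacobi q `|a1| = jacobi a `|q|.
  rewrite aE jacobiM // [jacobi g%:Z _](@jacobi_reciprocity g%:Z q) //.
  rewrite [LHS]jacobi_reciprocity // /hilbert_inf /hilbert_two q4.
  rewrite [q < 0]ltNge q0 /= !andbF !mulr1.
  have -> : jacobi q g = 1; last by rewrite mul1r.
  rewrite -(jacobi_coprime_sqr g0 co_vg) -jacobiM //; apply: jacobi_congr.
  have -> : q - v * v = g%:Z * (u1 * u) by rewrite /q uE; ring.
  exact: dvdz_mulr.
have E5 : jacobi u1 `|a1| = jacobi (-1) `|u1| * jacobi v `|u1| * jacobi s1 `|u1| *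
    (hilbert_inf u1 a1 * hilbert_two u1 a1).
  rewrite jacobi_reciprocity //; congr (_ * _); rewrite -!jacobiM //.
  apply: jacobi_congr; have -> : a1 - (-1) * v * s1 = u1 * r by rewrite /a1; ring.
  by apply: dvdz_mulr; rewrite dvdzE.
have [k [s' [os' s1E]]] : exists k s', odd `|s'| /\ s1 = 2 ^+ k * s'.
  have s1_gt0 : (0 < `|s1|)%N by move: s10; clear; lia.
  have [m co mE] := pfactor_coprime (isT : prime 2) s1_gt0.
  exists (logn 2 `|s1|), ((-1) ^+ (s1 < 0)%R * m%:Z); split.
    by rewrite abszMsign -coprime2n.
  rewrite {1}[s1]intEsign mulrCA; congr (_ * _).
  by rewrite {1}mE PoszM mulrC -[X in X * _]natz natrX.
have E6 : jacobi s1 `|a1| = jacobi s1 `|u1| * jacobi s1 `|r| *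
    (-1) ^+ ((s < 0) && ((a < 0) != (u1 * r < 0))) * (-1) ^+ ~~ (8 %| v * s)%Z.
  have dv : (4 %| v * s1)%Z.
    have [x ->] : exists x, v = x * 2 by exists (v %/ 2)%Z; move: ev; clear; lia.
    have [y ->] : exists y, s1 = y * 2 by exists (s1 %/ 2)%Z; move: es1; clear; lia.
    by have -> : x * 2 * (y * 2) = 4 * (x * y) :> int by [ring]; apply: dvdz_mulr.
  have := @jacobi_denominator k s' a1 (u1 * r) os' oa1.
  have -> : a1 - u1 * r = - (v * s1) by rewrite /a1; ring.
  rewrite odd_mulz ou1 or -s1E !rpredN; move=> /(_ isT).
  have -> : (s' %| v * s1)%Z by rewrite s1E mulrA dvdz_mull.
  move=> /(_ isT dv) ->; rewrite abszM jacobi_muln ?pos //.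
  have -> : (s < 0) = (s' < 0) by rewrite sE s1E mulrA pmulr_rlt0 // mulr_gt0 ?exprn_gt0 //.
  have -> : (a < 0) = (a1 < 0) by rewrite aE pmulr_rlt0.
  congr (_ * (-1) ^+ nat_of_bool _).
  have -> : (8 %| v * s)%Z = (8 %| v * s1)%Z.
    have co8 : coprimez 8 g by rewrite coprimezE (@coprime_pexpl 3 2) // coprime2n.
    by have -> : v * s = g%:Z * (v * s1) by [rewrite [in LHS]sE mulrCA]; rewrite (Gauss_dvdzr _ co8).
  case: (boolP (8 %| _)%Z) => [|n8]; first by rewrite andbF.
  case: k s1E => [|[|k]] s1E; rewrite ?andbT //=.
    by move: es1; rewrite s1E expr0 mul1r os'.
  case/negP: n8.
  have [x ->] : exists x, v = x * 2 by exists (v %/ 2)%Z; move: ev; clear; lia.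
  by rewrite s1E !exprS; have -> : x * 2 * (2 * (2 * 2 ^+ k) * s') = 8 * (x * 2 ^+ k * s') by [ring]; apply: dvdz_mulr.
have E7 : jacobi r g = jacobi g `|r| * hilbert_two r g.
  by rewrite [LHS](@jacobi_reciprocity r g%:Z) // /hilbert_inf andbF mul1r.
have Jv : jacobi v `|u| = jacobi v g * jacobi v `|u1| by rewrite uE abszM jacobi_muln ?pos.
have Js : jacobi s `|r| = jacobi g `|r| * jacobi s1 `|r| by rewrite {1}sE jacobiM.
have Jsu : jacobi s1 `|u1| * jacobi s1 `|u1| = 1.
  by apply: jacobi_coprime_sqr; rewrite ?pos // coprimez_sym.
have signs : hilbert_two r g * jacobi (-1) `|u1| * (hilbert_inf u1 a1 * hilbert_two u1 a1) *
   (-1) ^+ ((s < 0) && ((a < 0) != (u1 * r < 0))) =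
   (-1) ^+ (mult_sign u r s a) * (-1) ^+ ((u %% 4 == 3)%Z && (r %% 4 == 3)%Z).
  have -> : jacobi (-1) `|u1| = (-1) ^+ ((u1 < 0) (+) (u1 %% 4 == 3)%Z).
    rewrite jacobiN1 // -signr_odd; congr (_ ^+ nat_of_bool _).
    by move: ou1; case: (u1) => n /=; clear; lia.
  have r0 : r != 0 by apply: contraTneq or => ->.
  have u10 : u1 != 0 by apply: contraTneq ou1 => ->.
  have -> : (u1 * r < 0) = (u1 < 0) (+) (r < 0).
    rewrite neq0_mulr_lt0 //.
  have sgu : (u < 0) = (u1 < 0) by rewrite uE pmulr_rlt0.
  have sga : (a < 0) = (a1 < 0) by rewrite aE pmulr_rlt0.
  rewrite /hilbert_inf /hilbert_two /mult_sign sgu sga -!signr_addb; congr (_ ^+ nat_of_bool _).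
  have -> : (a1 %% 4 = (u1 * r) %% 4)%Z.
    apply/eqP; rewrite eqz_mod_dvd; have -> : a1 - u1 * r = - (v * s1) by rewrite /a1; ring.
    rewrite rpredN.
    have [x ->] : exists x, v = x * 2 by exists (v %/ 2)%Z; move: ev; clear; lia.
    have [y ->] : exists y, s1 = y * 2 by exists (s1 %/ 2)%Z; move: es1; clear; lia.
    by have -> : x * 2 * (y * 2) = 4 * (x * y) :> int by [ring]; apply: dvdz_mulr.
  rewrite uE -(modzMm u1 r) -(modzMm g%:Z u1).
  have : (r %% 4 = 1 \/ r %% 4 = 3)%Z by move: or; clear; lia.
  have : (u1 %% 4 = 1 \/ u1 %% 4 = 3)%Z by move: ou1; clear; lia.
  have : (g%:Z %% 4 = 1 \/ g%:Z %% 4 = 3)%Z by move: og; clear; lia.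
  by move: (u1 < 0) (s < 0) (r < 0) (a1 < 0) => [] [] [] [] [->|->] [->|->] [->|->].
rewrite Jb Jbg E1 E2 E5 E6 E7 Jv Js.
rewrite -[RHS]mulrA [(-1) ^+ mult_sign _ _ _ _ * _]mulrA -signs.
move: (jacobi s1 `|u1|) Jsu => S SS.
by apply: (etrans _ (_ : S * S * _ = _)); last (by rewrite SS mul1r); ring.
Qed.

Lemma jacobi_product_sign0 (u v : int) : odd `|u| -> ~~ odd `|v| -> coprimez u v ->
  jacobi v `|u| = jacobi v `|u| * jacobi u `|u ^+ 2 + v ^+ 2|.
Proof. by move=> ou ev co; rewrite jacobi_Re_norm // mulr1. Qed.

(** * Gaussian integers *)

Notation gre := (@complex.Re int).
Notation gim := (@complex.Im int).

Definition gnrm (z : gint) : nat := (`|gre z| ^ 2 + `|gim z| ^ 2)%N.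
Arguments gnrm z%_R.
Definition gprim (z : gint) : bool := coprimez (gre z) (gim z).
Definition gdvd (w z : gint) : Prop := exists t, z = w * t.

Lemma gmulE (a b c d : int) :
  (Complex a b : gint) * (Complex c d : gint) = Complex (a * c - b * d) (a * d + b * c).
Proof. by []. Qed.

Lemma gaddE (a b c d : int) :
  (Complex a b : gint) + (Complex c d : gint) = Complex (a + c) (b + d).
Proof. by []. Qed.

Lemma goppE (a b : int) : - (Complex a b : gint) = Complex (- a) (- b).
Proof. by []. Qed.

Lemma greM (z w : gint) : gre (z * w) = gre z * gre w - gim z * gim w.
Proof. by case: z w => [a b] [c d]. Qed.

Lemma gimM (z w : gint) : gim (z * w) = gre z * gim w + gim z * gre w.
Proof. by case: z w => [a b] [c d]. Qed.

Lemma gnrmZ (z : gint) : (gnrm z)%:Z = gre z ^+ 2 + gim z ^+ 2.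
Proof.
by rewrite /gnrm PoszD !expnS !expn0 !muln1 !PoszM !abszE -!expr2 !real_normK ?num_real.
Qed.

Lemma gnrmM (z w : gint) : gnrm (z * w) = (gnrm z * gnrm w)%N.
Proof.
by apply/eqP; rewrite -eqz_nat PoszM !gnrmZ greM gimM; apply/eqP; ring.
Qed.

Lemma gmulV (z : gint) : z * gconj z = Complex (gnrm z)%:Z 0.
Proof.
case: z => a b; rewrite gnrmZ /gconj /= gmulE /=; congr Complex; ring.
Qed.

Lemma gconjM (z w : gint) : gconj (z * w) = gconj z * gconj w.
Proof. case: z w => [a b] [c d]; rewrite /gconj /= !gmulE; congr Complex; ring. Qed.

Lemma gconjK (z : gint) : gconj (gconj z) = z.
Proof. by case: z => a b; rewrite /gconj /= opprK. Qed.

Lemma gnrmJ (z : gint) : gnrm (gconj z) = gnrm z.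
Proof. by case: z => a b; rewrite /gnrm /= abszN. Qed.

Lemma gnrm0 (z : gint) : (gnrm z == 0)%N = (z == 0).
Proof.
case: z => a b; rewrite /gnrm addn_eq0 !expn_eq0 /= !andbT !absz_eq0.
by apply/andP/eqP => [[/eqP -> /eqP ->]|[-> ->]].
Qed.

Lemma gmulfI (z : gint) : z != 0 -> injective (fun w => z * w).
Proof.
move=> z0 w w' /eqP; rewrite -subr_eq0 -mulrBr => /eqP h.
have /eqP : (gnrm z * gnrm (w - w') = 0)%N by rewrite -gnrmM h.
by rewrite muln_eq0 !gnrm0 (negPf z0) /= subr_eq0 => /eqP.
Qed.

Lemma primaryP (z : gint) :
  primary z <-> [/\ odd `|gre z|, ~~ odd `|gim z| & (4 %| gim z - gre z + 1)%Z].
Proof.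
rewrite /primary /gcong.
have m2 : 2%:R * (1 + gi) = Complex 2 2 :> gint by [].
rewrite m2; case: z => a b /=; split.
  case=> -[c d]; rewrite gmulE [X in X - _]/= => -[] e1 e2.
  have {}e1 : a = 1 + 2 * c - 2 * d by move: e1; lia.
  have {}e2 : b = 2 * c + 2 * d by move: e2; lia.
  split; try lia; apply/dvdzP; exists d; lia.
case=> oa eb /dvdzP[d dE].
exists (Complex ((b %/ 2)%Z - d) d : gint); rewrite gmulE; congr Complex => /=; lia.
Qed.

Lemma gcongM (m a b c d : gint) : gcong m a b -> gcong m c d -> gcong m (a * c) (b * d).
Proof.
move=> [x xE] [y yE]; exists (x * c + b * y).
have -> : a * c - b * d = (a - b) * c + b * (c - d) by ring.
by rewrite xE yE; ring.
Qed.

Lemma primaryM (w z : gint) : primary w -> primary z -> primary (w * z).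
Proof. by move=> pw pz; have := gcongM pw pz; rewrite mulr1. Qed.

Lemma primary_divr (w z : gint) : primary w -> primary (w * z) -> primary z.
Proof.
move=> [x xE] [y yE]; exists (y - x * z).
have -> : z - 1 = (w * z - 1) - (w - 1) * z by ring.
by rewrite xE yE; ring.
Qed.

Lemma primary_odd (z : gint) : primary z -> odd (gnrm z).
Proof.
by move/primaryP=> [oz ez _]; rewrite /gnrm oddD !oddX /= oz (negPf ez).
Qed.

Lemma primary_conj (z : gint) : primary z -> primary (gconj z).
Proof.
move/primaryP=> [oz ez dz]; apply/primaryP; case: z oz ez dz => a b /= oz ez dz.
split=> //; lia.
Qed.

Lemma primary_neq0 (z : gint) : primary z -> z != 0.
Proof. by move/primary_odd; rewrite -gnrm0; case: gnrm. Qed.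

Lemma primary_gnrm_gt0 (z : gint) : primary z -> (0 < gnrm z)%N.
Proof. by move/primary_odd; case: gnrm. Qed.

Lemma gnrm1_cases (z : gint) : gnrm z = 1%N -> [\/ z = 1, z = -1, z = gi | z = - gi].
Proof.
case: z => a b; rewrite /gnrm /= => h.
have le_sq m : (m <= m ^ 2)%N by case: m => // m; rewrite leq_pmulr.
have ha := le_sq `|a|%N; have hb := le_sq `|b|%N.
have : [\/ a = 1 /\ b = 0, a = -1 /\ b = 0, a = 0 /\ b = 1 | a = 0 /\ b = -1].
  have a1 : (`|a| <= 1)%N by lia.
  have b1 : (`|b| <= 1)%N by lia.
  have sq m : (m <= 1)%N -> (m ^ 2 = m)%N by case: m => [|[|]].
  rewrite !sq // in h.
  have : (a = 1 /\ b = 0) \/ (a = -1 /\ b = 0) \/ (a = 0 /\ b = 1) \/ (a = 0 /\ b = -1).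
    by move: h; clear; lia.
  by move=> [?|[?|[?|?]]]; [constructor 1|constructor 2|constructor 3|constructor 4].
by case=> -[-> ->]; [constructor 1|constructor 2|constructor 3|constructor 4].
Qed.

Lemma nearest_quotient (m : int) (n : nat) : (0 < n)%N ->
  exists q : int, (2 * `|m - q * n%:Z| <= n%:Z).
Proof.
move=> n0; have nZ : n%:Z != 0 by lia.
have r0 := modz_ge0 m nZ; have rn := ltz_pmod m (_ : 0 < n%:Z).
have {}rn : (m %% n)%Z < n%:Z by apply: rn; lia.
have mE := divz_eq m n.
case: (leP (2 * (m %% n)%Z) n%:Z) => h.
  exists (m %/ n)%Z; have -> : m - (m %/ n)%Z * n%:Z = (m %% n)%Z by rewrite {1}mE; ring.
  by rewrite ger0_norm.
exists ((m %/ n)%Z + 1).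
have -> : m - ((m %/ n)%Z + 1) * n%:Z = (m %% n)%Z - n%:Z by rewrite {1}mE; ring.
by move: h rn; clear; lia.
Qed.

Lemma geuclid (z w : gint) : w != 0 -> exists q : gint, (gnrm (z - q * w)%R < gnrm w)%N.
Proof.
move=> w0; have n0 : (0 < gnrm w)%N by rewrite lt0n gnrm0.
have [q1 h1] := nearest_quotient (gre (z * gconj w)) n0.
have [q2 h2] := nearest_quotient (gim (z * gconj w)) n0.
pose q : gint := Complex q1 q2; exists q.
set n := gnrm w in n0 h1 h2 *.
have : (2 * (gnrm (z - q * w) * n) <= n * n)%N.
  have -> : (gnrm (z - q * w) * n = gnrm ((z - q * w) * gconj w))%N by rewrite gnrmM gnrmJ.
  have -> : (z - q * w) * gconj w = z * gconj w - q * Complex n%:Z 0 by rewrite -gmulV; ring.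
  move: (z * gconj w) h1 h2 => [a b] /= h1 h2.
  rewrite /q gmulE goppE gaddE /gnrm /= !mulr0 subr0 add0r.
  move: h1 h2; set x := a - q1 * n%:Z; set y := b - _.
  have nn k : (0 <= k <= n)%N -> (k * k <= n * n)%N by move=> /andP[_ kn]; apply: leq_mul.
  move=> hx hy.
  have hx' : (2 * `|x| <= n)%N by lia.
  have hy' : (2 * `|y| <= n)%N by lia.
  have := leq_mul hx' hx'; have := leq_mul hy' hy'.
  rewrite -!mulnn; move: (absz x) (absz y) => c d; clear; lia.
rewrite mulnA leq_pmul2r // => h; move: h n0; clear; lia.
Qed.

Lemma gbezout (z w : gint) : exists g x y, [/\ g = x * z + y * w, gdvd g z & gdvd g w].
Proof.
have [n] := ubnP (gnrm w); elim: n z w => // n IH z w wn.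
have [->|w0] := eqVneq w 0.
  exists z, 1, 0; split; first by ring.
    by exists 1; ring.
  by exists 0; ring.
have [q qlt] := geuclid z w0.
have [g [x [y [gE [t tE] [s sE]]]]] := IH w (z - q * w) (leq_trans qlt wn).
exists g, y, (x - y * q); split; first by rewrite gE; ring.
  by exists (s + q * t); rewrite mulrDr -sE mulrCA -tE; ring.
by exists t.
Qed.

Lemma primary_associate (z : gint) : odd (gnrm z) ->
  exists e, gnrm e = 1%N /\ primary (e * z).
Proof.
case: z => a b; rewrite /gnrm /= oddD !oddX /= => oab.
have : (odd `|a| && ~~ odd `|b| && (4 %| b - a + 1)%Z) || (odd `|a| && ~~ odd `|b| && (4 %| - b + a + 1)%Z)
   || (~~ odd `|a| && odd `|b| && (4 %| a + b + 1)%Z) || (~~ odd `|a| && odd `|b| && (4 %| - a - b + 1)%Z).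
  by move: oab; clear; lia.
case/orP=> [/orP[/orP[]|]|] /andP[/andP[oa ob] dv].
- by exists 1; split=> //; rewrite mul1r; apply/primaryP.
- exists (-1); split=> //; rewrite mulN1r; apply/primaryP; rewrite goppE /= !abszN; split=> //.
  by move: dv; clear; lia.
- exists gi; split=> //; apply/primaryP; rewrite /gi gmulE /=.
  by split; move: oa ob dv; clear; lia.
- exists (- gi); split=> //; apply/primaryP; rewrite /gi goppE gmulE /=.
  by split; move: oa ob dv; clear; lia.
Qed.

Lemma primary_gnrm1 (z : gint) : primary z -> gnrm z = 1%N -> z = 1.
Proof.
move=> /primaryP[oz ez dz] /gnrm1_cases[] zE //; move: oz ez dz; rewrite zE //=.
Qed.

Lemma gunit_inv (e : gint) : gnrm e = 1%N -> e * gconj e = 1.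
Proof. by rewrite gmulV => ->. Qed.

Lemma primary_gcd (z w : gint) : primary z -> exists g x y,
  [/\ primary g, g = x * z + y * w, gdvd g z & gdvd g w].
Proof.
move=> pz; have [g [x [y [gE [t tE] [s sE]]]]] := gbezout z w.
have og : odd (gnrm g).
  by have := primary_odd pz; rewrite tE gnrmM oddM => /andP[].
have [e [e1 pe]] := primary_associate og; have ei := gunit_inv e1.
exists (e * g), (e * x), (e * y); split=> //.
- by rewrite gE; ring.
- by exists (gconj e * t); rewrite mulrACA ei mul1r.
- by exists (gconj e * s); rewrite mulrACA ei mul1r.
Qed.

Lemma gprim_divl (w z : gint) : gprim (w * z) -> gprim w.
Proof.
rewrite /gprim => /coprimezP[[x y] /= h]; apply/coprimezP.
exists (x * gre z + y * gim z, y * gre z - x * gim z) => /=.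
by rewrite -h greM gimM; ring.
Qed.

Lemma gprim_divr (w z : gint) : gprim (w * z) -> gprim z.
Proof. by rewrite mulrC; apply: gprim_divl. Qed.

Lemma gprim_natdvd (z : gint) (n : nat) : gprim z -> gdvd (Complex n%:Z 0) z -> n = 1%N.
Proof.
move=> pz [[a b]]; case: z pz => c d; rewrite /gprim /= => /coprimezP[[x y] /= h].
rewrite gmulE !mul0r subr0 addr0 => -[cE dE]; move: h; rewrite cE dE => h.
have : n%:Z * (x * a + y * b) = 1 by rewrite -h; ring.
by move/(congr1 absz); rewrite abszM absz_nat => /eqP; rewrite muln_eq1 => /andP[/eqP].
Qed.

Lemma gdvd_norm_eq (w w' : gint) : primary w -> primary w' -> gdvd w' w ->
  gnrm w = gnrm w' -> w = w'.
Proof.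
move=> pw pw' [t tE] nE.
have pt : primary t by apply: (primary_divr pw'); rewrite -tE.
suff -> : w = w' * 1 by rewrite mulr1.
rewrite tE; congr (_ * _); apply: (primary_gnrm1 pt).
have := primary_gnrm_gt0 pw'; move: nE; rewrite tE gnrmM => nE n0.
by apply/eqP; rewrite -(eqn_pmul2l n0) muln1 nE.
Qed.

(* A common divisor of [t] and [conj w] has its norm, a rational integer,
   dividing the primitive product [w t]. *)
Lemma gprim_coprime_conj (w t : gint) : primary t -> gprim (w * t) ->
  exists x y, x * t + y * gconj w = 1.
Proof.
move=> pt pr; have [g [x [y [pg gE [a aE] [b bE]]]]] := primary_gcd (gconj w) pt.
exists x, y; rewrite -gE; apply: primary_gnrm1 => //.
apply: (gprim_natdvd pr); exists (gconj b * a).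
by rewrite -gmulV -[w]gconjK bE gconjM aE; ring.
Qed.

Lemma primary_divisor_unique (w w' t t' : gint) : primary w -> primary w' ->
  primary t -> gprim (w * t) -> w * t = w' * t' -> gnrm w = gnrm w' -> w = w'.
Proof.
move=> pw pw' pt pr eq_wt nE; apply: gdvd_norm_eq => //.
have [x [y h]] := gprim_coprime_conj pt pr.
exists (x * t' + y * gconj w').
rewrite mulrDr mulrCA -eq_wt (mulrCA w') gmulV -nE -gmulV.
by rewrite -[LHS]mulr1 -h; ring.
Qed.

Lemma primary_divisor_exists (z : gint) (a : nat) : primary z -> gprim z ->
  (a %| gnrm z)%N -> exists w t, [/\ primary w, primary t, z = w * t & gnrm w = a].
Proof.
move=> pz pr da.
have [g [x [y [pg gE [t tE] [s sE]]]]] := primary_gcd (Complex a%:Z 0) pz.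
exists g, t; split=> //; first by apply: (primary_divr pg); rewrite -tE.
have prg : gprim g by apply: (@gprim_divl g t); rewrite -tE.
apply/eqP; rewrite eqn_dvd; apply/andP; split.
  have hE : (Complex (gnrm g)%:Z 0 : gint) * s = (Complex a%:Z 0 : gint) * gconj g.
    by rewrite sE -gmulV; ring.
  move: hE; case: (g) prg => c d; case: (s) => p q; move: (gnrm _) => n.
  rewrite /gprim /gconj /= !gmulE => /coprimezP[[k l] /= h] [h1 h2].
  have {}h1 : n%:Z * p = a%:Z * c by move: h1; clear; lia.
  have {}h2 : n%:Z * q = - (a%:Z * d) by move: h2; clear; lia.
  have : (n%:Z %| a%:Z)%Z.
    apply/dvdzP; exists (k * p - l * q).
    have -> : (k * p - l * q) * n%:Z = k * (n%:Z * p) - l * (n%:Z * q) by ring.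
    by rewrite h1 h2 -[LHS]mulr1 -h; ring.
  by rewrite dvdzE.
have : (a%:Z %| (gnrm g)%:Z)%Z; last by rewrite dvdzE.
move/dvdnP: da => [m mE]; have := gnrmZ z; rewrite mE PoszM gnrmZ gE.
case: (x) (y) (z) => [x1 x2] [y1 y2] [z1 z2]; rewrite !gmulE gaddE /= => zz.
apply/dvdzP.
exists (m%:Z * (x1 ^+ 2 + x2 ^+ 2) + 2 * ((x1 * z1 - x2 * z2) * y1 + (x1 * z2 + x2 * z1) * y2) + a%:Z * (y1 ^+ 2 + y2 ^+ 2)).
transitivity ((x1 ^+ 2 + x2 ^+ 2) * (z1 ^+ 2 + z2 ^+ 2) + a%:Z * (2 * ((x1 * z1 - x2 * z2) * y1 + (x1 * z2 + x2 * z1) * y2) + a%:Z * (y1 ^+ 2 + y2 ^+ 2))).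
  ring.
by rewrite -zz; ring.
Qed.

Definition ndiv (n : nat) : nat := size (divisors n).

Lemma card_le_rel (T U : eqType) (s : seq T) (D : seq U) (r : T -> U -> Prop) :
  uniq s -> (forall y, y \in s -> exists2 d, d \in D & r y d) ->
  (forall y y' d, y \in s -> y' \in s -> r y d -> r y' d -> y = y') -> (size s <= size D)%N.
Proof.
elim: s D => // y s IH D /= /andP[ys us] ex inj.
have [d dD rd] := ex y (mem_head _ _).
have -> : size D = (size (rem d D)).+1 by rewrite size_rem // prednK //; case: (D) dD.
rewrite ltnS; apply: IH => //; last first.
  by move=> a b e ha hb; apply: inj; rewrite inE ?ha ?hb orbT.
move=> z zs; have zin : z \in y :: s by rewrite inE zs orbT.
have [e eD re] := ex z zin; exists e => //.
have ed : e != d.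
  apply: contraNneq ys => ed; rewrite ed in re.
  by rewrite (inj y z d) // ?mem_head // inE zs orbT.
by move: eD; rewrite (perm_mem (perm_to_rem dD)) inE (negPf ed).
Qed.

Lemma count_primary_norm (s : seq gint) (n : nat) : uniq s -> (0 < n)%N ->
  (forall y, y \in s -> [/\ primary y, gprim y & gnrm y = n]) -> (size s <= ndiv n)%N.
Proof.
move=> us n0 hs; case: s us hs => [//|y0 s] us hs.
have [p0 pr0 n0E] := hs y0 (mem_head _ _).
pose r (y : gint) (d : nat) := exists g, exists a b, exists t t0,
   [/\ primary g, gnrm g = d, g = a * y + b * y0, y = g * t & y0 = g * t0].
apply: (card_le_rel (r := r) us).
  move=> y ys; have [py pry nE] := hs y ys.
  have [g [a [b [pg gE [t tE] [t0 t0E]]]]] := primary_gcd y0 py.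
  exists (gnrm g); last by exists g, a, b, t, t0.
  by rewrite -dvdn_divisors // -nE tE gnrmM dvdn_mulr.
move=> y y' d ys y's [g [a [b [t [t0 [pg gd gE tE t0E]]]]]] [g' [a' [b' [t' [t0' [pg' gd' gE' tE' t0E']]]]]].
have [py pry nE] := hs y ys; have [py' pry' nE'] := hs y' y's.
have key (h u u0 z c e : gint) : primary h -> primary z -> h = c * z + e * y0 -> z = h * u -> y0 = h * u0 ->
   gnrm z = n -> z = h * gconj u0.
  move=> ph pz hE uE u0E nz.
  have h0 := primary_neq0 ph.
  have pu : primary u by apply: (primary_divr ph); rewrite -uE.
  have pu0 : primary u0 by apply: (primary_divr ph); rewrite -u0E.
  have bz : c * u + e * u0 = 1.
    by apply: (gmulfI h0); rewrite /= mulr1 mulrDr ![h * (_ * _)]mulrCA -uE -u0E -hE.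
  have nu : gnrm u = gnrm u0.
    apply/eqP; rewrite -(eqn_pmul2l (primary_gnrm_gt0 ph)) -!gnrmM -uE -u0E nz n0E.
    by [].
  rewrite uE; congr (_ * _); symmetry; apply: gdvd_norm_eq => //; rewrite ?gnrmJ //.
    exact: primary_conj.
  exists (c * gconj u0 + e * gconj u).
  rewrite mulrDr (mulrCA u e) gmulV nu -gmulV -[LHS]mul1r -bz; ring.
have gg : g = g'.
  apply: (@primary_divisor_unique g g' t0 t0') => //; last by rewrite gd gd'.
  - by apply: (primary_divr pg); rewrite -t0E.
  - by rewrite -t0E.
  - by rewrite -t0E.
rewrite (key g t t0 y a b) // (key g' t' t0' y' a' b') // gg; congr (_ * gconj _).
by apply: (gmulfI (primary_neq0 pg)); rewrite /= -t0E gg -t0E'.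
Qed.

Definition dsym (w z : gint) : int := jacobi (gre (w * z)) (gnrm w).

Lemma gprim_prime_dvd (z : gint) : ~~ gprim z ->
  exists2 p : nat, prime p & (p %| gre z)%Z /\ (p %| gim z)%Z.
Proof.
rewrite /gprim /coprimez /gcdz eqz_nat => g1.
case: (posnP (gcdn `|gre z| `|gim z|)) => [g0|g0].
  have := gcdn_gt0 `|gre z| `|gim z|; rewrite g0 => /esym/negbT.
  rewrite negb_or -!eqn0Ngt !absz_eq0 => /andP[/eqP -> /eqP ->].
  by exists 2%N.
exists (pdiv (gcdn `|gre z| `|gim z|)); first by apply: pdiv_prime; rewrite ltn_neqAle eq_sym g1.
have := pdiv_dvd (gcdn `|gre z| `|gim z|); rewrite dvdn_gcd => /andP[d1 d2].
by rewrite !dvdzE.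
Qed.

Lemma jacobi_common_prime (a : int) (n p : nat) : (0 < n)%N -> prime p ->
  (p %| a)%Z -> (p %| n)%N -> jacobi a n = 0.
Proof.
move=> n0 pr_p da dn; apply/eqP; rewrite -[_ == 0]negbK jacobi_neq0 //.
rewrite /coprimez /gcdz eqz_nat; apply/negP => /eqP g1.
have : (p %| gcdn `|a| n)%N by rewrite dvdn_gcd dn andbT.
by rewrite g1 dvdn1 => /eqP p1; rewrite p1 in pr_p.
Qed.

Lemma jacobi_not_gprim (z : gint) : odd `|gre z| -> ~~ gprim z -> jacobi (gim z) `|gre z| = 0.
Proof.
move=> oz /gprim_prime_dvd[p pr_p [d1 d2]]; apply: (jacobi_common_prime (p := p)) => //.
by case: absz oz.
Qed.

Lemma dsymM (w z1 z2 : gint) : primary w -> gprim w ->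
  dsym w (z1 * z2) = dsym w z1 * dsym w z2.
Proof.
move=> pw prw; have ow := primary_odd pw; have [ou ev _] := iffLR (primaryP w) pw.
have J1 := jacobi_Re_norm ou ev prw.
rewrite -gnrmZ absz_nat in J1.
rewrite /dsym -jacobiM // -[LHS]mul1r -J1 -jacobiM //; apply: jacobi_congr.
apply/dvdzP; exists (- (gim z1 * gim z2)).
rewrite gnrmZ !greM !gimM; ring.
Qed.

Lemma dsym_not_gprim (w z : gint) : primary w -> gprim z -> ~~ gprim (w * z) -> dsym w z = 0.
Proof.
move=> pw prz /gprim_prime_dvd[p pr_p [d1 d2]].
apply: (jacobi_common_prime (p := p)) => //; first exact: primary_gnrm_gt0.
apply: contraT => ndv.
have co : coprimez p (gnrm w) by rewrite coprimezE prime_coprime.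
have e1 : (gnrm w)%:Z * gre z = gre w * gre (w * z) + gim w * gim (w * z).
  by rewrite gnrmZ greM gimM; ring.
have e2 : (gnrm w)%:Z * gim z = gre w * gim (w * z) - gim w * gre (w * z).
  by rewrite gnrmZ greM gimM; ring.
have p1 : (p %| gre z)%Z by rewrite -(Gauss_dvdzr _ co) e1 rpredD // dvdz_mull.
have p2 : (p %| gim z)%Z by rewrite -(Gauss_dvdzr _ co) e2 rpredB // dvdz_mull.
have := prz; rewrite /gprim /coprimez /gcdz eqz_nat => /eqP g1.
have : (p %| gcdn `|gre z| `|gim z|)%N by rewrite dvdn_gcd; apply/andP; split.
by rewrite g1 dvdn1 => /eqP p1'; rewrite p1' in pr_p.
Qed.

Lemma jacobi_kubota_int (w z : gint) : primary w -> primary z ->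
  jacobi (gim (w * z)) `|gre (w * z)| =
  jacobi (gim w) `|gre w| * jacobi (gim z) `|gre z| * dsym w z *
    (-1) ^+ (mult_sign (gre w) (gre z) (gim z) (gre (w * z))) *
    ((-1) ^+ ((gre w %% 4 == 3)%Z && (gre z %% 4 == 3)%Z) * (-1) ^+ ~~ (8 %| gim w * gim z)%Z).
Proof.
move=> pw pz; have [ou ev d1] := iffLR (primaryP w) pw; have [or es d2] := iffLR (primaryP z) pz.
have [oa _ _] := iffLR (primaryP _) (primaryM pw pz).
have [nw|nw] := boolP (gprim w); last first.
  rewrite jacobi_not_gprim ?(jacobi_not_gprim ou nw) ?mul0r //.
  by apply: contraNN nw; apply: gprim_divl.
have [nz|nz] := boolP (gprim z); last first.
  rewrite jacobi_not_gprim ?(jacobi_not_gprim or nz) ?mulr0 ?mul0r //.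
  by apply: contraNN nz; apply: gprim_divr.
rewrite /dsym; case: w z pw pz ou ev d1 or es d2 oa nw nz => [u v] [r s] /= pw pz ou ev d1 or es d2 oa nw nz.
have -> : gnrm (Complex u v) = absz (u ^+ 2 + v ^+ 2).
  by rewrite -[LHS]absz_nat gnrmZ.
have [s0|s0] := eqVneq s 0; last exact: jacobi_product.
have r1 : r = 1.
  move: nz or d2; rewrite /gprim /= s0 /coprimez /gcdz /= gcdn0 eqz_nat; clear; lia.
rewrite s0 r1 /= !mulr1 !mulr0 subr0 add0r jacobi1 mulr1 andbF expr0 mulr1.
rewrite -jacobi_product_sign0 // /mult_sign ltxx.
by case: (u < 0); rewrite /= !mulr1.
Qed.

Section Complex.
Variable R : realType.
Local Notation C := R[i].
Local Notation II := (Complex 0 1 : C).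

Lemma II2 : II ^+ 2 = -1.
Proof. exact: sqr_i. Qed.

Lemma II_unit : II \is a GRing.unit.
Proof. by rewrite unitfE eq_complex /= oner_eq0 andbF. Qed.

Lemma sign_exprz (m : int) : (-1 : C) ^ m = (-1) ^+ odd `|m|.
Proof.
case: m => n; first by rewrite -exprnP signr_odd.
by rewrite -[LHS]/(((-1) ^+ n.+1)^-1) invr_sign -signr_odd.
Qed.

Lemma jacobi_kubotaM (w z : gint) : primary w -> primary z ->
  jacobi_kubota R (w * z) = jacobi_kubota R w * jacobi_kubota R z *
   ((-1) ^+ (mult_sign (gre w) (gre z) (gim z) (gre (w * z))) * dsym w z)%:~R.
Proof.
move=> pw pz; have [ou ev d1] := iffLR (primaryP w) pw; have [or es d2] := iffLR (primaryP z) pz.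
rewrite /jacobi_kubota jacobi_kubota_int //.
set ms := (-1) ^+ mult_sign _ _ _ _; set D := dsym w z.
move: (jacobi (gim w) _) (jacobi (gim z) _) => J1 J2.
have [U uE] : exists U, gre w = U * 2 + 1 by exists (gre w %/ 2)%Z; move: ou; clear; lia.
have [P rE] : exists P, gre z = P * 2 + 1 by exists (gre z %/ 2)%Z; move: or; clear; lia.
have [V vE] : exists V, gim w = V * 2 by exists (gim w %/ 2)%Z; move: ev; clear; lia.
have [S sE] : exists S, gim z = S * 2 by exists (gim z %/ 2)%Z; move: es; clear; lia.
have e1 : ((gre w - 1) %/ 2)%Z = U by rewrite uE addrK mulzK.
have e2 : ((gre z - 1) %/ 2)%Z = P by rewrite rE addrK mulzK.
have e3 : ((gre (w * z) - 1) %/ 2)%Z = U + P + 2 * (U * P - V * S).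
  have -> : gre (w * z) - 1 = (U + P + 2 * (U * P - V * S)) * 2.
    by rewrite greM uE rE vE sE; ring.
  by rewrite mulzK.
rewrite e1 e2 e3 !exprzDr ?II_unit // -exprz_exp.
have -> : II ^ 2 = -1 by exact: II2.
rewrite sign_exprz.
have -> : (-1 : C) ^+ odd (absz (U * P - V * S)%R) = ((-1 : int) ^+ odd (absz (U * P - V * S)%R))%:~R.
  by rewrite rmorphXn /= rmorphN1.
have <- : ((-1) ^+ ((gre w %% 4 == 3)%Z && (gre z %% 4 == 3)%Z) * (-1) ^+ ~~ (8 %| gim w * gim z)%Z)%R
   = (-1) ^+ odd (absz (U * P - V * S)%R) :> int.
  have -> : (gre w %% 4 == 3)%Z = odd `|U| by rewrite uE; clear; lia.
  have -> : (gre z %% 4 == 3)%Z = odd `|P| by rewrite rE; clear; lia.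
  have -> : (8 %| gim w * gim z)%Z = ~~ odd (absz (V * S)%R).
    by rewrite vE sE; have -> : V * 2 * (S * 2) = 4 * (V * S) by [ring]; move: (V * S); clear; lia.
  rewrite negbK -signr_addb; congr (_ ^+ nat_of_bool _).
  have <- : odd (absz (U * P)%R) = odd `|U| && odd `|P| by rewrite abszM oddM.
  by move: (U * P) (V * S); clear; lia.
set T := _ * (-1) ^+ ~~ _.
have TT : (T%:~R * T%:~R = 1 :> C) by rewrite -rmorphM /= /T mulrACA !sign_sqr mulr1.
move: (II ^ U) (II ^ P) T TT => x y T TT; rewrite !rmorphM /=.
by apply: (etrans _ (_ : T%:~R * T%:~R * _ = _)); last (by rewrite TT mul1r); ring.
Qed.

Lemma normc_II (m : int) : ComplexField.Normc.normc (II ^ m) = 1.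
Proof.
have n1 : ComplexField.Normc.normc II = 1 by rewrite /= expr0n /= add0r expr1n sqrtr1.
have nX n : ComplexField.Normc.normc (II ^+ n) = 1.
  elim: n => [|n IH]; first by rewrite expr0 ComplexField.Normc.normc1.
  by rewrite exprS ComplexField.Normc.normcM n1 IH mulr1.
case: m => n; first exact: nX.
by rewrite -[II ^ _]/((II ^+ n.+1)^-1) ComplexField.Normc.normcV nX invr1.
Qed.
End Complex.

(** * Divisor functions and Vaughan's identity *)

Lemma ndiv_gt0 n : (0 < n)%N -> (0 < ndiv n)%N.
Proof.
move=> n0; have : 1%N \in divisors n by rewrite -dvdn_divisors // dvd1n.
by rewrite /ndiv; case: (divisors n).
Qed.

Lemma ndivM (m n : nat) : (0 < m)%N -> (0 < n)%N -> (ndiv (m * n) <= ndiv m * ndiv n)%N.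
Proof.
move=> m0 n0; rewrite /ndiv -(size_allpairs (@pair nat nat)).
apply: (card_le_rel (r := fun d (e : nat * nat) => d = (e.1 * e.2)%N)); first exact: divisors_uniq.
  move=> d; rewrite -dvdn_divisors ?muln_gt0 ?m0 // => dv.
  have d0 : (0 < d)%N by rewrite (dvdn_gt0 _ dv) // muln_gt0 m0.
  have g0 : (0 < gcdn d m)%N by rewrite gcdn_gt0 d0.
  exists (gcdn d m, d %/ gcdn d m)%N; last by rewrite /= mulnC divnK // dvdn_gcdl.
  apply: allpairs_f; rewrite -dvdn_divisors // ?dvdn_gcdr //.
  have co : coprime (d %/ gcdn d m) (m %/ gcdn d m).
    rewrite /coprime -(eqn_pmul2l g0) muln1 muln_gcdr ![(gcdn d m * (_ %/ _))%N]mulnC.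
    by rewrite !divnK ?dvdn_gcdl ?dvdn_gcdr.
  rewrite -(Gauss_dvdr _ co) -(dvdn_pmul2l g0) mulnA ![(gcdn d m * (_ %/ _))%N]mulnC.
  by rewrite !divnK ?dvdn_gcdl ?dvdn_gcdr.
by move=> y y' d _ _ -> ->.
Qed.

Lemma ndiv_pexp (p a : nat) : prime p -> (ndiv (p ^ a) <= a.+1)%N.
Proof.
move=> pr_p; rewrite -[a.+1](size_iota 0) /ndiv.
apply: (card_le_rel (r := fun d i => d = (p ^ i)%N)); first exact: divisors_uniq.
  move=> d; rewrite -dvdn_divisors ?expn_gt0 ?prime_gt0 // => /dvdn_pfactor[//|i ia ->].
  by exists i => //; rewrite mem_iota add0n ltnS.
by move=> y y' d _ _ -> ->.
Qed.

Lemma prod_primes_pfactor (n : nat) : (0 < n)%N -> (\prod_(p <- primes n) p ^ logn p n = n)%N.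
Proof.
move=> n0; rewrite [RHS]prod_prime_decomp // prime_decompE big_map; exact: eq_bigr.
Qed.

Lemma ndiv_prod (s : seq nat) (f : nat -> nat) : all prime s ->
  (ndiv (\prod_(p <- s) p ^ f p) <= \prod_(p <- s) (f p).+1)%N.
Proof.
elim: s => [|p s IH] /=; first by rewrite !big_nil.
move=> /andP[pr_p ps]; rewrite !big_cons.
apply: leq_trans (ndivM _ _) _.
- by rewrite expn_gt0 prime_gt0.
- rewrite big_seq; elim/big_ind: _ => [//|x y x0 y0|q qs]; first by rewrite muln_gt0 x0.
  by rewrite expn_gt0 prime_gt0 // (allP ps).
- by apply: leq_mul; [exact: ndiv_pexp | exact: IH].
Qed.

Lemma divisor_bound_nat (j : nat) : (0 < j)%N ->
  exists K, forall n, (0 < n)%N -> (ndiv n ^ j <= K * n)%N.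
Proof.
move=> j0; have two a : (a.+1 <= 2 ^ a)%N by exact: ltn_expl.
have small a : (a.+1 ^ j <= j ^ j * 2 ^ a)%N.
  apply: (@leq_trans ((j * 2 ^ (a %/ j)) ^ j)%N).
    rewrite leq_exp2r //; apply: leq_trans (_ : (j * (a %/ j).+1 <= _)%N); last by rewrite leq_mul2l two orbT.
    by rewrite mulnC; apply: ltn_ceil.
  rewrite expnMn leq_mul2l -expnM leq_exp2l // leq_trunc_div orbT; by [].
pose K0 := (j ^ j)%N.
have K0_gt0 : (0 < K0)%N by rewrite expn_gt0 j0.
pose c (p : nat) := if (p < 2 ^ j)%N then K0 else 1%N.
exists (K0 ^ (2 ^ j))%N => n n0.
have pp : all prime (primes n) by apply/allP => p; rewrite mem_primes => /andP[].
apply: (@leq_trans (\prod_(p <- primes n) (c p * p ^ logn p n))%N).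
  rewrite -{1}(prod_primes_pfactor n0).
  apply: (@leq_trans ((\prod_(p <- primes n) (logn p n).+1) ^ j)%N).
    by rewrite leq_exp2r // ndiv_prod.
  have -> : ((\prod_(p <- primes n) (logn p n).+1) ^ j = \prod_(p <- primes n) (logn p n).+1 ^ j)%N.
    elim: (primes n) => [|p s IH]; first by rewrite !big_nil exp1n.
    by rewrite !big_cons expnMn IH.
  rewrite big_seq [leqRHS]big_seq.
  apply: leq_prod => p pn; have pr_p := allP pp _ pn.
  rewrite /c; case: ltnP => h; last first.
    rewrite mul1n; apply: (@leq_trans ((2 ^ logn p n) ^ j)%N); first by rewrite leq_exp2r // two.
    by rewrite -expnM mulnC expnM; case: (logn p n) => [//|a]; rewrite leq_exp2r.
  apply: leq_trans (small _) _; rewrite leq_mul2l /K0; apply/orP; right.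
  by case: (logn p n) => [//|a]; rewrite leq_exp2r // prime_gt1.
rewrite big_split /= prod_primes_pfactor // leq_mul2r; apply/orP; right.
rewrite (bigID (fun p => p < 2 ^ j)%N) /= [X in (_ * X)%N]big1 ?muln1; last first.
  by move=> p; rewrite /c => /negPf ->.
rewrite (eq_bigr (fun _ => K0)); last by move=> p; rewrite /c => ->.
rewrite big_const_seq iter_muln_1 leq_pexp2l //.
rewrite -size_filter -[X in (_ <= X)%N](size_iota 0).
apply: uniq_leq_size; first by rewrite filter_uniq // primes_uniq.
by move=> p; rewrite mem_filter mem_iota => /andP[].
Qed.

Definition sqfree (n : nat) : bool := (0 < n)%N && all (fun p => logn p n == 1%N) (primes n).
Definition mobius (n : nat) : int := if sqfree n then (-1) ^+ size (primes n) else 0.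

Lemma mobius_abs_le1 n : `|mobius n| <= 1.
Proof. by rewrite /mobius; case: sqfree => //; rewrite normrX normrN1 expr1n. Qed.

Lemma primes_coprime_cons (p m : nat) : prime p -> (0 < m)%N -> ~~ (p %| m)%N ->
  perm_eq (primes (p * m)) (p :: primes m).
Proof.
move=> pr_p m0 pm; apply: uniq_perm; first exact: primes_uniq.
  by rewrite /= primes_uniq mem_primes pr_p m0 pm.
by move=> q; rewrite primesM // ?prime_gt0 // inE; congr (_ || _); rewrite primes_prime // inE.
Qed.

Lemma mobius_primeM (p m : nat) : prime p -> (0 < m)%N -> ~~ (p %| m)%N ->
  mobius (p * m) = - mobius m.
Proof.
move=> pr_p m0 pm; rewrite /mobius /sqfree (perm_all _ (primes_coprime_cons pr_p m0 pm)).
rewrite (perm_size (primes_coprime_cons pr_p m0 pm)) /= muln_gt0 (prime_gt0 pr_p) m0 /=.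
rewrite lognM // ?prime_gt0 // logn_prime // eqxx lognE pr_p m0 (negPf pm) /=.
rewrite (@eq_in_all _ _ (fun q => logn q m == 1)%N); last first.
  move=> q qm /=; have qp : q != p by apply: contraTneq qm => ->; rewrite mem_primes (negPf pm) !andbF.
  by rewrite lognM // ?prime_gt0 // logn_prime // (negPf qp).
by case: all; rewrite ?exprS ?mulN1r ?oppr0.
Qed.

Lemma sum_mobius (n : nat) : (0 < n)%N -> \sum_(d <- divisors n) mobius d = (n == 1%N)%:R.
Proof.
move=> n0; have [->|n1] := eqVneq n 1%N; first by rewrite big_seq1.
have pr_p : prime (pdiv n) by apply: pdiv_prime; lia.
set p := pdiv n in pr_p.
have p0 := prime_gt0 pr_p.
pose a := logn p n; pose m := (n %/ p ^ a)%N.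
have a0 : (0 < a)%N by rewrite logn_gt0 mem_primes pr_p n0 pdiv_dvd.
have nE : (n = p ^ a * m)%N by rewrite mulnC divnK // pfactor_dvdnn.
have m0 : (0 < m)%N by move: n0; rewrite nE muln_gt0 => /andP[].
have pm : ~~ (p %| m)%N.
  apply/negP => h; have : (p ^ a.+1 %| n)%N by rewrite nE expnSr dvdn_pmul2l ?expn_gt0 ?p0.
  by rewrite pfactor_dvdn // ltnn.
have dm d : (d %| n)%N -> ~~ (p %| d)%N -> (d %| m)%N.
  move=> dn pd; rewrite -(@Gauss_dvdr d (p ^ a)) -?nE //.
  by rewrite coprime_sym coprimeXl // prime_coprime.
rewrite (bigID (fun d => p %| d)%N) /= (bigID (fun d => p ^ 2 %| d)%N) /=.
rewrite [X in X + _ + _]big1_seq ?add0r; last first.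
  move=> d /andP[/andP[_ p2] dn]; rewrite /mobius /sqfree.
  have d0 : (0 < d)%N by move: dn; rewrite -dvdn_divisors // => /dvdn_gt0; apply.
  move: p2; rewrite pfactor_dvdn // => p2.
  have pin : p \in primes d by rewrite -logn_gt0; apply: ltnW.
  case: ifP => // /andP[_ /allP/(_ p pin)] /=; by case: (logn p d) p2 => [|[|]].
have -> : \sum_(d <- divisors n | ~~ (p %| d)%N) mobius d = \sum_(d <- divisors m) mobius d.
  rewrite -big_filter; apply: perm_big; apply: uniq_perm; rewrite ?filter_uniq ?divisors_uniq // => d.
  rewrite mem_filter -!dvdn_divisors //; apply/andP/idP => [[h1 h2]|h]; first exact: dm.
  by split; [apply: contraNN pm => /dvdn_trans; apply | rewrite nE dvdn_mull].
have -> : \sum_(d <- divisors n | (p %| d)%N && ~~ (p ^ 2 %| d)%N) mobius d =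
     \sum_(d <- map (muln p) (divisors m)) mobius d.
  rewrite -big_filter; apply: perm_big; apply: uniq_perm; rewrite ?filter_uniq ?divisors_uniq //.
    by rewrite map_inj_uniq ?divisors_uniq // => x y /eqP; rewrite eqn_pmul2l // => /eqP.
  move=> d; rewrite mem_filter -dvdn_divisors //.
  apply/andP/mapP => [[/andP[/dvdnP[e ->] p2] dn]|[e em ->]].
    exists e; last by rewrite mulnC.
    rewrite -dvdn_divisors //; apply: dm; first by apply: dvdn_trans dn; rewrite dvdn_mulr.
    by apply: contraNN p2; rewrite expnS expn1 => h; rewrite dvdn_pmul2r.
  move: em; rewrite -dvdn_divisors // => em; rewrite dvdn_mulr //= expnS expn1 dvdn_pmul2l //; split.
    by apply: contraNN pm => /dvdn_trans; apply.
  rewrite nE -(prednK a0) expnS -mulnA dvdn_pmul2l // dvdn_mull //.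
rewrite big_map -big_split big1_seq //= => d; rewrite -dvdn_divisors // => dm'.
rewrite mobius_primeM ?addNr ?(dvdn_gt0 m0) //.
by apply: contraNN pm => /dvdn_trans; apply.
Qed.

Section Vaughan.
Variable R : realType.
Implicit Types f g h : nat -> R.

Lemma von_mangoldt_ge0 n : 0 <= von_mangoldt R n.
Proof.
rewrite /von_mangoldt; case E: (primes n) => [|p [|q s]] //.
have : p \in primes n by rewrite E mem_head.
rewrite mem_primes => /and3P[pr_p _ _]; apply: ln_ge0.
by rewrite ler1n prime_gt0.
Qed.

Lemma von_mangoldt_pexp p k : prime p -> (0 < k)%N -> von_mangoldt R (p ^ k) = ln p%:R.
Proof. by move=> pr_p k0; rewrite /von_mangoldt primesX // primes_prime. Qed.

Lemma von_mangoldt_neq0 n p : von_mangoldt R n != 0 -> (0 < n)%N -> prime p -> (p %| n)%N ->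
  n = (p ^ logn p n)%N.
Proof.
move=> v0 n0 pr_p pn; move: v0; rewrite /von_mangoldt.
have : p \in primes n by rewrite mem_primes pr_p n0.
case E: (primes n) => [|q [|r s]] //; rewrite ?eqxx // inE => /eqP pq _.
by rewrite -{1}(prod_primes_pfactor n0) E big_seq1 pq.
Qed.

Lemma sum_von_mangoldt n : (0 < n)%N -> \sum_(d <- divisors n) von_mangoldt R d = ln n%:R.
Proof.
elim/ltn_ind: n => n IH n0; have [->|n1] := eqVneq n 1%N; first by rewrite big_seq1 ln1.
have pr_p : prime (pdiv n) by apply: pdiv_prime; lia.
set p := pdiv n in pr_p.
have p0 := prime_gt0 pr_p.
pose a := logn p n; pose m := (n %/ p ^ a)%N.
have a0 : (0 < a)%N by rewrite logn_gt0 mem_primes pr_p n0 pdiv_dvd.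
have nE : (n = p ^ a * m)%N by rewrite mulnC divnK // pfactor_dvdnn.
have m0 : (0 < m)%N by move: n0; rewrite nE muln_gt0 => /andP[].
have pm : ~~ (p %| m)%N.
  apply/negP => hp; have : (p ^ a.+1 %| n)%N by rewrite nE expnSr dvdn_pmul2l ?expn_gt0 ?p0.
  by rewrite pfactor_dvdn // ltnn.
have dm d : (d %| n)%N -> ~~ (p %| d)%N -> (d %| m)%N.
  move=> dn pd; rewrite -(@Gauss_dvdr d (p ^ a)) -?nE //.
  by rewrite coprime_sym coprimeXl // prime_coprime.
rewrite (bigID (fun d => p %| d)%N) /=.
have -> : \sum_(d <- divisors n | ~~ (p %| d)%N) von_mangoldt R d = ln m%:R.
  rewrite -IH //; last first.
    by rewrite ltn_Pdiv // -(exp1n a) ltn_exp2r // prime_gt1.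
  rewrite -big_filter; apply: perm_big; apply: uniq_perm; rewrite ?filter_uniq ?divisors_uniq // => d.
  rewrite mem_filter -!dvdn_divisors //; apply/andP/idP => [[h1 h2]|h]; first exact: dm.
  by split; [apply: contraNN pm => /dvdn_trans; apply | rewrite nE dvdn_mull].
rewrite (bigID (fun d => d == p ^ logn p d)%N) /= [X in _ + X + _]big1_seq ?addr0; last first.
  move=> d /andP[/andP[pd nd] dn]; apply: contraNeq nd => v0; apply/eqP.
  have d0 : (0 < d)%N by move: dn; rewrite -dvdn_divisors // => /dvdn_gt0; apply.
  exact: von_mangoldt_neq0.
have -> : \sum_(d <- divisors n | (p %| d)%N && (d == p ^ logn p d)%N) von_mangoldt R d =
     \sum_(d <- map (expn p) (iota 1 a)) von_mangoldt R d.
  rewrite -big_filter; apply: perm_big; apply: uniq_perm; rewrite ?filter_uniq ?divisors_uniq //.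
    rewrite map_inj_uniq ?iota_uniq // => x y /eqP; rewrite eqn_exp2l ?prime_gt1 // => /eqP.
    by [].
  move=> d; rewrite mem_filter -dvdn_divisors //.
  apply/andP/mapP => [[/andP[pd /eqP dE] dn]|[e em ->]].
    have d0 : (0 < d)%N by apply: dvdn_gt0 dn.
    exists (logn p d) => //; rewrite mem_iota add1n ltnS dvdn_leq_log // andbT logn_gt0.
    by rewrite mem_primes pr_p d0 pd.
  move: em; rewrite mem_iota add1n ltnS => /andP[e0 ea].
  by rewrite pfactorK // eqxx dvdn_exp //= nE dvdn_mulr // dvdn_exp2l.
rewrite big_map (eq_big_seq (fun _ => ln p%:R)); last first.
  by move=> e; rewrite mem_iota => /andP[e0 _] /=; rewrite von_mangoldt_pexp.
rewrite big_const_seq count_predT size_iota iter_addr_0 -lnXn ?ltr0n //.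
by rewrite -lnM ?posrE ?exprn_gt0 ?ltr0n // -natrX -natrM -nE.
Qed.

Definition dconv f g (n : nat) : R := \sum_(d <- divisors n) f d * g (n %/ d)%N.
Definition dcut (p : pred nat) f (n : nat) : R := if p n then f n else 0.

Lemma dconvA f g h (n : nat) : (0 < n)%N -> dconv (dconv f g) h n = dconv f (dconv g h) n.
Proof.
move=> n0; rewrite /dconv.
transitivity (\sum_(m <- divisors n) \sum_(d <- divisors n | (d %| m)%N) f d * g (m %/ d)%N * h (n %/ m)%N).
  apply: eq_big_seq => m; rewrite -dvdn_divisors // => mn; have m0 := dvdn_gt0 n0 mn.
  rewrite mulr_suml -[RHS]big_filter; apply: perm_big; apply: uniq_perm;
    rewrite ?filter_uniq ?divisors_uniq // => d.
  rewrite mem_filter -!dvdn_divisors //; apply/idP/andP => [dm|[]//].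
  by split=> //; apply: dvdn_trans mn.
rewrite (exchange_big_dep predT) //=; apply: eq_big_seq => d; rewrite -dvdn_divisors // => dn.
have d0 := dvdn_gt0 n0 dn.
rewrite mulr_sumr -big_filter.
rewrite (perm_big (map (muln d) (divisors (n %/ d)))) /=; last first.
  apply: uniq_perm; rewrite ?filter_uniq ?divisors_uniq //.
    by rewrite map_inj_uniq ?divisors_uniq // => x y /eqP; rewrite eqn_pmul2l // => /eqP.
  have nd0 : (0 < n %/ d)%N by rewrite divn_gt0 // dvdn_leq.
  move=> m; rewrite mem_filter -dvdn_divisors //; apply/andP/mapP.
    move=> [/dvdnP[e ->] mn]; exists e; last by rewrite mulnC.
    by rewrite -dvdn_divisors // -(dvdn_pmul2r d0) divnK.
  move=> [e]; rewrite -dvdn_divisors // => en ->; rewrite dvdn_mulr //; split=> //.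
  by rewrite -(divnK dn) mulnC dvdn_pmul2r.
rewrite big_map; apply: eq_big_seq => e _.
by rewrite mulKn // -divnMA mulrA.
Qed.

Lemma dconv_mobius_one g (n : nat) : (0 < n)%N ->
  dconv (fun d => (mobius d)%:~R) (dconv (fun=> 1) g) n = g n.
Proof.
move=> n0; rewrite -dconvA // /dconv (bigD1_seq 1%N) ?divisors_uniq -?dvdn_divisors ?dvd1n //=.
have one m : (0 < m)%N -> \sum_(d <- divisors m) (mobius d)%:~R * 1 = (m == 1%N)%:R :> R.
  move=> m0; under eq_bigr do rewrite mulr1.
  by rewrite -(rmorph_sum (intmul 1)) /= sum_mobius // natz -pmulrn.
rewrite one // eqxx mul1r divn1 big1_seq ?addr0 // => d /andP[d1].
rewrite -dvdn_divisors // => /(dvdn_gt0 n0) d0.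
by rewrite one // (negPf d1) mul0r.
Qed.

Lemma perm_divisors n : (0 < n)%N -> perm_eq [seq (n %/ d)%N | d <- divisors n] (divisors n).
Proof.
move=> n0; apply: uniq_perm.
- rewrite map_inj_in_uniq ?divisors_uniq // => x y; rewrite -!dvdn_divisors // => xn yn e.
  have : (n %/ (n %/ x) = n %/ (n %/ y))%N by rewrite e.
  by rewrite !divnA // !mulKn.
- exact: divisors_uniq.
move=> d; rewrite -dvdn_divisors //; apply/mapP/idP => [[e]|dn].
  by rewrite -dvdn_divisors // => en ->; apply: dvdn_div.
exists (n %/ d)%N; first by rewrite -dvdn_divisors // dvdn_div.
by rewrite divnA // mulKn.
Qed.

Lemma dconvC f g n : (0 < n)%N -> dconv f g n = dconv g f n.
Proof.
move=> n0; rewrite /dconv -[RHS](perm_big _ (perm_divisors n0)) big_map.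
apply: eq_big_seq => d; rewrite -dvdn_divisors // => dn.
by rewrite divnA // mulKn // mulrC.
Qed.

Lemma dconv_one g (n : nat) : (0 < n)%N -> dconv (fun=> 1) g n = \sum_(d <- divisors n) g d.
Proof. by move=> n0; rewrite dconvC // /dconv; under eq_bigr do rewrite mulr1. Qed.

Lemma eq_dconv f f' g g' n : (0 < n)%N -> (forall m, (0 < m)%N -> f m = f' m) ->
  (forall m, (0 < m)%N -> g m = g' m) -> dconv f g n = dconv f' g' n.
Proof.
move=> n0 ef eg; apply: eq_big_seq => d; rewrite -dvdn_divisors // => dn.
have d0 := dvdn_gt0 n0 dn.
by rewrite ef // eg // divn_gt0 // dvdn_leq.
Qed.

Lemma dconv_swap f g h n : (0 < n)%N -> dconv f (dconv g h) n = dconv g (dconv f h) n.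
Proof.
move=> n0; rewrite -!dconvA //; apply: eq_dconv => // m m0; exact: dconvC.
Qed.

Lemma dconvDl f f' g n : dconv (fun d => f d + f' d) g n = dconv f g n + dconv f' g n.
Proof. by rewrite /dconv -big_split; apply: eq_bigr => d _; rewrite mulrDl. Qed.

Lemma dconvDr f g g' n : dconv f (fun d => g d + g' d) n = dconv f g n + dconv f g' n.
Proof. by rewrite /dconv -big_split; apply: eq_bigr => d _; rewrite mulrDr. Qed.

Lemma dconvBr f g g' n : dconv f (fun d => g d - g' d) n = dconv f g n - dconv f g' n.
Proof. by rewrite /dconv -sumrB; apply: eq_bigr => d _; rewrite mulrBr. Qed.

Lemma dcutC (U : nat) f n : dcut (fun d => (d <= U)%N) f n + dcut (fun d => (U < d)%N) f n = f n.
Proof. by rewrite /dcut ltnNge; case: (n <= U)%N; rewrite ?addr0 ?add0r. Qed.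

Lemma vaughan (U V : nat) (n : nat) : (0 < n)%N ->
  let mu d : R := (mobius d)%:~R in
  let muU := dcut (fun d => (d <= U)%N) mu in let muU' := dcut (fun d => (U < d)%N) mu in
  let LV := dcut (fun d => (d <= V)%N) (von_mangoldt R) in
  let LV' := dcut (fun d => (V < d)%N) (von_mangoldt R) in
  von_mangoldt R n = LV n + dconv muU (fun d => ln d%:R) n - dconv (dconv muU LV) (fun=> 1) n
    + dconv muU' (dconv LV' (fun=> 1)) n.
Proof.
move=> n0 mu muU muU' LV LV'.
have mobg g : g n = dconv muU (dconv (fun=> 1) g) n + dconv muU' (dconv (fun=> 1) g) n.
  rewrite -dconvDl -[LHS]dconv_mobius_one //; apply: eq_dconv => // m _.
  by rewrite dcutC.
have lnE m : (0 < m)%N -> dconv (fun=> 1) (von_mangoldt R) m = ln m%:R.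
  by move=> m0; rewrite dconv_one // sum_von_mangoldt.
have -> : dconv muU' (dconv LV' (fun=> 1)) n =
   dconv muU' (dconv (fun=> 1) (von_mangoldt R)) n - dconv muU' (dconv (fun=> 1) LV) n.
  rewrite -dconvBr; apply: eq_dconv => // m m0; rewrite dconvC // -dconvBr.
  apply: eq_dconv => // k _; rewrite -[X in _ = X - _](dcutC V); rewrite /LV /LV'; ring.
rewrite dconvA // -(@eq_dconv muU muU (dconv (fun=> 1) (von_mangoldt R))) //.
rewrite (@eq_dconv muU muU (dconv LV (fun=> 1)) (dconv (fun=> 1) LV)) //; last first.
  by move=> m m0; apply: dconvC.
rewrite {1}(mobg (von_mangoldt R)) {1}(mobg LV); ring.
Qed.
End Vaughan.

(** * Orthogonality and convolution powers *)

Lemma sum_blocks (V : nmodType) (p m : nat) (F : nat -> V) :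
  \sum_(i < p * m) F i = \sum_(b < m) \sum_(a < p) F (p * b + a)%N.
Proof.
elim: m => [|m IH]; first by rewrite muln0 !big_ord0.
rewrite big_ord_recr /= -IH mulnS addnC -!(big_mkord predT).
rewrite (@big_cat_nat _ _ _ (p * m)%N) ?leq_addr //=; congr (_ + _).
rewrite -{1}[(p * m)%N]add0n big_addn addKn ?big_mkord; apply: eq_bigr => a _.
by rewrite addnC.
Qed.

Lemma sum_crt (V : pzRingType) (p m : nat) (F G : int -> V) : (0 < m)%N -> coprime p m ->
  (forall x, F (x + p%:Z) = F x) -> (forall x, G (x + m%:Z) = G x) ->
  \sum_(i < p * m) F i%:Z * G i%:Z = (\sum_(i < p) F i%:Z) * (\sum_(i < m) G i%:Z).
Proof.
move=> m0 co perF perG; rewrite (sum_blocks p m (fun i => F i%:Z * G i%:Z)) exchange_big mulr_suml.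
have perFn b x : F (x + (p * b)%N%:Z) = F x.
  elim: b => [|b IH]; first by rewrite muln0 addr0.
  by rewrite mulnS PoszD addrCA addrC perF.
apply: eq_bigr => a _.
rewrite (eq_bigr (fun b : 'I_m => F a%:Z * G (a%:Z + p%:Z * b%:Z))); last first.
  by move=> b _; rewrite PoszD [_%:Z + _]addrC perFn PoszM.
by rewrite -mulr_sumr (@sum_residues _ G m p%:Z a%:Z).
Qed.

Lemma incomplete_sum (f : int -> int) (P : nat) : (0 < P)%N -> (forall x, `|f x| <= 1) ->
  (forall x, \sum_(j < P) f (x + j%:Z) = 0) ->
  forall L x, `|\sum_(j < L) f (x + j%:Z)| <= P%:Z.
Proof.
move=> P0 f1 fz L; elim/ltn_ind: L => L IH x.
case: (ltnP L P) => LP.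
  apply: le_trans (ler_norm_sum _ _ _) _.
  apply: le_trans (ler_sum _ (fun i _ => f1 _)) _.
  by rewrite sumr_const card_ord; lia.
rewrite -(big_mkord predT (fun j => f (x + j%:Z))) (@big_cat_nat _ _ _ P) //= big_mkord fz add0r.
rewrite -{1}[P]add0n big_addn big_mkord.
have hl : (L - P < L)%N by move: P0 LP; clear; lia.
rewrite (eq_bigr (fun j : 'I_(L - P) => f (x + P%:Z + j%:Z))); first exact: IH.
by move=> j _; rewrite PoszD [j%:Z + _]addrC addrA.
Qed.

Lemma coprime_Re_norm (w : gint) : gprim w -> coprimez (gre w) (gnrm w)%:Z.
Proof.
move=> prw; rewrite gnrmZ /coprimez expr2 gcdzMDl -/(coprimez _ _).
by rewrite coprimez_pexpr.
Qed.

Lemma jacobi_affine_periodic (a b : int) (n : nat) (x : int) :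
  jacobi (a + b * (x + n%:Z)) n = jacobi (a + b * x) n.
Proof. by apply: jacobi_congr; apply/dvdzP; exists b; ring. Qed.

Lemma jacobi_affine_periodic_mul (a b : int) (n m : nat) (x : int) :
  jacobi (a + b * (x + (m * n)%N%:Z)) n = jacobi (a + b * x) n.
Proof. by apply: jacobi_congr; apply/dvdzP; exists (b * m%:Z); rewrite PoszM; ring. Qed.

Lemma sqfree_prime_exists (m n : nat) : sqfree m -> sqfree n -> m != n ->
  exists2 p, prime p & ((p %| m)%N && ~~ (p %| n)%N) || ((p %| n)%N && ~~ (p %| m)%N).
Proof.
move=> /andP[m0 /allP sm] /andP[n0 /allP sn] mn.
apply: contrapT => no; case/eqP: mn.
have iff p : prime p -> (p %| m)%N = (p %| n)%N.
  move=> pr_p; apply/idP/idP => h; apply: contraT => h'; case: no; exists p => //.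
    by rewrite h h'.
  by rewrite h h' orbT.
rewrite -(prod_primes_pfactor m0) -(prod_primes_pfactor n0).
have e : primes m = primes n.
  by apply/eq_primes => p; rewrite !mem_primes m0 n0 /=; case pr_p: (prime p) => //=; rewrite iff.
rewrite e; apply: eq_big_seq => p pn.
by rewrite (eqP (sn p pn)) (eqP (sm p _)) // e.
Qed.

Lemma sqfree_odd_split (p q : nat) : sqfree q -> prime p -> (p %| q)%N ->
  q = (p * (q %/ p))%N /\ ~~ (p %| q %/ p)%N.
Proof.
move=> /andP[q0 /allP sq] pr_p pq; rewrite mulnC divnK //; split=> //.
apply/negP => h; have : (p ^ 2 %| q)%N.
  by rewrite expnS expn1 -(divnK pq) dvdn_pmul2r // prime_gt0.
rewrite pfactor_dvdn // (eqP (sq p _)) //.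
by rewrite mem_primes pr_p q0.
Qed.

Lemma complete_jacobi_pair (a1 b1 a2 b2 : int) (q1 q2 : nat) (x : int) (p : nat) :
  odd q1 -> odd q2 -> sqfree q1 -> prime p -> (p %| q1)%N -> ~~ (p %| q2)%N -> coprimez b1 q1 ->
  \sum_(j < q1 * q2) jacobi (a1 + b1 * (x + j%:Z)) q1 * jacobi (a2 + b2 * (x + j%:Z)) q2 = 0.
Proof.
move=> o1 o2 s1 pr_p p1 p2 co; have [qE pm] := sqfree_odd_split s1 pr_p p1.
set m := (q1 %/ p)%N in qE pm.
have om : odd m by move: o1; rewrite qE oddM => /andP[].
have op : odd p by move: o1; rewrite qE oddM => /andP[].
have m0 : (0 < m)%N by case: (m) om.
have q20 : (0 < q2)%N by case: (q2) o2.
pose F y := jacobi (a1 + b1 * (x + y)) p.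
pose G y := jacobi (a1 + b1 * (x + y)) m * jacobi (a2 + b2 * (x + y)) q2.
have -> : (q1 * q2 = p * (m * q2))%N by rewrite qE mulnA.
transitivity (\sum_(j < p * (m * q2)) F j%:Z * G j%:Z).
  apply: eq_bigr => j _; by rewrite /F /G mulrA -jacobi_muln // ?prime_gt0 // -qE.
apply: (etrans (@sum_crt _ p (m * q2) F G _ _ _ _)).
- by rewrite muln_gt0 m0.
- by rewrite coprimeMr !prime_coprime // pm.
- by move=> y; rewrite /F addrA jacobi_affine_periodic.
- move=> y; rewrite /G !addrA jacobi_affine_periodic_mul; congr (_ * _).
  by rewrite mulnC jacobi_affine_periodic_mul.
suff -> : \sum_(i < p) F i%:Z = 0 by rewrite mul0r.
have cob : coprimez b1 p by apply: coprimez_dvdr co.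
have := sum_residues (a1 + b1 * x) (prime_gt0 pr_p) cob (legendreD p).
rewrite sum_legendre // => sum0; apply: (etrans _ sum0).
by apply: eq_bigr => i _; rewrite /F jacobi_prime // mulrDr addrA.
Qed.

Lemma dsym_affine (w : gint) (x y : int) :
  dsym w (Complex x y) = jacobi (- (gim w * y) + gre w * x) (gnrm w).
Proof. by rewrite /dsym greM /= addrC. Qed.

Lemma dsym_abs_le1 (w z : gint) : `|dsym w z| <= 1.
Proof. exact: jacobi_abs_le1. Qed.

Lemma dsym_orthogonal (w1 w2 : gint) (x y : int) (L : nat) : primary w1 -> primary w2 ->
  gprim w1 -> gprim w2 -> sqfree (gnrm w1) -> sqfree (gnrm w2) -> gnrm w1 != gnrm w2 ->
  `|\sum_(j < L) dsym w1 (Complex (x + j%:Z) y) * dsym w2 (Complex (x + j%:Z) y)| <=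
    (gnrm w1 * gnrm w2)%N%:Z.
Proof.
move=> p1 p2 g1 g2 s1 s2 n12.
have o1 := primary_odd p1; have o2 := primary_odd p2.
have pos := fun w h => primary_gnrm_gt0 (z := w) h.
apply: (@incomplete_sum (fun x => dsym w1 (Complex x y) * dsym w2 (Complex x y))).
- by rewrite muln_gt0 !pos.
- by move=> t; rewrite normrM mulr_ile1 // dsym_abs_le1.
move=> t; have [p pr_p /orP[/andP[h1 h2]|/andP[h1 h2]]] := sqfree_prime_exists s1 s2 n12.
  under eq_bigr do rewrite !dsym_affine.
  by apply: (@complete_jacobi_pair _ _ _ _ _ _ _ p) => //; apply: coprime_Re_norm.
under eq_bigr do rewrite !dsym_affine mulrC; rewrite mulnC.
by apply: (@complete_jacobi_pair _ _ _ _ _ _ _ p) => //; apply: coprime_Re_norm.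
Qed.

Definition gbox (n : nat) : seq gint :=
  [seq (Complex (i%:Z - n%:Z) (j%:Z - n%:Z) : gint) | j <- iota 0 (2 * n).+1, i <- iota 0 (2 * n).+1].

Lemma gbox_uniq n : uniq (gbox n).
Proof.
apply: allpairs_uniq; rewrite ?iota_uniq // => -[a b] [c d] _ _ /= [e1 e2].
by congr (_, _); lia.
Qed.

Lemma mem_gbox n (z : gint) : (z \in gbox n) = (`|gre z| <= n)%N && (`|gim z| <= n)%N.
Proof.
apply/idP/idP => [|/andP[h1 h2]].
  case/allpairsP => -[j i] [hj hi ->]; move: hj hi; rewrite !mem_iota add0n.
  by rewrite [gre _]/= [gim _]/= [(_, _).1]/= [(_, _).2]/=; clear; lia.
apply/allpairsP; exists (absz (gim z + n%:Z), absz (gre z + n%:Z)).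
rewrite !mem_iota add0n [(_, _).1]/= [(_, _).2]/=; split; [by move: h2; clear; lia|by move: h1; clear; lia|].
by case: z h1 h2 => a b /= h1 h2; congr Complex; lia.
Qed.

Lemma mem_gbox_norm n (z : gint) : (gnrm z <= n ^ 2)%N -> z \in gbox n.
Proof.
rewrite mem_gbox /gnrm => h; apply/andP; split; rewrite -(@leq_exp2r _ _ 2) //; apply: leq_trans h.
  exact: leq_addr.
exact: leq_addl.
Qed.

Lemma sum_gbox (V : nmodType) n (F : gint -> V) : \sum_(z <- gbox n) F z =
  \sum_(j < (2 * n).+1) \sum_(i < (2 * n).+1) F (Complex (- n%:Z + i%:Z) (j%:Z - n%:Z)).
Proof.
rewrite big_allpairs_dep -{1}[iota 0 _]/(index_iota 0 (2 * n).+1) big_mkord.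
apply: eq_bigr => j _; rewrite -[iota 0 _]/(index_iota 0 (2 * n).+1) big_mkord.
by apply: eq_bigr => i _; rewrite addrC.
Qed.

Section Inequalities.
Variable R : realType.
Variable I : Type.
Implicit Types (s : seq I) (a b : I -> R).

Lemma sum_chebyshev s a k : (forall i, 0 <= a i) ->
  (\sum_(i <- s) a i ^+ k) * (\sum_(i <- s) a i) <= (size s)%:R * \sum_(i <- s) a i ^+ k.+1.
Proof.
move=> a0; rewrite -(@ler_pM2l _ 2) //.
have -> : 2 * ((\sum_(i <- s) a i ^+ k) * (\sum_(i <- s) a i)) =
    \sum_(i <- s) \sum_(j <- s) (a i ^+ k * a j + a j ^+ k * a i).
  rewrite -[RHS]/(\sum_(i <- s) \sum_(j <- s) (a i ^+ k * a j + a j ^+ k * a i)).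
  under [RHS]eq_bigr do rewrite big_split /= -mulr_sumr -mulr_suml.
  by rewrite big_split /= -mulr_suml -mulr_sumr; ring.
have -> : 2 * ((size s)%:R * \sum_(i <- s) a i ^+ k.+1) =
    \sum_(i <- s) \sum_(j <- s) (a i ^+ k.+1 + a j ^+ k.+1).
  under [RHS]eq_bigr do rewrite big_split /= big_const_seq count_predT iter_addr_0.
  rewrite big_split /= big_const_seq count_predT iter_addr_0.
  by rewrite sumrMnl -mulr_natl; ring.
apply: ler_sum => i _; apply: ler_sum => j _; rewrite -subr_ge0.
have -> : a i ^+ k.+1 + a j ^+ k.+1 - (a i ^+ k * a j + a j ^+ k * a i) =
   (a i ^+ k - a j ^+ k) * (a i - a j) by rewrite !exprSr; ring.
case: (lerP (a i) (a j)) => h.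
  by rewrite mulr_le0 // subr_le0 // lerXn2r // nnegrE.
by rewrite mulr_ge0 // subr_ge0 ?lerXn2r ?nnegrE // ltW.
Qed.

Lemma sum_power_mean s a k : (forall i, 0 <= a i) ->
  (\sum_(i <- s) a i) ^+ k.+1 <= (size s)%:R ^+ k * \sum_(i <- s) a i ^+ k.+1.
Proof.
move=> a0; elim: k => [|k IH].
  by rewrite expr0 mul1r expr1; under [leRHS]eq_bigr do rewrite expr1.
have S0 : 0 <= \sum_(i <- s) a i by apply: sumr_ge0.
rewrite exprSr; apply: le_trans (ler_wpM2r S0 IH) _.
rewrite -mulrA exprSr -mulrA; apply: ler_wpM2l; first by rewrite exprn_ge0.
exact: sum_chebyshev.
Qed.

Lemma sum_cauchy_schwarz s a b :
  (\sum_(i <- s) a i * b i) ^+ 2 <= (\sum_(i <- s) a i ^+ 2) * (\sum_(i <- s) b i ^+ 2).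
Proof.
rewrite -(@ler_pM2l _ 2) //.
have -> : 2 * (\sum_(i <- s) a i * b i) ^+ 2 =
    \sum_(i <- s) \sum_(j <- s) (2 * (a i * b i) * (a j * b j)).
  under [RHS]eq_bigr do rewrite -mulr_sumr.
  by rewrite -mulr_suml -mulr_sumr; ring.
have -> : 2 * ((\sum_(i <- s) a i ^+ 2) * (\sum_(i <- s) b i ^+ 2)) =
    \sum_(i <- s) \sum_(j <- s) (a i ^+ 2 * b j ^+ 2 + a j ^+ 2 * b i ^+ 2).
  under [RHS]eq_bigr do rewrite big_split /= -mulr_sumr -mulr_suml.
  by rewrite big_split /= -mulr_suml -mulr_sumr; ring.
apply: ler_sum => i _; apply: ler_sum => j _; rewrite -subr_ge0.
have -> : a i ^+ 2 * b j ^+ 2 + a j ^+ 2 * b i ^+ 2 - 2 * (a i * b i) * (a j * b j) =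
   (a i * b j - a j * b i) ^+ 2 by ring.
exact: sqr_ge0.
Qed.
End Inequalities.

Lemma sum_nat_count (R : pzSemiRingType) (T : Type) (s : seq T) (p : pred T) :
  \sum_(x <- s) (p x)%:R = (count p s)%:R :> R.
Proof.
elim: s => [|x s IH]; first by rewrite big_nil.
by rewrite big_cons IH /= natrD.
Qed.

Section ConvolutionPower.
Variables (R : realType) (Zs : seq gint) (beta : gint -> R) (N0 m k : nat) (B E : R).
Hypotheses (N0m : (N0 ^ k <= m ^ 2)%N) (N0_gt0 : (0 < N0)%N).
Hypotheses (ZsP : forall z, z \in Zs -> (0 < gnrm z <= N0)%N) (B0 : 0 <= B) (E0 : 0 <= E).
Hypothesis betaB : forall z, z \in Zs -> `|beta z| <= B.
Hypothesis divE : forall Z, (0 < gnrm Z <= N0 ^ k)%N ->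
  (count (fun z => `[< gdvd z Z >]) Zs)%:R <= E.

Fixpoint cpow (j : nat) (Z : gint) : R :=
  if j is j'.+1 then \sum_(z <- Zs) \sum_(Z' <- gbox m) (z * Z' == Z)%:R * (beta z * cpow j' Z')
  else (Z == 1)%:R.

Lemma cpow0 Z : cpow 0 Z = (Z == 1)%:R.
Proof. by []. Qed.

Lemma cpowS j Z : cpow j.+1 Z =
  \sum_(z <- Zs) \sum_(Z' <- gbox m) (z * Z' == Z)%:R * (beta z * cpow j Z').
Proof. by []. Qed.

Arguments cpow : simpl never.

Lemma cpow_support j Z : cpow j Z != 0 -> (0 < gnrm Z <= N0 ^ j)%N.
Proof.
elim: j Z => [|j IH] Z; first by rewrite cpow0; have [->|] := eqVneq Z 1; rewrite ?eqxx.
rewrite cpowS.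
apply: contraNT => nZ; rewrite big_seq big1 // => z zs; rewrite big1 // => Z' _.
case: eqP => [e|]; rewrite ?mul0r //; apply/eqP; apply: contraNT nZ.
rewrite mul1r mulf_eq0 negb_or => /andP[_ /IH /andP[n0 nj]].
have /andP[z0 zN] := ZsP zs.
by rewrite -e gnrmM muln_gt0 z0 n0 expnS leq_mul.
Qed.

Lemma cpow_expand (w : gint) j : primary w -> gprim w -> (j <= k)%N ->
  (\sum_(z <- Zs) beta z * (dsym w z)%:~R) ^+ j = \sum_(Z <- gbox m) cpow j Z * (dsym w Z)%:~R.
Proof.
move=> pw gw; have d1 : dsym w 1 = 1.
  rewrite /dsym mulr1; have [ou ev _] := iffLR (primaryP w) pw.
  by have := jacobi_Re_norm ou ev gw; rewrite -gnrmZ absz_nat.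
have in_box j' Z : (j' <= k)%N -> cpow j' Z != 0 -> Z \in gbox m.
  move=> jk /cpow_support/andP[_ h]; apply: mem_gbox_norm.
  by apply: leq_trans N0m; apply: leq_trans h _; rewrite leq_pexp2l.
elim: j => [|j IH] jk.
  rewrite expr0 (bigD1_seq 1) ?gbox_uniq //=; last by apply: (in_box 0%N) => //; rewrite cpow0 eqxx oner_neq0.
  by rewrite cpow0 eqxx d1 mulr1 big1 ?addr0 // => Z /negPf; rewrite cpow0 => ->; rewrite mul0r.
rewrite exprS IH ?(ltnW jk) // mulr_suml.
under [RHS]eq_bigr do rewrite cpowS mulr_suml.
rewrite exchange_big /=; apply: eq_big_seq => z zs.
under [RHS]eq_bigr do rewrite mulr_suml.
rewrite exchange_big /= mulr_sumr; apply: eq_bigr => Z' _.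
have [c0|c0] := eqVneq (cpow j Z') 0.
  by rewrite c0 mul0r mulr0 big1 // => Z _; rewrite !mulr0 mul0r.
have inb : z * Z' \in gbox m.
  apply: mem_gbox_norm; have /andP[_ h] := cpow_support c0; have /andP[_ hz] := ZsP zs.
  apply: leq_trans N0m; apply: (@leq_trans (N0 ^ j.+1)); last by rewrite leq_pexp2l.
  by rewrite gnrmM expnS leq_mul.
rewrite (bigD1_seq (z * Z')) ?gbox_uniq //= eqxx mul1r big1 ?addr0; last first.
  by move=> Z; rewrite eq_sym => /negPf ->; rewrite !mul0r.
by rewrite dsymM // rmorphM /=; ring.
Qed.

Lemma cpow_sup j Z : (j <= k)%N -> `|cpow j Z| <= (B * E) ^+ j.
Proof.
elim: j Z => [|j IH] Z jk; first by rewrite cpow0 expr0; case: eqP; rewrite ?normr1 ?normr0 ?ler01.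
have [->|c0] := eqVneq (cpow j.+1 Z) 0; first by rewrite normr0 exprn_ge0 // mulr_ge0.
have /andP[Z0 Zj] := cpow_support c0.
have Zk : (0 < gnrm Z <= N0 ^ k)%N by rewrite Z0 (leq_trans Zj) // leq_pexp2l.
rewrite cpowS; apply: le_trans (ler_norm_sum _ _ _) _.
have BE0 : 0 <= (B * E) ^+ j by rewrite exprn_ge0 // mulr_ge0.
apply: (@le_trans _ _ (\sum_(z <- Zs) (`[< gdvd z Z >])%:R * (B * (B * E) ^+ j))).
  rewrite big_seq [leRHS]big_seq; apply: ler_sum => z zs.
  have z_neq0 : z != 0 by have /andP[] := ZsP zs; rewrite lt0n gnrm0.
  case: (asboolP (gdvd z Z)) => [[t tE]|nd]; last first.
    rewrite big1 ?normr0 ?mul0r // => Z' _; case: eqP => [e|]; last by rewrite mul0r.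
    by case: nd; exists Z'.
  rewrite mul1r; apply: (@le_trans _ _ (`|beta z * cpow j t|)).
    have [tb|tb] := boolP (t \in gbox m).
      rewrite (bigD1_seq t) ?gbox_uniq //= tE eqxx mul1r big1 ?addr0 // => Z' nt.
      by case: eqP => [/(gmulfI z_neq0) e|]; rewrite ?mul0r //; rewrite e eqxx in nt.
    rewrite big1_seq ?normr0 ?normr_ge0 // => Z' /= Zb.
    by case: eqP => [|]; rewrite ?mul0r // tE => /(gmulfI z_neq0) e; rewrite -e Zb in tb.
  by rewrite normrM ler_pM ?normr_ge0 ?betaB // IH // ltnW.
rewrite -mulr_suml sum_nat_count exprS mulrA ler_wpM2r // [B * E]mulrC ler_wpM2r //.
exact: divE.
Qed.

Lemma cpow_l1 j : \sum_(Z <- gbox m) `|cpow j Z| <= (B * (size Zs)%:R) ^+ j.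
Proof.
elim: j => [|j IH].
  rewrite expr0; apply: (@le_trans _ _ (\sum_(Z <- gbox m) (Z == 1)%:R)).
    by apply: ler_sum => Z _; rewrite cpow0; case: eqP; rewrite ?normr1 ?normr0.
  by rewrite sum_nat_count -[X in _ <= X]/(1%:R) ler_nat count_uniq_mem ?gbox_uniq // leq_b1.
apply: (@le_trans _ _ (\sum_(Z <- gbox m) \sum_(z <- Zs) \sum_(Z' <- gbox m)
   (z * Z' == Z)%:R * (B * `|cpow j Z'|))).
  apply: ler_sum => Z _; rewrite cpowS; apply: le_trans (ler_norm_sum _ _ _) _.
  rewrite big_seq [leRHS]big_seq; apply: ler_sum => z zs.
  apply: le_trans (ler_norm_sum _ _ _) _; apply: ler_sum => Z' _.
  rewrite !normrM normr_nat; apply: ler_wpM2l => //; apply: ler_wpM2r => //; exact: betaB.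
rewrite exchange_big /=.
apply: (@le_trans _ _ (\sum_(z <- Zs) \sum_(Z' <- gbox m) B * `|cpow j Z'|)).
  apply: ler_sum => z _; rewrite exchange_big /=; apply: ler_sum => Z' _.
  rewrite -mulr_suml -[leRHS]mul1r; apply: ler_wpM2r; first by rewrite mulr_ge0.
  rewrite (eq_bigr (fun Z => (Z == z * Z')%:R)); last by move=> Z _; rewrite eq_sym.
  by rewrite sum_nat_count -[X in _ <= X]/(1%:R) ler_nat count_uniq_mem ?gbox_uniq // leq_b1.
rewrite big_const_seq count_predT iter_addr_0 -mulr_sumr exprS -[leLHS]mulr_natr mulrAC.
by apply: ler_wpM2l => //; rewrite mulr_ge0.
Qed.

Lemma cpow_l2 : \sum_(Z <- gbox m) cpow k Z ^+ 2 <= (B * E) ^+ k * (B * (size Zs)%:R) ^+ k.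
Proof.
have BE0 : 0 <= (B * E) ^+ k by rewrite exprn_ge0 // mulr_ge0.
apply: le_trans (ler_wpM2l BE0 (cpow_l1 k)); rewrite mulr_sumr.
apply: ler_sum => Z _; rewrite -real_normK ?num_real // expr2 ler_wpM2r //.
exact: cpow_sup.
Qed.
End ConvolutionPower.

Section BilinearCore.
Variables (R : realType) (K : eqType) (cells : seq K) (kap : gint -> K).
Variables (W Zs : seq gint) (beta : K -> gint -> R) (N0 m k M : nat) (B E Dg : R).
Hypotheses (uniqC : uniq cells) (kapW : forall w, w \in W -> kap w \in cells).
Hypotheses (N0m : (N0 ^ k.+1 <= m ^ 2)%N) (N0_gt0 : (0 < N0)%N).
Hypotheses (ZsP : forall z, z \in Zs -> (0 < gnrm z <= N0)%N) (B0 : 0 <= B) (E0 : 0 <= E).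
Hypothesis betaB : forall c z, z \in Zs -> `|beta c z| <= B.
Hypothesis divE : forall Z, (0 < gnrm Z <= N0 ^ k.+1)%N ->
  (count (fun z => `[< gdvd z Z >]) Zs)%:R <= E.
Hypothesis WP : forall w, w \in W -> [/\ primary w, gprim w, sqfree (gnrm w) & (gnrm w <= M)%N].
Hypothesis WD : forall w, w \in W -> (count (fun w' => gnrm w == gnrm w') W)%:R <= Dg.

Lemma dsym_correlation (w1 w2 : gint) : w1 \in W -> w2 \in W ->
  `|\sum_(Z <- gbox m) (dsym w1 Z)%:~R * (dsym w2 Z)%:~R| <=
   (gnrm w1 == gnrm w2)%:R * ((2 * m).+1 ^ 2)%:R + ((2 * m).+1 * M ^ 2)%:R :> R.
Proof.
move=> /WP[p1 g1 s1 n1] /WP[p2 g2 s2 n2].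
have [e|ne] := eqVneq (gnrm w1) (gnrm w2).
  rewrite mul1r -[leLHS]addr0; apply: lerD => //; apply: le_trans (ler_norm_sum _ _ _) _.
  apply: (@le_trans _ _ (\sum_(Z <- gbox m) 1)).
    apply: ler_sum => Z _; rewrite normrM -!intr_norm mulr_ile1 ?ler0z ?lerz1 //; exact: dsym_abs_le1.
  by rewrite sum_gbox !big_const_ord !iter_addr_0 -mulrnA mulnn.
rewrite mul0r add0r sum_gbox natrM -[((2 * m).+1)%:R]mulr1 mulr_natl.
apply: le_trans (ler_norm_sum _ _ _) _.
apply: (@le_trans _ _ (\sum_(j < (2 * m).+1) (M ^ 2)%:R)); last first.
  by rewrite big_const_ord iter_addr_0 -mulr_natl mulrC mulr_natr mulrC mulr_natr.
apply: ler_sum => j _.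
have := @dsym_orthogonal w1 w2 (- m%:Z) (j%:Z - m%:Z) (2 * m).+1 p1 p2 g1 g2 s1 s2 ne.
rewrite -(ler_int R) intr_norm => h.
have -> : \sum_(i < (2 * m).+1) (dsym w1 (Complex (- m%:Z + i%:Z) (j%:Z - m%:Z)))%:~R *
   (dsym w2 (Complex (- m%:Z + i%:Z) (j%:Z - m%:Z)))%:~R = (\sum_(i < (2 * m).+1)
   dsym w1 (Complex (- m%:Z + i%:Z) (j%:Z - m%:Z)) * dsym w2 (Complex (- m%:Z + i%:Z) (j%:Z - m%:Z)))%:~R :> R.
  by rewrite rmorph_sum; apply: eq_bigr => i _; rewrite rmorphM.
by apply: le_trans h _; rewrite ler_nat expnS expn1 leq_mul.
Qed.

Lemma bilinear_core :
  (\sum_(w <- W) `|\sum_(z <- Zs) beta (kap w) z * (dsym w z)%:~R|) ^+ (2 * k.+1) <=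
  (size W)%:R ^+ (2 * k) * ((size cells)%:R * ((B * E) ^+ k.+1 * (B * (size Zs)%:R) ^+ k.+1)) *
   ((size W)%:R * (Dg * ((2 * m).+1 ^ 2)%:R + (size W)%:R * ((2 * m).+1 * M ^ 2)%:R)).
Proof.
pose A w := \sum_(z <- Zs) beta (kap w) z * (dsym w z)%:~R.
pose cp c Z := cpow Zs (beta c) m k.+1 Z.
pose sg w := Num.sg (A w ^+ k.+1).
pose D c Z : R := \sum_(w <- W | kap w == c) sg w * (dsym w Z)%:~R.
pose S := \sum_(w <- W) `|A w| ^+ k.+1.
have sg1 w : `|sg w| <= 1 by rewrite /sg normr_sg; case: eqP.
have W0 : 0 <= (size W)%:R :> R by [].
have SE : S = \sum_(c <- cells) \sum_(Z <- gbox m) cp c Z * D c Z.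
  transitivity (\sum_(w <- W) \sum_(Z <- gbox m) cp (kap w) Z * (sg w * (dsym w Z)%:~R)).
    apply: eq_big_seq => w wW; have [pw gw _ _] := WP wW.
    rewrite -normrX normrEsg -/(sg w) /A (@cpow_expand R Zs (beta (kap w)) N0 m k.+1) //.
    by rewrite mulr_sumr; apply: eq_bigr => Z _; rewrite -/(cp _ _) mulrCA.
  transitivity (\sum_(w <- W) \sum_(c <- cells) (kap w == c)%:R *
      \sum_(Z <- gbox m) cp c Z * (sg w * (dsym w Z)%:~R)).
    apply: eq_big_seq => w wW; rewrite (bigD1_seq (kap w)) ?kapW //= eqxx mul1r [X in _ + X]big1 ?addr0 //.
    by move=> c; rewrite eq_sym => /negPf ->; rewrite mul0r.
  rewrite exchange_big; apply: eq_bigr => c _; rewrite /D.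
  under [RHS]eq_bigr do rewrite mulr_sumr.
  rewrite [RHS](exchange_big_dep (fun w => kap w == c)) //= [RHS]big_mkcond.
  by apply: eq_bigr => w _; case: eqP => _; rewrite ?mul1r ?mul0r.
have CS : S ^+ 2 <= (\sum_(c <- cells) \sum_(Z <- gbox m) cp c Z ^+ 2) *
    (\sum_(c <- cells) \sum_(Z <- gbox m) D c Z ^+ 2).
  have := @sum_cauchy_schwarz R (K * gint) [seq (c, Z) | c <- cells, Z <- gbox m]
     (fun p => cp p.1 p.2) (fun p => D p.1 p.2).
  by rewrite !big_allpairs /= -SE.
have cp2 : \sum_(c <- cells) \sum_(Z <- gbox m) cp c Z ^+ 2 <=
    (size cells)%:R * ((B * E) ^+ k.+1 * (B * (size Zs)%:R) ^+ k.+1).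
  rewrite [leRHS]mulr_natl -[X in _ *+ X]count_predT -iter_addr_0 -big_const_seq.
  by apply: ler_sum => c _; apply: (@cpow_l2 R Zs (beta c) N0 m k.+1 B E) => // z; apply: betaB.
pose P w1 w2 : R := `|\sum_(Z <- gbox m) (dsym w1 Z)%:~R * (dsym w2 Z)%:~R|.
have D2 : \sum_(c <- cells) \sum_(Z <- gbox m) D c Z ^+ 2 <= \sum_(w1 <- W) \sum_(w2 <- W) P w1 w2.
  apply: (@le_trans _ _ (\sum_(c <- cells) \sum_(w1 <- W | kap w1 == c) \sum_(w2 <- W) P w1 w2)); last first.
    under eq_bigr do rewrite big_mkcond.
    rewrite exchange_big /= big_seq [leRHS]big_seq; apply: ler_sum => w1 w1W.
    rewrite (bigD1_seq (kap w1)) ?kapW //= eqxx [X in _ + X]big1 ?addr0 //.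
    by move=> c; rewrite eq_sym => /negPf ->.
  apply: ler_sum => c _.
  have -> : \sum_(Z <- gbox m) D c Z ^+ 2 = \sum_(w1 <- W | kap w1 == c) \sum_(w2 <- W | kap w2 == c)
      sg w1 * sg w2 * \sum_(Z <- gbox m) (dsym w1 Z)%:~R * (dsym w2 Z)%:~R.
    transitivity (\sum_(Z <- gbox m) \sum_(w1 <- W | kap w1 == c) \sum_(w2 <- W | kap w2 == c)
       sg w1 * sg w2 * ((dsym w1 Z)%:~R * (dsym w2 Z)%:~R)).
      apply: eq_bigr => Z _; rewrite expr2 /D mulr_suml; apply: eq_bigr => w1 _.
      by rewrite mulr_sumr; apply: eq_bigr => w2 _; ring.
    rewrite exchange_big; apply: eq_bigr => w1 _; rewrite exchange_big; apply: eq_bigr => w2 _.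
    by rewrite mulr_sumr.
  apply: ler_sum => w1 _; rewrite big_mkcond; apply: ler_sum => w2 _.
  case: eqP => _; last exact: normr_ge0.
  apply: le_trans (ler_norm _) _; rewrite normrM -[leRHS]mul1r; apply: ler_wpM2r => //.
  by rewrite normrM mulr_ile1.
have PW : \sum_(w1 <- W) \sum_(w2 <- W) P w1 w2 <=
   (size W)%:R * (Dg * ((2 * m).+1 ^ 2)%:R + (size W)%:R * ((2 * m).+1 * M ^ 2)%:R).
  rewrite [leRHS]mulr_natl -[X in _ *+ X]count_predT -iter_addr_0 -big_const_seq.
  rewrite big_seq [leRHS]big_seq; apply: ler_sum => w1 w1W.
  apply: (@le_trans _ _ (\sum_(w2 <- W) ((gnrm w1 == gnrm w2)%:R * ((2 * m).+1 ^ 2)%:R + ((2 * m).+1 * M ^ 2)%:R))).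
    by rewrite big_seq [leRHS]big_seq; apply: ler_sum => w2 w2W; apply: dsym_correlation.
  rewrite big_split /= -mulr_suml sum_nat_count big_const_seq count_predT iter_addr_0 -[X in _ + X <= _]mulr_natl.
  by apply: lerD => //; apply: ler_wpM2r => //; apply: WD.
have S0 : 0 <= S by apply: sumr_ge0 => w _; rewrite exprn_ge0.
have PM := @sum_power_mean R gint W (fun w => `|A w|) k (fun w => normr_ge0 _).
rewrite -/S in PM.
have T0 : 0 <= (\sum_(w <- W) `|A w|) ^+ k.+1 by rewrite exprn_ge0 // sumr_ge0.
apply: (@le_trans _ _ (((size W)%:R ^+ k * S) ^+ 2)).
  by rewrite mulnC exprM lerXn2r // nnegrE // mulr_ge0 // exprn_ge0.
have -> : ((size W)%:R ^+ k * S) ^+ 2 = (size W)%:R ^+ (2 * k) * S ^+ 2.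
  by rewrite exprMn -exprM mulnC.
rewrite -mulrA; apply: ler_wpM2l; first by rewrite exprn_ge0.
apply: le_trans CS _; apply: ler_pM => //.
- by apply: sumr_ge0 => c _; apply: sumr_ge0 => Z _; apply: sqr_ge0.
- by apply: sumr_ge0 => c _; apply: sumr_ge0 => Z _; apply: sqr_ge0.
- exact: le_trans D2 PW.
Qed.
End BilinearCore.

(** * Counting Gaussian integers *)

Lemma nat_sqrt_exists (n : nat) : exists r, (r ^ 2 <= n < r.+1 ^ 2)%N.
Proof.
elim: n => [|n [r /andP[h1 h2]]]; first by exists 0%N.
have [h|h] := ltnP n.+1 (r.+1 ^ 2); first by exists r; rewrite h (leq_trans h1).
exists r.+1; rewrite h /=; apply: leq_ltn_trans h2 _.
by rewrite ltn_exp2r.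
Qed.

Definition primaryb (z : gint) : bool :=
  [&& odd `|gre z|, ~~ odd `|gim z| & (4 %| gim z - gre z + 1)%Z].

Lemma primarybP (z : gint) : reflect (primary z) (primaryb z).
Proof. by apply: (iffP and3P); rewrite primaryP. Qed.

Definition pplist (X : nat) : seq gint :=
  [seq y <- gbox X | [&& primaryb y, gprim y & (gnrm y <= X)%N]].

Lemma pplist_uniq X : uniq (pplist X).
Proof. by rewrite filter_uniq // gbox_uniq. Qed.

Lemma pplistP X (y : gint) : reflect [/\ primary y, gprim y & (gnrm y <= X)%N] (y \in pplist X).
Proof.
rewrite mem_filter; apply: (iffP andP) => [[/and3P[/primarybP ? ? ?] _]//|[/primarybP p g n]].
rewrite p g n; split=> //; apply: mem_gbox_norm; apply: leq_trans n _.
by case: X => // X; rewrite leq_pmulr.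
Qed.

Lemma size_gbox n : size (gbox n) = ((2 * n).+1 ^ 2)%N.
Proof. by rewrite size_allpairs !size_iota mulnn. Qed.

Lemma size_norm_le (s : seq gint) (X : nat) : uniq s -> (0 < X)%N ->
  (forall y, y \in s -> (gnrm y <= X)%N) -> (size s <= 9 * X)%N.
Proof.
move=> us X0 hs; have [r /andP[h1 h2]] := nat_sqrt_exists X.
have r0 : (0 < r)%N by case: (r) h2 X0 => //; case: (X).
apply: (@leq_trans (size (gbox r))); last first.
  rewrite size_gbox; apply: leq_trans (_ : (9 * r ^ 2 <= _)%N); last by rewrite leq_mul2l h1 orbT.
  by rewrite -(expnMn 3 r 2) leq_exp2r //; lia.
apply: uniq_leq_size => // y /hs ny; rewrite mem_gbox.
have lt (a : nat) : (a ^ 2 <= X)%N -> (a <= r)%N.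
  by move=> ha; rewrite -ltnS -(@ltn_exp2r _ _ 2) //; apply: leq_ltn_trans ha h2.
by rewrite !lt // (leq_trans _ ny) // /gnrm ?leq_addr ?leq_addl.
Qed.

Lemma count_pplist_norm (s : seq gint) (n : nat) : uniq s -> (0 < n)%N ->
  (forall y, y \in s -> primary y /\ gprim y) ->
  (count (fun y => gnrm y == n) s <= ndiv n)%N.
Proof.
move=> us n0 hs; rewrite -size_filter; apply: count_primary_norm => //; first exact: filter_uniq.
by move=> y; rewrite mem_filter => /andP[/eqP nE /hs[]].
Qed.

Lemma count_divisors (s : seq gint) (Z : gint) (D : nat) : uniq s -> (0 < gnrm Z)%N ->
  (forall y, y \in s -> primary y /\ gprim y) -> (forall n, (0 < n <= gnrm Z)%N -> (ndiv n <= D)%N) ->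
  (count (fun z => `[< gdvd z Z >]) s <= D * D)%N.
Proof.
move=> us Z0 hs hD.
apply: (@leq_trans (\sum_(d <- divisors (gnrm Z)) count (fun y => gnrm y == d) s)).
  have -> : \sum_(d <- divisors (gnrm Z)) count (fun y => gnrm y == d) s =
     \sum_(y <- s) count (fun d => gnrm y == d) (divisors (gnrm Z)).
    under eq_bigr do rewrite -sum1_count big_mkcond.
    rewrite exchange_big; apply: eq_bigr => y _.
    by rewrite -sum1_count [RHS]big_mkcond.
  rewrite -sum1_count big_mkcond; apply: leq_sum => y _; case: asboolP => // -[t tE].
  rewrite -has_count; apply/hasP; exists (gnrm y) => //.
  by rewrite -dvdn_divisors // tE gnrmM dvdn_mulr.
apply: (@leq_trans (\sum_(d <- divisors (gnrm Z)) D)).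
  rewrite big_seq [leqRHS]big_seq; apply: leq_sum => d; rewrite -dvdn_divisors // => dZ.
  have d0 := dvdn_gt0 Z0 dZ.
  apply: leq_trans (count_pplist_norm us d0 hs) _; apply: hD.
  by rewrite d0 dvdn_leq.
rewrite big_const_seq count_predT iter_addn_0 leq_mul2l; apply/orP; right.
by apply: hD; rewrite Z0 leqnn.
Qed.

Lemma count_factor (s : seq gint) (y : gint) : uniq s -> primary y -> gprim y ->
  (forall w, w \in s -> primary w) ->
  (count (fun w => `[< gdvd w y >]) s <= ndiv (gnrm y))%N.
Proof.
move=> us py gy hs; rewrite -size_filter.
apply: (card_le_rel (r := fun w d => gnrm w = d)); first exact: filter_uniq.
  move=> w; rewrite mem_filter => /andP[/asboolP[t tE] ws]; exists (gnrm w) => //.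
  by rewrite -dvdn_divisors ?primary_gnrm_gt0 // tE gnrmM dvdn_mulr.
move=> w w' d; rewrite !mem_filter => /andP[/asboolP[t tE] /hs pw] /andP[/asboolP[t' tE'] /hs pw'] h h'.
apply: (@primary_divisor_unique w w' t t') => //; rewrite -?tE -?tE' ?h ?h' //.
by apply: (primary_divr pw); rewrite -tE.
Qed.

Lemma size_int_interval (s : seq int) (L : nat) : uniq s ->
  (forall a b, a \in s -> b \in s -> `|a - b| <= L%:Z) -> (size s <= L.+1)%N.
Proof.
case: s => // a0 s us hs.
have [b bs bmin] : exists2 b, b \in a0 :: s & forall a, a \in a0 :: s -> b <= a.
  elim: s a0 {us hs} => [|a1 s IH] a0.
    by exists a0; rewrite ?mem_head // => a; rewrite inE => /eqP ->.
  have [b bs hb] := IH a1; case: (leP a0 b) => h.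
    exists a0; first exact: mem_head.
    by move=> a; rewrite inE => /orP[/eqP ->//|/hb]; apply: le_trans.
  exists b; first by rewrite inE bs orbT.
  by move=> a; rewrite inE => /orP[/eqP ->|/hb//]; apply: ltW.
rewrite -(size_iota 0 L.+1) -(size_map (fun i => b + i%:Z)).
apply: uniq_leq_size => // a as_.
apply/mapP; exists (absz (a - b)).
  by rewrite mem_iota; have := hs a b as_ bs; lia.
by have := bmin a as_; lia.
Qed.

Lemma size_nat_interval (s : seq nat) (A L : nat) : uniq s ->
  (forall a, a \in s -> (A <= a <= A + L)%N) -> (size s <= L.+1)%N.
Proof.
move=> us hs; rewrite -(size_iota A L.+1); apply: uniq_leq_size => // a /hs.
by rewrite mem_iota addnS ltnS.
Qed.

Lemma count_norm_interval (s : seq gint) (A L D : nat) : uniq s ->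
  (forall y, y \in s -> primary y /\ gprim y) -> (forall y, y \in s -> (A <= gnrm y <= A + L)%N) ->
  (forall n, (0 < n <= A + L)%N -> (ndiv n <= D)%N) -> (size s <= L.+1 * D)%N.
Proof.
move=> us hs hA hD.
have -> : size s = \sum_(y <- s) count (fun n => gnrm y == n) (undup (map gnrm s)).
  rewrite -sum1_size; apply: eq_big_seq => y ys.
  by rewrite (eq_count (a2 := pred1 (gnrm y))) ?count_uniq_mem ?undup_uniq // ?mem_undup ?map_f // => n; rewrite /= eq_sym.
have -> : \sum_(y <- s) count (fun n => gnrm y == n) (undup (map gnrm s)) =
   \sum_(n <- undup (map gnrm s)) count (fun y => gnrm y == n) s.
  under eq_bigr do rewrite -sum1_count big_mkcond.
  rewrite exchange_big; apply: eq_bigr => n _.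
  by rewrite -sum1_count [RHS]big_mkcond.
apply: (@leq_trans (\sum_(n <- undup (map gnrm s)) D)).
  rewrite [leqLHS]big_seq [leqRHS]big_seq; apply: leq_sum => n; rewrite mem_undup => /mapP[y ys nE].
  have n0 : (0 < n)%N by rewrite nE primary_gnrm_gt0 //; case: (hs y ys).
  apply: leq_trans (count_pplist_norm us n0 hs) _; apply: hD.
  by rewrite n0 nE; case/andP: (hA y ys).
rewrite big_const_seq count_predT iter_addn_0 mulnC leq_mul2r; apply/orP; right.
apply: (@size_nat_interval _ A); first exact: undup_uniq.
by move=> a; rewrite mem_undup => /mapP[y ys ->]; apply: hA.
Qed.

(* One of the coefficients of the linear form [re (y z0)] has square at least
   [N z0 / 2]; fixing the other coordinate of [y] leaves few choices. *)
Lemma count_strip (s : seq gint) (z0 : gint) (X J : nat) : uniq s -> (0 < J)%N -> (0 < X)%N ->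
  z0 != 0 -> (forall y, y \in s -> (gnrm y <= 2 * X)%N) ->
  (forall y, y \in s -> ((absz (gre (y * z0)%R) * J) ^ 2 <= 2 * gnrm z0 * X)%N) ->
  exists r, (r ^ 2 <= X)%N /\ (size s <= (4 * r).+4 * (4 * r.+1 %/ J).+1)%N.
Proof.
move=> us J0 X0 nz hX hJ; have [r /andP[h1 h2]] := nat_sqrt_exists X.
exists r; split=> //.
have c0 : (0 < gnrm z0)%N by rewrite lt0n gnrm0.
have gen (f g : gint -> int) (a b : int) : injective (fun y => (f y, g y)) ->
   (forall y, (absz (g y) ^ 2 <= gnrm y)%N) ->
   (forall y, gre (y * z0) = a * f y + b * g y) -> (gnrm z0 <= 2 * absz a ^ 2)%N ->
   (size s <= (4 * r).+4 * (4 * r.+1 %/ J).+1)%N.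
  move=> inj hg lin ca.
  have -> : size s = \sum_(y <- s) count (fun n => g y == n) (undup (map g s)).
    rewrite -sum1_size; apply: eq_big_seq => y ys.
    by rewrite (eq_count (a2 := pred1 (g y))) ?count_uniq_mem ?undup_uniq // ?mem_undup ?map_f // => n; rewrite /= eq_sym.
  have -> : \sum_(y <- s) count (fun n => g y == n) (undup (map g s)) =
     \sum_(n <- undup (map g s)) count (fun y => g y == n) s.
    under eq_bigr do rewrite -sum1_count big_mkcond.
    rewrite exchange_big; apply: eq_bigr => n _.
    by rewrite -sum1_count [RHS]big_mkcond.
  apply: (@leq_trans (\sum_(n <- undup (map g s)) (4 * r.+1 %/ J).+1)).
    apply: leq_sum => n _; rewrite -size_filter.
    rewrite -(size_map f); apply: size_int_interval.
      rewrite map_inj_in_uniq ?filter_uniq // => y y'.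
      rewrite !mem_filter => /andP[/eqP e _] /andP[/eqP e' _] ef.
      by apply: inj; rewrite ef e e'.
    move=> _ _ /mapP[y + ->] /mapP[y' + ->]; rewrite !mem_filter => /andP[/eqP e ys] /andP[/eqP e' ys'].
    have := hJ y ys; have := hJ y' ys'; rewrite !lin e e' => k1 k2.
    set d := f y - f y'.
    have kd : ((absz a * absz d * J) ^ 2 <= 4 * (2 * gnrm z0 * X))%N.
      have : (absz a * absz d <= absz (a * f y + b * n)%R + absz (a * f y' + b * n)%R)%N.
        by rewrite -abszM /d; have -> : a * (f y - f y') = (a * f y + b * n) - (a * f y' + b * n) by [ring]; lia.
      move: k1 k2; move: (absz (_ + _)) (absz (_ + _)) (absz a * absz d)%N => p q t k1 k2 ht.
      apply: (@leq_trans (((p * J) + (q * J)) ^ 2)%N); first by rewrite leq_exp2r // -mulnDl leq_mul2r ht orbT.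
      move: k1 k2; move: (p * J)%N (q * J)%N (2 * gnrm z0 * X)%N; clear => p q Y k1 k2.
      have : (2 * (p * q) <= p ^ 2 + q ^ 2)%N by case: (nat_Cauchy p q).
      by move: k1 k2; rewrite !expnS !expn0 !muln1; clear; nia.
    have kd2 : ((absz d * J) ^ 2 <= 16 * X)%N.
      rewrite -(leq_pmul2l c0).
      apply: (@leq_trans (2 * absz a ^ 2 * (absz d * J) ^ 2)%N); first by rewrite leq_mul2r ca orbT.
      by move: kd; rewrite -mulnA mulnA !expnMn; move: (absz a ^ 2)%N (absz d ^ 2)%N (J ^ 2)%N; clear; nia.
    have : (absz d * J <= 4 * r.+1)%N.
      rewrite -(@leq_exp2r _ _ 2) //; apply: leq_trans kd2 _.
      by rewrite expnMn leq_mul2l /= ltnW.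
    by rewrite -leq_divRL // -lez_nat abszE.
  rewrite big_const_seq count_predT iter_addn_0 mulnC leq_mul2r; apply/orP; right.
  apply: (@leq_trans (size [seq (i%:Z - (2 * r).+1%:Z) | i <- iota 0 (4 * r).+3])).
    apply: uniq_leq_size; first exact: undup_uniq.
    move=> n; rewrite mem_undup => /mapP[y ys ->].
    have gb : (absz (g y) <= (2 * r).+1)%N.
      rewrite -(@leq_exp2r _ _ 2) //; apply: leq_trans (hg y) _; apply: leq_trans (hX y ys) _.
      by move: h2; rewrite !expnS !expn0 !muln1; clear; nia.
    apply/mapP; exists (absz (g y + (2 * r).+1%:Z)); last by move: gb; clear; lia.
    by rewrite mem_iota; move: gb; clear; lia.
  by rewrite size_map size_iota.
case: (leqP (gnrm z0) (2 * absz (gre z0) ^ 2)) => h.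
  apply: (gen gre gim (gre z0) (- gim z0)) => //.
  - by move=> [a b] [c d] /= [-> ->].
  - by move=> y; rewrite /gnrm leq_addl.
  - by move=> y; rewrite greM; ring.
apply: (gen gim gre (- gim z0) (gre z0)) => //.
- by move=> [a b] [c d] /= [-> ->].
- by move=> y; rewrite /gnrm leq_addr.
- by move=> y; rewrite greM; ring.
- by move: h; rewrite /gnrm abszN; clear; lia.
Qed.

Section Cells.
Variables (M J r : nat).
Hypotheses (rM : (r ^ 2 <= M < r.+1 ^ 2)%N) (r0 : (0 < r)%N) (J0 : (0 < J)%N).

Definition cell_side : nat := maxn 1 (r %/ J).
Definition cell_label (w : gint) : gint :=
  Complex (gre w %/ cell_side%:Z)%Z (gim w %/ cell_side%:Z)%Z.
Definition cell_corner (c : gint) : gint := Complex (gre c * cell_side%:Z) (gim c * cell_side%:Z).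

Lemma cell_side_gt0 : (0 < cell_side)%N. Proof. by rewrite /cell_side leq_maxl. Qed.

Lemma cell_side_le : ((cell_side - 1) * J <= r)%N.
Proof.
rewrite /cell_side /maxn; case: (ltnP 1 (r %/ J)) => h; last by rewrite subnn mul0n.
by apply: leq_trans (leq_trunc_div r J); rewrite leq_mul2r leq_subr orbT.
Qed.

Lemma coord_le (a : nat) : (a ^ 2 < 2 * M)%N -> (a <= (2 * r).+1)%N.
Proof.
move=> h; rewrite -(@leq_exp2r _ _ 2) //; case/andP: rM => _; move: h.
rewrite !expnS !expn0 !muln1; clear; nia.
Qed.

Lemma cell_label_box (w : gint) : (gnrm w < 2 * M)%N -> cell_label w \in gbox (8 * J).
Proof.
move=> nw; have h0 := cell_side_gt0.
have rh : (r < 2 * cell_side * J)%N.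
  apply: leq_trans (ltn_ceil r J0) _; rewrite leq_mul2r; apply/orP; right.
  by rewrite /cell_side /maxn; case: (ltnP 1 (r %/ J)); set q := (r %/ J)%N; clear; lia.
have gen (u : int) : (absz u ^ 2 < 2 * M)%N -> (absz (u %/ cell_side%:Z)%Z <= 8 * J)%N.
  move/coord_le => hu; have hZ : cell_side%:Z != 0 by move: h0; clear; lia.
  have e := divz_eq u cell_side%:Z; have e1 := modz_ge0 u hZ.
  have e2 : (u %% cell_side%:Z)%Z < cell_side%:Z by apply: ltz_pmod; move: h0; clear; lia.
  move: e e1 e2; move: (u %/ _)%Z (u %% _)%Z => q d e e1 e2.
  have qh : (absz q * cell_side <= absz u + cell_side)%N.
    have -> : (absz q * cell_side)%N = absz (q * cell_side%:Z)%R by rewrite abszM absz_nat.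
    by move: (q * _) e e1 e2; clear; lia.
  have : (absz q * cell_side <= (8 * J) * cell_side)%N.
    apply: leq_trans qh _; move: hu rh h0 J0 r0; clear; nia.
  by rewrite leq_pmul2r.
rewrite mem_gbox /=; apply/andP; split; apply: gen; apply: leq_ltn_trans nw; rewrite /gnrm.
  exact: leq_addr.
exact: leq_addl.
Qed.

Lemma cell_diff (w : gint) : exists d1 d2 : int,
  [/\ w = cell_corner (cell_label w) + Complex d1 d2,
      0 <= d1 <= cell_side%:Z - 1 & 0 <= d2 <= cell_side%:Z - 1].
Proof.
have h0 := cell_side_gt0; have hZ : cell_side%:Z != 0 by move: h0; clear; lia.
have gen (u : int) : 0 <= (u %% cell_side%:Z)%Z <= cell_side%:Z - 1.
  have hp : 0 < cell_side%:Z by move: h0; clear; lia.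
  by rewrite modz_ge0 //=; have := ltz_pmod u hp; clear; lia.
exists (gre w %% cell_side%:Z)%Z, (gim w %% cell_side%:Z)%Z; split=> //.
by case: w => a b; rewrite /cell_corner /cell_label gaddE /= -!divz_eq.
Qed.

Lemma cell_norm_diff (w : gint) : (gnrm w < 2 * M)%N ->
  (J%:Z * `|(gnrm w)%:Z - (gnrm (cell_corner (cell_label w)))%:Z| <= 14 * M%:Z).
Proof.
move=> nw; have [d1 [d2 [wE h1 h2]]] := cell_diff w.
have sl := cell_side_le; have h0 := cell_side_gt0.
have b1 : (absz (gre w) <= (2 * r).+1)%N.
  by apply: coord_le; apply: leq_ltn_trans nw; rewrite /gnrm leq_addr.
have b2 : (absz (gim w) <= (2 * r).+1)%N.
  by apply: coord_le; apply: leq_ltn_trans nw; rewrite /gnrm leq_addl.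
have hr : (cell_side <= r)%N.
  by rewrite /cell_side /maxn; case: ltnP => // _; apply: leq_div.
case/andP: rM => rM1 _.
have gen (u d : int) : (absz u <= (2 * r).+1)%N -> 0 <= d <= cell_side%:Z - 1 ->
   `|d * (2 * u - d)| <= (cell_side%:Z - 1) * (7 * r%:Z).
  move=> hu /andP[d0 dl]; rewrite normrM ger0_norm //; apply: ler_pM => //.
  by move: hu dl d0 hr r0; clear; lia.
have -> : (gnrm w)%:Z - (gnrm (cell_corner (cell_label w)))%:Z =
   d1 * (2 * gre w - d1) + d2 * (2 * gim w - d2).
  move: wE; case: (cell_corner _) => p q; rewrite gaddE => ->; rewrite !gnrmZ /=; ring.
have g1 := gen _ _ b1 h1; have g2 := gen _ _ b2 h2.
apply: (@le_trans _ _ (J%:Z * (14 * ((cell_side%:Z - 1) * r%:Z)))).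
  apply: ler_wpM2l => //; apply: le_trans (ler_normD _ _) _; apply: le_trans (lerD g1 g2) _.
  by rewrite le_eqVlt; apply/orP; left; apply/eqP; ring.
have -> : J%:Z * (14 * ((cell_side%:Z - 1) * r%:Z)) = 14 * ((((cell_side - 1) * J) * r)%N%:Z).
  by rewrite !PoszM -subzn //; ring.
apply: ler_wpM2l => //; rewrite lez_nat; apply: leq_trans rM1.
by rewrite expnS expn1 leq_mul2r sl orbT.
Qed.

Lemma cell_re_diff (w t : gint) : ((J * absz (gre (w * t)%R - gre (cell_corner (cell_label w) * t)%R)%R) ^ 2 <=
  2 * M * gnrm t)%N.
Proof.
have [d1 [d2 [wE /andP[h1 h1'] /andP[h2 h2']]]] := cell_diff w.
have sl := cell_side_le; have h0 := cell_side_gt0; case/andP: rM => rM1 _.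
have -> : gre (w * t) - gre (cell_corner (cell_label w) * t) = d1 * gre t - d2 * gim t.
  by rewrite {1}wE !greM; case: (cell_corner _) => p q; rewrite gaddE /=; ring.
have le1 : (absz (d1 * gre t - d2 * gim t)%R <= (cell_side - 1) * (absz (gre t) + absz (gim t)))%N.
  have a1 : (absz d1 <= cell_side - 1)%N by move: h1 h1' h0; clear; lia.
  have a2 : (absz d2 <= cell_side - 1)%N by move: h2 h2' h0; clear; lia.
  apply: (@leq_trans (absz (d1 * gre t)%R + absz (d2 * gim t)%R)%N); first by clear; lia.
  by rewrite !abszM mulnDr leq_add // leq_mul2r ?a1 ?a2 orbT.
apply: (@leq_trans ((r * (absz (gre t) + absz (gim t))) ^ 2)%N).
  rewrite leq_exp2r //; apply: (@leq_trans (J * ((cell_side - 1) * (absz (gre t) + absz (gim t))))%N).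
    by rewrite leq_mul2l le1 orbT.
  by rewrite mulnA leq_mul2r [(J * _)%N]mulnC sl orbT.
have -> : (2 * M * gnrm t = M * (2 * gnrm t))%N by rewrite mulnCA mulnA.
rewrite expnMn; apply: leq_mul => //.
rewrite /gnrm; move: (absz (gre t)) (absz (gim t)) => p q.
by have [h _] := nat_Cauchy p q; rewrite sqrnD; move: h; clear; lia.
Qed.
End Cells.

Definition sgnz (a : int) : int := if a < 0 then -1 else 1.

Section TypeTwoShell.
Variables (R : realType) (X M J k D : nat) (W : seq gint) (beta : gint -> R) (z0 : gint)
  (dl : bool) (B : R).
Hypotheses (J0 : (0 < J)%N) (M0 : (0 < M)%N) (MX : (M <= X)%N) (uniqW : uniq W) (z0_neq0 : z0 != 0).
Hypothesis WP : forall w, w \in W ->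
  [/\ primary w, gprim w, sqfree (gnrm w) & (M <= gnrm w < 2 * M)%N].
Hypotheses (B0 : 0 <= B) (betaB : forall z, z \in pplist (X %/ M) -> `|beta z| <= B).
Hypothesis hD : forall n, (0 < n <= 41 * X ^ k.+1)%N -> (ndiv n <= D)%N.

Definition phi (w z : gint) : R :=
  (gnrm (w * z) <= X)%N%:R * (if dl then (sgnz (gre (w * z * z0)))%:~R else 1).

Local Notation Zs := (pplist (X %/ M)).

Lemma phi_abs_le1 w z : `|phi w z| <= 1.
Proof.
rewrite /phi normrM mulr_ile1 ?normr_ge0 //; first by case: leqP; rewrite ?normr1 ?normr0.
by case: dl; rewrite ?normr1 // /sgnz; case: ifP; rewrite ?rmorphN1 ?rmorph1 ?normrN1 ?normr1.
Qed.

Definition bad (y : gint) : bool :=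
  ((J%:Z * `|(gnrm y)%:Z - X%:Z| <= 20 * X%:Z)) ||
  ((absz (gre (y * z0)%R) * J) ^ 2 <= 2 * gnrm z0 * X)%N.

Lemma XM_mul (z : gint) : (gnrm z <= X %/ M)%N -> (M * gnrm z <= X)%N.
Proof. by move=> h; rewrite mulnC -leq_divRL. Qed.

Lemma phi_mismatch r (w z : gint) : (r ^ 2 <= M < r.+1 ^ 2)%N -> (0 < r)%N ->
  (gnrm w < 2 * M)%N -> (gnrm z <= X %/ M)%N ->
  phi w z != phi (cell_corner J r (cell_label J r w)) z -> bad (w * z).
Proof.
move=> rM r0 nw /XM_mul nz ne; rewrite /bad.
set w' := cell_corner J r (cell_label J r w) in ne *.
have nd := cell_norm_diff J rM r0 nw; rewrite -/w' in nd.
have [e|e] := eqVneq (gnrm (w * z) <= X)%N (gnrm (w' * z) <= X)%N; last first.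
  apply/orP; left; move: e; rewrite !gnrmM.
  set a := gnrm w in nd *; set a' := gnrm w' in nd *; set b := gnrm z in nz *.
  move=> e; have h : `|(a * b)%N%:Z - X%:Z| <= `|(a * b)%N%:Z - (a' * b)%N%:Z|.
    by move: e; move: (a * b)%N (a' * b)%N => p q; clear; lia.
  apply: le_trans (ler_wpM2l _ h) _; first by [].
  rewrite !PoszM -mulrBl normrM mulrA.
  apply: le_trans (ler_wpM2r _ nd) _; first by rewrite normr_ge0.
  have : (M * b)%N%:Z <= X%:Z by rewrite lez_nat.
  by rewrite PoszM ger0_norm //; clear; lia.
move: ne; rewrite /phi -e; case: dl => /=; last by rewrite eqxx.
have [e2|e2] := eqVneq (gre (w * z * z0) < 0) (gre (w' * z * z0) < 0).
  by rewrite /sgnz e2 eqxx.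
move=> _; apply/orP; right.
have rd := cell_re_diff J rM w (z * z0); rewrite -/w' !mulrA in rd.
apply: (@leq_trans ((J * absz (gre (w * z * z0) - gre (w' * z * z0))%R) ^ 2)%N).
  by rewrite leq_exp2r // mulnC leq_mul2l; apply/orP; right; move: e2; clear; lia.
apply: leq_trans rd _; rewrite gnrmM.
rewrite (_ : (2 * M * (gnrm z * gnrm z0) = 2 * gnrm z0 * (M * gnrm z))%N); last by ring.
by rewrite leq_mul2l nz orbT.
Qed.

Lemma bad_count : exists rx, (rx ^ 2 <= X)%N /\
  (size [seq y <- pplist (2 * X) | bad y] <=
    (2 * (20 * X %/ J)).+1 * D + (4 * rx).+4 * (4 * rx.+1 %/ J).+1)%N.
Proof.
have X0 : (0 < X)%N by apply: leq_trans MX.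
pose s1 := [seq y <- pplist (2 * X) | J%:Z * `|(gnrm y)%:Z - X%:Z| <= 20 * X%:Z].
pose s2 := [seq y <- pplist (2 * X) | ((absz (gre (y * z0)%R) * J) ^ 2 <= 2 * gnrm z0 * X)%N].
have u2 : uniq s2 by rewrite filter_uniq ?pplist_uniq.
have h2 : forall y, y \in s2 -> (gnrm y <= 2 * X)%N.
  by move=> y; rewrite mem_filter => /andP[_ /pplistP[]].
have h2' : forall y, y \in s2 -> ((absz (gre (y * z0)%R) * J) ^ 2 <= 2 * gnrm z0 * X)%N.
  by move=> y; rewrite mem_filter => /andP[].
have [rx [rxX sz2]] := count_strip u2 J0 X0 z0_neq0 h2 h2'.
exists rx; split=> //.
have sz1 : (size s1 <= (2 * (20 * X %/ J)).+1 * D)%N.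
  apply: (@count_norm_interval s1 (X - 20 * X %/ J) (2 * (20 * X %/ J)) D).
  - by rewrite filter_uniq ?pplist_uniq.
  - by move=> y; rewrite mem_filter => /andP[_ /pplistP[]].
  - move=> y; rewrite mem_filter => /andP[h _].
    have : (absz ((gnrm y)%:Z - X%:Z) <= 20 * X %/ J)%N.
      by rewrite leq_divRL // -lez_nat !PoszM mulrC.
    by move: (20 * X %/ J)%N; clear; lia.
  move=> n /andP[n0 nn]; apply: hD; rewrite n0 /=; apply: leq_trans nn _.
  have : (20 * X %/ J <= 20 * X)%N by apply: leq_div.
  have : (X <= X ^ k.+1)%N by rewrite expnS leq_pmulr // expn_gt0 X0.
  by move: (20 * X %/ J)%N (X ^ k.+1)%N; clear; lia.
apply: leq_trans (leq_add sz1 sz2).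
rewrite -size_cat; apply: uniq_leq_size; first by rewrite filter_uniq ?pplist_uniq.
by move=> y; rewrite mem_cat !mem_filter => /andP[/orP[->|->] ->]; rewrite ?orbT.
Qed.

Lemma mismatch_sum r : (r ^ 2 <= M < r.+1 ^ 2)%N -> (0 < r)%N ->
  \sum_(w <- W) \sum_(z <- Zs) `|beta z * (phi w z - phi (cell_corner J r (cell_label J r w)) z) * (dsym w z)%:~R|
   <= 2 * B * (D * size [seq y <- pplist (2 * X) | bad y])%:R.
Proof.
move=> rM r0; have X0 : (0 < X)%N by apply: leq_trans MX.
set Y := [seq y <- pplist (2 * X) | bad y].
have uY : uniq Y by rewrite filter_uniq ?pplist_uniq.
apply: (@le_trans _ _ (\sum_(w <- W) \sum_(z <- Zs) \sum_(y <- Y) 2 * B * (w * z == y)%:R)).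
  rewrite big_seq [leRHS]big_seq; apply: ler_sum => w wW; rewrite big_seq [leRHS]big_seq; apply: ler_sum => z zZ.
  have [pw gw _ /andP[nw1 nw2]] := WP wW; have [pz gz nz] := pplistP _ _ zZ.
  have [gwz|ngwz] := boolP (gprim (w * z)); last first.
    rewrite (dsym_not_gprim pw gz ngwz) mulr0 normr0; apply: sumr_ge0 => y _.
    by rewrite mulr_ge0 // mulr_ge0.
  have [e|ne] := eqVneq (phi w z) (phi (cell_corner J r (cell_label J r w)) z).
    rewrite e subrr mulr0 mul0r normr0; apply: sumr_ge0 => y _.
    by rewrite mulr_ge0 // mulr_ge0.
  have yY : w * z \in Y.
    rewrite mem_filter (phi_mismatch rM r0 nw2 nz ne) /=; apply/pplistP; split=> //; first exact: primaryM.
    have := XM_mul nz; rewrite gnrmM; move: nw2; clear; nia.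
  rewrite (bigD1_seq (w * z) yY uY) eqxx mulr1 -[leLHS]addr0; apply: lerD; last first.
    by apply: sumr_ge0 => y _; rewrite mulr_ge0 // mulr_ge0.
  rewrite !normrM mulrC -[leRHS]mul1r; apply: ler_pM; rewrite ?mulr_ge0 ?normr_ge0 //.
    by rewrite -intr_norm lerz1 dsym_abs_le1.
  rewrite mulrC; apply: ler_pM; rewrite ?normr_ge0 ?betaB //.
  apply: le_trans (ler_normB _ _) _; have := phi_abs_le1 w z; have := phi_abs_le1 (cell_corner J r (cell_label J r w)) z.
  by move: `|_| `|_| => a b; lra.
have -> : \sum_(w <- W) \sum_(z <- Zs) \sum_(y <- Y) 2 * B * (w * z == y)%:R =
   2 * B * \sum_(y <- Y) \sum_(w <- W) \sum_(z <- Zs) (w * z == y)%:R.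
  under eq_bigr do rewrite exchange_big /=.
  rewrite exchange_big /= mulr_sumr; apply: eq_bigr => y _.
  by rewrite mulr_sumr; apply: eq_bigr => w _; rewrite mulr_sumr.
apply: ler_wpM2l; first by rewrite mulr_ge0.
rewrite mulnC natrM mulr_natl -[X in _ *+ X]count_predT -iter_addr_0 -big_const_seq.
rewrite big_seq [leRHS]big_seq; apply: ler_sum => y; rewrite mem_filter => /andP[_ /pplistP[py gy ny]].
apply: (@le_trans _ _ (\sum_(w <- W) (`[< gdvd w y >])%:R)).
  rewrite big_seq [leRHS]big_seq; apply: ler_sum => w wW; have [pw gw _ _] := WP wW.
  case: asboolP => [[t tE]|nd]; last first.
    by rewrite big1 // => z _; case: eqP => // e; case: nd; exists z.
  rewrite (eq_bigr (fun z => (z == t)%:R)); last first.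
    move=> z _; rewrite tE; congr (nat_of_bool _)%:R; apply/eqP/eqP => [|->//].
    exact: gmulfI (primary_neq0 pw) _ _.
  by rewrite sum_nat_count -[X in _ <= X]/(1%:R) ler_nat count_uniq_mem ?pplist_uniq // leq_b1.
rewrite sum_nat_count ler_nat; apply: leq_trans (count_factor uniqW py gy _) _.
  by move=> w /WP[].
apply: hD; rewrite primary_gnrm_gt0 //=; apply: leq_trans ny _.
by apply: leq_mul => //; rewrite expnS leq_pmulr // expn_gt0 X0.
Qed.

(* [phi] is not separable in [w] and [z]; replacing [w] by the corner of a cell
   of side about [sqrt M / J] makes it so, except for the [y = w z] whose norm is
   close to [X] or for which [re (y z0)] is small.  The main term [S1] is then
   bounded cell by cell by Hoelder's inequality with exponent [2 (k + 1)]. *)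
Lemma typeII_shell : exists (m rx : nat) (S1 : R), [/\ (m ^ 2 <= (X %/ M) ^ k.+1)%N, (rx ^ 2 <= X)%N, 0 <= S1,
  S1 ^+ (2 * k.+1) <= (size W)%:R ^+ (2 * k) *
    (((2 * (8 * J)).+1 ^ 2)%:R * ((B * (D * D)%:R) ^+ k.+1 * (B * (size Zs)%:R) ^+ k.+1)) *
   ((size W)%:R * (D%:R * ((2 * m.+1).+1 ^ 2)%:R + (size W)%:R * ((2 * m.+1).+1 * (2 * M) ^ 2)%:R)) &
  \sum_(w <- W) `|\sum_(z <- Zs) beta z * phi w z * (dsym w z)%:~R| <=
   S1 + 2 * B * (D * ((2 * (20 * X %/ J)).+1 * D + (4 * rx).+4 * (4 * rx.+1 %/ J).+1))%:R].
Proof.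
have X0 : (0 < X)%N by apply: leq_trans MX.
have N00 : (0 < X %/ M)%N by rewrite divn_gt0.
have NX : (X %/ M <= X)%N by apply: leq_div.
have [m /andP[m1 m2]] := nat_sqrt_exists ((X %/ M) ^ k.+1).
have [r rM] := nat_sqrt_exists M.
have r0 : (0 < r)%N by case: (r) rM M0 => //; case: (M).
have [rx [rxX szbad]] := bad_count.
pose b' c z := beta z * phi (cell_corner J r c) z.
exists m, rx, (\sum_(w <- W) `|\sum_(z <- Zs) b' (cell_label J r w) z * (dsym w z)%:~R|); split=> //.
- by apply: sumr_ge0.
- have XK : ((X %/ M) ^ k.+1 <= X ^ k.+1)%N by rewrite leq_exp2r.
  rewrite -(size_gbox (8 * J)).
  apply: (@bilinear_core R gint (gbox (8 * J)) (cell_label J r) W Zs b' (X %/ M) m.+1 k (2 * M) B (D * D)%:R D%:R).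
  + exact: gbox_uniq.
  + by move=> w /WP[_ _ _ /andP[_ nw]]; apply: (cell_label_box rM r0 J0).
  + exact: ltnW.
  + by [].
  + by move=> z /pplistP[pz _ ->]; rewrite primary_gnrm_gt0.
  + by [].
  + by [].
  + move=> c z zs; rewrite normrM -[leRHS]mulr1; apply: ler_pM => //; first exact: betaB.
    exact: phi_abs_le1.
  + move=> Z /andP[Z0 ZN]; rewrite ler_nat; apply: (count_divisors (pplist_uniq _) Z0).
      by move=> y /pplistP[].
    move=> n /andP[n0 nZ]; apply: hD; rewrite n0 /=; apply: leq_trans nZ _; apply: leq_trans ZN _.
    by apply: leq_trans XK _; rewrite leq_pmull.
  + by move=> w /WP[pw gw sw /andP[_ /ltnW nw]].
  + move=> w /WP[pw gw sw /andP[_ nw]]; rewrite ler_nat.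
    rewrite (eq_count (a2 := fun w' => gnrm w' == gnrm w)); last by move=> w'; rewrite eq_sym.
    apply: leq_trans (count_pplist_norm uniqW (primary_gnrm_gt0 pw) _) _; first by move=> y /WP[].
    apply: hD; rewrite primary_gnrm_gt0 //=; apply: leq_trans (ltnW nw) _.
    by apply: leq_mul => //; apply: leq_trans MX _; rewrite expnS leq_pmulr // expn_gt0 X0.
- apply: (@le_trans _ _ (\sum_(w <- W) (`|\sum_(z <- Zs) b' (cell_label J r w) z * (dsym w z)%:~R| +
      \sum_(z <- Zs) `|beta z * (phi w z - phi (cell_corner J r (cell_label J r w)) z) * (dsym w z)%:~R|))).
    apply: ler_sum => w _; apply: le_trans (lerD (lexx _) (ler_norm_sum _ _ _)).
    apply: le_trans (ler_normD _ _); rewrite -big_split /= le_eqVlt; apply/orP; left; apply/eqP.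
    by congr `|_|; apply: eq_bigr => z _; rewrite /b'; ring.
  rewrite big_split /=; apply: lerD => //; apply: le_trans (mismatch_sum rM r0) _.
  by apply: ler_wpM2l; rewrite ?mulr_ge0 // ler_nat leq_mul2l szbad orbT.
Qed.
End TypeTwoShell.

(** * Incomplete character sums *)

Lemma legendre_correlation (p : nat) (d : int) : prime p -> odd p -> ~~ (p %| d)%Z ->
  \sum_(x < p) legendre x%:Z p * legendre (x%:Z + d) p = -1.
Proof.
move=> pr_p op nd.
have p0 := prime_gt0 pr_p; have p1 := prime_gt1 pr_p.
have per (c : int) : forall x, legendre (x + p%:Z) p * legendre (x + p%:Z + c) p =
    legendre x p * legendre (x + c) p.
  by move=> x; rewrite legendreD addrAC legendreD.
pose T c := \sum_(x < p) legendre x%:Z p * legendre (x%:Z + c) p.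
have co c : ~~ (p %| c)%Z -> coprimez c p.
  by move=> nc; rewrite coprimez_sym coprimezE prime_coprime.
have TE c : ~~ (p %| c)%Z -> T c = T 1.
  move=> nc; rewrite /T -(sum_residues 0 p0 (co c nc) (per c)).
  apply: eq_bigr => x _; rewrite add0r -[X in _ + X]mulr1 -mulrDr !legendreM //.
  by rewrite mulrACA legendre_sqr // mul1r.
have sumT : \sum_(c < p) T c%:Z = 0.
  rewrite /T exchange_big big1 //= => x _; rewrite -mulr_sumr.
  have := sum_residues x%:Z p0 (coprime1n p : coprimez 1 p) (legendreD p).
  by under eq_bigr do rewrite mul1r; move=> ->; rewrite sum_legendre // mulr0.
move: sumT; rewrite (bigD1 (Ordinal p0)) //= => sumT.
have T0 : T 0 = p%:Z - 1.
  rewrite /T (bigD1 (Ordinal p0)) //= (_ : legendre 0 p = 0) ?mul0r ?add0r; last first.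
    by apply/eqP; rewrite legendre_eq0 dvdz0.
  transitivity (\sum_(i < p | i != Ordinal p0) (1 : int)).
    apply: eq_bigr => i i0; rewrite addr0 legendre_sqr // dvdzE /= gtnNdvd //.
    by rewrite lt0n; apply: contraNneq i0 => i0; apply/eqP/val_inj.
  by rewrite sumr_const cardC1 card_ord -natz; have := p0; clear; lia.
have T1 : \sum_(i < p | i != Ordinal p0) T i%:Z = (p%:Z - 1) * T 1.
  transitivity (\sum_(i < p | i != Ordinal p0) T 1).
    apply: eq_bigr => i i0; apply: TE; rewrite dvdzE /= gtnNdvd //.
    by rewrite lt0n; apply: contraNneq i0 => i0; apply/eqP/val_inj.
  by rewrite sumr_const cardC1 card_ord -mulr_natl; congr (_ * _); have := p0; clear; lia.
rewrite -/(T d) TE //; move: sumT; rewrite T0 T1 => h.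
have : (p%:Z - 1) * (T 1 + 1) = 0 by rewrite mulrDr mulr1 addrC.
by move/eqP; rewrite mulf_eq0 => /orP[/eqP|/eqP]; have := p1; clear; lia.
Qed.

Definition jcorr (n : nat) (b K d : int) : int :=
  \sum_(i < n) jacobi (b + K * i%:Z) n * jacobi (b + K * (i%:Z + d)) n.

Lemma jcorr_trivial n b K d : `|jcorr n b K d| <= n%:Z.
Proof.
apply: le_trans (ler_norm_sum _ _ _) _; apply: (@le_trans _ _ (\sum_(i < n) 1)).
  by apply: ler_sum => i _; rewrite normrM mulr_ile1 // jacobi_abs_le1.
by rewrite sumr_const card_ord -natz.
Qed.

Lemma jcorrM (m n : nat) b K d : odd m -> odd n -> coprime m n ->
  jcorr (m * n) b K d = jcorr m b K d * jcorr n b K d.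
Proof.
move=> om on co; have pos k : odd k -> (0 < k)%N by case: k.
pose F k x := jacobi (b + K * x) k * jacobi (b + K * (x + d)) k.
have perF k x : F k (x + k%:Z) = F k x.
  by rewrite /F jacobi_affine_periodic addrAC jacobi_affine_periodic.
apply: (etrans _ (@sum_crt _ m n (F m) (F n) (pos _ on) co (perF m) (perF n))).
apply: eq_bigr => i _; rewrite /F !jacobi_muln ?pos //; ring.
Qed.

Lemma jacobi_pexp_odd (x : int) (p a : nat) : prime p -> odd a -> jacobi x (p ^ a) = legendre x p.
Proof.
move=> pr_p oa; have a0 : (0 < a)%N by case: (a) oa.
rewrite /jacobi primesX // primes_prime // big_seq1 pfactorK //.
by case: (legendre_cases x p) => ->; rewrite ?expr1n ?expr0n ?(gtn_eqF a0) // -signr_odd oa expr1.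
Qed.

Lemma jcorr_pexp_odd (p a : nat) b K d : prime p -> odd p -> odd a -> ~~ (p %| K)%Z ->
  `|jcorr (p ^ a) b K d| * p%:Z <= (p ^ a * gcdn p `|d|)%N%:Z.
Proof.
move=> pr_p op oa nK; have p0 := prime_gt0 pr_p.
have a0 : (0 < a)%N by case: (a) oa.
case: (boolP (p %| d)%Z) => [dv|nd].
  have -> : gcdn p `|d| = p by apply/gcdn_idPl.
  by rewrite PoszM; apply: ler_wpM2r => //; apply: jcorr_trivial.
have -> : gcdn p `|d| = 1%N by apply/eqP; rewrite -[_ == _]/(coprime p `|d|) prime_coprime.
have -> : jcorr (p ^ a) b K d = (p ^ a.-1)%N%:Z * -1.
  have pE : (p ^ a = p * p ^ a.-1)%N by rewrite -expnS prednK.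
  rewrite /jcorr; under eq_bigr do rewrite !jacobi_pexp_odd //.
  rewrite pE (sum_blocks p (p ^ a.-1) (fun i => legendre (b + K * i%:Z) p * legendre (b + K * (i%:Z + d)) p)).
  have coK : coprimez K p by rewrite coprimez_sym coprimezE prime_coprime.
  have nKd : ~~ (p %| K * d)%Z by rewrite dvdzE abszM Euclid_dvdM // negb_or nK.
  pose G x := legendre x p * legendre (x + K * d) p.
  have perG x : G (x + p%:Z) = G x by rewrite /G legendreD addrAC legendreD.
  rewrite (eq_bigr (fun=> -1)); last first.
    move=> c _; rewrite -(legendre_correlation pr_p op nKd).
    rewrite -(@sum_residues _ G p K (b + K * (p%:Z * c%:Z)) p0 coK perG).
    apply: eq_bigr => i _; rewrite /G PoszD PoszM; congr (legendre _ _ * legendre _ _); ring.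
  by rewrite sumr_const card_ord -mulr_natl natz.
rewrite mulrN1 normrN muln1 ger0_norm // -PoszM -expnSr prednK //.
Qed.

(* At a prime [p] with odd exponent in [n], prime to [K], the correlation is at
   most [p^(a-1)] unless [p | d]: these primes make up [e].  The even exponents
   and the primes dividing [K] are left in [l^2] and [kp]. *)
Lemma jcorr_structure (K : int) (n : nat) : odd n -> exists kp e l : nat,
  [/\ n = (kp * e * l ^ 2)%N, (kp %| K)%Z, (e %| n)%N &
   forall b d, `|jcorr n b K d| * e%:Z <= (n * gcdn e `|d|)%N%:Z].
Proof.
elim/ltn_ind: n => n IH on; have [n1|n1] := eqVneq n 1%N.
  exists 1%N, 1%N, 1%N; rewrite n1; split=> // b d.
  by rewrite mulr1 gcd1n muln1; apply: jcorr_trivial.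
have n0 : (0 < n)%N by case: (n) on.
have pr_p : prime (pdiv n) by apply: pdiv_prime; move: n0 n1; clear; lia.
set p := pdiv n in pr_p.
have p0 := prime_gt0 pr_p; have op : odd p by apply: dvdn_odd (pdiv_dvd n) on.
pose a := logn p n; pose m := (n %/ p ^ a)%N.
have a0 : (0 < a)%N by rewrite logn_gt0 mem_primes pr_p n0 pdiv_dvd.
have nE : (n = p ^ a * m)%N by rewrite mulnC divnK // pfactor_dvdnn.
have m0 : (0 < m)%N by move: n0; rewrite nE muln_gt0 => /andP[].
have pm : ~~ (p %| m)%N.
  apply/negP => hp; have : (p ^ a.+1 %| n)%N by rewrite nE expnSr dvdn_pmul2l ?expn_gt0 ?p0.
  by rewrite pfactor_dvdn // ltnn.
have om : odd m by move: on; rewrite nE oddM => /andP[].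
have opa : odd (p ^ a) by rewrite oddX op orbT.
have co : coprime (p ^ a) m by rewrite coprimeXl // prime_coprime.
have mn : (m < n)%N by rewrite ltn_Pdiv // -(exp1n a) ltn_exp2r // prime_gt1.
have [kp [e [l [mE kK em hm]]]] := IH m mn om.
have coe : coprime p e by rewrite prime_coprime //; apply: contraNN pm => /dvdn_trans; apply.
have trivial_case b d : `|jcorr n b K d| * e%:Z <= (n * gcdn e `|d|)%N%:Z.
  rewrite nE jcorrM // normrM -mulrA -mulnA PoszM.
  by apply: ler_pM => //; rewrite ?mulr_ge0 ?normr_ge0 //; apply: jcorr_trivial.
have aE : a = (odd a + a./2.*2)%N by rewrite odd_double_half.
case: (boolP (odd a)) => oa; last first.
  exists kp, e, (l * p ^ a./2)%N; split=> //; last by rewrite nE dvdn_mull.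
  rewrite nE {1}mE [in LHS]aE (negPf oa) add0n -muln2 expnM expnMn.
  by rewrite mulnC mulnA.
case: (boolP (p %| K)%Z) => pK.
  exists (kp * p)%N, e, (l * p ^ a./2)%N; split=> //; last by rewrite nE dvdn_mull.
    rewrite nE {1}mE [in LHS]aE oa expnD expn1 -muln2 expnM expnMn.
    by ring.
  rewrite dvdzE Gauss_dvd; first by apply/andP; split.
  rewrite coprime_sym prime_coprime //; apply: contraNN pm => h.
  by rewrite mE -!mulnA; apply: dvdn_mulr.
exists kp, (e * p)%N, (l * p ^ a./2)%N; split=> //.
- rewrite nE {1}mE [in LHS]aE oa expnD expn1 -muln2 expnM expnMn.
  by ring.
- by rewrite nE mulnC dvdn_mul // -{1}(expn1 p) dvdn_exp2l.
move=> b d; rewrite nE jcorrM // normrM PoszM.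
rewrite (_ : _ * _ * (e%:Z * p%:Z) = (`|jcorr (p ^ a) b K d| * p%:Z) * (`|jcorr m b K d| * e%:Z)); last by ring.
apply: (@le_trans _ _ ((p ^ a * gcdn p `|d|)%N%:Z * (m * gcdn e `|d|)%N%:Z)).
  apply: ler_pM; rewrite ?mulr_ge0 ?normr_ge0 //; exact: jcorr_pexp_odd.
rewrite -PoszM lez_nat mulnACA leq_mul2l; apply/orP; right.
apply: dvdn_leq; first by rewrite gcdn_gt0 muln_gt0 p0 andbT; case: (e) em m0 => //; rewrite dvd0n => /eqP ->.
rewrite Gauss_dvd.
  apply/andP; split; rewrite dvdn_gcd dvdn_gcdr andbT.
    by apply: dvdn_mull; apply: dvdn_gcdl.
  by apply: dvdn_mulr; apply: dvdn_gcdl.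
by rewrite (coprime_dvdl (dvdn_gcdl _ _)) // (coprime_dvdr (dvdn_gcdl _ _)).
Qed.

Lemma sum_gcd_le (e m : nat) : (0 < e)%N -> (\sum_(1 <= i < m.+1) gcdn e i <= m * ndiv e)%N.
Proof.
move=> e0.
apply: (@leq_trans (\sum_(1 <= i < m.+1) \sum_(g <- divisors e) g * (g %| i))%N).
  rewrite big_nat_cond [leqRHS]big_nat_cond; apply: leq_sum => i _.
  rewrite (bigD1_seq (gcdn e i)) ?divisors_uniq //= -?dvdn_divisors ?dvdn_gcdl //.
  by rewrite dvdn_gcdr muln1 leq_addr.
rewrite exchange_big /=.
apply: (@leq_trans (\sum_(g <- divisors e) m)%N).
  rewrite big_seq [leqRHS]big_seq; apply: leq_sum => g _.
  by rewrite -big_distrr /= -divn_count_dvd mulnC leq_trunc_div.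
by rewrite big_const_seq count_predT iter_addn_0.
Qed.

Lemma sum_gcd_diff_le (e H s : nat) : (0 < e)%N -> (s < H)%N ->
  (\sum_(t < H) gcdn e `|t%:Z - s%:Z| <= e + 2 * H * ndiv e)%N.
Proof.
move=> e0 sH; rewrite -(big_mkord predT (fun t => gcdn e `|t%:Z - s%:Z|)).
rewrite (@big_cat_nat _ _ _ s) ?(ltnW sH) //=.
have h1 : (\sum_(0 <= t < s) gcdn e `|t%:Z - s%:Z| <= H * ndiv e)%N.
  rewrite big_nat_rev /= add0n.
  rewrite (_ : \sum_(0 <= i < s) _ = \sum_(1 <= i < s.+1) gcdn e i)%N.
    by apply: leq_trans (sum_gcd_le _ e0) _; rewrite leq_mul2r ltnW ?orbT.
  rewrite big_add1 /= [LHS]big_nat_cond [RHS]big_nat_cond; apply: eq_bigr => i /andP[/andP[_ is_] _].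
  by congr gcdn; move: is_; clear; lia.
have h2 : (\sum_(s <= t < H) gcdn e `|t%:Z - s%:Z| <= e + H * ndiv e)%N.
  rewrite -{1}[s]add0n big_addn big_ltn ?subn_gt0 // add0n subrr gcdn0 leq_add2l.
  rewrite (_ : \sum_(1 <= i < H - s) _ = \sum_(1 <= i < (H - s).-1.+1) gcdn e i)%N.
    apply: leq_trans (sum_gcd_le _ e0) _; rewrite leq_mul2r; apply/orP; right.
    by apply: leq_trans (leq_pred _) _; apply: leq_subr.
  rewrite prednK ?subn_gt0 //; apply: eq_bigr => i _.
  by congr gcdn; clear; lia.
by move: h1 h2; rewrite -mulnA; move: (_ * ndiv e)%N; clear; lia.
Qed.

Section CharacterSum.
Variables (R : realType) (K b : int) (n e : nat).
Hypotheses (n0 : (0 < n)%N) (e0 : (0 < e)%N).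
Hypothesis corr : forall b d, `|jcorr n b K d| * e%:Z <= (n * gcdn e `|d|)%N%:Z.

Local Notation f := (fun x : int => jacobi (b + K * x) n).

Definition window_sum (H : nat) (x : int) : int := \sum_(s < H) f (x + s%:Z).

Lemma window_sum_periodic H x : window_sum H (x + n%:Z) = window_sum H x.
Proof.
by apply: eq_bigr => s _; rewrite addrAC jacobi_affine_periodic.
Qed.

Lemma window_sum_square (H : nat) :
  e%:Z * \sum_(j < n) window_sum H j%:Z ^+ 2 <= (n * (H * (e + 2 * H * ndiv e)))%N%:Z.
Proof.
have -> : \sum_(j < n) window_sum H j%:Z ^+ 2 =
   \sum_(s < H) \sum_(t < H) jcorr n (b + K * s%:Z) K (t%:Z - s%:Z).
  rewrite /jcorr.
  transitivity (\sum_(j < n) \sum_(s < H) \sum_(t < H) f (j%:Z + s%:Z) * f (j%:Z + t%:Z)).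
    apply: eq_bigr => j _; rewrite expr2 /window_sum mulr_suml.
    by apply: eq_bigr => s _; rewrite mulr_sumr.
  rewrite exchange_big; apply: eq_bigr => s _; rewrite exchange_big; apply: eq_bigr => t _.
  by apply: eq_bigr => j _; congr (jacobi _ n * jacobi _ n); ring.
rewrite mulr_sumr mulnA [(n * H)%N]mulnC -mulnA.
have -> : (H * (n * (e + 2 * H * ndiv e)))%N%:Z = \sum_(s < H) (n * (e + 2 * H * ndiv e))%N%:Z.
  by rewrite sumr_const card_ord -mulr_natl natz PoszM.
apply: ler_sum => s _; rewrite mulr_sumr.
apply: (@le_trans _ _ (\sum_(t < H) (n * gcdn e `|t%:Z - s%:Z|)%N%:Z)).
  apply: ler_sum => t _; apply: le_trans (corr (b + K * s%:Z) (t%:Z - s%:Z)).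
  by rewrite mulrC; apply: ler_wpM2r => //; apply: ler_norm.
rewrite -(big_morph Posz PoszD (erefl 0%:Z)) lez_nat -big_distrr /= leq_mul2l; apply/orP; right.
exact: sum_gcd_diff_le.
Qed.

Lemma window_sum_square_long (H L : nat) :
  e%:Z * \sum_(j < L) window_sum H j%:Z ^+ 2 <= ((L + n) * (H * (e + 2 * H * ndiv e)))%N%:Z.
Proof.
pose q := (L %/ n).+1.
have Lq : (L <= n * q)%N by rewrite mulnC ltnW // ltn_ceil.
apply: (@le_trans _ _ (e%:Z * \sum_(j < n * q) window_sum H j%:Z ^+ 2)).
  apply: ler_wpM2l => //; rewrite -!(big_mkord predT (fun j => window_sum H j%:Z ^+ 2)).
  rewrite [leRHS](@big_cat_nat _ _ _ L) //= lerDl; apply: sumr_ge0 => j _; exact: sqr_ge0.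
rewrite (sum_blocks n q (fun j => window_sum H j%:Z ^+ 2)).
rewrite (eq_bigr (fun=> \sum_(j < n) window_sum H j%:Z ^+ 2)); last first.
  move=> c _; apply: eq_bigr => a _; congr (_ ^+ 2).
  rewrite PoszD PoszM addrC; elim: (nat_of_ord c) => [|c' IH]; first by rewrite mulr0 addr0.
  by rewrite -[RHS]IH -[in RHS]window_sum_periodic; congr window_sum; rewrite -addn1 PoszD; ring.
rewrite sumr_const card_ord -mulr_natl mulrCA natz.
apply: (@le_trans _ _ (q%:Z * (n * (H * (e + 2 * H * ndiv e)))%N%:Z)).
  by apply: ler_wpM2l => //; apply: window_sum_square.
rewrite -PoszM lez_nat mulnA leq_mul2r; apply/orP; right.
by rewrite /q mulSn addnC leq_add2r leq_trunc_div.
Qed.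

Lemma sum_shift_window (H L : nat) :
  `|H%:Z * (\sum_(j < L) f j%:Z) - \sum_(j < L) window_sum H j%:Z| <= (2 * H ^ 2)%N%:Z.
Proof.
have f1 x : `|f x| <= 1 by exact: jacobi_abs_le1.
have shift (s : nat) : `|\sum_(j < L) f j%:Z - \sum_(j < L) f (j%:Z + s%:Z)| <= (2 * s)%N%:Z.
  elim: s => [|s IH].
    by under [X in _ - X]eq_bigr do rewrite addr0; rewrite subrr normr0.
  have one (x : int) : `|\sum_(j < L) f (j%:Z + x) - \sum_(j < L) f (j%:Z + x + 1)| <= 2.
    case: (L) => [|L']; first by rewrite !big_ord0 subrr.
    rewrite big_ord_recl [X in _ - X]big_ord_recr /=.
    rewrite (_ : \sum_(i < L') f ((bump 0 i)%:Z + x) = \sum_(i < L') f (i%:Z + x + 1)); last first.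
      by apply: eq_bigr => i _; rewrite /bump /= add1n -addn1 PoszD addrAC.
    move: (f1 (0 + x)) (f1 (L'%:Z + x + 1)) => /=.
    move: (jacobi _ n) (jacobi _ n) (\sum_(i < L') _) => p q S.
    by clear; lia.
  have := one s%:Z; rewrite (_ : \sum_(j < L) f (j%:Z + s%:Z + 1) = \sum_(j < L) f (j%:Z + s.+1%:Z)); last first.
    by apply: eq_bigr => j _; rewrite -addn1 PoszD addrA.
  move: IH; move: (\sum_(j < L) f j%:Z) (\sum_(j < L) f (j%:Z + s%:Z)) (\sum_(j < L) f (j%:Z + s.+1%:Z)).
  by clear; lia.
have -> : H%:Z * (\sum_(j < L) f j%:Z) - \sum_(j < L) window_sum H j%:Z =
   \sum_(s < H) (\sum_(j < L) f j%:Z - \sum_(j < L) f (j%:Z + s%:Z)).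
  by rewrite sumrB sumr_const card_ord -mulr_natl natz /window_sum [X in _ - X]exchange_big.
apply: le_trans (ler_norm_sum _ _ _) _.
apply: (@le_trans _ _ (\sum_(s < H) (2 * H)%N%:Z)).
  apply: ler_sum => s _; apply: le_trans (shift s) _.
  by rewrite lez_nat leq_mul2l ltnW ?orbT.
by rewrite sumr_const card_ord -mulr_natl natz -PoszM mulnCA expnS expn1.
Qed.

(* The sum is compared with the mean of its shifts by [0 .. h^2 - 1]; Cauchy's
   inequality then brings in the correlations. *)
Lemma char_sum_bound (N h D L : nat) : (n <= N)%N -> (L <= N)%N -> (0 < h)%N ->
  (ndiv e <= D)%N ->
  (`|\sum_(j < L) f j%:Z|)%:~R <= 2 * h%:R ^+ 2 + 2 * N%:R / h%:R + 2 * N%:R * D%:R / Num.sqrt e%:R :> R.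
Proof.
move=> nN LN h0 eD; have D0 : (0 < D)%N by apply: leq_trans eD; apply: ndiv_gt0.
pose H := (h ^ 2)%N; have H0 : (0 < H)%N by rewrite expn_gt0 h0.
set S := \sum_(j < L) f j%:Z.
pose A : R := (\sum_(j < L) `|window_sum H j%:Z|)%:~R.
have A2 : e%:R * A ^+ 2 <= 2 * N%:R ^+ 2 * (H%:R * (e%:R + 2 * H%:R * D%:R)).
  have cs := @sum_cauchy_schwarz R _ (index_enum 'I_L) (fun=> 1) (fun j => (`|window_sum H j%:Z|)%:~R).
  have {cs} : A ^+ 2 <= L%:R * (\sum_(j < L) window_sum H j%:Z ^+ 2)%:~R.
    move: cs; under eq_bigr do rewrite mul1r; rewrite -rmorph_sum -/A => /le_trans; apply.
    under eq_bigr do rewrite expr1n; rewrite sumr_const card_ord -[1 *+ L]/(L%:R).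
    apply: ler_wpM2l => //; rewrite rmorph_sum; apply: ler_sum => j _.
    by rewrite -rmorphXn /= real_normK ?num_real.
  move=> h1; have := window_sum_square_long H L; rewrite -(ler_int R) rmorphM /= => h2.
  apply: (@le_trans _ _ (L%:R * (e%:R * (\sum_(j < L) window_sum H j%:Z ^+ 2)%:~R))).
    by rewrite [leRHS]mulrCA ler_wpM2l.
  apply: (@le_trans _ _ (L%:R * ((L + n) * (H * (e + 2 * H * ndiv e)))%:R)).
    by apply: ler_wpM2l.
  have -> : 2 * N%:R ^+ 2 * (H%:R * (e%:R + 2 * H%:R * D%:R)) =
     ((2 * N ^ 2) * (H * (e + 2 * H * D)))%:R :> R by rewrite !(natrM, natrD, natrX).
  rewrite -natrM ler_nat mulnA.
  apply: leq_mul; first by rewrite (_ : 2 * N ^ 2 = N * (N + N))%N; [apply: leq_mul => //; apply: leq_add | ring].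
  by rewrite leq_mul2l leq_add2l leq_mul2l eD !orbT.
have sqe : 0 < Num.sqrt e%:R :> R by rewrite sqrtr_gt0 ltr0n.
have hR : 0 < h%:R :> R by rewrite ltr0n.
have HE : H%:R = h%:R ^+ 2 :> R by rewrite natrX.
set u : R := h%:R^-1; set v : R := (Num.sqrt e%:R)^-1.
have u0 : 0 < u by rewrite invr_gt0.
have v0 : 0 < v by rewrite invr_gt0.
have uh : u * h%:R = 1 by rewrite mulVf // gt_eqF.
have ev : e%:R * v ^+ 2 = 1 by rewrite exprVn sqr_sqrtr ?ler0n // divff // pnatr_eq0 -lt0n.
have A_le : A <= H%:R * (2 * N%:R * u + 2 * N%:R * D%:R * v).
  have A0 : 0 <= A by rewrite /A ler0z; apply: sumr_ge0.
  have B0 : 0 <= H%:R * (2 * N%:R * u + 2 * N%:R * D%:R * v).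
    by rewrite mulr_ge0 // addr_ge0 // !mulr_ge0 // ltW.
  rewrite -(@ler_pXn2r _ 2) ?nnegrE // -(@ler_pM2l _ e%:R) ?ltr0n //.
  apply: le_trans A2 _.
  have D1 : 1 <= D%:R :> R by rewrite ler1n.
  have D2 : D%:R <= D%:R ^+ 2 :> R by rewrite expr2 ler_peMr.
  have -> : e%:R * (H%:R * (2 * N%:R * u + 2 * N%:R * D%:R * v)) ^+ 2 =
     4 * N%:R ^+ 2 * (H%:R * (H%:R * u ^+ 2 * e%:R + 2 * (H%:R * e%:R * u * v * D%:R) + H%:R * D%:R ^+ 2 * (e%:R * v ^+ 2))).
    by ring.
  rewrite ev (_ : H%:R * u ^+ 2 = 1); last by rewrite HE -exprMn mulrC uh expr1n.
  have p1 : 0 <= H%:R * e%:R * u * v * D%:R :> R by rewrite !mulr_ge0 // ltW.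
  have p2 : H%:R * D%:R <= H%:R * D%:R ^+ 2 :> R by apply: ler_wpM2l.
  rewrite mul1r mulr1.
  move: p1 p2; set X1 := H%:R * e%:R * u * v * D%:R; set X2 := H%:R * D%:R ^+ 2 => p1 p2.
  have N2 : 0 <= 2 * N%:R ^+ 2 :> R by rewrite mulr_ge0 // sqr_ge0.
  have q : H%:R * (e%:R + 2 * H%:R * D%:R) <= H%:R * (2 * (e%:R + 2 * X1 + X2)).
    apply: ler_wpM2l => //; have : 0 <= e%:R :> R by [].
    by move: p1 p2; rewrite -mulrA; move: (H%:R * D%:R) => w; lra.
  apply: le_trans (ler_wpM2l N2 q) _; rewrite le_eqVlt; apply/orP; left; apply/eqP.
  by ring.
have key : H%:R * (`|S|)%:~R <= 2 * H%:R ^+ 2 + A.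
  have : H%:Z * `|S| <= (2 * H ^ 2)%N%:Z + \sum_(j < L) `|window_sum H j%:Z|.
    have := sum_shift_window H L; rewrite -/S => sh'.
    have : `|\sum_(j < L) window_sum H j%:Z| <= \sum_(j < L) `|window_sum H j%:Z| by exact: ler_norm_sum.
    move: sh'; rewrite -[X in X * `|S|]ger0_norm // -normrM.
    by move: (H%:Z * S) (\sum_(j < L) window_sum H j%:Z) (\sum_(j < L) `|_|); clear; lia.
  rewrite -(ler_int R) rmorphM rmorphD /= => /le_trans; apply.
  by rewrite -natrX -natrM.
rewrite -(@ler_pM2l _ H%:R) ?ltr0n //; apply: le_trans key _.
apply: le_trans (lerD (lexx _) A_le) _; rewrite -/u -/v HE le_eqVlt; apply/orP; left; apply/eqP.
by ring.
Qed.
End CharacterSum.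

(** * Partial summation in the complex numbers *)

Notation cabs := (@ComplexField.Normc.normc _).

Section ComplexAbs.
Variable R : realType.
Local Notation C := R[i].
Implicit Types x y z : C.

Lemma cabsE z : cabs z = Num.sqrt (complex.Re z ^+ 2 + complex.Im z ^+ 2).
Proof. by case: z. Qed.

Lemma cabs_ge0 z : 0 <= cabs z.
Proof. by rewrite cabsE sqrtr_ge0. Qed.

Lemma cabsM x y : cabs (x * y) = cabs x * cabs y.
Proof. exact: ComplexField.Normc.normcM. Qed.

Lemma cabs0 : cabs (0 : C) = 0. Proof. exact: ComplexField.Normc.normc0. Qed.
Lemma cabs1 : cabs (1 : C) = 1. Proof. exact: ComplexField.Normc.normc1. Qed.

Lemma cabsN x : cabs (- x) = cabs x.
Proof. by rewrite !cabsE; case: x => a b /=; rewrite !sqrrN. Qed.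

Lemma cabsD x y : cabs (x + y) <= cabs x + cabs y.
Proof. by have := ler_normD x y; rewrite !normc_def -!cabsE -rmorphD lecR. Qed.

Lemma cabsB x y : cabs (x - y) <= cabs x + cabs y.
Proof. by apply: le_trans (cabsD _ _) _; rewrite cabsN. Qed.

Lemma cabs_sum (I : Type) (s : seq I) (P : pred I) (F : I -> C) :
  cabs (\sum_(i <- s | P i) F i) <= \sum_(i <- s | P i) cabs (F i).
Proof.
elim/big_rec2: _ => [|i y x _ h]; first by rewrite cabs0.
by apply: le_trans (cabsD _ _) _; rewrite lerD2l.
Qed.

Lemma cabs_real (a : R) : cabs (a%:C)%C = `|a|.
Proof. by rewrite cabsE /= expr0n addr0 sqrtr_sqr. Qed.

Lemma cabs_int (n : int) : cabs (n%:~R : C) = (`|n|)%:~R.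
Proof.
have -> : (n%:~R : C) = ((n%:~R : R)%:C)%C by rewrite rmorph_int.
by rewrite cabs_real intr_norm.
Qed.

Lemma cabs_le_ReIm z : cabs z <= `|complex.Re z| + `|complex.Im z|.
Proof.
rewrite cabsE -[leRHS]ger0_norm ?addr_ge0 // -sqrtr_sqr ler_wsqrtr //.
rewrite sqrrD !real_normK ?num_real // lerD2r lerDl.
by rewrite mulrn_wge0 // mulr_ge0.
Qed.

Lemma Re_le_cabs z : `|complex.Re z| <= cabs z.
Proof. by rewrite cabsE -sqrtr_sqr ler_wsqrtr // lerDl sqr_ge0. Qed.

Lemma Im_le_cabs z : `|complex.Im z| <= cabs z.
Proof. by rewrite cabsE -sqrtr_sqr ler_wsqrtr // lerDr sqr_ge0. Qed.

Lemma cabsV z : cabs z^-1 = (cabs z)^-1.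
Proof. exact: ComplexField.Normc.normcV. Qed.

Lemma cabs_exprz z (k : int) : cabs z = 1 -> cabs (z ^ k) = 1.
Proof.
move=> z1; have nX n : cabs (z ^+ n) = 1.
  by elim: n => [|n IH]; rewrite ?expr0 ?cabs1 // exprS cabsM z1 IH mulr1.
by case: k => n; [exact: nX | rewrite -[z ^ _]/((z ^+ n.+1)^-1) cabsV nX invr1].
Qed.

Lemma cabs_expr_sub x y n : cabs x = 1 -> cabs y = 1 ->
  cabs (x ^+ n - y ^+ n) <= n%:R * cabs (x - y).
Proof.
move=> x1 y1; elim: n => [|n IH]; first by rewrite subrr cabs0 mul0r.
have -> : x ^+ n.+1 - y ^+ n.+1 = x * (x ^+ n - y ^+ n) + (x - y) * y ^+ n by rewrite !exprS; ring.
apply: le_trans (cabsD _ _) _; rewrite !cabsM x1 mul1r (cabs_exprz n%:Z y1) mulr1.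
by rewrite -natr1 mulrDl mul1r lerD2r.
Qed.

Lemma cabs_exprz_sub x y (k : int) : cabs x = 1 -> cabs y = 1 ->
  cabs (x ^ k - y ^ k) <= `|k|%:~R * cabs (x - y).
Proof.
move=> x1 y1; case: k => n; first exact: cabs_expr_sub.
have x0 : x != 0 by apply: contra_eq_neq x1 => ->; rewrite cabs0 eq_sym oner_neq0.
have y0 : y != 0 by apply: contra_eq_neq y1 => ->; rewrite cabs0 eq_sym oner_neq0.
rewrite -[x ^ _]/((x ^+ n.+1)^-1) -[y ^ _]/((y ^+ n.+1)^-1) -!exprVn.
apply: le_trans (cabs_expr_sub _ _ _) _; rewrite ?cabsV ?x1 ?y1 ?invr1 //.
have -> : x^-1 - y^-1 = - (x^-1 * y^-1 * (x - y)) by field; rewrite x0 y0.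
by rewrite cabsN !cabsM !cabsV x1 y1 !invr1 !mul1r.
Qed.

Lemma abel_bound (L : nat) (a : nat -> int) (g : nat -> C) (P : R) :
  (forall L', (L' <= L)%N -> (`|\sum_(j < L') a j|)%:~R <= P) ->
  cabs (\sum_(j < L) (a j)%:~R * g j) <=
    P * (cabs (g L.-1) + \sum_(j < L.-1) cabs (g j.+1 - g j)).
Proof.
move=> hP; pose A n := \sum_(j < n) a j.
have idt n : \sum_(j < n.+1) (a j)%:~R * g j =
   (A n.+1)%:~R * g n - \sum_(j < n) (A j.+1)%:~R * (g j.+1 - g j).
  elim: n => [|n IH]; first by rewrite /A !big_ord_recr !big_ord0 /= subr0 !add0r.
  rewrite big_ord_recr IH /= [in RHS]big_ord_recr /= /A [in RHS]big_ord_recr /= rmorphD /=.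
  ring.
have P0 : 0 <= P by apply: le_trans (hP 0%N _); rewrite ?big_ord0.
case: L hP => [|L] hP; first by rewrite !big_ord0 cabs0 mulr_ge0 // addr_ge0 ?cabs_ge0 // sumr_ge0.
rewrite idt /=; apply: le_trans (cabsB _ _) _; rewrite mulrDr; apply: lerD.
  by rewrite cabsM cabs_int; apply: ler_wpM2r; [exact: cabs_ge0 | exact: hP].
apply: le_trans (cabs_sum _ _ _) _; rewrite mulr_sumr; apply: ler_sum => j _.
by rewrite cabsM cabs_int; apply: ler_wpM2r; [exact: cabs_ge0 | apply: hP; rewrite ltnS ltnW].
Qed.

Lemma monotone_variation (L : nat) (u : nat -> R) (m M : R) :
  (forall j, (j <= L)%N -> m <= u j <= M) -> ((forall j, u j <= u j.+1) \/ (forall j, u j.+1 <= u j)) ->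
  \sum_(j < L) `|u j.+1 - u j| <= M - m.
Proof.
have tel n : \sum_(j < n) (u j.+1 - u j) = u n - u 0%N.
  by elim: n => [|n IH]; rewrite ?big_ord0 ?subrr // big_ord_recr IH /=; ring.
move=> hu [inc|dec].
  under eq_bigr do rewrite ger0_norm ?subr_ge0 //.
  by rewrite tel; have /andP[] := hu L (leqnn L); have /andP[] := hu 0%N (leq0n L); lra.
under eq_bigr do rewrite ler0_norm ?subr_le0 //.
by rewrite sumrN tel; have /andP[] := hu L (leqnn L); have /andP[] := hu 0%N (leq0n L); lra.
Qed.

Definition gangle (z : gint) : C := gintC R z / `|gintC R z|.

Lemma gangleE (a b : int) (q := Num.sqrt (a%:~R ^+ 2 + b%:~R ^+ 2) : R) :
  gangle (Complex a b) = Complex (a%:~R / q) (b%:~R / q).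
Proof.
rewrite /gangle /gintC normc_def /= -/q -fmorphV /=.
by apply/eqP; rewrite eq_complex /= !mulr0 subr0 add0r !eqxx.
Qed.

Lemma gintCM (w z : gint) : gintC R (w * z) = gintC R w * gintC R z.
Proof.
case: w z => [a b] [c d]; rewrite /gintC gmulE /=.
by apply/eqP; rewrite eq_complex /= !(rmorphB, rmorphD, rmorphM) /= !eqxx.
Qed.

Lemma gangleM (w z : gint) : gangle (w * z) = gangle w * gangle z.
Proof. by rewrite /gangle gintCM normrM invfM mulrACA. Qed.

Lemma gangle_cabs (z : gint) : z != 0 -> cabs (gangle z) = 1.
Proof.
move=> z0; rewrite /gangle normc_def -cabsE cabsM cabsV cabs_real.
rewrite (ger0_norm (cabs_ge0 _)) divff //; apply: contra_neq z0 => /ComplexField.Normc.eq0_normc.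
case: z => a b /eqP; rewrite eq_complex /= !intr_eq0 => /andP[/eqP -> /eqP ->].
by [].
Qed.
Lemma gangle_variation (a : int) (sg b K : int) (L : nat) : a != 0 -> 0 <= b -> 0 <= K ->
  sg = 1 \/ sg = -1 ->
  \sum_(j < L) cabs (gangle (Complex a (sg * (b + K * j.+1%:Z))) - gangle (Complex a (sg * (b + K * j%:Z)))) <= 2.
Proof.
move=> a0 b0 K0 sg1.
pose s j : R := (b + K * j%:Z)%:~R.
pose q j : R := Num.sqrt (a%:~R ^+ 2 + s j ^+ 2).
have s0 j : 0 <= s j by rewrite ler0z addr_ge0 // mulr_ge0.
have smono j : s j <= s j.+1.
  by rewrite ler_int lerD2l ler_wpM2l // lez_nat.
have a2 : 0 < a%:~R ^+ 2 :> R by rewrite exprn_even_gt0 //= intr_eq0.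
have Q0 j : 0 < a%:~R ^+ 2 + s j ^+ 2 :> R by rewrite ltr_wpDr // sqr_ge0.
have q0 j : 0 < q j by rewrite sqrtr_gt0.
have qmono j : q j <= q j.+1.
  by rewrite ler_wsqrtr // lerD2l lerXn2r ?nnegrE // smono.
have ge_a j : `|a%:~R| <= q j by rewrite -sqrtr_sqr ler_wsqrtr // lerDl sqr_ge0.
have ge_s j : s j <= q j.
  by rewrite -[leLHS](ger0_norm (s0 j)) -sqrtr_sqr ler_wsqrtr // lerDr ltW.
have gE j : gangle (Complex a (sg * (b + K * j%:Z))) = Complex (a%:~R / q j) (sg%:~R * (s j / q j)).
  rewrite gangleE rmorphM /= exprMn.
  have -> : sg%:~R ^+ 2 = 1 :> R by case: sg1 => ->; rewrite ?rmorphN1 ?sqrrN ?rmorph1 expr1n.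
  by rewrite mul1r -/(s j) -/(q j) mulrA.
have sgn : `|sg%:~R| = 1 :> R by case: sg1 => ->; rewrite ?rmorphN1 ?normrN ?rmorph1 normr1.
apply: (@le_trans _ _ (\sum_(j < L) (`| `|a%:~R| / q j.+1 - `|a%:~R| / q j| + `|s j.+1 / q j.+1 - s j / q j|))).
  apply: ler_sum => j _; rewrite !gE; apply: le_trans (cabs_le_ReIm _) _; rewrite /=.
  apply: lerD; last by rewrite -mulrBr normrM sgn mul1r.
  by rewrite -!mulrBr !normrM normr_id.
rewrite big_split /= -[leRHS]/(1 + 1); apply: lerD.
  rewrite -[leRHS]subr0; apply: (monotone_variation (u := fun j => `|a%:~R| / q j)).
    by move=> j _; rewrite divr_ge0 ?(ltW (q0 j)) //= ler_pdivrMr // mul1r.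
  by right=> j; rewrite ler_wpM2l // lef_pV2 ?posrE.
rewrite -[leRHS]subr0; apply: (monotone_variation (u := fun j => s j / q j)).
  by move=> j _; rewrite divr_ge0 ?(ltW (q0 j)) //= ler_pdivrMr // mul1r.
left=> j; rewrite ler_pdivrMr // mulrAC ler_pdivlMr //.
rewrite -(@ler_pXn2r _ 2) ?nnegrE ?mulr_ge0 ?(ltW (q0 _)) // !exprMn !sqr_sqrtr ?(ltW (Q0 _)) //.
rewrite !mulrDr lerD //; last by rewrite mulrC.
by apply: ler_wpM2r; [exact: ltW | rewrite lerXn2r ?nnegrE // smono].
Qed.

Lemma weighted_variation (a sg b K k : int) (om : nat -> R) (Om : R) (L : nat) : a != 0 -> 0 <= b -> 0 <= K ->
  sg = 1 \/ sg = -1 -> (forall j, (j <= L)%N -> 0 <= om j <= Om) -> (forall j, om j <= om j.+1) ->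
  forall g, (forall j, g j = ((om j)%:C)%C * gangle (Complex a (sg * (b + K * j%:Z))) ^ k) ->
  cabs (g L) + \sum_(j < L) cabs (g j.+1 - g j) <= 2 * Om * (`|k|%:~R + 1).
Proof.
move=> a0 b0 K0 sg1 hom mono g gE.
have Om0 : 0 <= Om by have /andP[h1 h2] := hom _ (leqnn L); apply: le_trans h1 h2.
have th1 j : cabs (gangle (Complex a (sg * (b + K * j%:Z)))) = 1.
  apply: gangle_cabs; apply/eqP => -[e _]; by rewrite e eqxx in a0.
have k0 : 0 <= `|k|%:~R :> R by rewrite ler0z.
apply: (@le_trans _ _ (Om + (Om * (`|k|%:~R * 2) + Om))); last by lra.
apply: lerD.
  rewrite gE cabsM cabs_exprz // mulr1 cabs_real.
  by have /andP[h1 h2] := hom _ (leqnn L); rewrite ger0_norm.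
apply: (@le_trans _ _ (\sum_(j < L) (Om * (`|k|%:~R *
   cabs (gangle (Complex a (sg * (b + K * j.+1%:Z))) - gangle (Complex a (sg * (b + K * j%:Z))))) +
   `|om j.+1 - om j|))).
  apply: ler_sum => j _; rewrite !gE; set x := gangle _; set y := gangle _.
  have x1 : cabs x = 1 by exact: th1.
  have y1 : cabs y = 1 by exact: th1.
  have -> : ((om j.+1)%:C)%C * x ^ k - ((om j)%:C)%C * y ^ k =
    ((om j.+1)%:C)%C * (x ^ k - y ^ k) + ((om j.+1 - om j)%:C)%C * y ^ k.
    by rewrite rmorphB /= mulrBr mulrBl addrA subrK.
  apply: le_trans (cabsD _ _) _; rewrite !cabsM [cabs (y ^ k)]cabs_exprz // mulr1 !cabs_real lerD2r.
  have /andP[h1 h2] := hom j.+1 (ltn_ord j); rewrite ger0_norm //.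
  by apply: ler_pM; rewrite ?cabs_ge0 // cabs_exprz_sub.
rewrite big_split /= -!mulr_sumr; apply: lerD.
  by apply: ler_wpM2l => //; apply: ler_wpM2l => //; apply: gangle_variation.
rewrite -[leRHS]subr0; apply: monotone_variation; first exact: hom.
by left.
Qed.
End ComplexAbs.

Lemma sum_progressions (V : nmodType) (n K : nat) (F : nat -> V) : (0 < K)%N ->
  \sum_(i < n) F i = \sum_(a < K) \sum_(j < (n + K - a.+1) %/ K) F (K * j + a)%N.
Proof.
move=> K0; pose G i := if (i < n)%N then F i else 0.
transitivity (\sum_(i < K * n) G i).
  rewrite (big_ord_widen (K * n) F) ?leq_pmull // big_mkcond /=.
  by apply: eq_bigr => i _; rewrite /G.
rewrite (sum_blocks K n G) exchange_big; apply: eq_bigr => a _ /=.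
have eqv j : (K * j + a < n)%N = (j < (n + K - a.+1) %/ K)%N.
  rewrite leq_divRL // mulSn [(K * j)%N]mulnC; have := ltn_ord a; move: (nat_of_ord a) => c.
  by move: (j * K)%N; clear; lia.
rewrite (big_ord_widen n (fun j => F (K * j + a)%N)); last first.
  rewrite -ltnS ltn_divLR // mulSn; have := leq_pmulr n K0; have := ltn_ord a.
  by move: (nat_of_ord a) (n * K)%N; clear -K0; lia.
rewrite [RHS]big_mkcond; apply: eq_bigr => j _; rewrite /G eqv.
by [].
Qed.

Lemma two_sided_sum (R : realType) (S : nat) (T : int -> R[i]) (X Om : R) :
  (forall sg : int, sg = 1 \/ sg = -1 -> cabs (\sum_(i < S.+1) T (sg * i%:Z)) <= X) ->
  cabs (T 0) <= Om ->
  cabs (\sum_(i < S.+1) T i%:Z + \sum_(i < S) T (- i.+1%:Z)) <= 2 * X + Om.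
Proof.
move=> hX h0.
have e1 : \sum_(i < S.+1) T i%:Z = \sum_(i < S.+1) T (1 * i%:Z).
  by apply: eq_bigr => i _; rewrite mul1r.
have e2 : \sum_(i < S) T (- i.+1%:Z) = \sum_(i < S.+1) T (-1 * i%:Z) - T 0.
  rewrite big_ord_recl mulr0 [T 0 + _]addrC addrK; apply: eq_bigr => i _.
  by rewrite mulN1r.
rewrite e1 e2 addrA; apply: le_trans (cabsB _ _) _; apply: lerD => //.
apply: le_trans (cabsD _ _) _; rewrite mulr_natl mulr2n; apply: lerD; apply: hX.
  by left.
by right.
Qed.

Section TypeOneLine.
Variables (R : realType) (r : int) (k : int) (K n : nat) (rho : int -> R[i]) (om : nat -> R)
  (Om P : R) (S c : nat).
Hypotheses (r0 : r != 0) (K0 : (0 < K)%N).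
Hypotheses (rho1 : forall s, cabs (rho s) <= 1) (rhoP : forall s t, rho (s + K%:Z * t) = rho s).
Hypothesis rhoC : forall sg : int, sg = 1 \/ sg = -1 ->
  (count (fun b : nat => rho (sg * b%:Z)%R != 0%R) (iota 0 K) <= c)%N.
Hypotheses (om_bound : forall s, (s <= S)%N -> 0 <= om s <= Om) (om_mono : forall s t, (s <= t)%N -> om s <= om t).
Hypothesis hP : forall b K' L, `|K'| = K%:Z -> (L <= S.+1)%N ->
  (`|\sum_(j < L) jacobi (b + K' * j%:Z) n|)%:~R <= P.

Let term (s : int) : R[i] :=
  rho s * (jacobi s n)%:~R * (((om `|s|%N)%:C)%C * gangle R (Complex r s) ^ k).

Let rs_neq0 (s : int) : (Complex r s : gint) != 0.
Proof. by apply: contraNneq r0 => -[-> _]. Qed.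

Lemma line_half (sg : int) : sg = 1 \/ sg = -1 ->
  cabs (\sum_(i < S.+1) term (sg * i%:Z)) <= c%:R * (P * (2 * Om * (`|k|%:~R + 1))).
Proof.
move=> sg1.
have P0 : 0 <= P by have := @hP 0 K%:Z 0%N (erefl _) isT; rewrite big_ord0.
have Om0 : 0 <= Om by have /andP[h1 h2] := om_bound (leqnn S); apply: le_trans h1 h2.
have k0 : 0 <= `|k|%:~R :> R by rewrite ler0z.
have X0 : 0 <= P * (2 * Om * (`|k|%:~R + 1)) by rewrite !mulr_ge0 // addr_ge0.
rewrite (sum_progressions S.+1 (fun i => term (sg * i%:Z)) K0).
apply: le_trans (cabs_sum _ _ _) _.
apply: (@le_trans _ _ (\sum_(a < K) (rho (sg * a%:Z) != 0)%:R * (P * (2 * Om * (`|k|%:~R + 1))))).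
  apply: ler_sum => a _; set L := (_ %/ K)%N.
  have LS : (L <= S.+1)%N.
    rewrite -[(L <= _)%N]ltnS /L ltn_divLR //; have := leq_pmulr S.+1 K0; have := ltn_ord a.
    by move: (nat_of_ord a) => i; rewrite !mulSn; move: (S * K)%N; clear -K0; lia.
  have La : (0 < L)%N -> (K * L.-1 + a <= S)%N.
    move=> L0; have : (L * K <= S.+1 + K - a.+1)%N by rewrite leq_trunc_div.
    have := ltn_ord a; move: (nat_of_ord a) => q; case: (L) L0 => // l _ /=.
    by rewrite mulSn [(K * _)%N]mulnC; move: (l * K)%N => p; clear; lia.
  rewrite (eq_bigr (fun j : 'I_L => rho (sg * a%:Z) *
     ((jacobi (sg * a%:Z + sg * K%:Z * j%:Z) n)%:~R *
      (((om (a + K * j)%N)%:C)%C * gangle R (Complex r (sg * (a%:Z + K%:Z * j%:Z))) ^ k)))); last first.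
    move=> j _; rewrite /term.
    have e : sg * (K * j + a)%N%:Z = sg * a%:Z + K%:Z * (sg * j%:Z) by rewrite PoszD PoszM; ring.
    have e1 : rho (sg * (K * j + a)%N%:Z) = rho (sg * a%:Z) by rewrite e rhoP.
    have e2 : sg * (K * j + a)%N%:Z = sg * a%:Z + sg * K%:Z * j%:Z by rewrite PoszD PoszM; ring.
    have e3 : absz (sg * (K * j + a)%N%:Z) = (a + K * j)%N.
      by rewrite abszM absz_nat addnC; case: sg1 => ->; rewrite mul1n.
    have e4 : sg * (K * j + a)%N%:Z = sg * (a%:Z + K%:Z * j%:Z) by rewrite PoszD PoszM; ring.
    rewrite /term; move: (sg * (K * j + a)%N%:Z) e1 e2 e3 e4 => s e1 e2 e3 e4.
    have -> : jacobi s n = jacobi (sg * a%:Z + sg * K%:Z * j%:Z) n by rewrite e2.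
    have -> : gangle R (Complex r s) = gangle R (Complex r (sg * (a%:Z + K%:Z * j%:Z))) by rewrite e4.
    by rewrite e3 e1 -[LHS]mulrA.
  rewrite -mulr_sumr cabsM.
  have [->|rn0] := eqVneq (rho (sg * a%:Z)) 0; first by rewrite cabs0 !mul0r.
  rewrite mul1r -[leRHS]mul1r; apply: ler_pM; rewrite ?cabs_ge0 //.
  pose g j := ((om (a + K * j)%N)%:C)%C * gangle R (Complex r (sg * (a%:Z + K%:Z * j%:Z))) ^ k.
  have [L0|L0] := posnP L.
    by rewrite L0 big_ord0 cabs0.
  apply: le_trans (@abel_bound R L (fun j => jacobi (sg * a%:Z + sg * K%:Z * j%:Z) n) g P _) _.
    move=> L' L'L; apply: hP; last exact: leq_trans LS.
    by case: sg1 => ->; rewrite ?mulN1r ?mul1r ?normrN.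
  apply: ler_wpM2l => //.
  apply: (@weighted_variation R r sg a%:Z K%:Z k (fun j => om (a + K * j)%N) Om L.-1) => //.
    move=> j jL; apply: om_bound; apply: leq_trans (La L0); rewrite addnC leq_add2r.
    by rewrite leq_mul2l jL orbT.
  by move=> j; apply: om_mono; rewrite leq_add2l leq_mul2l leqnSn orbT.
rewrite -mulr_suml -(big_mkord predT (fun a => (rho (sg * a%:Z) != 0)%:R)) sum_nat_count.
by apply: ler_wpM2r => //; rewrite ler_nat /index_iota subn0; apply: rhoC.
Qed.

Lemma line_sum : cabs (\sum_(i < S.+1) term i%:Z + \sum_(i < S) term (- i.+1%:Z)) <=
  2 * (c%:R * (P * (2 * Om * (`|k|%:~R + 1)))) + Om.
Proof.
have t0 : cabs (term 0) <= Om.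
  have /andP[g1 g2] := om_bound (leq0n S).
  have a1 := rho1 0; have a2 := jacobi_abs_le1 0 n; have a3 := cabs_exprz k (gangle_cabs R (rs_neq0 0)).
  rewrite /term absz0; move: (rho 0) (jacobi 0 n) (gangle R _ ^ k) a1 a2 a3 => x J y a1 a2 a3.
  rewrite !cabsM cabs_int cabs_real (ger0_norm g1) a3 mulr1 -[leRHS]mul1r.
  apply: ler_pM => //; first by rewrite mulr_ge0 ?cabs_ge0 // ler0z.
  by rewrite mulr_ile1 ?cabs_ge0 ?ler0z // lerz1.
exact: two_sided_sum line_half t0.
Qed.
End TypeOneLine.

(** * Sums of type I *)

Ltac nneg := repeat first [assumption | exact: ler0n | exact: ler01 | exact: sqr_ge0 | exact: sqrtr_ge0
  | rewrite invr_ge0 | apply: addr_ge0 | apply: mulr_ge0 | apply: exprn_ge0].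

Lemma le_sum_mem (R : numDomainType) (T : eqType) (s : seq T) (F : T -> R) (x : T) :
  (forall y, y \in s -> 0 <= F y) -> x \in s -> F x <= \sum_(y <- s) F y.
Proof.
move=> F0 xs; rewrite (big_rem x) //= lerDl big_seq sumr_ge0 // => y ys.
by apply: F0; exact: mem_rem ys.
Qed.

Lemma sum_eq_le1 (R : numDomainType) (T : eqType) (s : seq T) (P : pred T) (x : T) : uniq s ->
  \sum_(y <- s | P y) (y == x)%:R <= (P x)%:R :> R.
Proof.
move=> us; rewrite big_mkcond /=.
have [xs|xs] := boolP (x \in s).
  rewrite (bigD1_seq x) //= eqxx big1 ?addr0; last by move=> y /negPf ->; case: ifP.
  by case: (P x).
rewrite big_seq big1 ?ler0n // => y ys; case: ifP => // _.
by case: eqP => // e; rewrite -e ys in xs.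
Qed.

Lemma harmonic_pow2 (R : realFieldType) (L : nat) :
  \sum_(1 <= i < (2 ^ L).+1) (i%:R)^-1 <= L.+1%:R :> R.
Proof.
elim: L => [|L IH]; first by rewrite expn0 big_nat1 invr1.
have p0 : (0 < 2 ^ L)%N by rewrite expn_gt0.
rewrite (@big_cat_nat _ _ _ (2 ^ L).+1) /=; last 2 first.
- by [].
- by rewrite ltnS leq_exp2l.
rewrite -[X in _ <= X%:R]addn1 natrD; apply: lerD => //.
have e2 : ((2 ^ L.+1).+1 - (2 ^ L).+1 = 2 ^ L)%N by rewrite subSS expnS mul2n -addnn addnK.
apply: (@le_trans _ _ (\sum_((2 ^ L).+1 <= i < (2 ^ L.+1).+1) ((2 ^ L)%:R)^-1)).
  apply: ler_sum_nat => i /andP[i1 _].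
  by rewrite lef_pV2 ?posrE ?ltr0n ?ler_nat // ?(leq_trans _ i1) // ltnW.
rewrite sumr_const_nat e2 -[_ *+ _]mulr_natl divff // pnatr_eq0.
by rewrite -lt0n.
Qed.

(* Here [e n] comes from [n = kp e l^2] with [kp | K], so the sum is at most
   the sum of [1 / sqrt e] over all such triples. *)
Lemma sum_sqrt_weights (R : realType) (K : int) (N L : nat) : K != 0 -> (N <= 2 ^ L)%N ->
  exists e : nat -> nat,
    (forall n, odd n -> [/\ (0 < e n)%N, (e n %| n)%N &
      forall b d, `|jcorr n b K d| * (e n)%:Z <= (n * gcdn (e n) `|d|)%N%:Z]) /\
    \sum_(n <- iota 0 N | odd n) (Num.sqrt ((e n)%:R : R))^-1 <=
      (ndiv `|K|)%:R * (Num.sqrt N%:R * L.+1%:R).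
Proof.
move=> K0 NL.
have ex n : exists T : nat * nat * nat, odd n -> [/\ n = (T.1.1 * T.1.2 * T.2 ^ 2)%N,
    (T.1.1 %| K)%Z, (T.1.2 %| n)%N &
   forall b d, `|jcorr n b K d| * (T.1.2)%:Z <= (n * gcdn T.1.2 `|d|)%N%:Z].
  case: (boolP (odd n)) => on; last by exists (0%N, 0%N, 0%N).
  by have [kp [e [l h]]] := jcorr_structure K on; exists (kp, e, l).
have [T hT] := boolp.choice ex; exists (fun n => (T n).1.2); split.
  move=> n on; have [h1 h2 h3 h4] := hT _ on; split=> //.
  by rewrite lt0n; apply: contraTneq on => e0; rewrite h1 e0 muln0.
pose G n kp e l : R := (n == kp * e * l ^ 2)%N%:R * (Num.sqrt e%:R)^-1.
have G0 n kp e l : 0 <= G n kp e l by rewrite mulr_ge0 // invr_ge0 sqrtr_ge0.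
apply: (@le_trans _ _ (\sum_(n <- iota 0 N | odd n) \sum_(kp <- divisors `|K|)
   \sum_(1 <= e < N.+1) \sum_(1 <= l < N.+1) G n kp e l)).
  rewrite big_seq_cond [leRHS]big_seq_cond; apply: ler_sum => n /andP[]; rewrite mem_iota add0n => nN on.
  have [h1 h2 h3 h4] := hT _ on; move: h1 h2 h3; case: (T n) => [[kp e] l] /= h1 h2 h3.
  have n0 : (0 < n)%N by case: (n) on.
  have ps : [/\ (0 < kp)%N, (0 < e)%N & (0 < l)%N].
    by move: n0; rewrite h1 !muln_gt0 => /andP[/andP[-> ->]] /andP[-> _].
  have [p1 p2 p3] := ps.
  have en : (e <= n)%N by rewrite dvdn_leq.
  have ln : (l <= n)%N.
    by rewrite dvdn_leq // h1 expnS; apply/dvdn_mull/dvdn_mulr.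
  apply: le_trans (le_sum_mem (x := kp) _ _); last first.
  - by rewrite -dvdn_divisors ?absz_gt0.
  - by move=> y _; apply: sumr_ge0 => i _; apply: sumr_ge0.
  apply: le_trans (le_sum_mem (x := e) _ _); last first.
  - by rewrite mem_index_iota p2 ltnS (leq_trans en) // ltnW.
  - by move=> y _; apply: sumr_ge0.
  apply: le_trans (le_sum_mem (x := l) _ _); last first.
  - by rewrite mem_index_iota p3 ltnS (leq_trans ln) // ltnW.
  - by move=> y _.
  by rewrite /G -h1 eqxx mul1r.
rewrite exchange_big /= /ndiv -sum1_size natr_sum mulr_suml; rewrite big_seq [leRHS]big_seq.
apply: ler_sum => kp kpK.
have kp0 : (0 < kp)%N by move: kpK; rewrite -dvdn_divisors ?absz_gt0 // => /dvdn_gt0 -> //; rewrite absz_gt0.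
rewrite mul1r exchange_big /=.
apply: (@le_trans _ _ (\sum_(1 <= e < N.+1) Num.sqrt N%:R * (e%:R)^-1)); last first.
  rewrite -mulr_sumr ler_wpM2l ?sqrtr_ge0 //; apply: le_trans (harmonic_pow2 R L).
  rewrite [leRHS](@big_cat_nat _ _ _ N.+1) //= lerDl sumr_ge0 // => i _.
  by rewrite invr_ge0.
apply: ler_sum_nat => e /andP[e1 eN]; rewrite exchange_big /=.
have [t /andP[t1 t2]] := nat_sqrt_exists (N %/ e).
have se0 : 0 < Num.sqrt e%:R :> R by rewrite sqrtr_gt0 ltr0n.
have tle : t%:R <= Num.sqrt N%:R / Num.sqrt e%:R :> R.
  rewrite ler_pdivlMr // -[t%:R]ger0_norm // -sqrtr_sqr -sqrtrM ?sqr_ge0 //.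
  by rewrite ler_wsqrtr // -natrX -natrM ler_nat -leq_divRL.
apply: (@le_trans _ _ (\sum_(1 <= l < N.+1) (l <= t)%N%:R * (Num.sqrt e%:R)^-1)).
  apply: ler_sum_nat => l /andP[l1 lN]; rewrite /G -mulr_suml.
  rewrite ler_wpM2r ?invr_ge0 ?sqrtr_ge0 //.
  case: leqP => lt; first by apply: le_trans (sum_eq_le1 _ _ _ (iota_uniq _ _)) _; case: (odd _).
  rewrite big_seq_cond big1 // => n /andP[]; rewrite mem_iota add0n => nN _; case: eqP => // nE; exfalso.
  have : (e * l ^ 2 <= N)%N by apply: leq_trans (ltnW nN); rewrite nE -mulnA leq_pmull.
  rewrite mulnC -leq_divRL //; apply/negP; rewrite -ltnNge; apply: leq_trans t2 _.
  by rewrite leq_exp2r.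
rewrite -mulr_suml sum_nat_count.
apply: (@le_trans _ _ (t%:R * (Num.sqrt e%:R)^-1)).
  rewrite ler_wpM2r ?invr_ge0 ?sqrtr_ge0 // ler_nat -size_filter.
  case: t {t1 t2 tle} => [|t].
    rewrite size_filter leqNgt -has_count; apply/hasPn => i.
    by rewrite mem_index_iota => /andP[i1 _]; rewrite leqn0 -lt0n.
  apply: (@size_nat_interval _ 1) => [|a]; first by rewrite filter_uniq ?iota_uniq.
  by rewrite mem_filter mem_index_iota add1n => /and3P[a1 -> _].
have -> : (e%:R : R)^-1 = (Num.sqrt e%:R)^-1 * (Num.sqrt e%:R)^-1 by rewrite -invfM -expr2 sqr_sqrtr.
by rewrite mulrA ler_wpM2r // invr_ge0 sqrtr_ge0.
Qed.

Section CharacterBasics.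
Variables (R : realType) (d : nat) (chi : gint -> R[i]).
Hypotheses (d0 : (0 < d)%N) (chiP : mult_char (4 * d)%:R chi).

Lemma gunit_mod1 m : gunit_mod m 1.
Proof. by exists 1, 0; rewrite mul1r subrr mul0r. Qed.

Lemma gunit_modMl m z w : gunit_mod m (z * w) -> gunit_mod m z.
Proof. by move=> [x hx]; exists (w * x); rewrite mulrA. Qed.

Lemma mult_charM_all z w : chi (z * w) = chi z * chi w.
Proof.
have [uz|nz] := pselect (gunit_mod (4 * d)%:R z); last first.
  rewrite (mult_char_eq0 chiP nz) mul0r; apply: (mult_char_eq0 chiP) => /gunit_modMl.
  exact: nz.
have [uw|nw] := pselect (gunit_mod (4 * d)%:R w); first exact: (mult_charM chiP).
rewrite (mult_char_eq0 chiP nw) mulr0; apply: (mult_char_eq0 chiP); rewrite mulrC => /gunit_modMl.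
exact: nw.
Qed.

Lemma mult_char1 : chi 1 = 1.
Proof.
have n0 := mult_char_neq0 chiP (gunit_mod1 _).
by apply: (mulfI n0); rewrite -mult_charM_all !mulr1.
Qed.

Lemma mult_charX z n : chi (z ^+ n) = chi z ^+ n.
Proof. by elim: n => [|n IH]; rewrite ?expr0 ?mult_char1 // !exprS mult_charM_all IH. Qed.

Lemma gcong_natP (m : nat) (z w : gint) :
  (gre z = gre w %[mod m])%Z -> (gim z = gim w %[mod m])%Z -> gcong m%:R z w.
Proof.
case: z w => [a b] [a' b'] /= /eqP; rewrite eqz_mod_dvd => /dvdzP[u ua] /eqP.
rewrite eqz_mod_dvd => /dvdzP[v vb]; exists (Complex u v).
by rewrite gint_natr gmulE goppE gaddE ua vb !mulr0 subr0 add0r.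
Qed.

Lemma mult_char_abs z : cabs (chi z) <= 1.
Proof.
have [uz|nz] := pselect (gunit_mod (4 * d)%:R z); last by rewrite (mult_char_eq0 chiP nz) cabs0.
set m := (4 * d)%N; have m0 : (0 < m)%N by rewrite muln_gt0.
pose g (n : 'I_(m * m).+1) : 'I_m * 'I_m :=
  (Ordinal (ltn_pmod `|(gre (z ^+ n) %% m)%Z| m0), Ordinal (ltn_pmod `|(gim (z ^+ n) %% m)%Z| m0)).
have [i [j [ij gij]]] : exists i j, i != j /\ g i = g j.
  have : ~~ injectiveb g.
    apply/negP => /injectiveP /leq_card; rewrite card_prod !card_ord; by rewrite ltnn.
  by move=> /injectivePn[i [j ij e]]; exists i, j.
wlog ltij : i j ij gij / (i < j)%N.
  move=> H; move: (ij); rewrite neq_ltn => /orP[] h; first exact: (H i j).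
  by apply: (H j i) => //; rewrite eq_sym.
have mod0 (a : int) : (a %% m)%Z = (`|(a %% m)%Z| %% m)%N.
  rewrite -modz_nat gez0_abs ?modz_ge0 ?modz_mod // -lt0n //; exact/lt0n_neq0.
have cij : gcong (4 * d)%:R (z ^+ i) (z ^+ j).
  apply: gcong_natP; rewrite mod0 [RHS]mod0.
    by have /(congr1 (fun x => nat_of_ord x.1)) /= -> := gij.
  by have /(congr1 (fun x => nat_of_ord x.2)) /= -> := gij.
have := mult_char_cong chiP cij; rewrite !mult_charX -(subnK (ltnW ltij)) exprD => e.
have n0 := mult_char_neq0 chiP uz.
have {}e : chi z ^+ (j - i) = 1.
  by apply: (mulIf (expf_neq0 i n0)); rewrite -e mul1r.
have : cabs (chi z) ^+ (j - i) = 1.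
  have cX : forall n, cabs (chi z ^+ n) = cabs (chi z) ^+ n.
    by elim=> [|n IH]; rewrite ?expr0 ?cabs1 // !exprS cabsM IH.
  by rewrite -cX e cabs1.
have ji : (0 < j - i)%N by rewrite subn_gt0.
by move/eqP; rewrite pexpr_eq1 ?cabs_ge0 // => /eqP ->.
Qed.

Lemma mult_char_shift (r s t : int) (Q : nat) :
  chi (Complex r (s + (4 * d * Q)%N%:Z * t)) = chi (Complex r s).
Proof.
apply: (mult_char_cong chiP); apply: gcong_natP => //=.
by apply/eqP; rewrite eqz_mod_dvd addrAC subrr add0r PoszM -mulrA dvdz_mulr.
Qed.

End CharacterBasics.

Lemma gprim_dvd_imag (mu : gint) (m : int) : gprim mu -> gdvd mu (Complex 0 m) -> (gnrm mu %| m)%Z.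
Proof.
move=> pm [t tE].
have e : gconj mu * (Complex 0 m : gint) = (Complex (gnrm mu)%:Z 0 : gint) * t by rewrite tE mulrA [gconj mu * mu]mulrC gmulV.
have e1 : gim mu * m = (gnrm mu)%:Z * gre t.
  have := congr1 gre e; rewrite !greM /gconj; case: (mu) => p q /=.
    by rewrite mulr0 mul0r sub0r subr0 mulNr opprK.
have e2 : gre mu * m = (gnrm mu)%:Z * gim t.
  have := congr1 gim e; rewrite !gimM /gconj; case: (mu) => p q /=.
    by rewrite mulr0 mul0r !addr0.
have /coprimezP[[u v] /= uv] : coprimez (gre mu) (gim mu) by exact: pm.
have -> : m = (gnrm mu)%:Z * (u * gim t + v * gre t).
  rewrite mulrDr mulrCA -e2 [(gnrm mu)%:Z * (v * _)]mulrCA -e1 !mulrA -mulrDl uv mul1r //.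
exact: dvdz_mulr.
Qed.

Lemma sum_centered (V : nmodType) (m : nat) (G : int -> V) :
  \sum_(j < (2 * m).+1) G (j%:Z - m%:Z) = \sum_(i < m.+1) G i%:Z + \sum_(i < m) G (- i.+1%:Z).
Proof.
have e : (2 * m).+1 = (m + m.+1)%N by rewrite addnS mul2n addnn.
rewrite -(big_mkord predT (fun j => G (j%:Z - m%:Z))) e (@big_cat_nat _ _ _ m) //= ?leq_addr //.
rewrite addrC; congr (_ + _).
  rewrite -[X in \sum_(X <= _ < _) _]add0n big_addn addKn big_mkord; apply: eq_bigr => i _.
  by rewrite PoszD addrK.
rewrite big_nat_rev add0n big_mkord; apply: eq_bigr => i _; congr (G _).
by have := ltn_ord i; move: (nat_of_ord i) => q; clear; lia.
Qed.

Lemma typeI_shuffle (T : comNzRingType) (a g j b u : T) :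
  b * (a * g * (u * j)) = u * (a * j * (b * g)).
Proof. by ring. Qed.

Lemma typeI_gen (R : realFieldType) (x y z u v : R) : 0 <= x -> 0 <= y -> 0 <= z -> 0 <= u -> 0 <= v ->
  2 * x + 2 * y + 2 * z * u <= 4 * x + 4 * y + 2 * z * (u + v).
Proof. nra. Qed.

Section TypeOne.
Variables (R : realType) (d : nat) (chi : gint -> R[i]) (k : int) (mu : gint) (b : nat -> R) (Om : R)
  (Y m : nat).
Hypotheses (d0 : (0 < d)%N) (chiP : mult_char (4 * d)%:R chi) (pmu : primary mu) (gmu : gprim mu).
Hypotheses (b_mono : forall i j, (i <= j)%N -> b i <= b j) (b_bound : forall i, (i <= Y)%N -> 0 <= b i <= Om).
Hypothesis mY : (m ^ 2 <= Y < m.+1 ^ 2)%N.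

Local Notation Q := (gnrm mu).
Local Notation K := (4 * d * gnrm mu)%N.

Let rho (r s : int) : R[i] :=
  if `[< primary (Complex r s) /\ gdvd mu (Complex r s) >] then chi (Complex r s) else 0.

Let rho_abs r s : cabs (rho r s) <= 1.
Proof. by rewrite /rho; case: ifP => _; rewrite ?cabs0 // (mult_char_abs d0 chiP). Qed.

Let rho_shift r s t : rho r (s + K%:Z * t) = rho r s.
Proof.
rewrite /rho (mult_char_shift chiP); congr (if _ then _ else _); apply/asbool_equiv_eq.
have sh u v : primary (Complex r u) /\ gdvd mu (Complex r u) ->
    primary (Complex r (u + K%:Z * v)) /\ gdvd mu (Complex r (u + K%:Z * v)).
  move=> [pr [q qE]]; split; last first.
    exists (q + gconj mu * Complex 0 (4%:Z * d%:Z * v)); rewrite mulrDr -qE mulrA gmulV gmulE gaddE.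
    by rewrite !mulr0 !mul0r subr0 !addr0 !PoszM; congr Complex; congr (_ + _); ring.
  apply/primaryP; move/primaryP: pr => /= [h1 h2 h3].
  have -> : K%:Z * v = 4 * (d%:Z * Q%:Z * v) by rewrite !PoszM; ring.
  by move: (d%:Z * Q%:Z * v) => w; split=> //; move: h2 h3; clear; lia.
split; last exact: sh.
by move=> /(@sh _ (- t)); rewrite mulrN addrK.
Qed.

Let rho_count r (sg : int) : sg = 1 \/ sg = -1 ->
  (count (fun i : nat => rho r (sg * i%:Z)%R != 0%R) (iota 0 K) <= 4 * d)%N.
Proof.
move=> sg1; rewrite -size_filter -[X in (_ <= X)%N](size_iota 0).
apply: (@card_le_rel _ _ _ _ (fun i q => (i %/ Q)%N = q)); first by rewrite filter_uniq ?iota_uniq.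
  move=> i; rewrite mem_filter mem_iota add0n => /andP[_ iK]; exists (i %/ Q)%N => //.
  by rewrite mem_iota add0n ltn_divLR // primary_gnrm_gt0.
have H i j : rho r (sg * i%:Z) != 0 -> rho r (sg * j%:Z) != 0 -> (Q %| i%:Z - j%:Z)%Z.
  rewrite /rho; case: asboolP => [[_ [u uE]] _|]; last by rewrite eqxx.
  case: asboolP => [[_ [v vE]] _|]; last by rewrite eqxx.
  have := @gprim_dvd_imag mu (sg * (i%:Z - j%:Z)) gmu.
  have -> : (Complex 0 (sg * (i%:Z - j%:Z)) : gint) = Complex r (sg * i%:Z) - Complex r (sg * j%:Z).
    by rewrite goppE gaddE subrr mulrBr.
  have hd : gdvd mu (Complex r (sg * i%:Z) - Complex r (sg * j%:Z) : gint).
    by exists (u - v); rewrite mulrBr uE vE.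
  move=> /(_ hd) {hd}.
  by case: sg1 => ->; rewrite ?mul1r // mulN1r !dvdzE abszN.
move=> i j q; rewrite !mem_filter => /andP[hi _] /andP[hj _] iq jq.
have := H _ _ hi hj; rewrite -eqz_mod_dvd -[Q%:Z]/(Posz Q) !modz_nat => /eqP[] e.
by rewrite (divn_eq i Q) (divn_eq j Q) iq jq e.
Qed.

Let F (y : gint) : R[i] := psi chi k y * jacobi_kubota R y.
Let sel (y : gint) : bool := (gnrm y <= Y)%N && `[< primary y /\ gdvd mu y >].

Let smd (y : gint) : R[i] := (sel y)%:R * (((b (gnrm y %/ Q)%N)%:C)%C * F y).

Lemma typeI_line (r : int) (P : R) : odd `|r| -> (`|r| <= m)%N ->
  (forall c K' L, `|K'| = K%:Z -> (L <= m.+1)%N ->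
    (`|\sum_(j < L) jacobi (c + K' * j%:Z) `|r|%N|)%:~R <= P) ->
  cabs (\sum_(j < (2 * m).+1) smd (Complex r (j%:Z - m%:Z))) <=
  2 * ((4 * d)%:R * (P * (2 * Om * (`|k|%:~R + 1)))) + Om.
Proof.
move=> odd_r rm hP.
have r0 : r != 0 by apply: contraTneq odd_r => ->.
have K0 : (0 < K)%N by rewrite !muln_gt0 d0 primary_gnrm_gt0.
pose G (s : int) : R[i] := smd (Complex r s).
rewrite -[X in cabs X]/(\sum_(j < (2 * m).+1) G (j%:Z - m%:Z)) sum_centered.
have r2Y : (`|r| ^ 2 <= Y)%N.
  by apply: leq_trans (_ : m ^ 2 <= _)%N; [rewrite leq_exp2r | case/andP: mY].
have [S /andP[S1 S2]] := nat_sqrt_exists (Y - `|r| ^ 2).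
have Sm : (S <= m)%N.
  rewrite -ltnS -(@ltn_exp2r _ _ 2) //; apply: leq_ltn_trans S1 _.
  by case/andP: mY => _ h; apply: leq_ltn_trans (leq_subr _ _) h.
have inY s : (gnrm (Complex r s) <= Y)%N = (`|s| <= S)%N.
  rewrite /gnrm /= -leq_subRL //; apply/idP/idP => h.
    by rewrite -ltnS -(@ltn_exp2r _ _ 2) //; apply: leq_ltn_trans h S2.
  by apply: leq_trans S1; rewrite leq_exp2r.
have G0 s : (S < `|s|)%N -> G s = 0 by move=> h; rewrite /G /smd /sel inY leqNgt h /= mul0r.
pose om (s : nat) := b ((`|r| ^ 2 + s ^ 2) %/ Q)%N.
pose u : R[i] := (Complex 0 1) ^ ((r - 1) %/ 2)%Z.
pose term (s : int) : R[i] := rho r s * (jacobi s `|r|)%:~R * (((om `|s|%N)%:C)%C * gangle R (Complex r s) ^ k).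
have GE s : (`|s| <= S)%N -> G s = u * term s.
  move=> sS; rewrite /G /smd /sel inY sS /= /term /rho.
  case: asboolP => _; last by rewrite !mul0r mulr0.
  rewrite mul1r /om /F /psi /jacobi_kubota /= -/u -/(gangle R (Complex r s)) /gnrm /=.
  move: (chi _) (gangle R _ ^ k) (_%:~R) (b _)%:C%C u => A B C E U.
  by rewrite typeI_shuffle.
have e1 : \sum_(i < m.+1) G i%:Z = u * \sum_(i < S.+1) term i%:Z.
  rewrite (big_ord_widen m.+1 (fun i => term i%:Z)) // mulr_sumr [RHS]big_mkcond.
  by apply: eq_bigr => i _; case: ltnP => h; [exact: GE | exact: G0].
have e2 : \sum_(i < m) G (- i.+1%:Z) = u * \sum_(i < S) term (- i.+1%:Z).
  rewrite (big_ord_widen m (fun i => term (- i.+1%:Z))) // mulr_sumr [RHS]big_mkcond.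
  by apply: eq_bigr => i _; case: ltnP => h; [apply: GE | apply: G0]; rewrite abszN.
rewrite e1 e2 -mulrDr cabsM (normc_II R) mul1r; clear e1 e2 GE G0 G.
rewrite /term; apply: (@line_sum R r k K `|r|%N (rho r) om Om P S (4 * d)) => //.
- exact: rho_count.
- move=> s sS; apply: b_bound; apply: leq_trans (leq_div _ _) _.
  by rewrite -leq_subRL //; apply: leq_trans S1; rewrite leq_exp2r.
- by move=> s t st; apply: b_mono; rewrite leq_div2r // leq_add2l leq_exp2r.
- by move=> c K' L hK hL; apply: hP => //; apply: leq_trans hL _; rewrite ltnS.
Qed.

Lemma typeI_sum (h D L : nat) : (0 < h)%N -> (m.+1 <= 2 ^ L)%N ->
  (forall n, (0 < n <= m.+1)%N -> (ndiv n <= D)%N) -> (ndiv K <= D)%N ->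
  cabs (\sum_(y <- gbox m | sel y) (((b (gnrm y %/ Q)%N)%:C)%C * F y)) <=
  2 * (m.+1%:R * Om + 16 * d%:R * Om * (`|k|%:~R + 1) *
    (m.+1%:R * (4 * h%:R ^+ 2 + 4 * m.+1%:R / h%:R) +
     4 * m.+1%:R * D%:R * (D%:R * (Num.sqrt m.+1%:R * L.+1%:R)))).
Proof.
move=> h0 mL hD hK.
have K0 : (0 < K)%N by rewrite !muln_gt0 d0 primary_gnrm_gt0.
have Om0 : 0 <= Om by have /andP[h1 h2] := b_bound (leq0n Y); apply: le_trans h1 h2.
have k0 : 0 <= `|k|%:~R :> R by rewrite ler0z.
have [|e [eP eS]] := @sum_sqrt_weights R K%:Z m.+1 L _ mL; first by rewrite gt_eqF // ltz_nat.
have [|e' [eP' eS']] := @sum_sqrt_weights R (- K%:Z) m.+1 L _ mL.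
  by rewrite oppr_eq0 gt_eqF // ltz_nat.
rewrite abszN absz_nat in eS'; rewrite absz_nat in eS.
set N := m.+1 in mL hD eS eS' *.
pose P n : R := 4 * h%:R ^+ 2 + 4 * N%:R / h%:R +
  2 * N%:R * D%:R * ((Num.sqrt (e n)%:R)^-1 + (Num.sqrt (e' n)%:R)^-1).
pose B n : R := 2 * ((4 * d)%:R * (P n * (2 * Om * (`|k|%:~R + 1)))) + Om.
have P0 n : 0 <= P n by rewrite /P; nneg.
have B0 n : 0 <= B n by have := P0 n; rewrite /B => ?; nneg.
have hP n : odd n -> (n <= m)%N -> forall c K' L, `|K'| = K%:Z -> (L <= m.+1)%N ->
    (`|\sum_(j < L) jacobi (c + K' * j%:Z) n|)%:~R <= P n.
  move=> on nm c K' L' hK' L'm.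
  have n0 : (0 < n)%N by case: (n) on.
  have pos (f : nat -> nat) : 0 <= (Num.sqrt (f n)%:R)^-1 :> R by rewrite invr_ge0 sqrtr_ge0.
  have X0 : 0 <= h%:R ^+ 2 :> R by rewrite sqr_ge0.
  have Y0 : 0 <= N%:R / h%:R :> R by rewrite divr_ge0.
  have Z0 : 0 <= N%:R * D%:R :> R by rewrite mulr_ge0.
  have main (f : nat -> nat) : [/\ (0 < f n)%N, (f n %| n)%N &
      forall b d, `|jcorr n b K' d| * (f n)%:Z <= (n * gcdn (f n) `|d|)%N%:Z] ->
      (`|\sum_(j < L') jacobi (c + K' * j%:Z) n|)%:~R <=
        2 * h%:R ^+ 2 + 2 * N%:R / h%:R + 2 * N%:R * D%:R / Num.sqrt (f n)%:R :> R.
    move=> [f0 fn fc]; apply: (@char_sum_bound R K' c n (f n) n0 f0 fc N h D L') => //; first exact: leqW.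
    by apply: hD; rewrite f0 /N (leq_trans (dvdn_leq n0 fn)) // leqW.
  rewrite /P; have /orP[/eqP K'E|/eqP K'E] : (K' == K%:Z) || (K' == - K%:Z).
  - by move: hK'; move: (Posz K) => q; clear; case: (ger0P K') => _ <-; rewrite ?opprK eqxx ?orbT.
  - have := main e; rewrite K'E => /(_ (eP _ on)) /le_trans; apply.
    rewrite -[2 * N%:R / h%:R]mulrA -[4 * N%:R / h%:R]mulrA -[2 * N%:R * D%:R]mulrA.
    by apply: typeI_gen.
  - have := main e'; rewrite K'E => /(_ (eP' _ on)) /le_trans; apply.
    rewrite -[2 * N%:R / h%:R]mulrA -[4 * N%:R / h%:R]mulrA -[2 * N%:R * D%:R]mulrA.
    by rewrite [(Num.sqrt (e n)%:R)^-1 + _]addrC; apply: typeI_gen.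
have -> : \sum_(y <- gbox m | sel y) (((b (gnrm y %/ Q)%N)%:C)%C * F y) =
    \sum_(y <- gbox m) smd y.
  by rewrite big_mkcond; apply: eq_bigr => y _; rewrite /smd; case: (sel y); rewrite ?mul1r ?mul0r.
rewrite sum_gbox exchange_big /=; apply: le_trans (cabs_sum _ _ _) _.
pose G (r : int) : R := if odd `|r| then B `|r|%N else 0.
apply: (@le_trans _ _ (\sum_(i < (2 * m).+1) G (i%:Z - m%:Z))).
  apply: ler_sum => i _; rewrite [- m%:Z + _]addrC.
  have rm : (`|i%:Z - m%:Z| <= m)%N.
    by have := ltn_ord i; move: (nat_of_ord i) => q; clear; lia.
  move: (i%:Z - m%:Z) rm => r rm; rewrite /G; case: (boolP (odd `|r|)) => or.
    by apply: typeI_line => // *; apply: hP.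
  rewrite big1 ?cabs0 // => j _; rewrite /smd /sel.
  by case: asboolP => [[/primaryP[] /=]|_]; [rewrite (negPf or) | rewrite andbF mul0r].
rewrite sum_centered.
have G0 r : 0 <= G r by rewrite /G; case: ifP.
have half (f : nat -> R) : (forall n, 0 <= f n) -> \sum_(n <- iota 0 N | odd n) f n =
  \sum_(i < N) (if odd i then f i else 0).
  by move=> _; rewrite big_mkcond -(big_mkord predT (fun n => if odd n then f n else 0)) /index_iota subn0.
have s1 : \sum_(i < m.+1) G i%:Z = \sum_(n <- iota 0 N | odd n) B n by rewrite half.
have s2 : \sum_(i < m) G (- i.+1%:Z) <= \sum_(n <- iota 0 N | odd n) B n.
  by rewrite half // /N [leRHS]big_ord_recl /= add0r; apply: ler_sum => i _; rewrite /G abszN.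
have s3 : \sum_(n <- iota 0 N | odd n) B n <= m.+1%:R * Om + 16 * d%:R * Om * (`|k|%:~R + 1) *
    (m.+1%:R * (4 * h%:R ^+ 2 + 4 * m.+1%:R / h%:R) +
     4 * m.+1%:R * D%:R * (D%:R * (Num.sqrt m.+1%:R * L.+1%:R))).
  have cnt (x : R) : 0 <= x -> \sum_(n <- iota 0 N | odd n) x <= N%:R * x.
    move=> x0; rewrite big_const_seq iter_addr addr0 -[x *+ _]mulr_natl.
    by rewrite ler_wpM2r // ler_nat (leq_trans (count_size _ _)) // size_iota.
  rewrite /B big_split /= addrC; apply: lerD; first exact: cnt.
  have -> : \sum_(i <- iota 0 N | odd i) 2 * ((4 * d)%:R * (P i * (2 * Om * (`|k|%:~R + 1)))) =
     16 * d%:R * Om * (`|k|%:~R + 1) * \sum_(i <- iota 0 N | odd i) P i :> R.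
    rewrite mulr_sumr; apply: eq_bigr => i _; rewrite natrM; move: (P i) => p; ring.
  apply: ler_wpM2l; first by rewrite !mulr_ge0 // addr_ge0.
  rewrite /P big_split /=; apply: lerD.
    by apply: cnt; rewrite addr_ge0 // ?mulr_ge0 ?invr_ge0 ?sqr_ge0.
  rewrite -mulr_sumr big_split /=.
  have sl : 0 <= Num.sqrt N%:R * L.+1%:R :> R by rewrite mulr_ge0 ?sqrtr_ge0.
  have b1 : (ndiv K)%:R * (Num.sqrt N%:R * L.+1%:R) <= D%:R * (Num.sqrt N%:R * L.+1%:R) :> R.
    by rewrite ler_wpM2r // ler_nat.
  have -> : 4 * m.+1%:R * D%:R * (D%:R * (Num.sqrt m.+1%:R * L.+1%:R)) =
     2 * N%:R * D%:R * (D%:R * (Num.sqrt N%:R * L.+1%:R) + D%:R * (Num.sqrt N%:R * L.+1%:R)) :> R.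
    by rewrite -mulr2n -[_ *+ 2]mulr_natl; move: (D%:R * _) => z; rewrite /N; ring.
  apply: ler_wpM2l; first by rewrite !mulr_ge0.
  by apply: lerD; [apply: le_trans eS _ | apply: le_trans eS' _].
rewrite s1 mulr_natl mulr2n; apply: lerD; first exact: s3.
exact: le_trans s2 s3.
Qed.
End TypeOne.

(** * Unfolding convolutions over Gaussian integers *)

Lemma gterm_shuffle (T : comNzRingType) (a b c e f g h : T) :
  a * b * (c * e) * (f * g * h) = a * c * f * (b * e * g) * h.
Proof. by ring. Qed.

Lemma big_pred1_seq_uniq (V : nmodType) (T : eqType) (s : seq T) (x : T) (F : T -> V) :
  x \in s -> uniq s -> \sum_(y <- s | y == x) F y = F x.
Proof.
move=> xs us; rewrite big_mkcond (bigD1_seq x) //= eqxx big1 ?addr0 // => y /negPf -> //.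
Qed.

Section GaussianSums.
Variables (R : realType).

Lemma dconv_gauss (X : nat) (a b : nat -> R) (Phi : gint -> R[i]) :
  (forall y, primary y -> ~~ gprim y -> Phi y = 0) ->
  \sum_(y <- pplist X) ((dconv a b (gnrm y))%:C)%C * Phi y =
  \sum_(w <- pplist X) \sum_(t <- pplist (X %/ gnrm w)) ((a (gnrm w) * b (gnrm t))%:C)%C * Phi (w * t).
Proof.
move=> hPhi; pose c w t : R := a (gnrm w) * b (gnrm t).
transitivity (\sum_(y <- pplist X) \sum_(w <- pplist X) \sum_(t <- pplist (X %/ gnrm w))
   (((y == w * t)%:R * c w t)%:C)%C * Phi y); last first.
  rewrite exchange_big big_seq [RHS]big_seq; apply: eq_bigr => w /pplistP[pw gw wX].
  rewrite exchange_big big_seq [RHS]big_seq; apply: eq_bigr => t /pplistP[pt gt tX] /=.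
  have w0 := primary_gnrm_gt0 pw.
  rewrite (eq_bigr (fun y => if y == w * t then ((c w t)%:C)%C * Phi (w * t) else 0)); last first.
    by move=> y _; case: eqP => [->|_]; rewrite ?mul1r // mul0r mul0r.
  rewrite -big_mkcond /=; have [inX|] := boolP (w * t \in pplist X).
    by rewrite (big_pred1_seq_uniq _ inX) ?pplist_uniq.
  move=> ninX; rewrite big_seq_cond big1; last first.
    by move=> y /andP[yX /eqP ye]; rewrite -ye yX in ninX.
  rewrite hPhi ?mulr0 //; first exact: primaryM.
  apply: contra ninX => gwt; apply/pplistP; split=> //; first exact: primaryM.
  by rewrite gnrmM mulnC -leq_divRL.
rewrite big_seq [RHS]big_seq; apply: eq_bigr => y /pplistP[py gy yX].
have y0 := primary_gnrm_gt0 py.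
pose sel w := `[< exists2 t, primary t & y = w * t >].
pose Wy := [seq w <- pplist X | sel w].
have pm : perm_eq (map gnrm Wy) (divisors (gnrm y)).
  apply: uniq_perm; last 1 first.
  - move=> e; rewrite -dvdn_divisors //; apply/mapP/idP => [[w]|ey].
      by rewrite mem_filter => /andP[/asboolP[t _ ->] _] ->; rewrite gnrmM dvdn_mulr.
    have [w [t [pw pt yE we]]] := primary_divisor_exists py gy ey.
    exists w => //; rewrite mem_filter; apply/andP; split; first by apply/asboolP; exists t.
    apply/pplistP; split=> //; first by apply: (@gprim_divl w t); rewrite -yE.
    by apply: leq_trans yX; rewrite yE gnrmM leq_pmulr // primary_gnrm_gt0.
  - rewrite map_inj_in_uniq; first exact: (filter_uniq _ (pplist_uniq _)).
    move=> w w'; rewrite !(mem_filter sel).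
    move=> /andP[/asboolP[t pt yE] /pplistP[pw _ _]] /andP[/asboolP[t' pt' yE'] /pplistP[pw' _ _]] e.
    apply: (@primary_divisor_unique w w' t t') => //; first by rewrite -yE.
    by rewrite -yE.
  - exact: divisors_uniq.
have -> : dconv a b (gnrm y) = \sum_(w <- Wy) a (gnrm w) * b (gnrm y %/ gnrm w)%N.
  by rewrite /dconv -(perm_big _ pm) big_map.
have -> : (((\sum_(w <- Wy) a (gnrm w) * b (gnrm y %/ gnrm w)%N)%:C)%C : R[i]) =
   \sum_(w <- Wy) ((a (gnrm w) * b (gnrm y %/ gnrm w)%N)%:C)%C by rewrite raddf_sum.
rewrite mulr_suml big_filter big_mkcond /= big_seq [RHS]big_seq; apply: eq_bigr => w /pplistP[pw gw wX].
have w0 := primary_gnrm_gt0 pw.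
rewrite /sel; case: asboolP => [[t pt yE]|ny]; last first.
  rewrite big_seq big1 // => t /pplistP[pt _ _]; case: eqP => yE; last by rewrite mul0r mul0r.
  by case: ny; exists t.
have wn0 : w != 0 by exact: primary_neq0.
rewrite (eq_bigr (fun t' => if t' == t then ((c w t)%:C)%C * Phi y else 0)); last first.
  move=> t' _; rewrite yE (inj_eq (gmulfI wn0)) eq_sym.
  by case: eqP => [->|_]; rewrite ?mul1r // mul0r mul0r.
rewrite -big_mkcond /= big_pred1_seq_uniq ?pplist_uniq //.
  by rewrite /c yE gnrmM mulKn.
apply/pplistP; split=> //; first by apply: (@gprim_divr w t); rewrite -yE.
by rewrite leq_divRL // mulnC -gnrmM -yE.
Qed.

Variables (d : nat) (chi : gint -> R[i]) (k : int).
Hypotheses (d0 : (0 < d)%N) (chiP : mult_char (4 * d)%:R chi).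

Definition gterm (y : gint) : R[i] := psi chi k y * jacobi_kubota R y.

Lemma gterm_not_gprim y : primary y -> ~~ gprim y -> gterm y = 0.
Proof.
by move=> /primaryP[oy _ _] ny; rewrite /gterm /jacobi_kubota jacobi_not_gprim // !mulr0.
Qed.

Lemma gterm_abs y : y != 0 -> cabs (gterm y) <= 1.
Proof.
move=> y0; rewrite /gterm /psi /jacobi_kubota -/(gangle R y) !cabsM cabs_int (normc_II R).
rewrite (cabs_exprz k (gangle_cabs R y0)) mulr1 mul1r.
rewrite mulr_ile1 ?cabs_ge0 ?ler0z ?(mult_char_abs d0 chiP) //.
by rewrite lerz1; exact: jacobi_abs_le1.
Qed.

Lemma gtermM w z : primary w -> primary z -> gterm (w * z) = gterm w * gterm z *
  ((-1) ^+ (mult_sign (gre w) (gre z) (gim z) (gre (w * z))) * dsym w z)%:~R.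
Proof.
move=> pw pz; rewrite /gterm jacobi_kubotaM // /psi (mult_charM_all chiP) -!/(gangle R _) gangleM.
by rewrite expfzMl; exact: gterm_shuffle.
Qed.

Lemma lambda_pplist (X c n : nat) : (0 < c)%N -> (n <= X)%N ->
  lambda chi k (c * n) = \sum_(y <- pplist (c * X) | gnrm y == (c * n)%N) gterm y.
Proof.
move=> c0 nX.
have -> : \sum_(y <- pplist (c * X) | gnrm y == (c * n)%N) gterm y =
    \sum_(y <- pplist (c * X) | primaryb y && (gnrm y == (c * n)%N)) gterm y.
  rewrite big_seq_cond [RHS]big_seq_cond; apply: eq_bigl => y.
  by case: pplistP => //= -[/primarybP -> _ _].
rewrite bigfs ?pplist_uniq //; last first.
  move=> y /andP[/primarybP py /eqP yn] nin; apply: gterm_not_gprim => //.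
  by apply: contra nin => gy; apply/pplistP; rewrite yn leq_mul2l nX orbT.
rewrite /lambda; apply: eq_fsbigl; apply/seteqP; split=> y /=.
  rewrite gmulV gint_natr => -[[e] /primarybP py]; apply/andP; split=> //; exact/eqP.
by move=> /andP[/primarybP py /eqP e]; split=> //; rewrite gmulV gint_natr e.
Qed.

Lemma lambda_sum (X c : nat) : (0 < c)%N ->
  \sum_(1 <= n < X.+1) ((von_mangoldt R n)%:C)%C * lambda chi k (c * n)%N =
  \sum_(z0 <- pplist (c * X) | gnrm z0 == c)
     \sum_(t <- pplist X) ((von_mangoldt R (gnrm t))%:C)%C * gterm (z0 * t).
Proof.
move=> c0; pose a (n : nat) : R := (n == c)%:R.
transitivity (\sum_(y <- pplist (c * X)) ((dconv a (von_mangoldt R) (gnrm y))%:C)%C * gterm y); last first.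
  rewrite dconv_gauss; last exact: gterm_not_gprim.
  rewrite [RHS]big_mkcond; apply: eq_bigr => z0 _; rewrite /a.
  case: eqP => [->|_]; last by rewrite big1 // => t _; rewrite mul0r mul0r.
  by rewrite mulKn //; apply: eq_bigr => t _; rewrite mul1r.
have aE y : y \in pplist (c * X) -> dconv a (von_mangoldt R) (gnrm y) =
    if (c %| gnrm y)%N then von_mangoldt R (gnrm y %/ c) else 0.
  move=> /pplistP[/primary_gnrm_gt0 y0 _ _]; rewrite /dconv /a.
  rewrite (eq_bigr (fun e => if e == c then von_mangoldt R (gnrm y %/ c) else 0)); last first.
    by move=> e _; case: eqP => [->|_]; rewrite ?mul1r ?mul0r.
  rewrite -big_mkcond /=; case: ifP => cy.
    by rewrite big_pred1_seq_uniq ?divisors_uniq // -dvdn_divisors.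
  rewrite big_seq_cond big1 // => e; rewrite -dvdn_divisors // => /andP[h /eqP ec].
  by rewrite ec cy in h.
rewrite big_seq [RHS]big_seq.
transitivity (\sum_(1 <= n < X.+1) \sum_(y <- pplist (c * X) | y \in pplist (c * X))
    (gnrm y == (c * n)%N)%:R * (((von_mangoldt R n)%:C)%C * gterm y)).
  rewrite -big_seq; apply: eq_big_nat => n /andP[n1 nX]; rewrite (lambda_pplist c0 (_ : n <= X)%N) //.
  rewrite mulr_sumr big_mkcond /= -big_seq; apply: eq_bigr => y _.
  by case: eqP; rewrite ?mul1r ?mul0r.
rewrite exchange_big /=; apply: eq_bigr => y yin; rewrite aE //.
have /pplistP[/primary_gnrm_gt0 y0 _ yX] := yin.
case: ifP => cy; last first.
  rewrite big1 ?mul0r // => n _; case: eqP => [e|_]; last by rewrite mul0r.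
  by rewrite e dvdn_mulr in cy.
rewrite (eq_bigr (fun n => if n == (gnrm y %/ c)%N then ((von_mangoldt R (gnrm y %/ c))%:C)%C * gterm y else 0)); last first.
  move=> n _; rewrite -[X in X == (c * n)%N](divnK cy) [(_ * c)%N]mulnC eqn_pmul2l // eq_sym.
  by case: eqP => [->|_]; rewrite ?mul1r ?mul0r.
rewrite -big_mkcond /= big_pred1_seq_uniq ?iota_uniq // mem_index_iota divn_gt0 // dvdn_leq //=.
by rewrite ltnS leq_divLR // mulnC.
Qed.
End GaussianSums.

(** * Sums of type II *)

Definition sgn_part (s : bool) (z : gint) : int :=
  if s then (if gim z < 0 then sgnz (gre z) else 0) else (if gim z < 0 then 0 else 1).

Lemma sgnz_sign (a : int) : sgnz a = (-1) ^+ (a < 0)%R.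
Proof. by rewrite /sgnz; case: ifP; rewrite ?expr1 ?expr0. Qed.

Lemma mult_sign_split (u a : int) (z : gint) :
  (-1) ^+ mult_sign u (gre z) (gim z) a =
  if u < 0 then sgn_part true z - sgn_part false z * sgnz a
  else sgn_part true z * sgnz a + sgn_part false z.
Proof.
rewrite /mult_sign /sgn_part !sgnz_sign; case: (u < 0); case: (gim z < 0).
- by rewrite mul0r subr0.
- by rewrite mul1r sub0r signrN.
- by rewrite signr_addb mulrC addr0.
- by rewrite mul0r add0r.
Qed.

Lemma typeII_shuffle (T : comNzRingType) (g w z s a b : T) :
  g * (w * z * (s * (b * a))) = w * a * (g * z * s * b).
Proof. by ring. Qed.

Section TypeTwoReduction.
Variables (R : realType) (d : nat) (chi : gint -> R[i]) (k : int) (z0 : gint) (X M : nat)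
  (W : seq gint) (g : nat -> R) (B Bd : R).
Hypotheses (d0 : (0 < d)%N) (chiP : mult_char (4 * d)%:R chi) (pz0 : primary z0) (M0 : (0 < M)%N).
Hypothesis WP : forall w, w \in W -> [/\ primary w, gprim w & (M <= gnrm w)%N].
Hypotheses (B0 : 0 <= B) (gB : forall n, (n <= X)%N -> `|g n| <= B).
Hypothesis shell : forall (beta : gint -> R) (dl : bool),
  (forall z, z \in pplist (X %/ M) -> `|beta z| <= B) ->
  \sum_(w <- W) `|\sum_(z <- pplist (X %/ M)) beta z * phi R X z0 dl w z * (dsym w z)%:~R| <= Bd.

Local Notation F := (gterm chi k).
Local Notation Zs := (pplist (X %/ M)).

Let beta (s : bool) (t : gint) : R[i] := ((g (gnrm t))%:C)%C * F (t * z0) * (sgn_part s (t * z0))%:~R.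
Let inner (s dl : bool) (w : gint) : R[i] :=
  \sum_(t <- Zs) beta s t * ((phi R X z0 dl w t * (dsym w t)%:~R)%:C)%C.

Let beta_abs s t : t \in Zs -> cabs (beta s t) <= B.
Proof.
move=> /pplistP[pt gt tX].
have h : cabs (F (t * z0)) <= 1 by apply: (gterm_abs _ d0 chiP); apply/primary_neq0/primaryM.
rewrite /beta; move: (F (t * z0)) h => f h.
rewrite !cabsM cabs_real cabs_int -[leRHS]mulr1 -[leRHS]mulr1.
apply: ler_pM; rewrite ?mulr_ge0 ?cabs_ge0 ?ler0z //.
  by apply: ler_pM; rewrite ?normr_ge0 ?cabs_ge0 // gB // (leq_trans tX) // leq_div.
by rewrite lerz1 /sgn_part /sgnz; case: s; case: (_ < 0) => //; case: (_ < 0).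
Qed.

Lemma typeII_inner s dl : \sum_(w <- W) cabs (inner s dl w) <= 2 * Bd.
Proof.
pose re (t : gint) := complex.Re (beta s t); pose im (t : gint) := complex.Im (beta s t).
have h1 : forall z, z \in Zs -> `|re z| <= B by move=> z /(beta_abs s); apply: le_trans (Re_le_cabs _).
have h2 : forall z, z \in Zs -> `|im z| <= B by move=> z /(beta_abs s); apply: le_trans (Im_le_cabs _).
rewrite mulr_natl mulr2n; apply: le_trans (lerD (shell dl h1) (shell dl h2)).
rewrite -big_split; apply: ler_sum => w _ /=; apply: le_trans (cabs_le_ReIm _) _.
have e1 : complex.Re (inner s dl w) = \sum_(z <- Zs) re z * phi R X z0 dl w z * (dsym w z)%:~R.
  have ReD : {morph (@complex.Re R) : x y / x + y >-> x + y} by case=> [? ?] [? ?].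
  rewrite /inner (big_morph _ ReD (erefl : complex.Re 0 = 0)); apply: eq_bigr => t _.
  rewrite /re -mulrA; move: (phi _ _ _ _ _ _ * _) (beta s t) => x [p q] /=.
  by rewrite mulr0 subr0.
have e2 : complex.Im (inner s dl w) = \sum_(z <- Zs) im z * phi R X z0 dl w z * (dsym w z)%:~R.
  have ImD : {morph (@complex.Im R) : x y / x + y >-> x + y} by case=> [? ?] [? ?].
  rewrite /inner (big_morph _ ImD (erefl : complex.Im 0 = 0)); apply: eq_bigr => t _.
  rewrite /im -mulrA; move: (phi _ _ _ _ _ _ * _) (beta s t) => x [p q] /=.
  by rewrite mulr0 add0r.
by rewrite e1 e2.
Qed.

Let typeII_term w : w \in W ->
  \sum_(t <- pplist (X %/ gnrm w)) ((g (gnrm t))%:C)%C * F (z0 * (w * t)) =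
  F w * (dsym w z0)%:~R *
    (if gre w < 0 then inner true false w - inner false true w
     else inner true true w + inner false false w).
Proof.
move=> wW; have [pw gw wM] := WP wW; have w0 := primary_gnrm_gt0 pw.
pose S (t : gint) : R[i] := ((g (gnrm t))%:C)%C * F (t * z0) *
   ((-1) ^+ mult_sign (gre w) (gre (t * z0)) (gim (t * z0)) (gre (w * (t * z0))))%:~R *
   (dsym w t)%:~R.
transitivity (F w * (dsym w z0)%:~R * \sum_(t <- Zs) (gnrm (w * t) <= X)%N%:R * S t).
  rewrite mulr_sumr.
  have sub : [seq t <- Zs | (gnrm (w * t) <= X)%N] =i pplist (X %/ gnrm w).
    move=> t; rewrite (mem_filter (fun t => (gnrm (w * t) <= X)%N)).
    apply/andP/pplistP => [[h /pplistP[pt gt _]]|[pt gt tX]].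
      by split=> //; rewrite leq_divRL // mulnC -gnrmM.
    split; first by rewrite gnrmM mulnC -leq_divRL.
    by apply/pplistP; split=> //; apply: leq_trans tX _; rewrite leq_div2l.
  have pe := uniq_perm (filter_uniq _ (pplist_uniq _)) (pplist_uniq _) sub.
  rewrite -(perm_big _ pe) big_filter big_mkcond /= big_seq [RHS]big_seq.
  apply: eq_bigr => t /pplistP[pt _ _]; case: ifP => _; last by rewrite mul0r mulr0.
  have -> : z0 * (w * t) = w * (t * z0) by rewrite mulrCA [z0 * t]mulrC.
  rewrite mul1r (gtermM k chiP) //; last exact: primaryM.
  by rewrite dsymM // /S rmorphM /= intrM; exact: typeII_shuffle.
congr (_ * _); rewrite /inner.
have phiE dl t : phi R X z0 dl w t = (gnrm (w * t) <= X)%N%:R * (if dl then (sgnz (gre (w * (t * z0))))%:~R else 1).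
  by rewrite /phi mulrA.
have T s dl t : beta s t * ((phi R X z0 dl w t * (dsym w t)%:~R)%:C)%C =
    (gnrm (w * t) <= X)%N%:R * (((g (gnrm t))%:C)%C * F (t * z0) *
      ((sgn_part s (t * z0) * (if dl then sgnz (gre (w * (t * z0))) else 1))%:~R) * (dsym w t)%:~R).
  rewrite phiE /beta !rmorphM /= rmorph_int rmorph_nat.
  have -> : (((if dl then (sgnz (gre (w * (t * z0))))%:~R else 1) : R)%:C)%C =
     (if dl then sgnz (gre (w * (t * z0))) else 1)%:~R :> R[i] by case: dl; rewrite ?rmorph_int.
  move: (_%:C)%C (F _) (sgn_part _ _)%:~R (_%:R) (if dl then _ else _)%:~R (dsym w t)%:~R => A E H P Q Z.
  by rewrite -!mulrA [RHS]mulrCA; congr (_ * _); rewrite [RHS]mulrCA; congr (_ * _); rewrite mulrCA.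
case: ifP => u0; [rewrite -sumrB | rewrite -big_split]; apply: eq_bigr => t _ /=; rewrite !T /S.
  rewrite mult_sign_split u0 mulr1 rmorphB /=.
  by rewrite -mulrBr -mulrBl -mulrBr.
rewrite mult_sign_split u0 mulr1 rmorphD /=.
by rewrite -mulrDr -mulrDl -mulrDr.
Qed.

Lemma typeII_reduce :
  \sum_(w <- W) cabs (\sum_(t <- pplist (X %/ gnrm w)) ((g (gnrm t))%:C)%C * F (z0 * (w * t))) <= 8 * Bd.
Proof.
apply: (@le_trans _ _ (\sum_(w <- W) ((cabs (inner true false w) + cabs (inner false true w)) +
   (cabs (inner true true w) + cabs (inner false false w))))).
  rewrite big_seq [leRHS]big_seq; apply: ler_sum => w wW; rewrite typeII_term // cabsM.
  have [pw gw wM] := WP wW.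
  have h : cabs (F w * (dsym w z0)%:~R) <= 1.
    rewrite cabsM cabs_int mulr_ile1 ?cabs_ge0 ?ler0z ?lerz1 ?dsym_abs_le1 //.
    by apply: (gterm_abs _ d0 chiP); exact: primary_neq0.
  apply: le_trans (_ : 1 * cabs (if gre w < 0 then inner true false w - inner false true w
     else inner true true w + inner false false w) <= _); first by rewrite ler_wpM2r ?cabs_ge0.
  rewrite mul1r; case: ifP => _.
    by apply: le_trans (cabsB _ _) _; rewrite lerDl addr_ge0 ?cabs_ge0.
  by apply: le_trans (cabsD _ _) _; rewrite lerDr addr_ge0 ?cabs_ge0.
rewrite !big_split /=.
have e : 8 * Bd = (2 * Bd + 2 * Bd) + (2 * Bd + 2 * Bd) by ring.
by rewrite e; apply: lerD; apply: lerD; apply: typeII_inner.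
Qed.
End TypeTwoReduction.

Lemma shell_mid_shuffle (R : comNzRingType) (a b c e f g : R) : a * b * c * e * (f * g) = a * (b * f) * c * e * g.
Proof. by ring. Qed.

Lemma shell_left_split (R : comNzRingType) (k : nat) (a b c e y D M q : R) :
  (a * M) ^+ (2 * k) * ((b * y) ^+ 2 * ((D * (D * D)) ^+ k.+1 * (D * (c * q)) ^+ k.+1)) *
    (e * (M * D * q ^+ k.+1)) * y ^+ (2 * k.+1) =
  a ^+ (2 * k) * c ^+ k.+1 * (b ^+ 2 * e) * ((D ^+ 4) ^+ k.+1 * D) *
    (M ^+ (2 * k) * M * (q ^+ k.+1) ^+ 2) * y ^+ (2 * k.+2).
Proof.
rewrite (_ : (2 * k.+2 = 2 + 2 * k.+1)%N); last by rewrite !mulnS; lia.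
rewrite (exprD y) (_ : (D ^+ 4) ^+ k.+1 = (D * (D * D)) ^+ k.+1 * D ^+ k.+1); last first.
  by rewrite -exprMn; congr (_ ^+ _); ring.
rewrite (exprMn _ a) (exprMn _ D (c * q)) (exprMn _ c) (exprMn _ b).
move: (y ^+ (2 * k.+1)) (D ^+ k.+1) ((D * (D * D)) ^+ _) (a ^+ _) (c ^+ k.+1) (M ^+ _) (q ^+ k.+1).
by move=> *; ring.
Qed.

Lemma shell_power_split (R : comNzRingType) (k : nat) (a D M q : R) :
  (a ^+ 3 * D ^+ 3 * (M * q)) ^+ (2 * k.+1) =
  (a ^+ (2 * k.+1) * a ^+ (4 * k.+1)) * (D ^+ 6) ^+ k.+1 * (M ^+ (2 * k) * M * (q ^+ k.+1) ^+ 2) * M.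
Proof.
rewrite (exprMn _ (a ^+ 3 * D ^+ 3)) (exprMn _ (a ^+ 3)) (exprMn _ M) -[(a ^+ 3) ^+ _]exprM -[(D ^+ 3) ^+ _]exprM -[(D ^+ 6) ^+ _]exprM -[(q ^+ _) ^+ 2]exprM (_ : (3 * (2 * k.+1) = 2 * k.+1 + 4 * k.+1)%N); last by lia.
rewrite (exprD a) (_ : (6 * k.+1 = 2 * k.+1 + 4 * k.+1)%N); last by lia.
rewrite [(k.+1 * 2)%N]mulnC.
have -> : M ^+ (2 * k.+1) = M ^+ (2 * k) * M * M by rewrite mulnS addnC exprD expr2 mulrA.
move: (a ^+ _) (a ^+ _) (D ^+ _) (M ^+ _) (q ^+ _) => a1 a2 a3 a4 a5; ring.
Qed.

Lemma expr_mixed_le (R : realFieldType) (k : nat) (a b : R) : 1 <= a -> 0 <= b ->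
  a ^+ (2 * k) * (b ^+ 2) ^+ k.+1 <= (a * b) ^+ (2 * k.+1).
Proof.
move=> a1 b0; rewrite -exprM (exprMn _ a b) ler_wpM2r ?exprn_ge0 // ler_weXn2l //.
by rewrite leq_mul2l leqnSn.
Qed.

Lemma shell_size_bound (R : realType) (k : nat) (S w z m J D M x y : R) :
  0 <= S -> 1 <= D -> 1 <= M -> M <= x -> 0 <= w <= 18 * M -> 0 <= z <= 9 * (x / M) ->
  0 <= J <= y -> 0 < y -> 0 <= m -> m ^+ 2 <= (x / M) ^+ k.+1 -> M ^+ 6 <= (x / M) ^+ k.+1 ->
  y ^+ (2 * k.+2) <= 4 * M ->
  S ^+ (2 * k.+1) <= w ^+ (2 * k) * ((17 * J) ^+ 2 * ((D * (D * D)) ^+ k.+1 * (D * z) ^+ k.+1)) *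
    (w * (D * (2 * m + 3) ^+ 2 + w * ((2 * m + 3) * (2 * M) ^+ 2))) ->
  S <= 54 ^+ 3 * D ^+ 3 * (x / y).
Proof.
move=> S0 D1 M1 Mx /andP[w0 wM] /andP[z0 zM] /andP[J0 Jy] y0 m0 mq Mq yM.
have D0 : 0 <= D by exact: le_trans D1.
have a1 : 0 <= 17 * J by lra.
have a2 : 17 * J <= 17 * y by lra.
have y00 := ltW y0.
have a2' : 0 <= 17 * y by exact: le_trans a2.
have M0 : 0 < M by lra.
have M00 := ltW M0.
have M18 : 0 <= 18 * M by lra.
have x0 : 0 < x by lra.
set q := x / M in zM mq Mq.
have xE : x = M * q by rewrite /q mulrC divfK // gt_eqF.
have q1 : 1 <= q by rewrite /q ler_pdivlMr // mul1r.
have q0 : 0 <= q by lra.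
set Qk := q ^+ k.+1 in mq Mq *.
have Q1 : 1 <= Qk by apply: exprn_ege1.
pose mu := Num.sqrt Qk.
have mu0 : 0 <= mu by apply: sqrtr_ge0.
have muE : mu ^+ 2 = Qk by rewrite sqr_sqrtr //; lra.
have mmu : m <= mu by rewrite -(@ler_pXn2r _ 2) ?nnegrE // muE.
have mu1 : 1 <= mu by rewrite -(@ler_pXn2r _ 2) ?nnegrE // ?muE ?expr1n //.
have M3 : M ^+ 3 <= mu.
  by rewrite -(@ler_pXn2r _ 2) ?nnegrE ?exprn_ge0 ?muE -?exprM // ltW.
have last : w * (D * (2 * m + 3) ^+ 2 + w * ((2 * m + 3) * (2 * M) ^+ 2)) <= 6930 * (M * D * Qk).
  have m5 : 2 * m + 3 <= 5 * mu by lra.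
  have m50 : 0 <= 2 * m + 3 by lra.
  have mu5 : 0 <= 5 * mu by lra.
  have h1 : (2 * m + 3) ^+ 2 <= 25 * Qk.
    rewrite -muE (_ : 25 * mu ^+ 2 = (5 * mu) ^+ 2); last by ring.
    by rewrite lerXn2r ?nnegrE.
  have h2 : w * ((2 * m + 3) * (2 * M) ^+ 2) <= 360 * Qk.
    apply: (@le_trans _ _ (18 * M * ((5 * mu) * (2 * M) ^+ 2))).
      apply: ler_pM => //; first by rewrite mulr_ge0 // sqr_ge0.
      by apply: ler_wpM2r => //; rewrite sqr_ge0.
    rewrite (_ : 18 * M * ((5 * mu) * (2 * M) ^+ 2) = 360 * (M ^+ 3 * mu)); last by ring.
    by apply: ler_wpM2l => //; rewrite -muE expr2 ler_wpM2r.
  have Qk0 : 0 <= Qk by exact: le_trans Q1.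
  have h3 : 0 <= 25 * Qk by nneg.
  apply: (@le_trans _ _ (18 * M * (D * (25 * Qk) + 360 * Qk))).
    apply: ler_pM => //.
      by nneg.
    by apply: lerD => //; apply: ler_wpM2l.
  have h4 : Qk <= D * Qk by rewrite ler_peMl.
  rewrite (_ : 6930 * (M * D * Qk) = 18 * M * (385 * (D * Qk))); last by ring.
  apply: ler_wpM2l => //; rewrite -subr_ge0 in h4; rewrite -subr_ge0.
  by rewrite (_ : _ - _ = 360 * (D * Qk - Qk)); [nneg | ring].
have fst : w ^+ (2 * k) * ((17 * J) ^+ 2 * ((D * (D * D)) ^+ k.+1 * (D * z) ^+ k.+1)) <=
   (18 * M) ^+ (2 * k) * ((17 * y) ^+ 2 * ((D * (D * D)) ^+ k.+1 * (D * (9 * q)) ^+ k.+1)).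
  have a3 : 0 <= D * (D * D) by nneg.
  have a4 : 0 <= D * z by nneg.
  apply: ler_pM.
  - exact: exprn_ge0.
  - by rewrite !mulr_ge0 // exprn_ge0.
  - by rewrite lerXn2r ?nnegrE.
  apply: ler_pM.
  - exact: exprn_ge0.
  - by rewrite mulr_ge0 // exprn_ge0.
  - by rewrite lerXn2r ?nnegrE.
  apply: ler_wpM2l; first exact: exprn_ge0.
  have a5 : D * z <= D * (9 * q) by exact: ler_wpM2l.
  have a6 := le_trans a4 a5.
  by apply: lerXn2r.
move=> hS; rewrite -(@ler_pXn2r _ (2 * k.+1)) ?nnegrE ?mulr_ge0 ?exprn_ge0 ?invr_ge0 // ?(ltW y0) ?(ltW x0) //.
apply: le_trans hS _;  apply: le_trans (ler_pM _ _ fst last) _.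
- by nneg.
- by nneg.
clear fst last.
have y2 : 0 < y ^+ (2 * k.+1) by rewrite exprn_gt0.
rewrite [leRHS](_ : _ = (54 ^+ 3 * D ^+ 3 * x) ^+ (2 * k.+1) / y ^+ (2 * k.+1)); last first.
  by rewrite -expr_div_n mulrA.
rewrite ler_pdivlMr // xE shell_power_split shell_left_split -/Qk.
have e9 : 3 ^+ 2 = 9 :> R by rewrite -natrX.
have e54 : 18 * 3 = 54 :> R by rewrite -natrM.
pose T : R := 18 ^+ (2 * k) * 9 ^+ k.+1.
rewrite -/T; have T0 : 0 <= T by exact: mulr_ge0 (exprn_ge0 _ (ler0n _ _)) (exprn_ge0 _ (ler0n _ _)).
have hT : T <= 54 ^+ (2 * k.+1).
  have := @expr_mixed_le R k 18 3 _ _; rewrite e9 e54 => h; apply: h => //.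
  by rewrite ler1n.
have hc : 17 ^+ 2 * 6930 * 4 <= 54 ^+ (4 * k.+1) :> R.
  apply: (@le_trans _ _ (54 ^+ 4)); last by rewrite ler_eXn2l ?ltr1n // mulnS leq_addr.
  have n1 : 34 * 84 <= 54 * 54 :> R by rewrite -!natrM ler_nat.
  have n2 : 17 ^+ 2 * 4 <= 34 * 34 :> R by rewrite -natrX -!natrM ler_nat.
  have n3 : 6930 <= 84 * 84 :> R by rewrite -!natrM ler_nat.
  rewrite mulrAC; apply: le_trans (ler_pM _ _ n2 n3) _; rewrite ?mulr_ge0 //.
  rewrite mulrACA (_ : 54 ^+ 4 = (54 * 54) * (54 * 54)); last by rewrite -!expr2 -exprM.
  by apply: (ler_pM _ _ n1 n1); rewrite mulr_ge0.
have hDk : (D ^+ 4) ^+ k.+1 * D <= (D ^+ 6) ^+ k.+1.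
  have hn : ((4 * k.+1).+1 <= 6 * k.+1)%N by rewrite !mulnS; clear; lia.
  by rewrite -(exprM D) -(exprM D) -exprSr; apply: ler_weXn2l.
apply: (@le_trans _ _ ((T * (17 ^+ 2 * 6930)) * ((D ^+ 4) ^+ k.+1 * D) * (M ^+ (2 * k) * M * Qk ^+ 2) * (4 * M))).
  apply: ler_wpM2l => //.
  by have := le_trans ler01 Q1 => ?; nneg.
rewrite shell_mid_shuffle.
apply: ler_wpM2r => //.
apply: ler_wpM2r; first by have := le_trans ler01 Q1 => ?; nneg.
apply: ler_pM.
- by nneg.
- by nneg.
- by apply: ler_pM => //; nneg.
- exact: hDk.
Qed.

Lemma shell_lin1 (R : realFieldType) (a b : R) : a <= b -> 1 <= b -> 4 * (a + 1) <= 8 * b.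
Proof. lra. Qed.
Lemma shell_lin2 (R : realFieldType) (a b : R) : a <= b -> 1 <= b -> 4 * a + 4 <= 8 * b.
Proof. lra. Qed.
Lemma shell_lin3 (R : realFieldType) (a b : R) : a <= 16 * b -> 1 <= b -> a + 1 <= 17 * b.
Proof. lra. Qed.
Lemma shell_lin4 (R : realFieldType) (a b : R) : a <= 40 * b -> 1 <= b -> 2 * a + 1 <= 81 * b.
Proof. lra. Qed.

Lemma eq_le_refl (d : Order.disp_t) (T : porderType d) (a b : T) : a = b -> (a <= b)%O.
Proof. by move=> ->. Qed.

Lemma shell_bound (R : realType) (X J D : nat) (y : R) (z0 : gint) (M k : nat) (W : seq gint)
  (beta : gint -> R) (dl : bool) :
  (0 < X)%N -> (0 < J)%N -> J%:R <= y <= 2 * J%:R -> 1 <= y -> y ^+ 2 <= X%:R -> (0 < D)%N ->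
  (forall n, (0 < n <= 41 * X ^ 8)%N -> (ndiv n <= D)%N) -> z0 != 0 ->
  (k < 8)%N -> (0 < M)%N -> (M <= X)%N -> uniq W ->
  (forall w, w \in W -> [/\ primary w, gprim w, sqfree (gnrm w) & (M <= gnrm w < 2 * M)%N]) ->
  (M ^ (6 + k.+1) <= X ^ k.+1)%N -> y ^+ (2 * k.+2) <= 4 * M%:R ->
  (forall z, z \in pplist (X %/ M) -> `|beta z| <= D%:R) ->
  \sum_(w <- W) `|\sum_(z <- pplist (X %/ M)) beta z * phi R X z0 dl w z * (dsym w z)%:~R| <=
    54 ^+ 4 * D%:R ^+ 3 * (X%:R / y).
Proof.
move=> X0 J0 yJ y1 y2 D0 hD; set x : R := X%:R in y2 *; move=> z00 k8 M0 MX uW WP MXk yM bB.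
have hD' n : (0 < n <= 41 * X ^ k.+1)%N -> (ndiv n <= D)%N.
  move=> /andP[n0 nX]; apply: hD; rewrite n0 (leq_trans nX) // leq_mul2l /=.
  by rewrite leq_pexp2l.
have DR : 1 <= D%:R :> R by rewrite ler1n.
have [m [rx [S [mq rxX S0 hS hT]]]] := typeII_shell dl J0 M0 MX uW z00 WP (ler0n _ _) bB hD'.
have MR : 1 <= M%:R :> R by rewrite ler1n.
have M0R : 0 < M%:R :> R by rewrite ltr0n.
have y0 : 0 < y by exact: lt_le_trans y1.
have J0R : 0 < J%:R :> R by rewrite ltr0n.
have divle : ((X %/ M)%:R : R) <= x / M%:R by rewrite ler_pdivlMr // -natrM ler_nat leq_divM.
have sW : (size W)%:R <= 18 * M%:R :> R.
  rewrite -natrM ler_nat (_ : 18 * M = 9 * (2 * M))%N; last by rewrite mulnA.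
  apply: size_norm_le => //; first by rewrite muln_gt0.
  by move=> w /WP[_ _ _ /andP[_ /ltnW]].
have XM0 : (0 < X %/ M)%N by rewrite divn_gt0.
have sZ : (size (pplist (X %/ M)))%:R <= 9 * (x / M%:R).
  apply: le_trans (_ : 9 * (X %/ M)%:R <= _); last by rewrite ler_wpM2l.
  rewrite -natrM ler_nat; apply: size_norm_le => //; first exact: pplist_uniq.
  by move=> z /pplistP[].
have hS1 : S <= 54 ^+ 3 * D%:R ^+ 3 * (x / y).
  move: yJ => /andP[yJ1 yJ2].
  apply: (@shell_size_bound R k S (size W)%:R (size (pplist (X %/ M)))%:R m%:R J%:R D%:R M%:R x y) => //.
  all: try by rewrite ler_nat.
  all: try by rewrite ler0n.
  - apply: le_trans (_ : ((X %/ M)%:R) ^+ k.+1 <= _); first by rewrite -!natrX ler_nat.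
    by rewrite lerXn2r ?nnegrE // divr_ge0.
  - rewrite expr_div_n ler_pdivlMr ?exprn_gt0 // -exprD -!natrX ler_nat //.
  - apply: le_trans hS _; rewrite natrM; apply: ler_pM.
    + by nneg.
    + by nneg.
    + apply: ler_wpM2l; first by nneg.
      apply: ler_wpM2r; first by nneg.
      rewrite -natrM -!natrX ler_nat leq_exp2r //; move: J0; clear; lia.
    + apply: ler_wpM2l; first by nneg.
      rewrite -[2 * m%:R]natrM -[_ + 3]natrD -[2 * M%:R]natrM -!natrX -!natrM -!natrD -?natrM ler_nat.
      by rewrite (_ : (2 * m.+1).+1 = 2 * m + 3)%N; last by clear; lia.
have xy0 : 1 <= x / y by rewrite ler_pdivlMr // mul1r; apply: le_trans y2; rewrite expr2 ler_peMl // ltW.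
apply: le_trans hT _.
have tail : (D * ((2 * (20 * X %/ J)).+1 * D + (4 * rx).+4 * (4 * rx.+1 %/ J).+1))%:R <=
    D%:R * (D%:R * (256 * (x / y))) :> R.
  have /andP[yJ1 yJ2] := yJ.
  have Jy : (J%:R)^-1 <= 2 / y :> R by rewrite ler_pdivlMr // mulrC ler_pdivrMr // mulrC.
  have h1 : ((20 * X %/ J)%:R : R) <= 40 * (x / y).
    apply: (@le_trans _ _ ((20 * x) * (J%:R)^-1)).
      by rewrite ler_pdivlMr // -!natrM ler_nat leq_divM.
    apply: le_trans (ler_wpM2l _ Jy) _; first by nneg.
    by apply: eq_le_refl; rewrite !mulrA; congr (_ / y); ring.
  pose rt := Num.sqrt x.
  have rtE : rt ^+ 2 = x by rewrite sqr_sqrtr.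
  have rt0 : 0 <= rt by apply: sqrtr_ge0.
  have yrt : y <= rt by rewrite -(@ler_pXn2r _ 2) ?nnegrE // ?(ltW y0) // rtE.
  have rxr : rx%:R <= rt by rewrite -(@ler_pXn2r _ 2) ?nnegrE // rtE -natrX ler_nat.
  have rt1 : 1 <= rt by exact: le_trans yrt.
  have h2 : ((4 * rx.+1 %/ J)%:R : R) <= 16 * (rt / y).
    apply: (@le_trans _ _ ((4 * rx.+1%:R) * (J%:R)^-1)).
      by rewrite ler_pdivlMr // -!natrM ler_nat leq_divM.
    apply: (@le_trans _ _ ((8 * rt) * (2 / y))).
      apply: ler_pM; [by nneg | by nneg | | exact: Jy].
      by rewrite -[rx.+1%:R]natr1; apply: shell_lin1.
    by apply: eq_le_refl; rewrite !mulrA; congr (_ / y); ring.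
  have ry1 : 1 <= rt / y by rewrite ler_pdivlMr // mul1r.
  have h3 : ((4 * rx).+4 * (4 * rx.+1 %/ J).+1)%:R <= 136 * (x / y) :> R.
    rewrite natrM; apply: (@le_trans _ _ ((8 * rt) * (17 * (rt / y)))).
      apply: ler_pM; [by nneg | by nneg | |].
        by rewrite -addn4 natrD natrM; apply: shell_lin2.
      by rewrite -natr1; apply: shell_lin3.
    by rewrite -rtE; apply: eq_le_refl; rewrite !mulrA; congr (_ / y); ring.
  rewrite natrM; apply: ler_wpM2l => //; rewrite natrD natrM.
  have h4 : ((2 * (20 * X %/ J)).+1%:R : R) <= 81 * (x / y).
    by rewrite -natr1 natrM; apply: shell_lin4.
  apply: (@le_trans _ _ (81 * (x / y) * D%:R + D%:R * (136 * (x / y)))).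
    apply: lerD; first by apply: ler_wpM2r.
    apply: le_trans h3 _; rewrite ler_peMl //; have := le_trans ler01 xy0 => ?; by nneg.
  have := mulr_ge0 (ler0n R D) (le_trans ler01 xy0).
  by move: (x / y) (D%:R) => a b h; rewrite -subr_ge0 (_ : _ - _ = 39 * (b * a)); [nneg | ring].
apply: le_trans (lerD hS1 (ler_wpM2l _ tail)) _; first by nneg.
have h0 : 0 <= D%:R ^+ 3 * (x / y) by have := le_trans ler01 xy0 => ?; nneg.
have n54 : (2 * 256 <= 54 ^+ 2 :> R) by rewrite -natrX -natrM ler_nat.
have n54' : (54 ^+ 2 <= 54 ^+ 3 :> R) by rewrite ler_eXn2l // ltr1n.
rewrite (_ : 2 * D%:R * (D%:R * (D%:R * (256 * (x / y)))) = 2 * 256 * (D%:R ^+ 3 * (x / y))); last first.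
  by move: (x / y) (D%:R) => a b; ring.
rewrite -[_ ^+ 3 * _ ^+ 3 * _]mulrA -mulrDl -[leRHS]mulrA; apply: ler_wpM2r => //.
apply: le_trans (lerD (lexx _) (le_trans n54 n54')) _.
rewrite -mulr2n -[_ *+ 2]mulr_natl [54 ^+ 4]exprS; apply: ler_wpM2r; first by rewrite exprn_ge0.
by rewrite ler_nat.
Qed.

(* With [M] the dyadic size of [N w], the Hoelder exponent [2 (k + 1)] is taken
   with [k = 0] for [M^7 <= X], [k = 3] for [X < M^7] and [M^10 <= X^4], and
   [k = 7] beyond. *)
Lemma typeII_dyadic (R : realType) (d : nat) (chi : gint -> R[i]) (k : int) (z0 : gint)
  (X J D V s L : nat) (y : R) (Ws : seq gint) (g : nat -> R) :
  (0 < d)%N -> mult_char (4 * d)%:R chi -> primary z0 ->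
  (0 < X)%N -> (0 < J)%N -> J%:R <= y <= 2 * J%:R -> 1 <= y -> y ^+ 70 = X%:R -> (0 < D)%N ->
  (forall n, (0 < n <= 41 * X ^ 8)%N -> (ndiv n <= D)%N) ->
  y ^+ 4 <= V.+1%:R -> (s ^ 2 <= X)%N -> (X < 2 ^ L)%N -> uniq Ws ->
  (forall w, w \in Ws -> [/\ primary w, gprim w, sqfree (gnrm w) & (V < gnrm w <= s)%N]) ->
  (forall n, (n <= X)%N -> `|g n| <= D%:R) ->
  \sum_(w <- Ws) cabs (\sum_(t <- pplist (X %/ gnrm w)) ((g (gnrm t))%:C)%C * gterm chi k (z0 * (w * t))) <=
    L%:R * (8 * (54 ^+ 4 * D%:R ^+ 3 * (X%:R / y))).
Proof.
move=> d0 chiP pz0 X0 J0 yJ y1 yX D0 hD yV sX XL uW hW hg.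
have y0 : 0 <= y by exact: le_trans y1.
pose f w := cabs (\sum_(t <- pplist (X %/ gnrm w)) ((g (gnrm t))%:C)%C * gterm chi k (z0 * (w * t))).
have sX' : (s <= X)%N by apply: leq_trans sX; case: (s) => // n; rewrite expnS leq_pmulr // expn_gt0.
have lt_L w : w \in Ws -> (trunc_log 2 (gnrm w) < L)%N.
  move=> /hW[pw _ _ /andP[_ ws]]; rewrite -(@ltn_exp2l 2) //.
  by apply: leq_ltn_trans XL; apply: leq_trans sX'; apply: leq_trans ws; apply: trunc_logP; rewrite ?primary_gnrm_gt0.
have -> : \sum_(w <- Ws) f w = \sum_(j < L) \sum_(w <- [seq w <- Ws | trunc_log 2 (gnrm w) == j]) f w.
  under [RHS]eq_bigr do rewrite big_filter big_mkcond.
  rewrite exchange_big big_seq [RHS]big_seq; apply: eq_bigr => w /lt_L h.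
  rewrite (bigD1 (Ordinal h)) //= eqxx big1 ?addr0 // => j /negP nj; case: eqP => // e.
  by case: nj; apply/eqP/val_inj.
rewrite mulr_natl -[L in leRHS]card_ord -sumr_const; apply: ler_sum => j _.
set W := [seq w <- Ws | _]; set M := (2 ^ j)%N.
have M0 : (0 < M)%N by rewrite expn_gt0.
have WP w : w \in W -> [/\ primary w, gprim w, sqfree (gnrm w) & (M <= gnrm w < 2 * M)%N].
  rewrite mem_filter => /andP[/eqP jw /hW[pw gw sw _]]; split=> //.
  by rewrite /M -jw -expnS; apply: trunc_log_bounds; rewrite ?primary_gnrm_gt0.
have z00 : z0 != 0 by exact: primary_neq0.
have [W0|[w0 w0W]] : W = [::] \/ exists w, w \in W.
  by case: (W) => [|w W']; [left | right; exists w; rewrite mem_head].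
  by rewrite W0 big_nil; nneg.
have Ms : (M <= s)%N.
  have [_ _ _ /andP[h _]] := WP _ w0W; apply: leq_trans h _.
  by move: w0W; rewrite mem_filter => /andP[_ /hW[_ _ _ /andP[_ ->]]].
have VM : (V.+1 <= 2 * M)%N.
  have [_ _ _ /andP[_ h]] := WP _ w0W; apply: leq_trans (ltnW h).
  by move: w0W; rewrite mem_filter => /andP[_ /hW[_ _ _ /andP[-> _]]].
have MX : (M <= X)%N by exact: leq_trans sX'.
have M2 : (M ^ 2 <= X)%N by apply: leq_trans sX; rewrite leq_exp2r.
have uniqW : uniq W by exact: filter_uniq.
have M0R : 0 <= M%:R :> R by [].
have M4 : M%:R <= 4 * M%:R :> R by rewrite ler_peMl // ler1n.
have y2 : y ^+ 2 <= X%:R by rewrite -yX ler_weXn2l.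
have sel (kk : nat) : (kk < 8)%N -> (M ^ (6 + kk.+1) <= X ^ kk.+1)%N -> y ^+ (2 * kk.+2) <= 4 * M%:R ->
    \sum_(w <- W) f w <= 8 * (54 ^+ 4 * D%:R ^+ 3 * (X%:R / y)).
  move=> k8 Mk yk; apply: (@typeII_reduce R d chi k z0 X M W g D%:R _ d0 chiP pz0 M0) => //.
    by move=> w /WP[pw gw _ /andP[-> _]].
  by move=> beta dl hb; apply: (@shell_bound R X J D y z0 M kk W beta dl).
have [h7|h7] := leqP (M ^ 7) X.
  apply: (sel 0%N) => //; apply: le_trans yV _.
  apply: (@le_trans _ _ ((2 * M)%:R)); first by rewrite ler_nat.
  by rewrite natrM ler_wpM2r // ler_nat.
have [h10|h10] := leqP (M ^ 10) (X ^ 4).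
  apply: (sel 3%N) => //; apply: le_trans M4.
  rewrite -(@ler_pXn2r _ 7) ?nnegrE ?exprn_ge0 // -exprM yX -natrX ler_nat; exact: ltnW.
apply: (sel 7%N) => //.
  apply: (@leq_trans (X ^ 7)); last by rewrite leq_pexp2l.
  by rewrite (_ : (6 + 8 = 2 * 7)%N) // expnM leq_exp2r.
apply: le_trans M4; apply: (@le_trans _ _ (y ^+ 28)); first by rewrite ler_weXn2l.
rewrite -(@ler_pXn2r _ 10) ?nnegrE ?exprn_ge0 // -exprM (_ : (28 * 10 = 70 * 4)%N) // exprM yX.
by rewrite -!natrX ler_nat ltnW.
Qed.

Lemma cabs_double_sum (R : realType) (X : nat) (a b : nat -> R) (Phi : gint -> R[i]) :
  cabs (\sum_(w <- pplist X) \sum_(t <- pplist (X %/ gnrm w)) ((a (gnrm w) * b (gnrm t))%:C)%C * Phi (w * t)) <=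
  \sum_(w <- pplist X) `|a (gnrm w)| *
    cabs (\sum_(t <- pplist (X %/ gnrm w)) ((b (gnrm t))%:C)%C * Phi (w * t)).
Proof.
apply: le_trans (cabs_sum _ _ _) _; apply: ler_sum => w _.
rewrite -cabs_real -cabsM mulr_sumr; apply: eq_le_refl; congr (cabs _); apply: eq_bigr => t _.
by rewrite rmorphM -mulrA.
Qed.

Lemma inner_sum_trivial (R : realType) (X : nat) (b : nat -> R) (Phi : gint -> R[i]) (w : gint) (B : R) :
  0 <= B -> primary w -> (gnrm w <= X)%N -> (forall n, (n <= X)%N -> `|b n| <= B) ->
  (forall t, primary t -> cabs (Phi (w * t)) <= 1) ->
  cabs (\sum_(t <- pplist (X %/ gnrm w)) ((b (gnrm t))%:C)%C * Phi (w * t)) <=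
    9 * B * (X%:R / (gnrm w)%:R).
Proof.
move=> B0 pw wX hb hP; have w0 := primary_gnrm_gt0 pw.
apply: le_trans (cabs_sum _ _ _) _.
apply: (@le_trans _ _ (\sum_(t <- pplist (X %/ gnrm w)) B)).
  rewrite big_seq [leRHS]big_seq; apply: ler_sum => t /pplistP[pt _ tX].
  rewrite cabsM cabs_real -[leRHS]mulr1; apply: ler_pM; rewrite ?normr_ge0 ?cabs_ge0 ?hP //.
  by apply: hb; apply: leq_trans tX (leq_div _ _).
rewrite big_const_seq count_predT iter_addr addr0 -[_ *+ _]mulr_natl [leRHS]mulrAC.
apply: ler_wpM2r => //.
have h9 : (size (pplist (X %/ gnrm w)) <= 9 * (X %/ gnrm w))%N.
  by apply: size_norm_le; rewrite ?pplist_uniq ?divn_gt0 // => z /pplistP[].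
apply: le_trans (_ : (9 * (X %/ gnrm w))%:R <= _); first by rewrite ler_nat.
rewrite natrM ler_wpM2l // ler_pdivlMr ?ltr0n // -natrM ler_nat; exact: leq_divM.
Qed.

Lemma sum_prime_powers (R : realType) (X V v L D : nat) : (0 < v)%N -> (v ^ 2 <= V.+1)%N -> (X < 2 ^ L)%N ->
  (forall n, (0 < n <= X)%N -> (ndiv n <= D)%N) ->
  \sum_(w <- pplist X | [&& (V < gnrm w)%N, ~~ prime (gnrm w) & von_mangoldt R (gnrm w) != 0])
     ((gnrm w)%:R : R)^-1 <= D%:R * L.+1%:R ^+ 2 / v%:R.
Proof.
move=> v0 vV XL hD.
apply: (@le_trans _ _ (\sum_(w <- pplist X) \sum_(1 <= p < (2 ^ L).+1) \sum_(j < L.+1)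
    ((p ^ j <= X)%N && (gnrm w == p ^ j)%N)%:R * (v%:R * p%:R : R)^-1)).
  rewrite big_mkcond big_seq [leRHS]big_seq; apply: ler_sum => w /pplistP[pw gw wX]; case: ifP => [|_]; last first.
    by apply: sumr_ge0 => i _; apply: sumr_ge0 => j _; rewrite mulr_ge0 ?invr_ge0 ?mulr_ge0.
  move=> /and3P[wV np vm]; have w0 := primary_gnrm_gt0 pw.
  move: vm; rewrite /von_mangoldt; case E: (primes (gnrm w)) => [|p [|q l]]; rewrite ?eqxx // => _.
  have pr : prime p by have := mem_head p [::]; rewrite -E mem_primes => /andP[].
  have nE := prod_primes_pfactor w0; rewrite E big_seq1 in nE.
  set j := logn p (gnrm w) in nE.
  have j2 : (2 <= j)%N.
    have j1 : (0 < j)%N by rewrite logn_gt0 E mem_head.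
    by case: (j) j1 nE np => [|[|//]] // _ <-; rewrite expn1 pr.
  have p2 := prime_gt1 pr; have p0 := prime_gt0 pr.
  have jL : (j < L.+1)%N.
    rewrite ltnS ltnW // -(@ltn_exp2l 2) //; apply: leq_ltn_trans XL; apply: leq_trans wX.
    by rewrite -nE leq_exp2r // (leq_trans _ j2).
  have pL : (p < (2 ^ L).+1)%N.
    rewrite ltnS ltnW //; apply: leq_ltn_trans XL; apply: leq_trans wX; rewrite -nE.
    by rewrite -{1}[p]expn1 leq_pexp2l // (leq_trans _ j2).
  apply: le_trans (le_sum_mem (x := p) _ _); last first.
  - by rewrite mem_index_iota p0.
  - by move=> i _; apply: sumr_ge0 => q _; rewrite mulr_ge0 ?invr_ge0 ?mulr_ge0.
  apply: le_trans (_ : ((p ^ j <= X)%N && (gnrm w == p ^ j)%N)%:R * (v%:R * p%:R : R)^-1 <= _); last first.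
    rewrite (bigD1 (Ordinal jL)) //= lerDl sumr_ge0 // => i _.
    by rewrite mulr_ge0 ?invr_ge0 ?mulr_ge0.
  rewrite nE wX eqxx mul1r lef_pV2 ?posrE ?ltr0n ?mulr_gt0 ?ltr0n // -natrM ler_nat.
  rewrite -(@leq_exp2r _ _ 2) // expnMn [X in (_ <= X)%N]expnS expn1; apply: leq_mul.
    exact: leq_trans vV wV.
  by rewrite -nE leq_pexp2l.
rewrite exchange_big /=.
apply: (@le_trans _ _ (\sum_(1 <= p < (2 ^ L).+1) (D%:R * L.+1%:R / v%:R) * (p%:R : R)^-1)).
  apply: ler_sum_nat => p /andP[p1 _]; rewrite exchange_big /=.
  apply: (@le_trans _ _ (\sum_(j < L.+1) D%:R * (v%:R * p%:R : R)^-1)).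
    apply: ler_sum => j _; rewrite -mulr_suml; apply: ler_wpM2r; first by rewrite invr_ge0 mulr_ge0.
    case: leqP => h /=; last by rewrite big1.
    have pj0 : (0 < p ^ j)%N by rewrite expn_gt0 p1.
    have hd := hD (p ^ j)%N; rewrite pj0 h in hd.
    rewrite sum_nat_count ler_nat; apply: leq_trans (hd isT).
    apply: count_pplist_norm => //; first exact: pplist_uniq.
    by move=> z /pplistP[].
  rewrite sumr_const card_ord -[_ *+ _]mulr_natl invfM; apply: eq_le_refl.
  by move: (v%:R^-1) (p%:R^-1) (D%:R) (L.+1%:R) => a b c e; ring.
rewrite -mulr_sumr; apply: le_trans (ler_wpM2l _ (harmonic_pow2 R L)) _; first by nneg.
by apply: eq_le_refl; rewrite expr2; move: (v%:R^-1) (D%:R) (L.+1%:R) => a c e; ring.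
Qed.

Lemma sqfree_prime p : prime p -> sqfree p.
Proof.
by move=> pr; rewrite /sqfree prime_gt0 // primes_prime //= logn_prime // eqxx.
Qed.

Lemma ndiv_le_bound (X D n : nat) : (0 < D)%N -> (forall m, (0 < m <= X)%N -> (ndiv m <= D)%N) ->
  (n <= X)%N -> (ndiv n <= D)%N.
Proof. by move=> D0 hD nX; case: n nX => [|n] nX; [exact: D0 | exact: hD]. Qed.

Lemma dconv_one_abs (R : realType) (a : nat -> R) (n : nat) : (forall m, `|a m| <= 1) ->
  `|dconv a (fun=> 1) n| <= (ndiv n)%:R.
Proof.
move=> a1; apply: le_trans (ler_norm_sum _ _ _) _.
apply: (@le_trans _ _ (\sum_(e <- divisors n) 1)).
  by apply: ler_sum => e _; rewrite mulr1.
by rewrite big_const_seq count_predT iter_addr addr0.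
Qed.

Lemma dconv_mangoldt_abs (R : realType) (a : nat -> R) (n : nat) :
  (forall m, 0 <= a m <= von_mangoldt R m) -> `|dconv a (fun=> 1) n| <= ln n%:R.
Proof.
move=> a1; have aL e : 0 <= a e by have /andP[] := a1 e.
rewrite ger0_norm; last by apply: sumr_ge0 => e _; rewrite mulr1.
case: n => [|n].
  rewrite /dconv big_seq1 mulr1 ln0 //.
  by have /andP[_] := a1 1%N.
rewrite -sum_von_mangoldt //; apply: ler_sum => e _; rewrite mulr1.
by have /andP[] := a1 e.
Qed.

Lemma gterm_shift_not_gprim (R : realType) (chi : gint -> R[i]) (k : int) (z0 y : gint) :
  primary z0 -> primary y -> ~~ gprim y -> gterm chi k (z0 * y) = 0.
Proof.
move=> pz py ny; apply: gterm_not_gprim; first exact: primaryM.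
by apply: contra ny => /gprim_divr.
Qed.

Lemma typeII_collect (T : comNzRingType) (p a c : T) : (16 * p + 72) * a ^+ 5 * c =
  a * (a * (8 * (p * a ^+ 3 * c))) + 72 * a ^+ 5 * c + a * (a * (8 * (p * a ^+ 3 * c))).
Proof. by ring. Qed.

Section TypeTwoTotal.
Variables (R : realType) (d : nat) (chi : gint -> R[i]) (k : int) (z0 : gint)
  (X J D V s L : nat) (y : R).
Hypotheses (d0 : (0 < d)%N) (chiP : mult_char (4 * d)%:R chi) (pz0 : primary z0).
Hypotheses (X0 : (0 < X)%N) (J0 : (0 < J)%N) (yJ : J%:R <= y <= 2 * J%:R) (y1 : 1 <= y)
  (yX : y ^+ 70 = X%:R) (D0 : (0 < D)%N).
Hypothesis hD : forall n, (0 < n <= 41 * X ^ 8)%N -> (ndiv n <= D)%N.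
Hypotheses (yV : y ^+ 4 <= V.+1%:R) (sX : (s ^ 2 <= X < s.+1 ^ 2)%N) (XL : (X < 2 ^ L)%N) (LD : (L <= D)%N).
Hypothesis lnD : forall n, (0 < n <= X)%N -> ln n%:R <= D%:R :> R.

Let muV : nat -> R := dcut (fun e => (V < e)%N) (fun e => (mobius e)%:~R).
Let LV : nat -> R := dcut (fun e => (V < e)%N) (von_mangoldt R).
Let Phi (t : gint) : R[i] := gterm chi k (z0 * t).
Let A1 (n : nat) : R := if [&& V < n, n <= s & prime n]%N then von_mangoldt R n else 0.
Let A2 (n : nat) : R := if [&& V < n, n <= s & ~~ prime n]%N then von_mangoldt R n else 0.
Let A3 (n : nat) : R := if (V < n)%N && (s < n)%N then von_mangoldt R n else 0.
Let g := dconv muV (fun=> 1).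
Let h := dconv A3 (fun=> 1).

Let X41 : (X <= 41 * X ^ 8)%N.
Proof. by rewrite (leq_trans (_ : X <= X ^ 8)%N) ?leq_pmull // -{1}[X]expn1 leq_pexp2l. Qed.

Let hDX n : (0 < n <= X)%N -> (ndiv n <= D)%N.
Proof. by move=> /andP[n0 nX]; apply: hD; rewrite n0 (leq_trans nX). Qed.

Let DR : 1 <= D%:R :> R. Proof. by rewrite ler1n. Qed.
Let xy0 : 0 <= X%:R / y. Proof. by rewrite divr_ge0 // (le_trans _ y1). Qed.

Let mangoldt_le n : (n <= X)%N -> von_mangoldt R n <= D%:R.
Proof.
case: n => [|n] nX; first by rewrite /von_mangoldt.
apply: le_trans (lnD (_ : (0 < n.+1 <= X)%N)); last by rewrite nX.
rewrite -sum_von_mangoldt //; apply: le_sum_mem; last by rewrite -dvdn_divisors.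
by move=> e _; apply: von_mangoldt_ge0.
Qed.

Let muV_abs n : `|muV n| <= 1.
Proof.
rewrite /muV /dcut; case: ifP => _; last by rewrite normr0.
by rewrite -intr_norm lerz1 mobius_abs_le1.
Qed.

Let gD n : (n <= X)%N -> `|g n| <= D%:R.
Proof.
move=> nX; apply: le_trans (dconv_one_abs _ muV_abs) _.
by rewrite ler_nat; apply: (ndiv_le_bound D0 hDX).
Qed.

Let hDn n : (n <= X)%N -> `|h n| <= D%:R.
Proof.
move=> nX; apply: (@le_trans _ _ (ln n%:R)).
  apply: dconv_mangoldt_abs => m; rewrite /A3.
  by case: ifP => _; rewrite ?lexx ?von_mangoldt_ge0.
by case: n nX => [|n] nX; [rewrite ln0 | apply: lnD].
Qed.

Let split_conv n : (0 < n)%N ->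
  dconv muV (dconv LV (fun=> 1)) n = dconv A1 g n + dconv A2 g n + dconv muV h n.
Proof.
move=> n0; rewrite /g (dconv_swap A1) // (dconv_swap A2) // -!dconvDr.
apply: eq_dconv => // m m0; rewrite -!dconvDl; apply: eq_dconv => // e _.
rewrite /LV /dcut /A1 /A2 /A3; case: (V < e)%N => //=; last by rewrite !addr0.
by case: (leqP e s) => _ /=; case: (prime e); rewrite ?addr0 ?add0r.
Qed.

Let inner (b : nat -> R) (w : gint) : R :=
  cabs (\sum_(t <- pplist (X %/ gnrm w)) ((b (gnrm t))%:C)%C * Phi (w * t)).

Let dyadic (P : pred nat) (b : nat -> R) : (forall n, P n -> (V < n <= s)%N && sqfree n) ->
  (forall n, (n <= X)%N -> `|b n| <= D%:R) ->
  \sum_(w <- pplist X | P (gnrm w)) inner b w <= D%:R * (8 * (54 ^+ 4 * D%:R ^+ 3 * (X%:R / y))).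
Proof.
move=> hP hb; rewrite -big_filter.
apply: le_trans (_ : L%:R * (8 * (54 ^+ 4 * D%:R ^+ 3 * (X%:R / y))) <= _); last first.
  by apply: ler_wpM2r; [nneg | rewrite ler_nat].
have /andP[s1 _] := sX.
apply: (@typeII_dyadic R d chi k z0 X J D V s L y [seq w <- pplist X | P (gnrm w)] b d0 chiP pz0) => //.
  by apply: filter_uniq; exact: pplist_uniq.
move=> w; rewrite (mem_filter (fun w => P (gnrm w))) => /andP[/hP/andP[h1 h2] /pplistP[pw gw _]].
by split.
Qed.

Lemma typeII_total :
  cabs (\sum_(t <- pplist X) ((dconv muV (dconv LV (fun=> 1)) (gnrm t))%:C)%C * Phi t) <=
  (16 * 54 ^+ 4 + 72) * D%:R ^+ 5 * (X%:R / y).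
Proof.
have hPhi t : primary t -> ~~ gprim t -> Phi t = 0 by exact: gterm_shift_not_gprim.
have -> : \sum_(t <- pplist X) ((dconv muV (dconv LV (fun=> 1)) (gnrm t))%:C)%C * Phi t =
   \sum_(t <- pplist X) ((dconv A1 g (gnrm t))%:C)%C * Phi t +
   \sum_(t <- pplist X) ((dconv A2 g (gnrm t))%:C)%C * Phi t +
   \sum_(t <- pplist X) ((dconv muV h (gnrm t))%:C)%C * Phi t.
  rewrite -!big_split big_seq [RHS]big_seq; apply: eq_bigr => t /pplistP[/primary_gnrm_gt0 t0 _ _] /=.
  by rewrite split_conv // !rmorphD /= !mulrDl.
rewrite !dconv_gauss //.
apply: le_trans (cabsD _ _) _.
apply: le_trans (lerD (cabsD _ _) (lexx _)) _.
have E0 := xy0; set E := X%:R / y in E0 *; set B8 := 8 * (54 ^+ 4 * D%:R ^+ 3 * E).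
have B80 : 0 <= B8 by rewrite /B8; nneg.
have i0 b w : 0 <= inner b w by exact: cabs_ge0.
have b1 : cabs (\sum_(w <- pplist X) \sum_(t <- pplist (X %/ gnrm w)) ((A1 (gnrm w) * g (gnrm t))%:C)%C * Phi (w * t)) <=
    D%:R * (D%:R * B8).
  apply: le_trans (cabs_double_sum _ _ _ _) _.
  apply: le_trans (_ : \sum_(w <- pplist X | [&& V < gnrm w, gnrm w <= s & prime (gnrm w)]%N) D%:R * inner g w <= _).
    rewrite big_seq [leRHS]big_mkcond [leRHS]big_seq; apply: ler_sum => w /pplistP[_ _ wX].
    rewrite /A1 -/(inner g w); case: ifP => _; last by rewrite normr0 mul0r.
    by apply: ler_wpM2r => //; rewrite ger0_norm ?von_mangoldt_ge0 ?mangoldt_le.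
  rewrite -mulr_sumr; apply: ler_wpM2l => //.
  apply: (dyadic (P := fun n => [&& V < n, n <= s & prime n]%N)) gD => n /and3P[-> -> pr].
  exact: sqfree_prime.
have b3 : cabs (\sum_(w <- pplist X) \sum_(t <- pplist (X %/ gnrm w)) ((muV (gnrm w) * h (gnrm t))%:C)%C * Phi (w * t)) <=
    D%:R * B8.
  apply: le_trans (cabs_double_sum _ _ _ _) _.
  apply: le_trans (_ : \sum_(w <- pplist X | (V < gnrm w <= s)%N && sqfree (gnrm w)) inner h w <= _); last first.
    by apply: (dyadic (P := fun n => (V < n <= s)%N && sqfree n)) hDn => n.
  rewrite [leRHS]big_mkcond /= big_seq [leRHS]big_seq; apply: ler_sum => w /pplistP[pw _ wX].
  rewrite -/(inner h w); have w0 := primary_gnrm_gt0 pw.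
  case: ifP => [_|nP]; first by rewrite ler_piMl.
  have [Vw|Vw] := leqP (gnrm w) V; first by rewrite /muV /dcut ltnNge Vw /= normr0 mul0r.
  have [ws|ws] := leqP (gnrm w) s.
    rewrite /muV /dcut Vw /mobius; case: ifP => sf; last by rewrite normr0 mul0r.
    by rewrite Vw ws sf in nP.
  rewrite /inner big_seq big1 ?cabs0 ?mulr0 // => t /pplistP[pt _ tX].
  have ts : (gnrm t <= s)%N.
    rewrite -ltnS; apply: leq_ltn_trans tX _; rewrite ltn_divLR //.
    case/andP: sX => _ h1; apply: leq_trans h1 _; rewrite expnS expn1 leq_mul2l.
    by rewrite ws orbT.
  rewrite /h /dconv big_seq big1 ?mul0r // => e; rewrite -dvdn_divisors ?primary_gnrm_gt0 // => et.
  have es : (e <= s)%N by rewrite (leq_trans _ ts) // dvdn_leq ?primary_gnrm_gt0.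
  by rewrite /A3 ltnNge [(s < e)%N]ltnNge es andbF mul0r.
have b2 : cabs (\sum_(w <- pplist X) \sum_(t <- pplist (X %/ gnrm w)) ((A2 (gnrm w) * g (gnrm t))%:C)%C * Phi (w * t)) <=
    72 * D%:R ^+ 5 * E.
  apply: le_trans (cabs_double_sum _ _ _ _) _.
  apply: le_trans (_ : \sum_(w <- pplist X | [&& (V < gnrm w)%N, ~~ prime (gnrm w) & von_mangoldt R (gnrm w) != 0])
     (9 * D%:R * D%:R * X%:R) * ((gnrm w)%:R : R)^-1 <= _).
    rewrite [leRHS]big_mkcond big_seq [leRHS]big_seq; apply: ler_sum => w /pplistP[pw _ wX].
    rewrite -/(inner g w); have pos : 0 <= 9 * D%:R * D%:R * X%:R * ((gnrm w)%:R : R)^-1 by nneg.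
    rewrite /A2; case: ifP => [/and3P[h1 h2 h3]|_]; last first.
      by rewrite normr0 mul0r; case: ifP.
    rewrite h1 h3 /=; case: eqP => [->|_]; first by rewrite normr0 mul0r.
    rewrite (_ : 9 * D%:R * D%:R * X%:R * ((gnrm w)%:R : R)^-1 = D%:R * (9 * D%:R * (X%:R / (gnrm w)%:R))); last first.
      by move: (_^-1) => iv; move: (D%:R) (X%:R) => a b; ring.
    apply: ler_pM => //; first by rewrite ger0_norm ?von_mangoldt_ge0 ?mangoldt_le.
    apply: inner_sum_trivial => // t pt; apply: (gterm_abs k d0 chiP).
    by apply: primary_neq0; do 2?apply: primaryM.
  rewrite -mulr_sumr.
  have J2V : (J ^ 2 <= V.+1)%N.
    have /andP[Jy _] := yJ; rewrite -(ler_nat R) natrX; apply: le_trans yV.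
    apply: (@le_trans _ _ (y ^+ 2)); first by rewrite lerXn2r ?nnegrE // (le_trans ler01).
    by rewrite ler_weXn2l.
  apply: le_trans (ler_wpM2l _ (sum_prime_powers R J0 J2V XL hDX)) _; first by nneg.
  have y0 : 0 < y by exact: lt_le_trans y1.
  have Jy : (J%:R)^-1 <= 2 / y :> R.
    have J0R : 0 < J%:R :> R by rewrite ltr0n.
    by have /andP[_ yJ2] := yJ; rewrite ler_pdivlMr // mulrC ler_pdivrMr // mulrC.
  have L2 : L.+1%:R ^+ 2 <= (2 * D%:R) ^+ 2 :> R.
    rewrite lerXn2r ?nnegrE //; first by nneg.
    by rewrite -natrM ler_nat; move: D0 LD; clear; lia.
  apply: (@le_trans _ _ (9 * D%:R * D%:R * X%:R * (D%:R * (2 * D%:R) ^+ 2 * (2 / y)))).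
    apply: ler_wpM2l; first by nneg.
    apply: ler_pM; [by nneg | by nneg | | exact: Jy].
    by apply: ler_wpM2l.
  apply: eq_le_refl; rewrite /E; move: (y^-1) (D%:R) (X%:R) => a b c; ring.
apply: le_trans (lerD (lerD b1 b2) b3) _.
have DB : D%:R * B8 <= D%:R * (D%:R * B8) by rewrite ler_peMl // mulr_ge0.
have -> : (16 * 54 ^+ 4 + 72) * D%:R ^+ 5 * E = D%:R * (D%:R * B8) + 72 * D%:R ^+ 5 * E + D%:R * (D%:R * B8).
  exact: typeII_collect.
by rewrite lerD2l.
Qed.
End TypeTwoTotal.

(** * Estimates in powers of x *)

Lemma typeI_collect (T : comNzRingType) (n p a b e f : T) :
  n * a * (b * (p * (e * f))) = n * p * b * e * (a * f).
Proof. by ring. Qed.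

Lemma typeI_numeric (R : realFieldType) (N D d c y h L kap rt s : R) :
  1 <= D -> 1 <= d -> 1 <= s -> s ^+ 2 = c -> 1 <= y -> 0 < h -> h <= y ^+ 12 -> y ^+ 12 <= 2 * h ->
  0 <= L <= 2 * D -> 1 <= kap -> 0 <= N <= 2 * (s * y ^+ 35) -> 0 <= rt <= 2 * (s * y ^+ 18) ->
  2 * (N * D + 16 * d * D * kap * (N * (4 * h ^+ 2 + 4 * N / h) + 4 * N * D * (D * (rt * L)))) <=
  2308 * (c * d * kap * D ^+ 4 * y ^+ 59).
Proof.
move=> D1 d1 s1 sE y1 h0 hy yh /andP[L0 L2] k1 /andP[N0 Ny] /andP[r0 ry].
have D0 : 0 <= D by exact: le_trans D1.
have d0 : 0 <= d by exact: le_trans d1.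
have s0 : 0 <= s by exact: le_trans s1.
have y0 : 0 <= y by exact: le_trans y1.
have k0 : 0 <= kap by exact: le_trans k1.
have c0 : 0 <= c by rewrite -sE sqr_ge0.
have sc : s <= c by rewrite -sE expr2 ler_peMl.
have h00 := ltW h0.
have ypos n : 0 <= y ^+ n by exact: exprn_ge0.
have yle m n : (m <= n)%N -> y ^+ m <= y ^+ n by move=> mn; exact: ler_weXn2l.
have cy m n : (m <= n)%N -> c * y ^+ m <= c * y ^+ n by move=> mn; apply: ler_wpM2l => //; exact: yle.
have N1 : N <= 2 * (c * y ^+ 59).
  apply: le_trans Ny _; apply: ler_wpM2l => //; apply: ler_pM => //; exact: yle.
have e1 : N * (4 * h ^+ 2) <= 8 * (c * y ^+ 59).
  apply: (@le_trans _ _ (2 * (c * y ^+ 35) * (4 * (y ^+ 12) ^+ 2))).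
    apply: ler_pM => //; first by nneg.
      by apply: le_trans Ny _; apply: ler_wpM2l => //; apply: ler_wpM2r.
    by apply: ler_wpM2l => //; rewrite lerXn2r ?nnegrE.
  rewrite (_ : 2 * (c * y ^+ 35) * (4 * (y ^+ 12) ^+ 2) = 8 * (c * (y ^+ 35 * (y ^+ 12) ^+ 2))); last first.
    by move: (y ^+ 35) (y ^+ 12) => a b; ring.
  by rewrite -exprM -exprD.
have e2 : N * (4 * N / h) <= 32 * (c * y ^+ 59).
  have y12 : 0 < y ^+ 12 by rewrite exprn_gt0 // (lt_le_trans ltr01).
  rewrite [N * _]mulrA ler_pdivrMr //.
  apply: (@le_trans _ _ (16 * (c * y ^+ 70))).
    rewrite (_ : N * (4 * N) = 4 * (N * N)); last by ring.
    apply: (@le_trans _ _ (4 * ((2 * (s * y ^+ 35)) * (2 * (s * y ^+ 35))))).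
      by apply: ler_wpM2l => //; apply: ler_pM.
    apply: eq_le_refl; rewrite -sE (_ : 70 = 35 + 35)%N // exprD; move: (y ^+ 35) => a; ring.
  apply: (@le_trans _ _ (16 * (c * (y ^+ 59 * y ^+ 12)))).
    by apply: ler_wpM2l => //; rewrite -exprD; apply: cy.
  rewrite (_ : 32 * (c * y ^+ 59) * h = 16 * (c * (y ^+ 59 * (2 * h)))); last by move: (y ^+ 59) => a; ring.
  by do 3!(apply: ler_wpM2l; rewrite ?mulr_ge0 //).
have e3 : N * rt <= 4 * (c * y ^+ 59).
  apply: (@le_trans _ _ (2 * (s * y ^+ 35) * (2 * (s * y ^+ 18)))); first exact: ler_pM.
  rewrite (_ : 2 * (s * y ^+ 35) * (2 * (s * y ^+ 18)) = 4 * (c * (y ^+ 35 * y ^+ 18))); last first.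
    by rewrite -sE; move: (y ^+ 35) (y ^+ 18) => a b; ring.
  by apply: ler_wpM2l => //; rewrite -exprD; apply: cy.
set Z := c * y ^+ 59 in N1 e1 e2 e3 *.
have Z0 : 0 <= Z by rewrite /Z mulr_ge0.
have DD n : 1 <= D ^+ n by exact: exprn_ege1.
have e4 : 4 * N * D * (D * (rt * L)) <= 32 * (D ^+ 3 * Z).
  apply: (@le_trans _ _ (4 * D ^+ 2 * (4 * Z * (2 * D)))).
    rewrite (_ : 4 * N * D * (D * (rt * L)) = 4 * D ^+ 2 * (N * rt * L)); last by ring.
    apply: ler_wpM2l; first by nneg.
    by apply: ler_pM => //; nneg.
  by apply: eq_le_refl; ring.
have sum1 : N * (4 * h ^+ 2 + 4 * N / h) + 4 * N * D * (D * (rt * L)) <= 72 * (D ^+ 3 * Z).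
  rewrite mulrDr; apply: le_trans (lerD (lerD e1 e2) e4) _.
  have h3 : Z <= D ^+ 3 * Z by rewrite ler_peMl.
  rewrite -mulrDl (_ : 72 * (D ^+ 3 * Z) = (8 + 32) * (D ^+ 3 * Z) + 32 * (D ^+ 3 * Z)); last by ring.
  by apply: lerD => //; apply: ler_wpM2l => //; nneg.
have -> : 2308 * (c * d * kap * D ^+ 4 * y ^+ 59) = 2 * (2 * (d * kap * D ^+ 4 * Z) + 16 * d * D * kap * (72 * (D ^+ 3 * Z))).
  by rewrite /Z; move: (y ^+ 59) => a; ring.
apply: ler_wpM2l => //; apply: lerD; last by apply: ler_wpM2l => //; nneg.
apply: (@le_trans _ _ (2 * Z * D)); first exact: ler_wpM2r.
have f1 : 1 <= d * kap * D ^+ 3.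
  rewrite -[1]mulr1 -[X in X * 1]mulr1; apply: ler_pM => //; first by nneg.
  by apply: ler_pM.
rewrite (_ : 2 * (d * kap * D ^+ 4 * Z) = (d * kap * D ^+ 3) * (2 * Z * D)); last by ring.
by rewrite ler_peMl //; nneg.
Qed.

Section TypeOnePiece.
Variables (R : realType) (d : nat) (chi : gint -> R[i]) (k : int) (z0 : gint) (X D h L c m : nat) (y : R).
Hypotheses (d0 : (0 < d)%N) (chiP : mult_char (4 * d)%:R chi) (pz0 : primary z0) (z0c : gnrm z0 = c).
Hypotheses (X0 : (0 < X)%N) (y1 : 1 <= y) (yX : y ^+ 70 = X%:R) (D0 : (0 < D)%N).
Hypothesis hD : forall n, (0 < n <= 41 * X ^ 8)%N -> (ndiv n <= D)%N.
Hypotheses (XL : (X < 2 ^ L)%N) (LD : (L <= D)%N) (cX : (c <= X)%N) (dX : (d <= X)%N).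
Hypotheses (h0 : (0 < h)%N) (hy : h%:R <= y ^+ 12 <= 2 * h%:R) (mcX : (m ^ 2 <= c * X < m.+1 ^ 2)%N).

Local Notation F := (gterm chi k).

Lemma typeI_reindex (mu : gint) (Y : nat) (b : nat -> R) : primary mu -> (Y < m.+1 ^ 2)%N ->
  \sum_(t <- pplist (Y %/ gnrm mu)) ((b (gnrm t))%:C)%C * F (mu * t) =
  \sum_(u <- gbox m | (gnrm u <= Y)%N && `[< primary u /\ gdvd mu u >])
     ((b (gnrm u %/ gnrm mu)%N)%:C)%C * F u.
Proof.
move=> pm Ym; have q0 := primary_gnrm_gt0 pm; have m0 := primary_neq0 pm.
pose sel u := (gnrm u <= Y)%N && `[< primary u /\ gdvd mu u >].
pose s1 := [seq t <- pplist (Y %/ gnrm mu) | gprim (mu * t)].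
pose s2 := [seq u <- gbox m | sel u && gprim u].
have pe : perm_eq [seq mu * t | t <- s1] s2.
  apply: uniq_perm.
  - rewrite map_inj_uniq; last exact: gmulfI.
    by apply: filter_uniq; exact: pplist_uniq.
  - by apply: filter_uniq; exact: gbox_uniq.
  move=> u; rewrite (mem_filter (fun u => sel u && gprim u)); apply/mapP/idP => [[t]|].
    rewrite (mem_filter (fun t => gprim (mu * t))) => /andP[g /pplistP[pt _ tY]] ->.
    have tY' : (gnrm (mu * t) <= Y)%N by rewrite gnrmM mulnC -leq_divRL.
    rewrite /sel tY' g /= andbT; apply/andP; split.
      by apply/asboolP; split; [exact: primaryM | exists t].
    rewrite mem_gbox; apply/andP; split; rewrite -ltnS -(@ltn_exp2r _ _ 2) //; apply: leq_ltn_trans Ym;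
      apply: leq_trans tY'; rewrite /gnrm; [exact: leq_addr | exact: leq_addl].
  move=> /andP[/andP[/andP[uY /asboolP[pu [t tE]]] gu] _]; exists t => //.
  rewrite (mem_filter (fun t => gprim (mu * t))) -tE gu /=; apply/pplistP; split.
  - by apply: (primary_divr pm); rewrite -tE.
  - by apply: (@gprim_divr mu); rewrite -tE.
  - by rewrite leq_divRL // mulnC -gnrmM -tE.
have -> : \sum_(t <- pplist (Y %/ gnrm mu)) ((b (gnrm t))%:C)%C * F (mu * t) =
    \sum_(u <- [seq mu * t | t <- s1]) ((b (gnrm u %/ gnrm mu)%N)%:C)%C * F u.
  rewrite big_map [RHS]big_filter [RHS]big_mkcond big_seq [RHS]big_seq; apply: eq_bigr => t /pplistP[pt _ _].
  rewrite gnrmM mulKn //; case: ifP => // /negbT ng.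
  by rewrite gterm_not_gprim ?mulr0 //; exact: primaryM.
rewrite (perm_big _ pe) big_filter big_mkcond [RHS]big_mkcond; apply: eq_bigr => u _.
rewrite /sel; case: (boolP (gprim u)) => gu; rewrite ?andbT ?andbF //.
case: ifP => // /andP[_ /asboolP[pu _]].
by rewrite gterm_not_gprim // mulr0.
Qed.

Let cX8 n : (n <= 4 * X ^ 8)%N -> (n <= 41 * X ^ 8)%N.
Proof. by move=> /leq_trans; apply; rewrite leq_mul2r orbT. Qed.

Lemma typeI_piece (a b : nat -> R) (T : nat) (E : R) : 0 <= E -> T%:R <= y ^+ 8 ->
  (forall n, (n <= X)%N -> `|a n| <= E) -> (forall n, (T < n)%N -> a n = 0) ->
  (forall i j, (i <= j)%N -> b i <= b j) -> (forall n, (n <= X)%N -> 0 <= b n <= D%:R) ->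
  cabs (\sum_(t <- pplist X) ((dconv a b (gnrm t))%:C)%C * F (z0 * t)) <=
  (9 * 2308) * E * (c%:R * d%:R * (`|k|%:~R + 1) * D%:R ^+ 4) * (X%:R / y).
Proof.
move=> E0 Ty aE aT bm bD.
have c0 : (0 < c)%N by rewrite -z0c primary_gnrm_gt0.
have y0 : 0 < y by exact: lt_le_trans y1.
rewrite (@dconv_gauss R X a b (fun u => F (z0 * u))); last by move=> u; exact: gterm_shift_not_gprim.
apply: le_trans (cabs_double_sum X a b (fun u => F (z0 * u))) _.
set B := 2308 * (c%:R * d%:R * (`|k|%:~R + 1) * D%:R ^+ 4 * y ^+ 59).
have k0 : 0 <= `|k|%:~R :> R by rewrite ler0z.
have B0 : 0 <= B by have := ltW y0 => ?; rewrite /B; nneg.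
have inner w : primary w -> (gnrm w <= X)%N ->
    cabs (\sum_(t <- pplist (X %/ gnrm w)) ((b (gnrm t))%:C)%C * F (z0 * (w * t))) <= B.
  move=> pw wX; have w0 := primary_gnrm_gt0 pw.
  have pm : primary (z0 * w) by exact: primaryM.
  have [gm|ngm] := boolP (gprim (z0 * w)); last first.
    rewrite big_seq big1 ?cabs0 // => t /pplistP[pt _ _].
    rewrite mulrA gterm_not_gprim ?mulr0 //; first exact: primaryM.
    by apply: contra ngm => /gprim_divl.
  pose b' n := b (minn n X).
  have -> : \sum_(t <- pplist (X %/ gnrm w)) ((b (gnrm t))%:C)%C * F (z0 * (w * t)) =
     \sum_(t <- pplist ((c * X) %/ gnrm (z0 * w))) ((b' (gnrm t))%:C)%C * F (z0 * w * t).
    rewrite gnrmM z0c divnMl // big_seq [RHS]big_seq; apply: eq_bigr => t /pplistP[_ _ tX].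
    by rewrite /b' mulrA (minn_idPl _) // (leq_trans tX) // leq_div.
  have /andP[mc1 mc2] := mcX.
  rewrite typeI_reindex //.
  have mX : (m <= X)%N.
    by rewrite -(@leq_exp2r _ _ 2) // (leq_trans mc1) // expnS expn1 leq_mul2r cX orbT.
  have b'm i j : (i <= j)%N -> b' i <= b' j.
    by move=> ij; apply: bm; rewrite leq_min geq_minr andbT (leq_trans (geq_minl _ _)).
  have b'D i : (i <= c * X)%N -> 0 <= b' i <= D%:R by move=> _; apply: bD; exact: geq_minr.
  have X1 : (1 <= X ^ 8)%N by rewrite expn_gt0 X0.
  have mL : (m.+1 <= 2 ^ L)%N by exact: leq_ltn_trans mX XL.
  have hDm n : (0 < n <= m.+1)%N -> (ndiv n <= D)%N.
    move=> /andP[n0 nm]; apply: hD; rewrite n0 /=; apply: cX8; apply: leq_trans nm _.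
    apply: (@leq_trans (2 * X)); first by move: mX X0; clear; lia.
    by apply: leq_mul => //; rewrite -{1}[X]expn1 leq_pexp2l.
  have hDK : (ndiv (4 * d * gnrm (z0 * w)%R) <= D)%N.
    apply: hD; apply/andP; split; first by rewrite !muln_gt0 d0 primary_gnrm_gt0.
    apply: cX8; rewrite gnrmM z0c -mulnA leq_mul2l /=.
    apply: (@leq_trans (X ^ 3)); last by rewrite leq_pexp2l.
    by rewrite !expnS expn0 muln1; do !apply: leq_mul.
  apply: le_trans (@typeI_sum R d chi k (z0 * w) b' D%:R (c * X) m d0 chiP pm gm b'm b'D mcX h D L h0 mL hDm hDK) _.
  have /andP[hy1 hy2] := hy.
  apply: (@typeI_numeric R m.+1%:R D%:R d%:R c%:R y h%:R L.+1%:R (`|k|%:~R + 1) (Num.sqrt m.+1%:R) (Num.sqrt c%:R)) => //.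
  all: try by rewrite ler1n.
  all: try by rewrite -[leLHS]sqrtr1 ler_wsqrtr // ler1n.
  all: try by rewrite sqr_sqrtr.
  all: try by rewrite ltr0n.
  all: try by rewrite lerDr.
  all: try by rewrite ler0n -natrM ler_nat; move: D0 LD; clear; lia.
  - rewrite ler0n /=; apply: (@le_trans _ _ (2 * m%:R)) => //; last first.
      apply: ler_wpM2l => //; rewrite -(@ler_pXn2r _ 2) ?nnegrE ?mulr_ge0 ?sqrtr_ge0 ?exprn_ge0 ?(ltW y0) //.
      by rewrite exprMn sqr_sqrtr // -exprM yX -natrX -natrM ler_nat.
    rewrite -natrM ler_nat mul2n -addnn -addn1 leq_add2l lt0n.
    apply: contraTneq mc2 => ->; rewrite exp1n -leqNgt muln_gt0 c0 X0 //.
  - rewrite sqrtr_ge0 /= -(@ler_pXn2r _ 2) ?nnegrE ?mulr_ge0 ?sqrtr_ge0 ?exprn_ge0 ?(ltW y0) //.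
    rewrite sqr_sqrtr // (exprMn _ 2) (exprMn _ (Num.sqrt c%:R)) sqr_sqrtr // -(exprM y).
    have mm : m.+1%:R <= 2 * m%:R :> R.
      rewrite -natrM ler_nat mul2n -addnn -addn1 leq_add2l lt0n.
      by apply: contraTneq mc2 => ->; rewrite exp1n -leqNgt muln_gt0 c0 X0.
    have mr : m%:R <= c%:R * y ^+ 35 :> R.
      rewrite -(@ler_pXn2r _ 2) ?nnegrE ?mulr_ge0 ?exprn_ge0 ?(ltW y0) //.
      rewrite exprMn -exprM yX -!natrX -natrM ler_nat (leq_trans mc1) // leq_mul2r.
      by rewrite expnS expn1 leq_pmulr ?orbT.
    apply: le_trans mm _; apply: (@le_trans _ _ (2 * (c%:R * y ^+ 36))).
      apply: ler_wpM2l => //; apply: le_trans mr _; apply: ler_wpM2l => //.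
      by rewrite ler_weXn2l.
    apply: ler_wpM2r; first by rewrite mulr_ge0 // exprn_ge0 // ltW.
    by rewrite expr2 -natrM ler_nat.
apply: (@le_trans _ _ (\sum_(w <- pplist X | (gnrm w <= T)%N) E * B)).
  rewrite [leRHS]big_mkcond big_seq [leRHS]big_seq; apply: ler_sum => w /pplistP[pw _ wX].
  case: leqP => wT; last by rewrite aT // normr0 mul0r.
  by apply: ler_pM; rewrite ?normr_ge0 ?cabs_ge0 ?aE ?inner.
rewrite -big_filter big_const_seq count_predT iter_addr addr0 -[_ *+ _]mulr_natl.
have [T0|T0] := posnP T.
  rewrite (_ : [seq w <- pplist X | (gnrm w <= T)%N] = [::]) ?mul0r; last first.
    apply/eqP; rewrite -size_eq0 -leqn0 leqNgt -has_predT; apply/hasPn => w.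
    rewrite (mem_filter (fun w => (gnrm w <= T)%N)) T0 leqn0 => /andP[/eqP e /pplistP[/primary_gnrm_gt0]].
    by rewrite e.
  by have := ltW y0 => ?; nneg.
have sz : (size [seq w <- pplist X | (gnrm w <= T)%N])%:R <= 9 * y ^+ 8.
  apply: le_trans (_ : 9 * T%:R <= _); last by rewrite ler_wpM2l.
  rewrite -natrM ler_nat; apply: size_norm_le => //; first by apply: filter_uniq; exact: pplist_uniq.
  by move=> w; rewrite (mem_filter (fun w => (gnrm w <= T)%N)) => /andP[].
apply: le_trans (ler_wpM2r _ sz) _; first by rewrite mulr_ge0.
have y67 : y ^+ 8 * y ^+ 59 <= X%:R / y.
  by rewrite ler_pdivlMr // -yX -exprD -exprSr ler_weXn2l.
rewrite (_ : 9 * y ^+ 8 * (E * B) = (9 * 2308) * E * (c%:R * d%:R * (`|k|%:~R + 1) * D%:R ^+ 4) * (y ^+ 8 * y ^+ 59)); last first.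
  by rewrite /B; exact: typeI_collect.
by apply: ler_wpM2l => //; nneg.
Qed.
End TypeOnePiece.

Lemma primary_collect2 (T : comNzRingType) (n p e : T) : (n + 2 * p) * e = n * e + p * e + p * e.
Proof. by ring. Qed.

Lemma primary_collect (T : comNzRingType) (a K f b e : T) : a * (K * (f * b * e)) = K * (f * (a * b) * e).
Proof. by ring. Qed.

Lemma divisor_bound_powR (R : realType) (e : R) : 0 < e ->
  exists2 C : R, 0 < C & forall n, (0 < n)%N -> (ndiv n)%:R <= C * n%:R `^ e.
Proof.
move=> e0; pose j := (Num.truncn e^-1).+1.
have [K hK] := divisor_bound_nat (ltn0Sn (Num.truncn e^-1)).
exists K.+1%:R => // n n0.
have n1 : 1 <= n%:R :> R by rewrite ler1n.
have pw0 : 0 <= n%:R `^ e by exact: powR_ge0.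
rewrite -(@ler_pXn2r _ j) ?nnegrE // ?mulr_ge0 //.
apply: (@le_trans _ _ (K * n)%:R); first by rewrite -natrX ler_nat hK.
rewrite exprMn natrM; apply: ler_pM => //.
  apply: (@le_trans _ _ K.+1%:R); first by rewrite ler_nat.
  by rewrite -[leLHS]expr1 ler_weXn2l // ler1n.
rewrite -powR_mulrn // -powRrM -[leLHS]powRr1 ?ler0n //.
apply: ler_powR => //; rewrite -ler_pdivrMl // mulr1.
by apply: ltW; rewrite /j; exact: truncnS_gt.
Qed.

Lemma divisor_parameter (R : realType) (e : R) : 0 < e ->
  exists2 C : R, 0 < C & forall X, (0 < X)%N -> exists D : nat,
    [/\ (0 < D)%N, forall n, (0 < n <= 41 * X ^ 8)%N -> (ndiv n <= D)%N & D%:R <= C * X%:R `^ e].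
Proof.
move=> e0; have e80 : 0 < e / 8 by rewrite divr_gt0.
have [C C0 hC] := divisor_bound_powR e80.
exists (C * 41 `^ (e / 8) + 1); first by rewrite ltr_wpDl // mulr_ge0 ?powR_ge0 // ltW.
move=> X X0; pose B : R := C * (41 * X ^ 8)%:R `^ (e / 8).
have B0 : 0 <= B by rewrite mulr_ge0 ?powR_ge0 // ltW.
exists (Num.truncn B).+1; split=> //.
  move=> n /andP[n0 nX]; rewrite -(ler_nat R); apply: le_trans (hC _ n0) _.
  apply: le_trans (_ : B <= _); last by apply: ltW; exact: truncnS_gt.
  rewrite /B; apply: ler_wpM2l; first exact: ltW.
  by apply: ge0_ler_powR; rewrite ?nnegrE ?ler0n ?ler_nat // ltW.
rewrite -natr1; apply: le_trans (lerD (_ : _ <= B) (lexx _)) _.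
  by rewrite truncn_le.
rewrite mulrDl mul1r; apply: lerD.
  rewrite /B natrM powRM // natrX -powR_mulrn // -powRrM mulrA.
  have -> : 8 * (e / 8) = e by rewrite mulrC divfK // pnatr_eq0.
  by [].
by rewrite -[leLHS](powRr0 X%:R); apply: ler_powR; rewrite ?ler1n // ltW.
Qed.

Lemma truncn_double (R : realType) (a : R) : 1 <= a ->
  exists n : nat, [/\ (0 < n)%N, n%:R <= a, a <= 2 * n%:R & a <= n.+1%:R].
Proof.
move=> a1; have a0 : 0 <= a by exact: le_trans a1.
exists (Num.truncn a); have h1 : (0 < Num.truncn a)%N by rewrite truncn_gt0.
have h2 : (Num.truncn a)%:R <= a by rewrite truncn_le.
have h3 : a <= (Num.truncn a).+1%:R by apply: ltW; exact: truncnS_gt.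
split=> //; apply: le_trans h3 _; rewrite -natrM ler_nat; move: h1; clear; lia.
Qed.

Lemma pow2_parameter (X D : nat) : (0 < X)%N -> (forall n, (0 < n <= 41 * X ^ 8)%N -> (ndiv n <= D)%N) ->
  exists L, (X < 2 ^ L)%N /\ (L <= D)%N.
Proof.
move=> X0 hD; exists (trunc_log 2 X).+1; have := trunc_log_bounds (isT : (1 < 2)%N) X0.
move: (trunc_log 2 X) => l /andP[lX Xl]; split=> //.
have l0 : (0 < 2 ^ l)%N by rewrite expn_gt0.
apply: (@leq_trans (ndiv (2 ^ l))); last first.
  apply: hD; rewrite l0 (leq_trans lX) // (leq_trans (_ : X <= X ^ 8)%N) ?leq_pmull //.
  by rewrite -{1}[X]expn1 leq_pexp2l.
rewrite /ndiv -(size_iota 0 l.+1) -(size_map (fun i => 2 ^ i)%N); apply: uniq_leq_size.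
  rewrite map_inj_uniq ?iota_uniq // => i j /eqP; rewrite eqn_exp2l // => /eqP //.
apply/allP; rewrite all_map; apply/allP => i; rewrite mem_iota add0n ltnS => il /=.
by rewrite -dvdn_divisors // dvdn_exp2l.
Qed.

Lemma ln_nat_le (R : realType) (L D X n : nat) : (X < 2 ^ L)%N -> (L <= D)%N -> (0 < n <= X)%N ->
  ln n%:R <= D%:R :> R.
Proof.
move=> XL LD /andP[n0 nX].
have h : forall l, ln ((2 ^ l)%:R : R) <= l%:R.
  elim=> [|l IH]; first by rewrite expn0 ln1.
  rewrite expnS natrM lnM ?posrE ?ltr0n ?expn_gt0 // -[l.+1]add1n natrD; apply: lerD => //.
  rewrite -ler_expR lnK ?posrE ?ltr0n //; apply: le_trans (expR_ge1Dx 1%:R); exact: lexx.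
apply: (@le_trans _ _ (ln (2 ^ L)%:R)).
  by rewrite ler_ln ?posrE ?ltr0n ?expn_gt0 // ler_nat ltnW // (leq_ltn_trans nX).
by apply: le_trans (h L) _; rewrite ler_nat.
Qed.

Lemma ln_nat_mono (R : realType) (i j : nat) : (i <= j)%N -> ln i%:R <= ln j%:R :> R.
Proof.
case: i => [|i] ij; last by rewrite ler_ln ?posrE ?ltr0n ?ler_nat // (leq_trans _ ij).
by rewrite ln0 //; case: j {ij} => [|j]; [rewrite ln0 | rewrite ln_ge0 // ler1n].
Qed.

Section PrimarySums.
Variables (R : realType) (d : nat) (chi : gint -> R[i]) (k : int) (X D c : nat) (y : R).
Hypotheses (d0 : (0 < d)%N) (chiP : mult_char (4 * d)%:R chi) (c0 : (0 < c)%N).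
Hypotheses (X0 : (0 < X)%N) (y1 : 1 <= y) (yX : y ^+ 70 = X%:R) (D0 : (0 < D)%N).
Hypothesis hD : forall n, (0 < n <= 41 * X ^ 8)%N -> (ndiv n <= D)%N.

Local Notation F := (gterm chi k).
Local Notation size_f := (c%:R * d%:R * (`|k|%:~R + 1) : R).

Let k0 : 0 <= `|k|%:~R :> R. Proof. by rewrite ler0z. Qed.
Let f1 : 1 <= size_f.
Proof.
by apply: mulr_ege1; [apply: mulr_ege1; rewrite ler1n | rewrite lerDr].
Qed.
Let DR : 1 <= D%:R :> R. Proof. by rewrite ler1n. Qed.
Let xyE : X%:R / y = y ^+ 69.
Proof.
have y0 : y != 0 by rewrite gt_eqF // (lt_le_trans ltr01).
by rewrite -yX exprSr mulfK.
Qed.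
Let yle m n : (m <= n)%N -> y ^+ m <= y ^+ n. Proof. by move=> mn; exact: ler_weXn2l. Qed.
Let ypos n : 0 <= y ^+ n. Proof. by rewrite exprn_ge0 // (le_trans ler01). Qed.

Let mangoldt_le n : (n <= X)%N -> von_mangoldt R n <= D%:R.
Proof.
have [L [XL LD]] := pow2_parameter X0 hD.
case: n => [|n] nX; first by rewrite /von_mangoldt.
apply: le_trans (ln_nat_le R XL LD (_ : (0 < n.+1 <= X)%N)); last by rewrite nX.
rewrite -sum_von_mangoldt //; apply: le_sum_mem; last by rewrite -dvdn_divisors.
by move=> e _; apply: von_mangoldt_ge0.
Qed.

Let F1 z0 t : primary z0 -> primary t -> cabs (F (z0 * t)) <= 1.
Proof. by move=> pz pt; apply: (gterm_abs k d0 chiP); apply/primary_neq0/primaryM. Qed.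

Lemma primary_sum_bound (z0 : gint) : primary z0 -> gnrm z0 = c -> (c <= X)%N -> (d <= X)%N ->
  cabs (\sum_(t <- pplist X) ((von_mangoldt R (gnrm t))%:C)%C * F (z0 * t)) <=
  (9 + 2 * (9 * 2308) + (16 * 54 ^+ 4 + 72)) * (size_f * D%:R ^+ 5 * (X%:R / y)).
Proof.
move=> pz0 z0c cX dX; have [L [XL LD]] := pow2_parameter X0 hD.
have lnD := fun n => @ln_nat_le R L D X n XL LD.
have [J [J0 J1 J2 _]] := truncn_double y1.
have y4 : 1 <= y ^+ 4 by exact: exprn_ege1.
have [V [V0 V1 _ V3]] := truncn_double y4.
have y12 : 1 <= y ^+ 12 by exact: exprn_ege1.
have [h [h0 h1 h2 _]] := truncn_double y12.
have [s hs] := nat_sqrt_exists X; have [m hm] := nat_sqrt_exists (c * X).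
set E := size_f * D%:R ^+ 5 * (X%:R / y).
have xy0 : 0 <= X%:R / y by rewrite xyE.
have fE a n : 0 <= a -> (n <= 5)%N -> a * D%:R ^+ n * (X%:R / y) <= a * D%:R ^+ 5 * (X%:R / y).
  by move=> a0 n5; apply: ler_wpM2r => //; apply: ler_wpM2l => //; exact: ler_weXn2l.
have fE1 n : (n <= 5)%N -> D%:R ^+ n * (X%:R / y) <= E.
  move=> n5; apply: le_trans (_ : 1 * D%:R ^+ 5 * (X%:R / y) <= _).
    by rewrite -[D%:R ^+ n]mul1r; apply: fE.
  by apply: ler_wpM2r => //; apply: ler_wpM2r => //; rewrite exprn_ge0.
pose muU : nat -> R := dcut (fun e => (e <= V)%N) (fun e => (mobius e)%:~R).
pose muU' : nat -> R := dcut (fun e => (V < e)%N) (fun e => (mobius e)%:~R).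
pose LU := dcut (fun e => (e <= V)%N) (von_mangoldt R).
pose LU' := dcut (fun e => (V < e)%N) (von_mangoldt R).
pose S (a : nat -> R) := \sum_(t <- pplist X) ((a (gnrm t))%:C)%C * F (z0 * t).
have muU1 n : `|muU n| <= 1.
  rewrite /muU /dcut; case: ifP => _; last by rewrite normr0.
  by rewrite -intr_norm lerz1 mobius_abs_le1.
have -> : \sum_(t <- pplist X) ((von_mangoldt R (gnrm t))%:C)%C * F (z0 * t) =
   S LU + S (dconv muU (fun e => ln e%:R)) - S (dconv (dconv muU LU) (fun=> 1)) +
   S (dconv muU' (dconv LU' (fun=> 1))).
  rewrite /S -big_split -sumrB -big_split /= big_seq [RHS]big_seq.
  apply: eq_bigr => t /pplistP[/primary_gnrm_gt0 t0 _ _].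
  by rewrite (vaughan R V V t0) rmorphD rmorphB rmorphD /= !mulrDl mulNr.
have b1 : cabs (S LU) <= 9 * E.
  apply: le_trans (cabs_sum _ _ _) _.
  apply: (@le_trans _ _ (\sum_(t <- pplist X | (gnrm t <= V)%N) D%:R)).
    rewrite [leRHS]big_mkcond big_seq [leRHS]big_seq; apply: ler_sum => t /pplistP[pt _ tX].
    rewrite cabsM cabs_real /LU /dcut; case: ifP => _; last by rewrite normr0 mul0r.
    rewrite -[leRHS]mulr1; apply: ler_pM; rewrite ?normr_ge0 ?cabs_ge0 ?F1 //.
    by rewrite ger0_norm ?von_mangoldt_ge0 ?mangoldt_le.
  rewrite -big_filter big_const_seq count_predT iter_addr addr0 -[_ *+ _]mulr_natl.
  apply: (@le_trans _ _ (9 * (D%:R ^+ 1 * (X%:R / y)))); last by rewrite ler_wpM2l // fE1.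
  rewrite expr1 [D%:R * _]mulrC mulrA; apply: ler_wpM2r => //.
  apply: (@le_trans _ _ (9 * V%:R)); last first.
    by rewrite ler_wpM2l // (le_trans V1) // xyE; apply: yle.
  rewrite -natrM ler_nat; apply: size_norm_le => //; first by apply: filter_uniq; exact: pplist_uniq.
  by move=> w; rewrite (mem_filter (fun w => (gnrm w <= V)%N)) => /andP[].
have hyb : h%:R <= y ^+ 12 <= 2 * h%:R by rewrite h1 h2.
have b2 : cabs (S (dconv muU (fun e => ln e%:R))) <= 9 * 2308 * E.
  have := @typeI_piece R d chi k z0 X D h L c m y d0 chiP pz0 z0c X0 y1 yX D0 hD XL LD cX dX h0 hyb hm
    muU (fun e => ln e%:R) V 1 ler01 _ (fun n _ => muU1 n) _ (@ln_nat_mono R) _.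
  move=> /(_ (le_trans V1 (yle (isT : (4 <= 8)%N)))) H; apply: le_trans (H _ _) _.
  - by move=> n Vn; rewrite /muU /dcut leqNgt Vn.
  - move=> n nX; have := @ln_nat_mono R 0 n (leq0n n); rewrite ln0 // => -> /=.
    by case: n nX => [|n] nX; [rewrite ln0 | apply: lnD; rewrite nX].
  by rewrite mulr1 -mulrA; apply: ler_wpM2l; [nneg | rewrite /E; apply: fE => //; apply: le_trans f1].
have b3 : cabs (S (dconv (dconv muU LU) (fun=> 1))) <= 9 * 2308 * E.
  have := @typeI_piece R d chi k z0 X D h L c m y d0 chiP pz0 z0c X0 y1 yX D0 hD XL LD cX dX h0 hyb hm
    (dconv muU LU) (fun=> 1) (V ^ 2) D%:R (ler0n _ _) _ _ _ (fun _ _ _ => lexx _) _.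
  move=> H; apply: le_trans (H _ _ _ _) _.
  - rewrite natrX (_ : 8 = 4 * 2)%N // exprM lerXn2r ?nnegrE //.
  - move=> n nX; case: n nX => [|n] nX.
      by rewrite /dconv big_seq1 div0n /LU /dcut leq0n (_ : von_mangoldt R 0 = 0) // mulr0 normr0.
    apply: le_trans (lnD _ (_ : (0 < n.+1 <= X)%N)); last by rewrite nX.
    rewrite dconvC // -(sum_von_mangoldt R (ltn0Sn n)) /dconv; apply: le_trans (ler_norm_sum _ _ _) _.
    apply: ler_sum => e _; rewrite normrM -[leRHS]mulr1; apply: ler_pM => //.
    by rewrite /LU /dcut; case: ifP => _; rewrite ?normr0 ?ger0_norm ?von_mangoldt_ge0.
  - move=> n Vn; rewrite /dconv big_seq big1 // => e.
    have n0 : (0 < n)%N by apply: leq_ltn_trans Vn.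
    rewrite -dvdn_divisors // => en; rewrite /muU /LU /dcut.
    case: leqP => eV; last by rewrite mul0r.
    case: leqP => qV; last by rewrite mulr0.
    by move: Vn; rewrite -(divnK en) ltnNge expnS expn1 leq_mul.
  - by move=> n _; rewrite ler01 DR.
  rewrite -mulrA -mulrA; apply: ler_wpM2l; first nneg.
  apply: eq_le_refl; rewrite /E; move: (X%:R / y) (D%:R) size_f => p q r; ring.
have b4 : cabs (S (dconv muU' (dconv LU' (fun=> 1)))) <= (16 * 54 ^+ 4 + 72) * E.
  have yJ : J%:R <= y <= 2 * J%:R by rewrite J1 J2.
  apply: le_trans (@typeII_total R d chi k z0 X J D V s L y d0 chiP pz0 X0 J0 yJ y1 yX D0 hD V3 hs XL LD lnD) _.
  by rewrite -mulrA; apply: ler_wpM2l; [nneg | apply: fE1].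
apply: le_trans (cabsD _ _) _; rewrite [leRHS]mulrDl; apply: lerD => //.
apply: le_trans (cabsB _ _) _.
rewrite primary_collect2.
by apply: lerD => //; apply: le_trans (cabsD _ _) _; apply: lerD.
Qed.

Lemma primary_sum_trivial (z0 : gint) : primary z0 ->
  cabs (\sum_(t <- pplist X) ((von_mangoldt R (gnrm t))%:C)%C * F (z0 * t)) <= 9 * X%:R * D%:R.
Proof.
move=> pz0; apply: le_trans (cabs_sum _ _ _) _.
apply: (@le_trans _ _ (\sum_(t <- pplist X) D%:R)).
  rewrite big_seq [leRHS]big_seq; apply: ler_sum => t /pplistP[pt _ tX].
  rewrite cabsM cabs_real -[leRHS]mulr1; apply: ler_pM; rewrite ?normr_ge0 ?cabs_ge0 ?F1 //.
  by rewrite ger0_norm ?von_mangoldt_ge0 ?mangoldt_le.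
rewrite big_const_seq count_predT iter_addr addr0 -[_ *+ _]mulr_natl; apply: ler_wpM2r => //.
rewrite -natrM ler_nat; apply: size_norm_le => //; first exact: pplist_uniq.
by move=> w /pplistP[].
Qed.

Lemma mangoldt_lambda_bound (C2 : R) : 0 <= C2 -> (ndiv c)%:R <= C2 * Num.sqrt c%:R ->
  cabs (\sum_(1 <= n < X.+1) ((von_mangoldt R n)%:C)%C * lambda chi k (c * n)%N) <=
  (9 + 2 * (9 * 2308) + (16 * 54 ^+ 4 + 72) + 9 * C2) * (size_f * D%:R ^+ 6 * (X%:R / y)).
Proof.
move=> C20 hC2; rewrite (@lambda_sum R chi k X c c0).
have cnt : (count (fun z => gnrm z == c) (pplist (c * X)) <= ndiv c)%N.
  by apply: count_pplist_norm => //; [exact: pplist_uniq | move=> z /pplistP[]].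
have reduce (B : R) : 0 <= B -> (forall z0, primary z0 -> gnrm z0 = c ->
    cabs (\sum_(t <- pplist X) ((von_mangoldt R (gnrm t))%:C)%C * F (z0 * t)) <= B) ->
    cabs (\sum_(z0 <- pplist (c * X) | gnrm z0 == c)
     \sum_(t <- pplist X) ((von_mangoldt R (gnrm t))%:C)%C * F (z0 * t)) <= (ndiv c)%:R * B.
  move=> B0 hB; apply: le_trans (cabs_sum _ _ _) _.
  apply: (@le_trans _ _ (\sum_(z0 <- pplist (c * X) | gnrm z0 == c) B)).
    rewrite big_seq_cond [leRHS]big_seq_cond; apply: ler_sum => z /andP[/pplistP[pz _ _] /eqP zc].
    exact: hB.
  rewrite big_const_seq iter_addr addr0 -[_ *+ _]mulr_natl; apply: ler_wpM2r => //.
  by rewrite ler_nat.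
set K := 9 + 2 * (9 * 2308) + (16 * 54 ^+ 4 + 72).
have xy1 : 1 <= X%:R / y by rewrite xyE exprn_ege1.
have xy0 : 0 <= X%:R / y by exact: le_trans xy1.
have f0 : 0 <= size_f by exact: le_trans f1.
have K9 : 9 <= K by rewrite /K -addrA lerDl; nneg.
have K0 : 0 <= K by exact: le_trans K9.
have D2 : D%:R ^+ 2 <= D%:R ^+ 6 :> R by exact: ler_weXn2l.
set G := size_f * D%:R ^+ 6 * (X%:R / y).
have G0 : 0 <= G by rewrite /G; nneg.
rewrite mulrDl; have [cX|cX] := leqP c X; last first.
  apply: le_trans (reduce (9 * X%:R * D%:R) _ _) _; first by nneg.
    by move=> z0 pz0 _; exact: primary_sum_trivial.
  apply: le_trans (_ : 9 * C2 * G <= _); last by rewrite lerDr; nneg.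
  have sX : Num.sqrt c%:R * X%:R <= c%:R * (X%:R / y).
    have sc : Num.sqrt X%:R <= Num.sqrt c%:R :> R by rewrite ler_wsqrtr // ler_nat ltnW.
    have sXE : Num.sqrt X%:R = y ^+ 35 :> R.
      by rewrite -yX (_ : 70 = 35 * 2)%N // exprM sqrtr_sqr ger0_norm.
    apply: (@le_trans _ _ (Num.sqrt c%:R * (y ^+ 35 * y ^+ 35))).
      by rewrite -exprD yX.
    rewrite xyE -[X in _ <= X * _](@sqr_sqrtr _ c%:R) // expr2 -mulrA; apply: ler_wpM2l; first exact: sqrtr_ge0.
    by apply: ler_pM; rewrite ?yle // -sXE.
  apply: le_trans (ler_wpM2r _ hC2) _; first by nneg.
  apply: (@le_trans _ _ (9 * C2 * (D%:R * (c%:R * (X%:R / y))))).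
    rewrite (_ : C2 * Num.sqrt c%:R * (9 * X%:R * D%:R) = 9 * C2 * (D%:R * (Num.sqrt c%:R * X%:R))); last first.
      by move: (Num.sqrt _) (X%:R) (D%:R) => p q r; ring.
    by do 2!(apply: ler_wpM2l; first by nneg).
  apply: ler_wpM2l; first by nneg.
  rewrite /G mulrA; apply: ler_wpM2r => //; rewrite mulrC; apply: ler_pM => //.
    by rewrite -mulrA ler_peMr //; apply: mulr_ege1; rewrite ?ler1n ?lerDr.
  by rewrite -[leLHS]expr1; exact: ler_weXn2l.
have cD : (ndiv c <= D)%N.
  apply: hD; rewrite c0 (leq_trans cX) // (leq_trans (_ : X <= X ^ 8)%N) ?leq_pmull //.
  by rewrite -{1}[X]expn1 leq_pexp2l.
apply: le_trans (_ : K * G <= _); last by rewrite lerDl; nneg.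
have [dX|dX] := leqP d X; last first.
  apply: le_trans (reduce (9 * X%:R * D%:R) _ _) _; first by nneg.
    by move=> z0 pz0 _; exact: primary_sum_trivial.
  apply: (@le_trans _ _ (D%:R * (9 * d%:R * D%:R))).
    apply: ler_pM => //; [by nneg | by rewrite ler_nat |].
    by apply: ler_wpM2r => //; apply: ler_wpM2l => //; rewrite ler_nat ltnW.
  apply: (@le_trans _ _ (9 * (d%:R * D%:R ^+ 2 * 1))).
    by apply: eq_le_refl; move: (d%:R) (D%:R) => p q; ring.
  apply: ler_pM => //; first by nneg.
  have df : d%:R <= size_f.
    by rewrite -mulrA mulrCA ler_peMr //; apply: mulr_ege1; rewrite ?ler1n ?lerDr.
  rewrite /G; apply: ler_pM; [by nneg | by [] | | exact: xy1].
  by apply: ler_pM; [by nneg | by nneg | exact: df | exact: D2].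
apply: le_trans (reduce (K * (size_f * D%:R ^+ 5 * (X%:R / y))) _ _) _.
- by nneg.
- by move=> z0 pz0 z0c; exact: primary_sum_bound.
apply: (@le_trans _ _ (D%:R * (K * (size_f * D%:R ^+ 5 * (X%:R / y))))).
  by apply: ler_wpM2r; [nneg | rewrite ler_nat].
by apply: eq_le_refl; rewrite /G [D%:R ^+ 6]exprS; exact: primary_collect.
Qed.
End PrimarySums.

Lemma final_collect (T : comNzRingType) (a b c e f g : T) : a * b * c * (e * f) * g = a * (c * e * f * (b * g)).
Proof. by ring. Qed.

Theorem mainTheorem3 (R : realType) :
  exists C : R, 0 < C /\
    forall (d : nat) (k : int) (chi : gint -> R[i]),
      (1 <= d)%N -> mult_char (4 * d)%:R chi ->
    forall (c : nat) (x : R), (1 <= c)%N -> 2 <= x ->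
      `| \sum_(1 <= n < (Num.truncn x).+1)
           (von_mangoldt R n)%:C%C * lambda chi k (c * n)%N |
      <= (C * c%:R * (d%:R * (`|k|%:~R + 1)) * x `^ (76%:R / 77%:R))%:C%C.
Proof.
pose e : R := (6 * 770)^-1.
have e0 : 0 < e by rewrite invr_gt0 mulr_gt0 ?ltr0n.
have [CD CD0 hCD] := divisor_parameter e0.
have h20 : 0 < 2^-1 :> R by rewrite invr_gt0 ltr0n.
have [C2 C20 hC2] := divisor_bound_powR h20.
pose K : R := 9 + 2 * (9 * 2308) + (16 * 54 ^+ 4 + 72) + 9 * C2.
have K0 : 0 < K.
  rewrite /K; apply: ltr_wpDl; last by rewrite mulr_gt0 ?ltr0n.
  by nneg.
exists (K * CD ^+ 6); split; first by rewrite mulr_gt0 ?exprn_gt0.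
move=> d k chi d1 chiP c x c1 x2; set X := Num.truncn x.
have x0 : 0 <= x by exact: le_trans x2.
have X0 : (0 < X)%N by rewrite truncn_gt0 (le_trans _ x2) // ler1n.
have X1 : 1 <= X%:R :> R by rewrite ler1n.
have Xx : X%:R <= x by rewrite truncn_le.
have [D [D0 hD DC]] := hCD X X0.
pose y : R := X%:R `^ 70^-1.
have y0 : 0 < y by rewrite powR_gt0 // ltr0n.
have yX : y ^+ 70 = X%:R.
  by rewrite -powR_mulrn ?powR_ge0 // -powRrM mulVf ?pnatr_eq0 // powRr1.
have y1 : 1 <= y.
  by rewrite -[leLHS](powRr0 (X%:R : R)); apply: ler_powR => //; rewrite invr_ge0 ler0n.
have hC2' : (ndiv c)%:R <= C2 * Num.sqrt c%:R by rewrite -powR12_sqrt // hC2.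
have main := @mangoldt_lambda_bound R d chi k X D c y d1 chiP c1 X0 y1 yX D0 hD C2 (ltW C20) hC2'.
rewrite -/X -/K in main *; move: main; set S := \sum_(1 <= n < X.+1) _ => main.
have -> : `|S| = ((cabs S)%:C)%C by case: (S).
rewrite lecR; apply: le_trans main _.
have k0 : 0 <= `|k|%:~R + 1 :> R by rewrite addr_ge0 // ler0z.
have pw0 (a : R) : 0 <= X%:R `^ a :> R by exact: powR_ge0.
have key : D%:R ^+ 6 * (X%:R / y) <= CD ^+ 6 * x `^ (76 / 77).
  apply: (@le_trans _ _ ((CD * X%:R `^ e) ^+ 6 * (X%:R / y))).
    apply: ler_wpM2r; first by rewrite divr_ge0 // ltW.
    by rewrite lerXn2r ?nnegrE // mulr_ge0 // ltW.
  rewrite (exprMn _ CD) -[leLHS]mulrA; apply: ler_wpM2l; first by rewrite exprn_ge0 // ltW.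
  apply: (@le_trans _ _ (X%:R `^ (76 / 77))); last first.
    by apply: ge0_ler_powR; rewrite ?nnegrE // divr_ge0.
  rewrite mulrA ler_pdivrMr // -powR_mulrn // -powRrM -[X in _ * X <= _]powRr1 // /y.
  rewrite -!powRD; try by rewrite pnatr_eq0 -lt0n X0 implybT.
  by apply: ler_powR => //; apply: eq_le_refl; rewrite /e; field.
rewrite (_ : K * CD ^+ 6 * c%:R * (d%:R * (`|k|%:~R + 1)) * x `^ (76 / 77) =
   K * (c%:R * d%:R * (`|k|%:~R + 1) * (CD ^+ 6 * x `^ (76 / 77)))); last exact: final_collect.
apply: ler_wpM2l; first exact: ltW.
rewrite -[leLHS]mulrA; apply: ler_wpM2l => //.
by rewrite !mulr_ge0.
Qed.
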